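(* For each integer $N\ge1$, let $\{\mathcal X^N_z\}_{z\in V_N}$ be the discrete Gaussian free field on $V_N=([0,N-1]\cap\mathbb Z)^2$ with Dirichlet boundary conditions and let $\mathcal X_N^*=\max_{z\in V_N}\mathcal X_z^N$. Then, with $c_1=2\sqrt{2/\pi}\,\log 2$ and $c_2=(3/4)\sqrt{2/\pi}$, $$E\mathcal X_{2^n}^*=c_1 n-c_2\log n+O(1),$$ that is, there is a constant $C$ such that $|E\mathcal X_{2^n}^*-c_1n+c_2\log n|\le C$ for all integers $n\ge1$.
   Context: For an integer $N\ge1$, $V_N=([0,N-1]\cap\mathbb Z)^2$, $V_N^o=((0,N-1)\cap\mathbb Z)^2$ and $\partial V_N=V_N\setminus V_N^o$. Let $\{w_m\}_{m\ge0}$ be simple random walk on $\mathbb Z^2$, killed at $\tau=\min\{m\ge 0: w_m\in\partial V_N\}$, and let $E^x$ denote expectation for the walk started at $x$. Define $G_N(x,y)=E^x\big(\sum_{m=0}^{\tau-1}\mathbf 1_{\{w_m=y\}}\big)$ for $x,y\in V_N$ (so $G_N(x,y)=0$ if $x$ or $y$ lies in $\partial V_N$). The discrete Gaussian free field (GFF) on $V_N$ with Dirichlet boundary conditions is the zero-mean Gaussian field $\{\mathcal X_z^N\}_{z\in V_N}$ with covariance $E(\mathcal X_x^N\mathcal X_y^N)=G_N(x,y)$. Here $\log$ is the natural logarithm. *)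

(* Defs.v *)
From HB Require Import structures.
From mathcomp Require Import all_boot all_order all_algebra.
From mathcomp Require Import all_classical all_reals all_analysis.

Set Implicit Arguments.
Unset Strict Implicit.
Unset Printing Implicit Defensive.

Import Order.TTheory GRing.Theory Num.Theory.
Import numFieldNormedType.Exports.

Local Open Scope classical_set_scope.
Local Open Scope ring_scope.

Definition box (N : nat) (z : int * int) : bool :=
  (0 <= z.1 <= N%:Z - 1) && (0 <= z.2 <= N%:Z - 1).

Definition box_interior (N : nat) (z : int * int) : bool :=
  (0 < z.1 < N%:Z - 1) && (0 < z.2 < N%:Z - 1).

Definition box_boundary (N : nat) (z : int * int) : bool :=
  box N z && ~~ box_interior N z.

(* Fields on the box are indexed by the finite type 'I_N * 'I_N; [point] is the
   bijection of this type onto the set of z such that [box N z]. *)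
Definition point (N : nat) (z : 'I_N * 'I_N) : int * int :=
  ((z.1 : nat)%:Z, (z.2 : nat)%:Z).

Definition srw_step (R : realType) (p q : int * int) : R :=
  if `|p.1 - q.1| + `|p.2 - q.2| == 1 then 4^-1 else 0.

(* Under P, (w_m) is the Markov chain on Z^2 started at x with transition
   matrix [srw_step]. *)
Definition is_srw (R : realType) (d : measure_display) (W : measurableType d)
    (P : probability W R) (w : nat -> W -> int * int) (x : int * int) : Prop :=
  (forall m z, measurable (w m @^-1` [set z])) /\
  (forall (p : nat -> int * int) (m : nat),
     P [set o | forall k, (k <= m)%N -> w k o = p k] =
     ((p 0%N == x)%:R * \prod_(k < m) srw_step R (p k) (p k.+1))%:E).

(* The value is +oo on the event that the boundary is never hit. *)
Definition hitting_time (R : realType) (W : Type) (w : nat -> W -> int * int)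
    (N : nat) (o : W) : \bar R :=
  ereal_inf [set (m%:R)%:E | m in [set m : nat | box_boundary N (w m o)]].

Definition green (R : realType) (d : measure_display) (W : measurableType d)
    (Q : int * int -> probability W R) (w : nat -> W -> int * int)
    (N : nat) (x y : int * int) : \bar R :=
  (\int[Q x]_o
     \sum_(0 <= m <oo | (m%:R)%:E < hitting_time R w N o) ((w m o == y)%:R)%:E)%E.

(* [normal_prob m 0] is by convention the uniform law on [0, 1], so the
   degenerate Gaussian law has to be given separately. *)
Definition gaussian_law (R : realType) (m s : R) : set R -> \bar R :=
  if s == 0 then \d_m else normal_prob m s.

Definition is_gaussian (R : realType) (d : measure_display)
    (T : measurableType d) (P : probability T R) (f : T -> R) : Prop :=
  exists m s : R, forall A : set R, measurable A ->
    P (f @^-1` A) = gaussian_law m s A.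

Definition gaussian_field (R : realType) (d : measure_display)
    (T : measurableType d) (P : probability T R) (I : finType)
    (X : I -> {RV P >-> R}) : Prop :=
  forall a : I -> R, is_gaussian P (fun o => \sum_i a i * X i o).

Definition is_gff (R : realType)
    (dW : measure_display) (W : measurableType dW)
    (Q : int * int -> probability W R) (w : nat -> W -> int * int) (N : nat)
    (d : measure_display) (T : measurableType d) (P : probability T R)
    (X : 'I_N * 'I_N -> {RV P >-> R}) : Prop :=
  [/\ gaussian_field X,
      forall z, ('E_P[X z] = 0)%E
    & forall x y,
        ('E_P[fun o => (X x o * X y o)%R] = green Q w N (point x) (point y))%E].

(* For 0 < N this is the supremum of a nonempty finite set, i.e. its maximum. *)
Definition field_max (R : realType) (N : nat) (T : Type)
    (X : 'I_N * 'I_N -> T -> R) (o : T) : R :=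
  sup (range (fun z => X z o)).

(* Main.v *)
(* The field is compared, by the Sudakov-Fernique inequality, with Gaussian branching
   random walks on the 4-ary tree. The variance of X_u - X_v is the dissipated energy
   of a unit current from u to v: Thomson's principle, with the angular flow of
   x / |x|^2, bounds it above by (4/pi) log |u - v| + O(1), and Dirichlet's principle,
   with truncated logarithms, bounds it below by (4/pi) log |u - v| - O(1) away from
   the boundary. The upper bound embeds the dyadic cells of the box into the leaves
   of a walk with variance (2/pi) log 2 per step. For the lower bound, corridors of
   relative width min(l, n - l)^(-2) are removed between the subboxes of side 2^l;
   this makes all increments of the field exceed those of a walk whose variances
   decrease slightly, while losing only O(1) in the number of scales.

   The distribution functions of the maxima satisfy F_{l+1} = (g_l * F_l)^4 with g_l
   a centred Gaussian density. They are controlled by explicit super- and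
   subsolutions of the form K Z exp(- mu Z - kappa Z^2 / 2), where Z is the distance
   to a moving barrier: convolution with a Gaussian preserves this form and
   multiplies it by (1 + kappa s)^(-3/2), which is where the coefficient 3/2 of the
   logarithmic correction comes from. *)

Require Import Defs.
From HB Require Import structures.
From mathcomp Require Import all_boot all_order all_algebra.
From mathcomp Require Import all_classical all_reals all_analysis.
From mathcomp Require Import measurable_realfun.
From mathcomp Require Import ring lra zify.

Set Implicit Arguments.
Unset Strict Implicit.
Unset Printing Implicit Defensive.

Import Order.TTheory GRing.Theory Num.Theory.
Import numFieldNormedType.Exports.

Local Open Scope classical_set_scope.
Local Open Scope ring_scope.

(** The total error over n scales must be O(1), so what is lost at each scale must be summable. The
    energy estimates lose an additive constant per pair of points, not per scale, and the variance
    [rho] at the leaves absorbs it once. The passage from one subtree to four is nonlinear: from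
    above the union bound suffices, but from below each scale loses a factor 1 - O(prefactor), so
    the prefactor of the subsolution must itself be summable. It is kept below X^-2, where X - [J0]
    counts the scales to the nearer end of the tree, and the relative widths of the corridors are
    X^-2 as well. Both effects disappear at the root, since X returns there to its initial value.
    Hence the variances lie slightly below their mean in the lower half of the tree and slightly
    above it in the upper half, with unchanged total, and the barrier makes an excursion of order
    log X of which only the coefficient 3/2 survives at the root. Laws are identified by
    characteristic functions and maxima are compared by swapping, so no differentiation under an
    integral sign is needed. *)

Section real_integrability.
Context d {T : measurableType d} {R : realType} (P : probability T R).
Implicit Types f g : T -> R.

Definition itg f := P.-integrable setT (EFin \o f).

Lemma itg_measurable f : itg f -> measurable_fun setT f.
Proof. by move=> h; apply/measurable_EFinP; exact: measurable_int h. Qed.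

Lemma itg_cst c : itg (cst c).
Proof. exact: finite_measure_integrable_cst. Qed.

Lemma itgD f g : itg f -> itg g -> itg (fun x => f x + g x).
Proof.
move=> hf hg; have := integrableD measurableT hf hg.
by apply: eq_integrable.
Qed.

Lemma itgZ c f : itg f -> itg (fun x => c * f x).
Proof.
move=> hf; have := integrableZl measurableT c hf.
by apply: eq_integrable.
Qed.

Lemma itgN f : itg f -> itg (fun x => - f x).
Proof.
by move=> /(itgZ (-1)); apply: eq_integrable => // x _; rewrite /= mulN1r.
Qed.

Lemma itgB f g : itg f -> itg g -> itg (fun x => f x - g x).
Proof. by move=> hf hg; apply: itgD => //; exact: itgN. Qed.

Lemma itg_dom f g : measurable_fun setT f -> (forall x, `|f x| <= g x) ->
  itg g -> itg f.
Proof.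
move=> mf fg hg; apply: (le_integrable measurableT _ _ hg).
  exact/measurable_EFinP.
by move=> x _ /=; rewrite lee_fin (le_trans (fg x)) // ler_norm.
Qed.

Lemma itg_bounded f M : measurable_fun setT f -> (forall x, `|f x| <= M) ->
  itg f.
Proof. by move=> mf fM; apply: itg_dom mf fM (itg_cst M). Qed.

Lemma itg_norm f : itg f -> itg (fun x => `|f x|).
Proof.
move=> hf; apply: (@itg_dom _ (fun x => `|f x|)).
- by apply: measurableT_comp => //; exact: itg_measurable.
- by move=> x; rewrite normr_id.
- exact: integrable_norm.
Qed.

Lemma itg_sum (I : Type) (s : seq I) (F : I -> T -> R) :
  (forall i, itg (F i)) -> itg (fun x => \sum_(i <- s) F i x).
Proof.
move=> h; elim: s => [|i s ih].
  by under eq_fun do rewrite big_nil; exact: itg_cst.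
by under eq_fun do rewrite big_cons; exact: itgD.
Qed.

Lemma Rintegral_sum (I : Type) (s : seq I) (F : I -> T -> R) :
  (forall i, itg (F i)) ->
  \int[P]_x (\sum_(i <- s) F i x) = \sum_(i <- s) \int[P]_x F i x.
Proof.
move=> h; elim: s => [|i s ih].
  rewrite big_nil; under eq_Rintegral do rewrite big_nil.
  by rewrite Rintegral_cst // mul0r.
rewrite big_cons; under eq_Rintegral do rewrite big_cons.
rewrite RintegralD ?ih //; [exact: h|exact: itg_sum].
Qed.

Lemma Rintegral_probability_cst c : \int[P]_x c = c.
Proof. by rewrite Rintegral_cst //= probability_setT mulr1. Qed.

Lemma EFin_Rintegral f : itg f -> (\int[P]_x f x)%:E = (\int[P]_x (f x)%:E)%E.
Proof. by move=> h; rewrite /Rintegral fineK //; exact: integrable_fin_num. Qed.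

Lemma itg_of_ge0 f c : measurable_fun setT f -> (forall x, 0 <= f x) ->
  (\int[P]_x (f x)%:E = c%:E)%E -> itg f.
Proof.
move=> mf f0 h; apply/integrableP; split; first exact/measurable_EFinP.
under eq_integral do rewrite /= ger0_norm //.
by rewrite h ltry.
Qed.

Lemma Rintegral_cvg (f_ : nat -> T -> R) f g :
  (forall n, measurable_fun setT (f_ n)) -> measurable_fun setT f ->
  (forall x, f_ n x @[n --> \oo] --> f x) ->
  itg g -> (forall n x, `|f_ n x| <= g x) ->
  (\int[P]_x f_ n x) @[n --> \oo] --> \int[P]_x f x.
Proof.
move=> mf_ mf cf hg dom.
have [] := @dominated_convergence _ T R P setT measurableT
  (fun n => EFin \o f_ n) (EFin \o f) (EFin \o g).
- by move=> n; exact/measurable_EFinP.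
- exact/measurable_EFinP.
- by apply: aeW => x _; apply: cvg_EFin; [exact: nearW|exact: cf].
- exact: hg.
- by apply: aeW => x n _; rewrite lee_fin.
move=> hf _; rewrite -(EFin_Rintegral hf) => h3.
exact: fine_cvg h3.
Qed.

End real_integrability.

(** * Calculus on the line and elementary bounds for exp and ln *)

Section derivatives.
Context {R : realType}.
Implicit Types (f g : R -> R) (x c : R).

Lemma isd_cst c x : is_derive x 1 (fun _ : R => c) 0.
Proof. exact: is_derive_cst. Qed.

Lemma isd_id x : is_derive x 1 (fun y : R => y) 1.
Proof. exact: is_derive_id. Qed.

Lemma isdD f g x df dg : is_derive x 1 f df -> is_derive x 1 g dg ->
  is_derive x 1 (fun y => f y + g y) (df + dg).
Proof. exact: is_deriveD. Qed.

Lemma isdN f x df : is_derive x 1 f df -> is_derive x 1 (fun y => - f y) (- df).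
Proof. exact: is_deriveN. Qed.

Lemma isdM f g x df dg : is_derive x 1 f df -> is_derive x 1 g dg ->
  is_derive x 1 (fun y => f y * g y) (f x * dg + g x * df).
Proof. exact: is_deriveM. Qed.

Lemma isdZ c f x df : is_derive x 1 f df ->
  is_derive x 1 (fun y => c * f y) (c * df).
Proof.
move=> h; apply: (is_derive_eq (isdM (isd_cst c x) h)).
by rewrite mulr0 addr0.
Qed.

Lemma isdX n f x df : is_derive x 1 f df ->
  is_derive x 1 (fun y => f y ^+ n) (n%:R * f x ^+ n.-1 * df).
Proof.
move=> h; elim: n => [|n ih].
  by apply: (is_derive_eq (isd_cst 1 x)); rewrite !mul0r.
under eq_fun do rewrite exprS.
apply: (is_derive_eq (isdM h ih)).
case: n {ih} => [|n] /=; first by rewrite !expr0; ring.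
by rewrite !exprS -[in RHS]natr1; ring.
Qed.

Lemma isdV f x df : f x != 0 -> is_derive x 1 f df ->
  is_derive x 1 (fun y => (f y)^-1) (- df / f x ^+ 2).
Proof.
move=> fx0 h; apply: is_derive_eq (is_deriveV fx0 h) _.
by rewrite /GRing.scale /= !mulNr mulrC.
Qed.

Lemma isd_comp f g x df dg : is_derive (g x) 1 f df -> is_derive x 1 g dg ->
  is_derive x 1 (fun y => f (g y)) (df * dg).
Proof.
move=> hf hg; apply: is_derive_eq (@is_derive1_comp _ f g x df dg hf hg) _.
by [].
Qed.

Lemma is_derive_continuous f df : (forall x, is_derive x 1 f (df x)) ->
  continuous f.
Proof.
move=> h x; have hx := h x.
by apply/differentiable_continuous/derivable1_diffP.
Qed.

Lemma is_derive_MVT f df a b : a <= b ->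
  (forall x, is_derive x 1 f (df x)) ->
  exists2 c, a <= c <= b & f b - f a = df c * (b - a).
Proof.
move=> ab h; have [//|c hc e] := @MVT_segment R f df a b ab (fun x _ => h x).
  exact/continuous_subspaceT/is_derive_continuous.
by exists c => //; move: hc; rewrite in_itv.
Qed.

Lemma le_of_derive_ge0 f df a b : a <= b ->
  (forall x, is_derive x 1 f (df x)) ->
  (forall x, a <= x <= b -> 0 <= df x) -> f a <= f b.
Proof.
move=> ab h df0; have [c /df0 hc e] := is_derive_MVT ab h.
by rewrite -subr_ge0 e mulr_ge0 // subr_ge0.
Qed.

Lemma expR_le_inv (t : R) : t < 1 -> expR t <= (1 - t)^-1.
Proof.
move=> t1; have h := expR_ge1Dx (- t).
have p : 0 < 1 - t by lra.
rewrite -[leLHS]invrK lef_pV2 ?posrE ?invr_gt0 ?expR_gt0 //.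
by rewrite -expRN.
Qed.

(** Two monotone functions give the two bounds: the remainder has derivative e^x - 1 - x >= 0, and
    the remainder minus [z ^+ 3] has a derivative that is nonpositive on [-1/2, 1/2] by e^x <= 1 /
    (1 - x). Both vanish at 0. *)
Lemma expR_taylor2 (y : R) : `|y| <= 2^-1 ->
  `|expR y - 1 - y - y ^+ 2 / 2| <= `|y| ^+ 3.
Proof.
rewrite ler_norml => /andP[y1 y2].
have d1 x : is_derive x 1 (fun z : R => expR z - 1 - z - z ^+ 2 / 2) (expR x - 1 - x).
  apply: (is_derive_eq (isdD (isdD (isdD (is_derive_expR x) (isd_cst (- 1) x))
    (isdN (isd_id x))) (isdN (isdM (isdX 2 (isd_id x)) (isd_cst 2^-1 x))))).
  by rewrite /=; field.
have d2 x : is_derive x 1 (fun z : R => expR z - 1 - z - z ^+ 2 / 2 - z ^+ 3)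
    (expR x - 1 - x - 3 * x ^+ 2).
  apply: (is_derive_eq (isdD (d1 x) (isdN (isdX 3 (isd_id x))))).
  by rewrite /=; ring.
have pos x : 0 <= expR x - 1 - x by have := expR_ge1Dx x; lra.
have neg x : - 2^-1 <= x -> x <= 2^-1 -> expR x - 1 - x - 3 * x ^+ 2 <= 0.
  move=> x1 x2; have p : 0 < 1 - x by lra.
  have := expR_le_inv (_ : x < 1); rewrite -(ler_pM2r p) mulVf ?gt_eqF //.
  by move=> /(_ ltac:(lra)) h; nra.
have z0 : expR 0 - 1 - 0 - 0 ^+ 2 / 2 = 0 :> R by rewrite expR0; ring.
have z1 : expR 0 - 1 - 0 - 0 ^+ 2 / 2 - 0 ^+ 3 = 0 :> R by rewrite expR0; ring.
case: (leP 0 y) => y0.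
  have h1 := @le_of_derive_ge0 _ _ 0 y y0 d1 (fun x _ => pos x).
  rewrite z0 in h1; rewrite (ger0_norm h1) (ger0_norm y0).
  have h2 := @le_of_derive_ge0 (fun z : R => - (expR z - 1 - z - z ^+ 2 / 2 - z ^+ 3))
    _ 0 y y0 (fun x => isdN (d2 x)).
  rewrite /= z1 in h2.
  have {}h2 : - 0 <= - (expR y - 1 - y - y ^+ 2 / 2 - y ^+ 3).
    by apply: h2 => x /andP[x1 x2]; rewrite oppr_ge0; apply: neg; lra.
  lra.
have h1 := @le_of_derive_ge0 _ _ y 0 (ltW y0) d1 (fun x _ => pos x).
rewrite z0 in h1; rewrite (ler0_norm h1) (ltr0_norm y0).
have h2 := @le_of_derive_ge0 (fun z : R => - (expR z - 1 - z - z ^+ 2 / 2 - z ^+ 3))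
  _ y 0 (ltW y0) (fun x => isdN (d2 x)).
rewrite /= z1 in h2.
have {}h2 : - (expR y - 1 - y - y ^+ 2 / 2 - y ^+ 3) <= - 0.
  by apply: h2 => x /andP[x1 x2]; rewrite oppr_ge0; apply: neg; lra.
rewrite (_ : (- y) ^+ 3 = - y ^+ 3); last by ring.
lra.
Qed.

Lemma ln1D_bounds (s : R) : - 2^-1 <= s -> s - 2 * s ^+ 2 <= ln (1 + s) <= s.
Proof.
move=> s1; have p : 0 < 1 + s by lra.
apply/andP; split; last by apply: le_ln1Dx; lra.
rewrite -ler_expR lnK ?posrE //.
have q : 0 < 1 - (s - 2 * s ^+ 2) by nra.
apply: (le_trans (expR_le_inv _)); first by lra.
rewrite -(ler_pM2r q) mulVf ?gt_eqF //.
have : 0 <= s ^+ 2 * (1 + 2 * s) by rewrite mulr_ge0 ?sqr_ge0 //; lra.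
nra.
Qed.

End derivatives.

(* Locked: otherwise unification keeps unfolding the density. *)
Definition idmR {R : realType} : measurableTypeR R -> R := idfun.

Lemma measurable_idmR {R : realType} : measurable_fun setT (@idmR R).
Proof. by move=> _ A mA; rewrite setTI. Qed.

HB.instance Definition _ (R : realType) :=
  isMeasurableFun.Build _ _ _ _ (@idmR R) measurable_idmR.

(** Parametrised by the variance, so that parameters add under convolution; the pushforward
    transports the law from [measurableTypeR R] to [R]. *)
HB.lock Definition normalP {R : realType} (m v : R) : probability R R :=
  distribution (normal_prob m (Num.sqrt v)) (@idmR R).

(** * Gaussian integrals, tilts and moments *)

Section gaussian_integrals.
Context {R : realType}.
Local Notation mu := (@lebesgue_measure R).
Local Open Scope ereal_scope.

Lemma lebesgue_measure_shift (c : R) (A : set R) : measurable A ->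
  pushforward mu ((fun x : R => (x + c)%R) : _ -> measurableTypeR R) A = mu A.
Proof.
move=> mA; apply/esym/lebesgue_measure_unique => //=.
  exact: measurable_funD.
move=> ms _ [[a b]] _ <- /=.
rewrite /pushforward.
rewrite (_ : _ @^-1` _ = `](a - c)%R, (b - c)%R]%classic); last first.
  by apply/seteqP; split => x /=; rewrite !in_itv/= => /andP[? ?];
    apply/andP; split; lra.
rewrite !lebesgue_measure_itv/= !lte_fin ltrD2r; case: ifP => // _.
by rewrite -!EFinD; congr (_%:E); ring.
Qed.

Lemma ge0_integral_lebesgue_shift (c : R) (f : R -> \bar R) :
  measurable_fun [set: R] f -> (forall x, 0 <= f x) ->
  \int[mu]_x f (x + c)%R = \int[mu]_x f x.
Proof.
move=> mf f0.
have ms : measurable_fun [set: measurableTypeR R]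
    ((fun x : R => (x + c)%R) : measurableTypeR R -> measurableTypeR R).
  exact: measurable_funD.
transitivity (\int[pushforward mu
    ((fun x : R => (x + c)%R) : measurableTypeR R -> measurableTypeR R)]_x f x).
  by rewrite ge0_integral_pushforward.
by apply: eq_measure_integral => A mA _; exact: lebesgue_measure_shift.
Qed.

(** A change of variables is available for the Radon-Nikodym derivative; it agrees almost everywhere
    with the density, since both have the same integral over every measurable set. *)
Lemma ge0_integral_normal_prob (m s : R) (f : R -> \bar R) :
  measurable_fun [set: R] f -> (forall x, 0 <= f x) ->
  \int[normal_prob m s]_x f x = \int[mu]_x (f x * (normal_pdf m s x)%:E).
Proof.
move=> mf f0; have dom := @normal_prob_dominates R m s.
rewrite -(Radon_Nikodym_SigmaFinite.change_of_variables dom) //.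
apply: ae_eq_integral => //.
- apply: emeasurable_funM => //.
  exact: measurable_int (Radon_Nikodym_SigmaFinite.f_integrable dom).
- apply: emeasurable_funM => //; apply/measurable_EFinP.
  exact: measurable_normal_pdf.
- apply: ae_eqe_mul2l; apply: integral_ae_eq => //.
  + exact: (Radon_Nikodym_SigmaFinite.f_integrable dom).
  + by apply/measurable_EFinP; exact: measurable_normal_pdf.
  + by move=> E _ mE; rewrite -(Radon_Nikodym_SigmaFinite.f_integral dom).
Qed.

Lemma ge0_integral_normalP (m v : R) (f : R -> \bar R) :
  measurable_fun [set: R] f -> (forall x, 0 <= f x) ->
  \int[normalP m v]_x f x =
  \int[mu]_x (f x * (normal_pdf m (Num.sqrt v) x)%:E).
Proof.
move=> mf f0; rewrite -ge0_integral_normal_prob //.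
rewrite normalP.unlock ge0_integral_distribution //.
Qed.

Lemma normal_pdf_sqrtE (m v x : R) : (0 < v)%R ->
  normal_pdf m (Num.sqrt v) x =
  ((Num.sqrt (v * pi *+ 2))^-1 * expR (- (x - m) ^+ 2 / (v *+ 2)))%R.
Proof.
move=> v0; rewrite normal_pdfE; last by rewrite gt_eqF ?sqrtr_gt0.
by rewrite /normal_peak /normal_fun sqr_sqrtr // ltW.
Qed.

(* Exponential-quadratic tilts of a centred Gaussian density are again Gaussian
   densities. *)
Lemma normal_pdf_tilt (s a k w z : R) : (0 < s)%R -> (0 < 1 + k * s)%R ->
  (normal_pdf 0 (Num.sqrt s) z * expR (- a * (w - z) - k * (w - z) ^+ 2 / 2) =
  (Num.sqrt (1 + k * s))^-1 *
    expR ((- a * w + a ^+ 2 * s / 2 - k * w ^+ 2 / 2) / (1 + k * s)) *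
    normal_pdf (s * (a + k * w) / (1 + k * s)) (Num.sqrt (s / (1 + k * s))) z)%R.
Proof.
move=> s0 D0; have s'0 : (0 < s / (1 + k * s))%R by exact: divr_gt0.
rewrite !normal_pdf_sqrtE //.
have -> : (Num.sqrt (s / (1 + k * s) * pi *+ 2) =
           Num.sqrt (s * pi *+ 2) / Num.sqrt (1 + k * s))%R.
  rewrite -sqrtrV ?ltW // -sqrtrM; last by rewrite mulrn_wge0// mulr_ge0 ?pi_ge0// ltW.
  by congr Num.sqrt; rewrite !mulrnAl mulrAC.
rewrite invf_div; set q := Num.sqrt (1 + _); set A := Num.sqrt (s * _ *+ 2).
have q0 : (q != 0)%R by rewrite gt_eqF ?sqrtr_gt0.
set e1 := expR _; set e2 := expR _; set e3 := expR _; set e4 := expR _.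
have -> : (A^-1 * e1 * e2 = A^-1 * (e1 * e2))%R by rewrite mulrA.
have -> : (e1 * e2 = e3 * e4)%R.
  rewrite /e1 /e2 /e3 /e4 -!expRD; congr expR.
  by field; rewrite !gt_eqF.
by field; rewrite q0 gt_eqF // sqrtr_gt0 mulrn_wgt0 // mulr_gt0 ?pi_gt0.
Qed.

Lemma measurable_tilt (a k w : R) : measurable_fun [set: R]
  (fun z => expR (- a * (w - z) - k * (w - z) ^+ 2 / 2))%R.
Proof.
apply: measurableT_comp => //; apply: measurable_funB; last first.
  apply: measurable_funM => //; apply: measurable_funM => //.
  by apply: measurable_funX; exact: measurable_funB.
by apply: measurable_funM => //; exact: measurable_funB.
Qed.

Lemma integral_normal_tilt (s a k w : R) (f : R -> \bar R) :
  (0 < s)%R -> (0 < 1 + k * s)%R -> measurable_fun [set: R] f ->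
  (forall x, 0 <= f x) ->
  \int[normalP 0 s]_z
     (f z * (expR (- a * (w - z) - k * (w - z) ^+ 2 / 2))%:E) =
  ((Num.sqrt (1 + k * s))^-1 *
    expR ((- a * w + a ^+ 2 * s / 2 - k * w ^+ 2 / 2) / (1 + k * s)))%:E *
  \int[normalP (s * (a + k * w) / (1 + k * s)) (s / (1 + k * s))]_z f z.
Proof.
move=> s0 D0 mf f0.
have me := measurable_tilt a k w.
rewrite [LHS]ge0_integral_normalP; last 2 first.
- by apply: emeasurable_funM => //; exact/measurable_EFinP.
- by move=> x; rewrite mule_ge0 ?lee_fin ?expR_ge0.
rewrite [in RHS]ge0_integral_normalP; [|exact: mf|exact: f0].
rewrite -ge0_integralZl; last 4 first.
- exact: measurableT.
- apply: emeasurable_funM => //; apply/measurable_EFinP.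
  exact: measurable_normal_pdf.
- by move=> x _; rewrite mule_ge0 ?lee_fin ?normal_pdf_ge0.
- by rewrite lee_fin mulr_ge0 ?expR_ge0 ?invr_ge0 ?sqrtr_ge0.
apply: eq_integral => z _.
rewrite -muleA -EFinM [(expR _ * _)%R]mulrC normal_pdf_tilt // EFinM.
by rewrite muleCA.
Qed.

Lemma integral_normal_tilt1 (s a k w : R) :
  (0 < s)%R -> (0 < 1 + k * s)%R ->
  \int[normalP 0 s]_z
     (expR (- a * (w - z) - k * (w - z) ^+ 2 / 2))%:E =
  ((Num.sqrt (1 + k * s))^-1 *
    expR ((- a * w + a ^+ 2 * s / 2 - k * w ^+ 2 / 2) / (1 + k * s)))%:E.
Proof.
move=> s0 D0; have := @integral_normal_tilt s a k w (cst 1) s0 D0.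
under eq_integral do rewrite mul1e.
by move=> -> //; rewrite integral_cst //= probability_setT !mule1.
Qed.

Lemma normal_mgf (s a : R) : (0 < s)%R ->
  \int[normalP 0 s]_z (expR (a * z))%:E =
  (expR (a ^+ 2 * s / 2))%:E.
Proof.
move=> s0; have := @integral_normal_tilt1 s a 0 0 s0.
rewrite !(mul0r, addr0, sqrtr1, invr1, mul1r, mulr1, subr0, mulr0, add0r).
move=> /(_ ltr01) <-; apply: eq_integral => z _.
by congr (expR _)%:E; rewrite !mul0r; ring.
Qed.

Lemma normal_conv (v1 v2 : R) (h : R -> \bar R) :
  (0 < v1)%R -> (0 < v2)%R ->
  measurable_fun [set: R] h -> (forall x, 0 <= h x) ->
  \int[normalP 0 v1]_x \int[normalP 0 v2]_y
     h (x + y)%R = \int[normalP 0 (v1 + v2)]_z h z.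
Proof.
move=> v10 v20 mh h0.
set N1 := normalP 0 v1.
transitivity (\int[N1]_x \int[mu]_z
    (h z * (normal_pdf 0 (Num.sqrt v2) (z - x))%:E)).
  apply: eq_integral => x _.
  have mhx : measurable_fun [set: R] (fun y => h (x + y)%R).
    by apply: (measurableT_comp mh); exact: measurable_funD.
  rewrite (ge0_integral_normalP 0 v2 mhx); last by move=> y; exact: h0.
  rewrite -[RHS](ge0_integral_lebesgue_shift x).
  - by apply: eq_integral => y _; rewrite addrK addrC.
  - apply: emeasurable_funM => //; apply/measurable_EFinP.
    apply: measurableT_comp; first exact: measurable_normal_pdf.
    exact: measurable_funB.
  - by move=> y; rewrite mule_ge0 // lee_fin normal_pdf_ge0.
rewrite (@fubini_tonelli _ _ _ _ _ N1 mu (fun p : R * measurableTypeR R =>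
  h p.2 * (normal_pdf 0 (Num.sqrt v2) (p.2 - p.1))%:E)); last 2 first.
- apply: emeasurable_funM; first exact: measurableT_comp.
  apply/measurable_EFinP.
  apply: (@measurableT_comp _ _ _ _ _ _ (normal_pdf 0 (Num.sqrt v2))).
    exact: measurable_normal_pdf.
  exact: measurable_funB.
- by move=> p; rewrite mule_ge0 // lee_fin normal_pdf_ge0.
rewrite ge0_integral_normalP //; apply: eq_integral => z _ /=.
rewrite ge0_integralZl //; last 2 first.
- apply/measurable_EFinP.
  apply: (@measurableT_comp _ _ _ _ _ _ (normal_pdf 0 (Num.sqrt v2))).
    exact: measurable_normal_pdf.
  exact: measurable_funB.
- by move=> x _; rewrite lee_fin normal_pdf_ge0.
congr (_ * _).
have D0 : (0 < 1 + v2^-1 * v1)%R by rewrite addr_gt0 // mulr_gt0 ?invr_gt0.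
(* Up to its peak, the density of variance [v2] is the quadratic tilt with a = 0 and k = 1 / v2, so
   the convolution of the two densities is an instance of the tilt formula. *)
transitivity (\int[N1]_x ((Num.sqrt (v2 * pi *+ 2))^-1%:E *
    (expR (- 0 * (z - x) - v2^-1 * (z - x) ^+ 2 / 2))%:E)).
  apply: eq_integral => x _; rewrite normal_pdf_sqrtE // -EFinM.
  congr ((_ * expR _)%:E); rewrite subr0 -mulr_natr.
  by field; rewrite gt_eqF.
rewrite ge0_integralZl_EFin; [|exact: measurableT|by move=> x _; rewrite lee_fin expR_ge0
  |by apply/measurable_EFinP; exact: measurable_tilt|by rewrite invr_ge0 sqrtr_ge0].
rewrite integral_normal_tilt1 // -EFinM normal_pdf_sqrtE ?addr_gt0 //.
congr EFin; rewrite mulrA -invfM -sqrtrM; last first.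
  by rewrite mulrn_wge0 // mulr_ge0 ?pi_ge0 // ltW.
congr (_^-1 * expR _)%R.
  by congr Num.sqrt; rewrite !mulr2n; field; rewrite gt_eqF.
rewrite !mulr2n; field.
by rewrite !gt_eqF ?addr_gt0 // [X in (0 < X)%R]addrC.
Qed.

End gaussian_integrals.

Section gaussian_moments.
Context {R : realType}.
Local Open Scope ereal_scope.

(** Raise |x| / n <= e^(|x| / n) to the power n. All moments are thereby dominated by exponential
    ones. *)
Lemma powX_le_expR (n : nat) (x : R) :
  (`|x| ^+ n <= n%:R ^+ n * (expR x + expR (- x)))%R.
Proof.
have [->|n0] := eqVneq n 0%N.
  rewrite !expr0 mul1r; have := expR_ge1Dx x; have := expR_ge1Dx (- x).
  by lra.
have n1 : (0 < n%:R :> R)%R by rewrite ltr0n lt0n.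
apply: (@le_trans _ _ (n%:R ^+ n * expR `|x|)%R); last first.
  rewrite ler_pM2l ?exprn_gt0 //; have := expR_ge0 x; have := expR_ge0 (- x).
  by case: (ger0P x) => _; lra.
have -> : (expR `|x| = expR (`|x| / n%:R) ^+ n)%R.
  by rewrite -expRM_natl; congr expR; field; rewrite gt_eqF.
rewrite -exprMn; apply: lerXn2r; rewrite ?nnegrE ?mulr_ge0 ?expR_ge0 //.
have h := expR_ge1Dx (`|x| / n%:R)%R.
have := ler_wpM2l (ltW n1) h; rewrite mulrDr mulr1 mulrCA divff ?gt_eqF // mulr1.
by apply: le_trans; rewrite lerDr ltW.
Qed.

(** Linear combinations of a Gaussian vector may degenerate, and variance 0 must then mean a point
    mass; [normalP 0 0] is a different law. *)
Definition gaussP (v : R) : probability R R :=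
  if v == 0%R then (\d_(0%R : R) : probability R R) else normalP 0 v.

Lemma gaussP0 : gaussP 0 = (\d_(0%R : R) : probability R R).
Proof. by rewrite /gaussP eqxx. Qed.

Lemma gaussPE (v : R) : (0 < v)%R ->
  gaussP v = normalP 0 v.
Proof. by move=> v0; rewrite /gaussP gt_eqF. Qed.

Lemma gaussP_mgf (v a : R) : (0 <= v)%R ->
  \int[gaussP v]_z (expR (a * z))%:E = (expR (a ^+ 2 * v / 2))%:E.
Proof.
rewrite le_eqVlt => /predU1P[<-|v0]; last by rewrite (gaussPE v0) normal_mgf.
rewrite gaussP0 integral_dirac //=.
  by rewrite diracT mul1e !(mulr0, mul0r).
by apply/measurable_EFinP; apply: measurableT_comp => //; exact: measurable_funM.
Qed.

Lemma gaussP_itg_expR (v a : R) : (0 <= v)%R ->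
  itg (gaussP v) (fun z => expR (a * z)).
Proof.
move=> v0; apply: (@itg_of_ge0 _ _ _ _ _ (expR (a ^+ 2 * v / 2))).
- by apply: measurableT_comp => //; exact: measurable_funM.
- by move=> x; exact: expR_ge0.
- exact: gaussP_mgf.
Qed.

Lemma gaussP_itg_dom (v K : R) (f : R -> R) : (0 <= v)%R ->
  measurable_fun setT f ->
  (forall z, `|f z| <= K * (expR z + expR (- z)))%R ->
  itg (gaussP v) f.
Proof.
move=> v0 mf fK.
have h := itgZ K (itgD (gaussP_itg_expR 1 v0) (gaussP_itg_expR (-1) v0)).
by apply: (itg_dom mf _ h) => x; rewrite mul1r mulN1r.
Qed.

Lemma gaussP_itg_powX (v : R) (n : nat) : (0 <= v)%R ->
  itg (gaussP v) (fun z => `|z| ^+ n)%R.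
Proof.
move=> v0; apply: (@gaussP_itg_dom _ (n%:R ^+ n)%R) => //.
  by apply: measurable_funX; exact: normr_measurable.
by move=> z; rewrite normrX normr_id powX_le_expR.
Qed.

Lemma gaussP_itg_id (v : R) : (0 <= v)%R -> itg (gaussP v) idfun.
Proof.
move=> v0; apply: (@gaussP_itg_dom _ 1 _ v0); first exact: measurable_id.
by move=> z; have := powX_le_expR 1 z; rewrite !expr1.
Qed.

Lemma gaussP_itg_sqr (v : R) : (0 <= v)%R ->
  itg (gaussP v) (fun z => z ^+ 2)%R.
Proof.
move=> v0; apply: itg_dom (gaussP_itg_powX 2 v0); first exact: measurable_funX.
by move=> x; rewrite normrX.
Qed.

(** Reads off a first-order coefficient from a second-order error; in the next two moment
    computations it replaces differentiation under the integral sign. *)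
Lemma eq0_of_quadratic_bound (a b : R) : (0 <= b)%R ->
  (forall t, 0 < t -> t <= 1 -> `|t * a| <= b * t ^+ 2)%R -> a = 0%R.
Proof.
move=> b0 h; apply/eqP; rewrite -normr_le0; apply/ler_addgt0Pr => e e0.
rewrite add0r.
pose t := (Num.min 1 (e / (b + 1)))%R.
have b1 : (0 < b + 1)%R by rewrite ltr_pwDr.
have t0 : (0 < t)%R by rewrite lt_min ltr01 divr_gt0.
have t1 : (t <= 1)%R by rewrite ge_min lexx.
have := h _ t0 t1; rewrite normrM (gtr0_norm t0) expr2 mulrCA ler_pM2l //.
move=> /le_trans; apply; apply: (@le_trans _ _ (b * (e / (b + 1)))%R).
  by rewrite ler_wpM2l // ge_min lexx orbT.
by rewrite mulrCA ler_piMr ?ltW // ltr_pdivrMr // mul1r ltrDl.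
Qed.

(** Integrating 1 + a z <= e^(a z) gives 1 + a M <= e^(a^2 v / 2) for both signs of a, which leaves
    no room for a first-order term. *)
Lemma gaussP_mean (v : R) : (0 <= v)%R -> (\int[gaussP v]_z z = 0)%R.
Proof.
move=> v0; set M := (\int[_]_z _)%R.
have iid := gaussP_itg_id v0.
have key a : (1 + a * M <= expR (a ^+ 2 * v / 2))%R.
  have -> : expR (a ^+ 2 * v / 2) = (\int[gaussP v]_z expR (a * z))%R.
    by apply: EFin_inj; rewrite EFin_Rintegral ?gaussP_mgf //; exact: gaussP_itg_expR.
  have -> : (1 + a * M = \int[gaussP v]_z (1 + a * z))%R.
    rewrite RintegralD //; [|exact: itg_cst|exact: itgZ].
    by rewrite RintegralZl // Rintegral_probability_cst.
  apply: le_Rintegral => //.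
  - by apply: itgD; [exact: itg_cst|exact: itgZ].
  - exact: gaussP_itg_expR.
  - by move=> z _; exact: expR_ge1Dx.
have b0 : (0 <= v / 2 * expR (v / 2))%R by rewrite mulr_ge0 ?expR_ge0 // divr_ge0.
apply: (eq0_of_quadratic_bound b0) => t t0 t1.
have E : (expR (t ^+ 2 * v / 2) - 1 <= v / 2 * expR (v / 2) * t ^+ 2)%R.
  have h := expR_ge1Dx (- (t ^+ 2 * v / 2))%R.
  have := expR_gt0 (t ^+ 2 * v / 2)%R => p.
  have : (expR (t ^+ 2 * v / 2) * (1 - t ^+ 2 * v / 2) <= 1)%R.
    rewrite -[leRHS](expRxMexpNx_1 (t ^+ 2 * v / 2)%R).
    by rewrite ler_wpM2l // ltW.
  have : (expR (t ^+ 2 * v / 2) <= expR (v / 2))%R.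
    rewrite ler_expR -mulrA ler_piMl // ?divr_ge0 //.
    by rewrite exprn_ile1 // ltW.
  have t20 : (0 <= t ^+ 2 * (v / 2))%R by rewrite mulr_ge0 ?sqr_ge0 // divr_ge0.
  move=> h1 h2.
  have h3 := ler_wpM2l t20 h1.
  move: (expR (t ^+ 2 * v / 2)) h h2 h3 p => X h h2 h3 p.
  move: (expR (v / 2)) h3 h1 => Y h3 h1.
  lra.
have := key t; have := key (- t)%R; rewrite sqrrN => h1 h2.
rewrite ler_norml; apply/andP; split; lra.
Qed.

Lemma gaussP_second_moment (v : R) : (0 <= v)%R ->
  (\int[gaussP v]_z (z ^+ 2) = v)%R.
Proof.
rewrite le_eqVlt => /predU1P[<-|v0].
  rewrite gaussP0 /Rintegral integral_dirac //.
    by rewrite diracT mul1e /= expr0n.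
  by apply/measurable_EFinP; exact: measurable_funX.
set q := (\int[_]_z _)%R.
have i2 := gaussP_itg_sqr (ltW v0).
(* The role of e^(a z) is now played by e^(-k z^2 / 2), whose integral is known for small negative k
   too; the two signs of k bound the second moment from both sides. *)
have key k : (0 < 1 + k * v)%R -> (1 - k / 2 * q <= (Num.sqrt (1 + k * v))^-1)%R.
  move=> D0.
  have E : \int[gaussP v]_z (expR (- (k / 2 * z ^+ 2)))%:E = ((Num.sqrt (1 + k * v))^-1)%:E.
    have := @integral_normal_tilt1 R v 0 k 0 v0 D0.
    rewrite !(mul0r, expr0n, mulr0, oppr0, subr0, add0r, expR0, mulr1) /= => <-.
    rewrite (gaussPE v0); apply: eq_integral => z _.
    by congr (expR _)%:E; rewrite !mul0r; field.
  have me : measurable_fun setT (fun z : R => expR (- (k / 2 * z ^+ 2)))%R.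
    apply: measurableT_comp => //; apply: measurableT_comp => //.
    by apply: measurable_funM => //; exact: measurable_funX.
  have ie : itg (gaussP v) (fun z : R => expR (- (k / 2 * z ^+ 2)))%R.
    by apply: itg_of_ge0 E => // x; exact: expR_ge0.
  have -> : (Num.sqrt (1 + k * v))^-1%R = (\int[gaussP v]_z expR (- (k / 2 * z ^+ 2)))%R.
    by apply: EFin_inj; rewrite EFin_Rintegral.
  have -> : (1 - k / 2 * q = \int[gaussP v]_z (1 - k / 2 * z ^+ 2))%R.
    rewrite RintegralB //; [|exact: itg_cst|exact: itgZ].
    by rewrite RintegralZl // Rintegral_probability_cst.
  apply: le_Rintegral => //.
  - by apply: itgB; [exact: itg_cst|exact: itgZ].
  - by move=> z _; exact: expR_ge1Dx.
have bnd (x : R) : (`|x| <= 2^-1 -> (Num.sqrt (1 + x))^-1 <= 1 - x / 2 + x ^+ 2)%R.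
  rewrite ler_norml => /andP[x1 x2].
  have y0 : (0 < Num.sqrt (1 + x))%R by rewrite sqrtr_gt0; lra.
  rewrite -[leLHS]mul1r ler_pdivrMr //.
  have z0 : (0 <= 1 - x / 2 + x ^+ 2)%R by nra.
  rewrite -(@ler_pXn2r _ 2) ?nnegrE ?mulr_ge0 ?(ltW y0) //.
  rewrite exprMn sqr_sqrtr; last by lra.
  have x4 : (x ^+ 2 <= 4^-1)%R by nra.
  have h : (0 <= x ^+ 2 * (5 / 4 + 5 / 4 * x + x * x ^+ 2))%R.
    by rewrite mulr_ge0 ?sqr_ge0 //; have := sqr_ge0 x; nra.
  rewrite -subr_ge0; apply: le_trans h _; rewrite le_eqVlt; apply/orP; left.
  by apply/eqP; field.
(* Scales the parameter so that t c v <= 1/2 for every t <= 1. *)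
pose c := ((2 * (v + 1))^-1)%R.
have v10 : (0 < 2 * (v + 1))%R by rewrite mulr_gt0 // addr_gt0.
have c0 : (0 < c)%R by rewrite invr_gt0.
have cv : (c * v <= 2^-1)%R.
  by rewrite /c mulrC ler_pdivrMr //; lra.
apply/eqP; rewrite -subr_eq0; apply/eqP.
apply: (@eq0_of_quadratic_bound _ (2 * c * v ^+ 2)%R).
  by rewrite mulr_ge0 ?sqr_ge0 // mulr_ge0 // ltW.
move=> t t0 t1.
have tcv0 : (0 <= t * c * v)%R by rewrite !mulr_ge0 // ltW.
have tcv : (t * c * v <= 2^-1)%R.
  have cv0 : (0 <= c * v)%R by apply: mulr_ge0; exact: ltW.
  by rewrite -mulrA; nra.
have k1 : (- (t * c * q) <= - (t * c * v) + 2 * (t * c * v) ^+ 2)%R.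
  have h1 : (`|t * c * v| <= 2^-1)%R by rewrite ger0_norm.
  have D0 : (0 < 1 + t * c * v)%R by lra.
  by have := le_trans (key _ D0) (bnd _ h1); lra.
have k2 : (t * c * q <= t * c * v + 2 * (t * c * v) ^+ 2)%R.
  have h1 : (`|- (t * c) * v| <= 2^-1)%R by rewrite mulNr normrN ger0_norm.
  have D0 : (0 < 1 + - (t * c) * v)%R by lra.
  by have := le_trans (key _ D0) (bnd _ h1); rewrite !mulNr sqrrN; lra.
rewrite -(ler_pM2l c0).
rewrite -[X in (X * `|_|)%R](gtr0_norm c0) -normrM ler_norml.
apply/andP; split.
  rewrite (_ : c * (t * (q - v)) = t * c * q - t * c * v)%R; last by ring.
  rewrite (_ : c * (2 * c * v ^+ 2 * t ^+ 2) = 2 * (t * c * v) ^+ 2)%R; last by ring.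
  lra.
rewrite (_ : c * (t * (q - v)) = t * c * q - t * c * v)%R; last by ring.
rewrite (_ : c * (2 * c * v ^+ 2 * t ^+ 2) = 2 * (t * c * v) ^+ 2)%R; last by ring.
lra.
Qed.

End gaussian_moments.

Section gaussP_convolution.
Context {R : realType}.
Local Open Scope ereal_scope.

Lemma measurable_shift_fun (x : R) (h : R -> \bar R) :
  measurable_fun [set: R] h -> measurable_fun [set: R] (fun y => h (x + y)%R).
Proof. by move=> mh; apply: (measurableT_comp mh); exact: measurable_funD. Qed.

Lemma integral_gaussP0 (h : R -> \bar R) : measurable_fun [set: R] h ->
  \int[gaussP 0]_y h y = h 0%R.
Proof. by move=> mh; rewrite gaussP0 integral_dirac // diracT mul1e. Qed.

Lemma gaussP_conv (v1 v2 : R) (h : R -> \bar R) : (0 <= v1)%R -> (0 <= v2)%R ->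
  measurable_fun [set: R] h -> (forall x, 0 <= h x) ->
  \int[gaussP v1]_x \int[gaussP v2]_y h (x + y)%R = \int[gaussP (v1 + v2)]_z h z.
Proof.
move=> + + mh h0.
rewrite le_eqVlt => /predU1P[<- _|v10].
  rewrite integral_gaussP0.
    by under eq_integral do rewrite add0r; rewrite add0r.
  apply: (@measurable_fun_fubini_tonelli_F _ _ _ _ _ (gaussP v2) (fun p : R * R => h (p.1 + p.2)%R)).
    apply: measurableT_comp => //; exact: measurable_funD.
  by move=> p; exact: h0.
rewrite le_eqVlt => /predU1P[<-|v20].
  rewrite addr0; apply: eq_integral => x _.
  by rewrite integral_gaussP0 ?addr0 //; exact: measurable_shift_fun.
rewrite (gaussPE v10) (gaussPE v20) (gaussPE (addr_gt0 v10 v20)).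
exact: normal_conv.
Qed.

End gaussP_convolution.

(** * Centred Gaussian fields on a finite index set *)

Section gaussian_fields.
Context {R : realType}.

Definition lin (I : finType) (a x : I -> R) : R := \sum_i a i * x i.

Definition quad (I : finType) (C : I -> I -> R) (a : I -> R) : R :=
  lin a (fun i => lin a (C i)).

(** The laws of all linear forms are prescribed, so degenerate fields are included, and [C] enters
    only through its quadratic form. *)
Definition isG d (T : measurableType d) (P : probability T R) (I : finType)
    (X : I -> T -> R) (C : I -> I -> R) : Prop :=
  [/\ forall i, measurable_fun setT (X i),
      forall a, 0 <= quad C a
    & forall a A, measurable A ->
        P ((fun o => lin a (X^~ o)) @^-1` A) = gaussP (quad C a) A].

(** Serves to reindex a field along a map that may repeat indices: coefficients are summed over the
    fibres of [phi]. *)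
Lemma lin_partition (I J : finType) (phi : J -> I) (b : J -> R) (x : I -> R) :
  lin (fun i => \sum_(j | phi j == i) b j) x = \sum_j b j * x (phi j).
Proof.
rewrite [RHS](partition_big phi xpredT) //=; apply: eq_bigr => i _.
by rewrite big_distrl /=; apply: eq_bigr => j /eqP ->.
Qed.

Lemma quad_partition (I J : finType) (phi : J -> I) (b : J -> R)
    (C : I -> I -> R) :
  quad C (fun i => \sum_(j | phi j == i) b j) =
  \sum_j b j * \sum_k b k * C (phi j) (phi k).
Proof.
rewrite /quad lin_partition; apply: eq_bigr => j _.
by rewrite lin_partition.
Qed.

Section on_space.
Context d (T : measurableType d) (P : probability T R) (I : finType).
Variables (X : I -> T -> R) (C : I -> I -> R).
Hypothesis GX : isG P X C.

Lemma isG_measurable_lin a : measurable_fun setT (fun o => lin a (X^~ o)).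
Proof.
case: GX => mX _ _; apply: measurable_sum => i.
by apply: measurable_funM => //; exact: measurable_cst.
Qed.

Lemma isG_ge0_integral a (h : R -> \bar R) : measurable_fun setT h ->
  (forall x, 0 <= h x)%E ->
  (\int[P]_o h (lin a (X^~ o)) = \int[gaussP (quad C a)]_z h z)%E.
Proof.
move=> mh h0; have ml := isG_measurable_lin a.
rewrite -(@ge0_integral_pushforward _ _ _ _ _ _ ml P setT h) //.
by apply: eq_measure_integral => A mA _; case: GX => _ _ l; exact: (l a A mA).
Qed.

Lemma isG_itg a (h : R -> R) : itg (gaussP (quad C a)) h ->
  itg P (fun o => h (lin a (X^~ o))).
Proof.
move=> ih; have mh := itg_measurable ih.
apply/integrableP; split.
  by apply/measurable_EFinP; apply: (measurableT_comp mh); exact: isG_measurable_lin.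
have := @isG_ge0_integral a (fun z => `|(h z)%:E|)%E.
move=> /= -> //.
- by case/integrableP : ih.
- by apply/measurable_EFinP; apply: measurableT_comp.
Qed.

Lemma isG_Rintegral a (h : R -> R) : itg (gaussP (quad C a)) h ->
  \int[P]_o h (lin a (X^~ o)) = \int[gaussP (quad C a)]_z h z.
Proof.
move=> ih; have mh := itg_measurable ih; have ml := isG_measurable_lin a.
apply: EFin_inj; rewrite !EFin_Rintegral //; last exact: isG_itg.
rewrite -(@integral_pushforward _ _ _ _ _ _ ml P setT (EFin \o h)) //.
- by apply: eq_measure_integral => A mA _; case: GX => _ _ l; exact: (l a A mA).
- exact/measurable_EFinP.
- by rewrite preimage_setT; exact: isG_itg.
Qed.

Lemma lin_delta (i : I) (x : I -> R) : lin (fun j => (j == i)%:R) x = x i.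
Proof.
rewrite /lin (bigD1 i) //= eqxx mul1r big1 ?addr0 // => j /negPf ->.
by rewrite mul0r.
Qed.

Lemma isG_itg_powX i n : itg P (fun o => `|X i o| ^+ n).
Proof.
have [_ C0 _] := GX.
have := @isG_itg (fun j => (j == i)%:R) (fun z => `|z| ^+ n) (gaussP_itg_powX n (C0 _)).
by under eq_fun do rewrite lin_delta.
Qed.

Lemma isG_itg_X i : itg P (X i).
Proof.
have [_ C0 _] := GX.
have := @isG_itg (fun j => (j == i)%:R) idfun (gaussP_itg_id (C0 _)).
by rewrite /=; under eq_fun do rewrite lin_delta.
Qed.

Lemma isG_mean i : \int[P]_o X i o = 0.
Proof.
have [_ C0 _] := GX.
have := @isG_Rintegral (fun j => (j == i)%:R) idfun (gaussP_itg_id (C0 _)).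
rewrite /= gaussP_mean // => <-.
by apply: eq_Rintegral => o _; rewrite lin_delta.
Qed.

Lemma isG_second a : \int[P]_o (lin a (X^~ o)) ^+ 2 = quad C a.
Proof.
have [_ C0 _] := GX.
have := @isG_Rintegral a (fun z => z ^+ 2) (gaussP_itg_sqr (C0 _)).
by rewrite /= gaussP_second_moment.
Qed.

Lemma isG_itg_second a : itg P (fun o => (lin a (X^~ o)) ^+ 2).
Proof.
have [_ C0 _] := GX.
exact: (@isG_itg a (fun z => z ^+ 2) (gaussP_itg_sqr (C0 _))).
Qed.

Lemma isG_map (J : finType) (phi : J -> I) (c : J -> R) :
  isG P (fun j o => c j * X (phi j) o)
        (fun j k => c j * c k * C (phi j) (phi k)).
Proof.
case: GX => mX C0 lX.
have E1 a x : lin a (fun j => c j * x (phi j)) =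
    lin (fun i => \sum_(j | phi j == i) (a j * c j)) x.
  by rewrite lin_partition; apply: eq_bigr => j _; rewrite mulrA.
have E2 a : quad (fun j k => c j * c k * C (phi j) (phi k)) a =
    quad C (fun i => \sum_(j | phi j == i) (a j * c j)).
  rewrite quad_partition; apply: eq_bigr => j _.
  rewrite /lin -mulrA; congr (_ * _); rewrite big_distrr /=.
  by apply: eq_bigr => k _; ring.
split.
- by move=> j; apply: measurable_funM => //; exact: measurable_cst.
- by move=> a; rewrite E2.
- move=> a A mA; rewrite E2 -lX //; congr (P _).
  by apply/seteqP; split => o /=; rewrite (E1 a (X^~ o)).
Qed.

End on_space.

(** By Tonelli the inner integral is a Gaussian integral of a translate, and what remains is the
    convolution of two one-dimensional laws. With the index maps and coefficients free, this covers
    the edges of a tree, independent copies of a subtree and the mixtures used in the comparison. *)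
Lemma isG_prod d1 d2 (T1 : measurableType d1) (T2 : measurableType d2)
    (P1 : probability T1 R) (P2 : probability T2 R) (I1 I2 J : finType)
    (X1 : I1 -> T1 -> R) (X2 : I2 -> T2 -> R) C1 C2
    (f1 : J -> I1) (f2 : J -> I2) (c1 c2 : J -> R) :
  isG P1 X1 C1 -> isG P2 X2 C2 ->
  isG (P1 \x P2)%E (fun j (p : T1 * T2) => c1 j * X1 (f1 j) p.1 + c2 j * X2 (f2 j) p.2)
    (fun j k => c1 j * c1 k * C1 (f1 j) (f1 k) + c2 j * c2 k * C2 (f2 j) (f2 k)).
Proof.
move=> G1 G2; have G1' := isG_map G1 f1 c1; have G2' := isG_map G2 f2 c2.
set Y1 := fun j o => c1 j * X1 (f1 j) o; set Y2 := fun j o => c2 j * X2 (f2 j) o.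
have [m1 D1 l1] := G1'; have [m2 D2 l2] := G2'.
set D := (D in isG _ _ D).
have EQ a : quad D a = quad (fun j k => c1 j * c1 k * C1 (f1 j) (f1 k)) a +
    quad (fun j k => c2 j * c2 k * C2 (f2 j) (f2 k)) a.
  rewrite /quad /lin -big_split /=; apply: eq_bigr => j _.
  rewrite -mulrDr -big_split /=; congr (_ * _); apply: eq_bigr => k _.
  by rewrite -mulrDr.
split.
- move=> j; apply: measurable_funD.
    by apply: (measurableT_comp (m1 j)).
  by apply: (measurableT_comp (m2 j)).
- by move=> a; rewrite EQ addr_ge0.
- move=> a A mA; rewrite EQ.
  have mh : measurable_fun [set: R] (fun x => (\1_A x)%:E : \bar R).
    by apply/measurable_EFinP; exact: measurable_indic.
  have h0 (x : R) : (0 <= ((\1_A x)%:E : \bar R))%E by rewrite lee_fin.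
  set g := fun p : T1 * T2 => (\1_A (lin a (Y1^~ p.1) + lin a (Y2^~ p.2)))%:E : \bar R.
  have mg : measurable_fun setT g.
    apply: (measurableT_comp mh); apply: measurable_funD.
      exact: (measurableT_comp (isG_measurable_lin G1' a)).
    exact: (measurableT_comp (isG_measurable_lin G2' a)).
  have mgA : measurable (g @^-1` [set 1%:E]%E).
    by rewrite -[X in measurable X]setTI; apply: mg.
  have gA : (fun p : T1 * T2 => lin a (fun j => c1 j * X1 (f1 j) p.1 + c2 j * X2 (f2 j) p.2))
      @^-1` A = g @^-1` [set 1%:E]%E.
    have E p : lin a (fun j => c1 j * X1 (f1 j) p.1 + c2 j * X2 (f2 j) p.2) =
        lin a (Y1^~ p.1) + lin a (Y2^~ p.2).
      by rewrite /lin -big_split /=; apply: eq_bigr => j _; rewrite mulrDr.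
    apply/seteqP; split => p /=; rewrite E /g indicE; first by move=> /mem_set ->.
    by case: (boolP (_ \in A)) => [/set_mem //|_ [/esym/eqP]]; rewrite oner_eq0.
  transitivity ((P1 \x P2)%E (g @^-1` [set 1%:E]%E)); first by rewrite -gA.
  have -> : (P1 \x P2)%E (g @^-1` [set 1%:E]%E) = (\int[P1 \x P2]_p g p)%E.
    rewrite -[in LHS](setIT (g @^-1` _)) -integral_indic //.
    apply: eq_integral => p _; rewrite /g /= !indicE.
    case: (boolP (_ \in A)) => hA; first by rewrite mem_set //= /g indicE hA.
    rewrite memNset //= /g indicE (negbTE hA) => -[/esym/eqP].
    by rewrite oner_eq0.
  rewrite fubini_tonelli1; [|exact: mg|by move=> p; rewrite lee_fin].
  pose h (x : R) : \bar R := (\1_A x)%:E.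
  set q1 := quad _ a; set q2 := quad _ a.
  have inner x : (\int[P2]_y g (x, y) =
      \int[gaussP q2]_z h (lin a (Y1^~ x) + z)%R)%E.
    rewrite -(@isG_ge0_integral _ _ _ _ _ _ G2' a (fun z => h (lin a (Y1^~ x) + z)%R)).
    - by apply: eq_integral => y _.
    - exact: measurable_shift_fun.
    - by move=> y; exact: h0.
  pose k (x : R) := (\int[gaussP q2]_z h (x + z)%R)%E.
  transitivity (\int[P1]_x k (lin a (Y1^~ x)))%E.
    by apply: eq_integral => x _; exact: inner.
  rewrite (@isG_ge0_integral _ _ _ _ _ _ G1' a k); last 2 first.
  - apply: (@measurable_fun_fubini_tonelli_F _ _ _ _ _ (gaussP q2) (fun p : R * R => h (p.1 + p.2)%R)).
      by apply: measurableT_comp => //; exact: measurable_funD.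
    by move=> p; exact: h0.
  - by move=> x; apply: integral_ge0 => z _; exact: h0.
  rewrite gaussP_conv; [|exact: D1|exact: D2|exact: mh|exact: h0].
  by rewrite integral_indic // setIT.
Qed.

End gaussian_fields.

(** * Gaussian fields with equal covariances have the same law *)

Section smooth_sign.
Context {R : realType}.

(* Its iterates are polynomials that converge on [-1, 1] to the sign function, so
   that an algebra containing [sin] yields [Num.sg \o sin] in the limit. *)
Definition cubic_step (y : R) : R := 3 / 2 * y - y ^+ 3 / 2.

Lemma cubic_step_itv (y : R) : 0 <= y <= 1 -> 0 <= cubic_step y <= 1.
Proof.
move=> /andP[y0 y1]; rewrite /cubic_step; apply/andP; split; first by nra.
have : 0 <= (1 - y) ^+ 2 * (2 + y) by rewrite mulr_ge0 ?sqr_ge0 //; lra.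
nra.
Qed.

Lemma iter_cubic_itv k (y : R) : 0 <= y <= 1 -> 0 <= iter k cubic_step y <= 1.
Proof. by move=> h; elim: k => [//|k ih]; rewrite iterS cubic_step_itv. Qed.

Lemma iter_cubicN k (y : R) : iter k cubic_step (- y) = - iter k cubic_step y.
Proof. by elim: k => [//|k ih]; rewrite !iterS ih /cubic_step; ring. Qed.

Lemma norm_iter_cubic k (y : R) : `|y| <= 1 -> `|iter k cubic_step y| <= 1.
Proof.
move=> y1; wlog y0 : y y1 / 0 <= y.
  move=> h; case: (leP 0 y) => [/h ->//|/ltW y0].
  by rewrite -[y]opprK iter_cubicN normrN; apply: h; rewrite ?normrN // oppr_ge0.
have /andP[h0 h1] : 0 <= iter k cubic_step y <= 1.
  by apply: iter_cubic_itv; rewrite y0 -(ger0_norm y0).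
by rewrite ger0_norm.
Qed.

Lemma iter_cubic_cvg (y : R) : `|y| <= 1 ->
  iter k cubic_step y @[k --> \oo] --> Num.sg y.
Proof.
move=> y1; wlog y0 : y y1 / 0 <= y.
  move=> h; case: (leP 0 y) => [y0|/ltW y0]; first exact: h.
  rewrite -[y]opprK sgrN; under eq_fun do rewrite iter_cubicN.
  by apply: cvgN; apply: h; rewrite ?normrN // oppr_ge0.
move: y0; rewrite le_eqVlt => /predU1P[<-|y0].
  rewrite sgr0; apply: cvg_near_cst; apply: nearW => k.
  by elim: k => [//|k ih]; rewrite iterS ih /cubic_step; ring.
rewrite gtr0_sg //; rewrite gtr0_norm // in y1.
(* The iterates stay above y, and 1 - z is multiplied at each step by 1 - (z + z^2) / 2, which is at
   most 1 - y / 2. *)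
have b k : y <= iter k cubic_step y <= 1 /\ 1 - iter k cubic_step y <= (1 - y / 2) ^+ k.
  elim: k => [|k [/andP[h1 h2] h3]].
    by rewrite expr0 /= lexx y1; split => //; lra.
  have /cubic_step_itv/andP[g0 g1] : 0 <= iter k cubic_step y <= 1 by apply/andP; split; lra.
  rewrite iterS; set z := iter k _ _ in h1 h2 h3 g0 g1 *.
  have e : cubic_step z - z = z * (1 - z) * (1 + z) / 2 by rewrite /cubic_step; field.
  have p : 0 <= z * (1 - z) * (1 + z) / 2 by rewrite divr_ge0 // !mulr_ge0 //; lra.
  split; first by apply/andP; split => //; lra.
  have -> : 1 - cubic_step z = (1 - (z + z ^+ 2) / 2) * (1 - z).
    by rewrite /cubic_step; field.
  rewrite [leRHS]exprS; apply: ler_pM => //; nra.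
apply/cvgrPdist_le => e e0.
have c : (1 - y / 2) ^+ k @[k --> \oo] --> (0 : R).
  by apply: cvg_expr; rewrite ger0_norm; lra.
near=> k; have [/andP[h1 h2] h3] := b k.
rewrite ger0_norm ?subr_ge0 //; apply: le_trans h3 _.
have : `|0 - (1 - y / 2) ^+ k| <= e by near: k; exact: cvgr_dist_le.
by rewrite sub0r normrN; apply: le_trans; exact: ler_norm.
Unshelve. all: end_near. Qed.

Lemma sg_sin_cvg (x : R) : Num.sg (sin (x / k.+1%:R)) @[k --> \oo] --> Num.sg x.
Proof.
wlog x0 : x / 0 <= x.
  move=> h; case: (leP 0 x) => [x0|/ltW x0]; first exact: h.
  rewrite -[x]opprK sgrN; under eq_fun do rewrite mulNr sinN sgrN.
  by apply: cvgN; apply: h; rewrite oppr_ge0.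
move: x0; rewrite le_eqVlt => /predU1P[<-|x0].
  by apply: cvg_near_cst; apply: nearW => k; rewrite mul0r sin0.
apply: cvg_near_cst; near=> k; rewrite !gtr0_sg // sin_gt0_pi //.
rewrite divr_gt0 //= ltr_pdivrMr //.
rewrite mulrC -ltr_pdivrMr ?pi_gt0 //.
have : x / pi <= k%:R by near: k; exact: nbhs_infty_ger.
by move=> /le_lt_trans; apply; rewrite ltr_nat.
Unshelve. all: end_near. Qed.

End smooth_sign.

Section cramer_wold.
Context {R : realType} d1 d2 (T1 : measurableType d1) (T2 : measurableType d2).
Variables (P : probability T1 R) (Q : probability T2 R) (I : finType).
Variables (X : I -> T1 -> R) (Y : I -> T2 -> R).
Hypotheses (mX : forall i, measurable_fun setT (X i))
           (mY : forall i, measurable_fun setT (Y i)).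
Hypothesis XY : forall a b, \int[P]_o cos (lin a (X^~ o) + b) =
                            \int[Q]_o cos (lin a (Y^~ o) + b).

(* Starting from the equality of the characteristic functions, the multipliers
   [cw_adm] of the class [cw_good] form an algebra that is stable under bounded
   limits and contains the cosines, hence also the indicators of intervals; a
   Lipschitz function is then a limit of step functions on a grid. *)
Definition cw_good (r : (I -> R) -> R) : Prop :=
  [/\ measurable_fun setT (fun o => r (X^~ o)),
      measurable_fun setT (fun o => r (Y^~ o)),
      exists M, forall x, `|r x| <= M
    & forall a b, \int[P]_o (r (X^~ o) * cos (lin a (X^~ o) + b)) =
                  \int[Q]_o (r (Y^~ o) * cos (lin a (Y^~ o) + b))].

Definition cw_adm (i : I) (f : R -> R) : Prop :=
  [/\ measurable_fun setT f, exists M, forall x, `|f x| <= M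
    & forall r, cw_good r -> cw_good (fun x => f (x i) * r x)].

Let mcos d (T : measurableType d) (Z : I -> T -> R) a b :
  (forall i, measurable_fun setT (Z i)) ->
  measurable_fun setT (fun o => cos (lin a (Z^~ o) + b)).
Proof.
move=> mZ; apply: measurableT_comp; first exact: continuous_measurable_fun (@continuous_cos R).
apply: measurable_funD => //; apply: measurable_sum => i.
by apply: measurable_funM => //; exact: measurable_cst.
Qed.

Let itg_rcos d (T : measurableType d) (S : probability T R) (Z : I -> T -> R) (r : (I -> R) -> R) a b :
  (forall i, measurable_fun setT (Z i)) ->
  measurable_fun setT (fun o => r (Z^~ o)) -> (exists M, forall x, `|r x| <= M) ->
  itg S (fun o => r (Z^~ o) * cos (lin a (Z^~ o) + b)).
Proof.
move=> mZ mr [M rM]; apply: (@itg_bounded _ _ _ _ _ M).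
  by apply: measurable_funM => //; exact: mcos.
move=> o; rewrite normrM -[leRHS]mulr1; apply: ler_pM => //.
by rewrite ler_norml cos_geN1 cos_le1.
Qed.

Lemma cw_good1 : cw_good (fun=> 1).
Proof.
split; [exact: measurable_cst|exact: measurable_cst| |].
- by exists 1 => x; rewrite normr1.
- by move=> a b; under eq_Rintegral do rewrite mul1r;
    under [RHS]eq_Rintegral do rewrite mul1r; exact: XY.
Qed.

Lemma cw_goodD r1 r2 : cw_good r1 -> cw_good r2 -> cw_good (fun x => r1 x + r2 x).
Proof.
move=> [a1 b1 M1 e1] [a2 b2 M2 e2]; split.
- exact: measurable_funD.
- exact: measurable_funD.
- case: M1 M2 => M1 h1 [M2 h2]; exists (M1 + M2) => x.
  by rewrite (le_trans (ler_normD _ _)) // lerD.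
- move=> a b; under eq_Rintegral do rewrite mulrDl.
  under [RHS]eq_Rintegral do rewrite mulrDl.
  by rewrite !RintegralD // ?e1 ?e2 //; exact: itg_rcos.
Qed.

Lemma cw_goodZ c r : cw_good r -> cw_good (fun x => c * r x).
Proof.
move=> [a1 b1 M1 e1]; split.
- by apply: measurable_funM => //; exact: measurable_cst.
- by apply: measurable_funM => //; exact: measurable_cst.
- case: M1 => M1 h1; exists (`|c| * M1) => x.
  by rewrite normrM ler_wpM2l.
- move=> a b; under eq_Rintegral do rewrite -mulrA.
  under [RHS]eq_Rintegral do rewrite -mulrA.
  by rewrite !RintegralZl // ?e1 //; exact: itg_rcos.
Qed.

Lemma cw_admD i f g : cw_adm i f -> cw_adm i g -> cw_adm i (fun x => f x + g x).
Proof.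
move=> [mf [M fM] hf] [mg [N gN] hg]; split.
- exact: measurable_funD.
- by exists (M + N) => x; rewrite (le_trans (ler_normD _ _)) // lerD.
- move=> r rg; have := cw_goodD (hf _ rg) (hg _ rg).
  by under eq_fun do rewrite -mulrDl.
Qed.

Lemma cw_admZ i c f : cw_adm i f -> cw_adm i (fun x => c * f x).
Proof.
move=> [mf [M fM] hf]; split.
- by apply: measurable_funM => //; exact: measurable_cst.
- by exists (`|c| * M) => x; rewrite normrM ler_wpM2l.
- move=> r rg; have := cw_goodZ c (hf _ rg).
  by under eq_fun do rewrite mulrA.
Qed.

Lemma cw_admM i f g : cw_adm i f -> cw_adm i g -> cw_adm i (fun x => f x * g x).
Proof.
move=> [mf [M fM] hf] [mg [N gN] hg]; split.
- exact: measurable_funM.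
- by exists (M * N) => x; rewrite normrM ler_pM.
- move=> r rg; have := hf _ (hg _ rg).
  by under eq_fun do rewrite mulrA.
Qed.

Lemma cw_adm_cos i al be : cw_adm i (fun x => cos (al * x + be)).
Proof.
have mc : measurable_fun [set: R] (fun x => cos (al * x + be)).
  apply: measurableT_comp; first exact: continuous_measurable_fun (@continuous_cos R).
  by apply: measurable_funD => //; apply: measurable_funM => //; exact: measurable_cst.
have c1 (x : R) : `|cos x| <= 1 by rewrite ler_norml cos_geN1 cos_le1.
split => //; first by exists 1.
move=> r [m1 m2 [M rM] e]; split.
- by apply: measurable_funM => //; exact: measurableT_comp mc (mX i).
- by apply: measurable_funM => //; exact: measurableT_comp mc (mY i).
- by exists M => x; rewrite normrM -[M]mul1r ler_pM.
- move=> a b.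
  (* A product of two cosines is a sum of two cosines, whose linear forms differ from [a] only at
     the coordinate [i]. *)
  pose ap := fun j => a j + al * (j == i)%:R; pose am := fun j => a j - al * (j == i)%:R.
  have lp x : lin ap x = lin a x + al * x i.
    rewrite -(lin_delta i x) /lin big_distrr -big_split /=.
    by apply: eq_bigr => j _; rewrite /ap mulrDl mulrA.
  have lm x : lin am x = lin a x - al * x i.
    rewrite -(lin_delta i x) /lin big_distrr -sumrB /=.
    by apply: eq_bigr => j _; rewrite /am mulrBl mulrA.
  have key x : cos (al * x i + be) * r x * cos (lin a x + b) =
     2^-1 * (r x * cos (lin ap x + (b + be))) + 2^-1 * (r x * cos (lin am x + (b - be))).
    rewrite lp lm.
    have -> : lin a x + al * x i + (b + be) = (lin a x + b) + (al * x i + be) by ring.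
    have -> : lin a x - al * x i + (b - be) = (lin a x + b) - (al * x i + be) by ring.
    by move: (lin a x + b) (al * x i + be) => v u; rewrite cosD cosB; field.
  under eq_Rintegral do rewrite key.
  under [RHS]eq_Rintegral do rewrite key.
  have ex : exists M, forall x, `|r x| <= M by exists M.
  rewrite !RintegralD //; try (by apply: itgZ; exact: itg_rcos).
  by rewrite !RintegralZl // ?e //; exact: itg_rcos.
Qed.

Lemma cw_adm_lim i (f_ : nat -> R -> R) f : (forall k, cw_adm i (f_ k)) ->
  (forall k x, `|f_ k x| <= 1) -> (forall x, f_ k x @[k --> \oo] --> f x) ->
  cw_adm i f.
Proof.
move=> hf b cf.
have mf : measurable_fun setT f.
  apply: (@measurable_fun_cvg _ _ _ _ f_) => [k|x _]; first by case: (hf k).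
  exact: cf.
have bf x : `|f x| <= 1.
  have c : `|f_ k x| @[k --> \oo] --> `|f x| by apply: cvg_norm; exact: cf.
  rewrite -(cvg_lim (@Rhausdorff R) c).
  apply: limr_le; first by apply/cvg_ex; exists `|f x|.
  by apply: nearW => k; exact: b.
split => //; first by exists 1.
move=> r rg; have [m1 m2 [M rM] e] := rg; split.
- by apply: measurable_funM => //; exact: measurableT_comp mf (mX i).
- by apply: measurable_funM => //; exact: measurableT_comp mf (mY i).
- by exists M => x; rewrite normrM -[M]mul1r ler_pM.
- move=> a c.
  have L d (T : measurableType d) (S : probability T R) (Z : I -> T -> R) :
      (forall i, measurable_fun setT (Z i)) ->
      measurable_fun setT (fun o => r (Z^~ o)) ->
      \int[S]_o (f_ k (Z i o) * r (Z^~ o) * cos (lin a (Z^~ o) + c)) @[k --> \oo] -->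
      \int[S]_o (f (Z i o) * r (Z^~ o) * cos (lin a (Z^~ o) + c)).
    move=> mZ mr; apply: (@Rintegral_cvg _ _ _ _ _ _ (cst M)).
    - move=> k; apply: measurable_funM; last exact: mcos.
      by apply: measurable_funM => //; case: (hf k) => mk _ _; exact: measurableT_comp mk (mZ i).
    - apply: measurable_funM; last exact: mcos.
      by apply: measurable_funM => //; exact: measurableT_comp mf (mZ i).
    - by move=> o; apply: cvgM; last exact: cvg_cst; apply: cvgM; [exact: cf|exact: cvg_cst].
    - exact: itg_cst.
    - move=> k o; rewrite normrM -[leRHS]mulr1; apply: ler_pM => //.
        by rewrite normrM -[M]mul1r ler_pM.
      by rewrite ler_norml cos_geN1 cos_le1.
  have LX := L _ _ P X mX m1; have LY := L _ _ Q Y mY m2.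
  have E : (fun k => \int[P]_o (f_ k (X i o) * r (X^~ o) * cos (lin a (X^~ o) + c))) =
           (fun k => \int[Q]_o (f_ k (Y i o) * r (Y^~ o) * cos (lin a (Y^~ o) + c))).
    by apply/funext => k; case: (hf k) => _ _ /(_ r rg) [_ _ _ ->].
  by rewrite E in LX; exact: (cvg_unique (@Rhausdorff R) LX LY).
Qed.

(** Two successive limits: the iterates of [cubic_step] turn the sine into its sign, and stretching
    the period pushes the unwanted sign changes to infinity. *)
Lemma cw_adm_sg i s : cw_adm i (fun x => Num.sg (x - s)).
Proof.
apply: (@cw_adm_lim _ (fun k x => Num.sg (sin ((x - s) / k.+1%:R)))); last 2 first.
- by move=> k x; rewrite normr_sg; case: eqP.
- by move=> x; exact: sg_sin_cvg.
move=> k.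
apply: (@cw_adm_lim _ (fun n x => iter n cubic_step (sin ((x - s) / k.+1%:R)))); last 2 first.
- by move=> n x; apply: norm_iter_cubic; rewrite ler_norml sin_geN1 sin_le1.
- by move=> x; apply: iter_cubic_cvg; rewrite ler_norml sin_geN1 sin_le1.
elim=> [|n ih].
  have := cw_adm_cos i k.+1%:R^-1 (- (s / k.+1%:R) - pi / 2).
  congr cw_adm; apply/funext => x /=.
  rewrite addrA cosB cos_pihalf sin_pihalf mulr0 add0r mulr1.
  by congr sin; field.
have h3 := cw_admM (cw_admM ih ih) ih.
have := cw_admD (cw_admZ (3 / 2) ih) (cw_admZ (- 2^-1) h3).
congr cw_adm; apply/funext => x; rewrite iterS /cubic_step.
by rewrite !exprS expr0 mulr1; ring.
Qed.

(** (sg + sg^2) / 2 is 1 on positive numbers and 0 on negative ones, and also 0 at 0, as the strict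
    inequality requires. *)
Lemma cw_adm_gt i s : cw_adm i (fun x => (s < x)%R%:R).
Proof.
have h := cw_adm_sg i s.
have := cw_admD (cw_admZ 2^-1 h) (cw_admZ 2^-1 (cw_admM h h)).
congr cw_adm; apply/funext => x.
have [xs|xs|->] := ltgtP s x.
- by rewrite gtr0_sg ?subr_gt0 // mulr1n; field.
- by rewrite ltr0_sg ?subr_lt0 // mulr0n; ring.
- by rewrite subrr sgr0 !mulr0 addr0.
Qed.

Definition boxf (s t x : R) : R := (s < x)%R%:R - (t < x)%R%:R.

Lemma cw_adm_box i s t : cw_adm i (boxf s t).
Proof.
have := cw_admD (cw_adm_gt i s) (cw_admZ (-1) (cw_adm_gt i t)).
by congr cw_adm; apply/funext => x; rewrite mulN1r.
Qed.

Lemma cw_good_prod (f : I -> R -> R) : (forall i, cw_adm i (f i)) ->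
  cw_good (fun x => \prod_i f i (x i)).
Proof.
move=> hf; elim: (index_enum I) => [|i s ih].
  by under eq_fun do rewrite big_nil; exact: cw_good1.
under eq_fun do rewrite big_cons.
by case: (hf i) => _ _; exact.
Qed.

Lemma boxf_ge0 s t x : s <= t -> 0 <= boxf s t x.
Proof.
move=> st; rewrite /boxf subr_ge0 ler_nat.
by case: (ltP t x) => // tx; rewrite (le_lt_trans st tx).
Qed.

Lemma boxf_neq0 s t x : boxf s t x != 0 -> s <= t -> s < x <= t.
Proof.
rewrite /boxf => + st; case: (ltP t x) => tx; first by rewrite (le_lt_trans st tx) subrr eqxx.
by case: (ltP s x) => //; rewrite subrr eqxx.
Qed.

(** As m grows, the mesh 1 / (m + 1) tends to 0 while the grid exhausts the line from - (m + 1) to m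
    + 1; this takes 2 (m + 1)^2 cells. *)
Definition gridpt m (j : nat) : R := j%:R / m.+1%:R - m.+1%:R.

Lemma sum_boxf_grid m x :
  \sum_(j < 2 * m.+1 * m.+1) boxf (gridpt m j) (gridpt m j.+1) x =
  boxf (- m.+1%:R) m.+1%:R x.
Proof.
rewrite -(big_mkord xpredT (fun j => boxf (gridpt m j) (gridpt m j.+1) x)).
under eq_bigr do rewrite /boxf -opprB.
rewrite sumrN telescope_sumr // opprB /boxf.
have -> : gridpt m (2 * m.+1 * m.+1) = m.+1%:R.
  by rewrite /gridpt natrM mulfK ?pnatr_eq0 // natrM; ring.
by rewrite /gridpt mul0r add0r.
Qed.

Lemma gridpt_le m j : gridpt m j <= gridpt m j.+1.
Proof. by rewrite lerD2r ler_pM2r ?invr_gt0 // ler_nat. Qed.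

Lemma gridptS m j : gridpt m j.+1 = gridpt m j + m.+1%:R^-1.
Proof. by rewrite /gridpt -natr1 mulrDl div1r addrAC. Qed.

Section lipschitz.
Variable f : (I -> R) -> R.
Hypothesis fL : forall x y, `|f x - f y| <= \sum_i `|x i - y i|.

Definition gridf m (x : I -> R) : R :=
  \sum_(k : {ffun I -> 'I_(2 * m.+1 * m.+1)})
    f (fun i => gridpt m (k i)) *
    \prod_i boxf (gridpt m (k i)) (gridpt m (k i).+1) (x i).

Lemma cw_good_gridf m : cw_good (gridf m).
Proof.
rewrite /gridf; elim: (index_enum _) => [|k s ih].
  under eq_fun do rewrite big_nil.
  have := cw_goodZ 0 cw_good1.
  by congr cw_good; apply/funext => x; rewrite mul0r.
under eq_fun do rewrite big_cons.
apply: cw_goodD => //; apply: cw_goodZ.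
by apply: (@cw_good_prod (fun i => boxf (gridpt m (k i)) (gridpt m (k i).+1))) => i; exact: cw_adm_box.
Qed.

Let cutf m (x : I -> R) : R := \prod_i boxf (- m.+1%:R) m.+1%:R (x i).

Lemma gridf_close m x : `|gridf m x - f x * cutf m x| <= #|I|%:R / m.+1%:R.
Proof.
have E : cutf m x = \sum_(k : {ffun I -> 'I_(2 * m.+1 * m.+1)})
    \prod_i boxf (gridpt m (k i)) (gridpt m (k i).+1) (x i).
  by rewrite /cutf; under eq_bigr do rewrite -sum_boxf_grid; rewrite bigA_distr_bigA.
have c1 : cutf m x <= 1.
  apply: prodr_ile1 => i _; rewrite boxf_ge0 /=; last by rewrite (@le_trans _ _ 0) // oppr_le0.
  rewrite /boxf lerBlDr (@le_trans _ _ 1) // ?lerDl //.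
  by rewrite -[1]/(true%:R) ler_nat; case: (_ < _).
apply: (@le_trans _ _ (#|I|%:R / m.+1%:R * cutf m x)); last first.
  by rewrite ler_piMr // divr_ge0.
rewrite E /gridf !mulr_sumr -sumrB; apply: (le_trans (ler_norm_sum _ _ _)).
apply: ler_sum => k _; rewrite -mulrBl normrM.
have p0 : 0 <= \prod_i boxf (gridpt m (k i)) (gridpt m (k i).+1) (x i).
  by apply: prodr_ge0 => i _; apply: boxf_ge0; exact: gridpt_le.
rewrite [X in _ * X]ger0_norm //.
have [->|nz] := eqVneq (\prod_i boxf (gridpt m (k i)) (gridpt m (k i).+1) (x i)) 0.
  by rewrite !mulr0.
apply: ler_wpM2r => //; apply: (le_trans (fL _ _)).
apply: (@le_trans _ _ (\sum_(i : I) m.+1%:R^-1)); last first.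
  by rewrite sumr_const [leRHS]mulr_natl.
apply: ler_sum => i _.
have /boxf_neq0 : boxf (gridpt m (k i)) (gridpt m (k i).+1) (x i) != 0.
  by move: nz; rewrite (bigD1 i) //= mulf_eq0 negb_or => /andP[].
move=> /(_ (gridpt_le _ _))/andP[]; rewrite gridptS => h1 h2.
by rewrite distrC ger0_norm ?subr_ge0 ?(ltW h1) // lerBlDl.
Qed.

Lemma cutf_cvg x : cutf m x @[m --> \oo] --> (1 : R).
Proof.
apply: cvg_near_cst; near=> m; rewrite /cutf big1 // => i _.
have : \sum_i `|x i| < m.+1%:R.
  have : \sum_i `|x i| <= m%:R by near: m; exact: nbhs_infty_ger.
  by move=> /le_lt_trans; apply; rewrite ltr_nat.
rewrite (bigD1 i) //= => h.
have : `|x i| < m.+1%:R.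
  by apply: le_lt_trans h; rewrite lerDl sumr_ge0.
rewrite ltr_norml => /andP[h1 h2].
by rewrite /boxf h1 (lt_gtF h2) subr0.
Unshelve. all: end_near. Qed.

Lemma gridf_cvg x : gridf m x @[m --> \oo] --> f x.
Proof.
have c0 : (gridf m x - f x * cutf m x) @[m --> \oo] --> (0 : R).
  apply/cvgr0Pnorm_le => e e0; near=> m.
  apply: (le_trans (gridf_close m x)); rewrite ler_pdivrMr // mulrC -ler_pdivrMr //.
  have : #|I|%:R / e <= m%:R by near: m; exact: nbhs_infty_ger.
  by move=> /le_trans; apply; rewrite ler_nat.
have : (gridf m x - f x * cutf m x) + f x * cutf m x @[m --> \oo] --> 0 + f x * 1.
  by apply: cvgD => //; apply: cvgM; [exact: cvg_cst|exact: cutf_cvg].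
by rewrite add0r mulr1; under eq_fun do rewrite subrK.
Unshelve. all: end_near. Qed.

Lemma gridf_bound m x : `|gridf m x| <= `|f (fun=> 0)| + \sum_i `|x i| + #|I|%:R.
Proof.
have h1 := gridf_close m x.
have h2 : #|I|%:R / m.+1%:R <= #|I|%:R :> R by rewrite ler_piMr // invf_le1 ?ler1n.
have h3 : `|f x| <= `|f (fun=> 0)| + \sum_i `|x i|.
  have := fL x (fun=> 0); under eq_bigr do rewrite subr0.
  move=> h; have -> : f x = f (fun=> 0) + (f x - f (fun=> 0)) by ring.
  by apply: (le_trans (ler_normD _ _)); rewrite lerD2l.
have c0 : 0 <= cutf m x.
  by apply: prodr_ge0 => i _; apply: boxf_ge0; rewrite (@le_trans _ _ 0) // oppr_le0.
have c1 : cutf m x <= 1.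
  apply: prodr_ile1 => i _; rewrite boxf_ge0 /=; last by rewrite (@le_trans _ _ 0) // oppr_le0.
  rewrite /boxf lerBlDr (@le_trans _ _ 1) // ?lerDl //.
  by rewrite -[1]/(true%:R) ler_nat; case: (_ < _).
have -> : gridf m x = f x * cutf m x + (gridf m x - f x * cutf m x) by ring.
apply: (le_trans (ler_normD _ _)); apply: lerD; last exact: le_trans h1 h2.
apply: le_trans h3; rewrite normrM [X in _ * X]ger0_norm //.
by rewrite ler_piMr.
Qed.

Lemma measurable_lipschitz d (T : measurableType d) (Z : I -> T -> R) :
  (forall m, measurable_fun setT (fun o => gridf m (Z^~ o))) ->
  measurable_fun setT (fun o => f (Z^~ o)).
Proof.
move=> h; apply: (@measurable_fun_cvg _ _ _ _ (fun m o => gridf m (Z^~ o))) => // o _.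
exact: gridf_cvg.
Qed.

Theorem cramer_wold_lipschitz :
  (forall i, itg P (X i)) -> (forall i, itg Q (Y i)) ->
  \int[P]_o f (X^~ o) = \int[Q]_o f (Y^~ o).
Proof.
move=> iX iY.
have L d (T : measurableType d) (S : probability T R) (Z : I -> T -> R) :
    (forall i, itg S (Z i)) ->
    (forall m, measurable_fun setT (fun o => gridf m (Z^~ o))) ->
    \int[S]_o gridf m (Z^~ o) @[m --> \oo] --> \int[S]_o f (Z^~ o).
  move=> iZ mg.
  apply: (@Rintegral_cvg _ _ _ _ _ _ (fun o => `|f (fun=> 0)| + \sum_i `|Z i o| + #|I|%:R)).
  - exact: mg.
  - exact: measurable_lipschitz.
  - by move=> o; exact: gridf_cvg.
  - apply: itgD; last exact: itg_cst; apply: itgD; first exact: itg_cst.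
    by apply: itg_sum => i; exact: itg_norm.
  - by move=> m o; exact: gridf_bound.
have gX m : measurable_fun setT (fun o => gridf m (X^~ o)) by case: (cw_good_gridf m).
have gY m : measurable_fun setT (fun o => gridf m (Y^~ o)) by case: (cw_good_gridf m).
have LX := L _ _ P X iX gX; have LY := L _ _ Q Y iY gY.
have E : (fun m => \int[P]_o gridf m (X^~ o)) = (fun m => \int[Q]_o gridf m (Y^~ o)).
  (* Tested with the cosine of 0, membership in [cw_good] is equality of plain expectations. *)
  apply/funext => m; case: (cw_good_gridf m) => _ _ _ /(_ (fun=> 0) 0).
  have l0 x : lin (fun=> 0) x + 0 = 0 :> R by rewrite addr0 /lin big1 // => i _; rewrite mul0r.
  under eq_Rintegral do rewrite l0 cos0 mulr1.
  by under [RHS]eq_Rintegral do rewrite l0 cos0 mulr1.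
by rewrite E in LX; exact: (cvg_unique (@Rhausdorff R) LX LY).
Qed.

End lipschitz.

End cramer_wold.

(** * Second-order expansion of the soft maximum *)

Section cumulant_expansion.
Context {R : realType} (I : finType).
Variables (p w : I -> R) (M : R).
Hypotheses (p0 : forall i, 0 <= p i) (p1 : \sum_i p i = 1)
  (wM : forall i, `|w i| <= M).

Let m := \sum_i p i * w i.
Let y i := w i - m.
Let V := \sum_i p i * y i ^+ 2.

Let M0 (i : I) : 0 <= M. Proof. exact: le_trans (wM i). Qed.

Let sum_le (f : I -> R) K : (forall i, `|f i| <= K) -> `|\sum_i p i * f i| <= K.
Proof.
move=> fK; apply: (le_trans (ler_norm_sum _ _ _)).
rewrite -[leRHS]mul1r -p1 mulr_suml; apply: ler_sum => i _.
by rewrite normrM ger0_norm // ler_wpM2l.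
Qed.

Let yM i : `|y i| <= 2 * M.
Proof.
rewrite /y (le_trans (ler_normB _ _)) // mulr_natl mulr2n lerD //.
exact: sum_le.
Qed.

Let sum_y : \sum_i p i * y i = 0.
Proof.
rewrite /y; under eq_bigr do rewrite mulrBr.
by rewrite sumrB -mulr_suml p1 mul1r subrr.
Qed.

Let VE : \sum_i \sum_j p i * p j * (w i - w j) ^+ 2 = 2 * V.
Proof.
have E i j : p i * p j * (w i - w j) ^+ 2 =
    p j * (p i * y i ^+ 2) + p i * (p j * y j ^+ 2) - 2 * ((p i * y i) * (p j * y j)).
  by rewrite /y; ring.
under eq_bigr => i _.
  under eq_bigr do rewrite E.
  rewrite sumrB big_split /= -mulr_suml p1 mul1r -!mulr_sumr sum_y !mulr0 subr0.
  over.
by rewrite big_split /= -mulr_suml p1 mul1r -/V; ring.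
Qed.

Let SE : \sum_i p i * expR (w i) = expR m * \sum_i p i * expR (y i).
Proof.
rewrite mulr_sumr; apply: eq_bigr => i _.
by rewrite mulrCA -expRD /y addrC subrK.
Qed.

(** The logarithm of an exponential moment is expanded up to its second cumulant. Half the variance
    is written as a sum over pairs, so that only differences of [w] occur in it. *)
Lemma cumulant_taylor2 (i0 : I) :
  `|ln (\sum_i p i * expR (w i)) - \sum_i p i * w i -
    4^-1 * \sum_i \sum_j p i * p j * (w i - w j) ^+ 2| <= 100 * M ^+ 3.
Proof.
have M0' := M0 i0.
have cE (c : R) : c = \sum_i p i * c by rewrite -mulr_suml p1 mul1r.
have Sb : expR (- (2 * M)) <= \sum_i p i * expR (y i) <= expR (2 * M).
  apply/andP; split.
    rewrite [leLHS]cE; apply: ler_sum => i _.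
    by rewrite ler_wpM2l // ler_expR; have := yM i; rewrite ler_norml => /andP[].
  rewrite [leRHS]cE; apply: ler_sum => i _.
  by rewrite ler_wpM2l // ler_expR; have := yM i; rewrite ler_norml => /andP[].
have S0 : 0 < \sum_i p i * expR (y i).
  by case/andP: Sb => + _; apply: lt_le_trans; exact: expR_gt0.
rewrite SE lnM ?posrE ?expR_gt0 // expRK -/m VE.
set S := \sum_i _ in Sb S0 *.
have V0 : 0 <= V by apply: sumr_ge0 => i _; rewrite mulr_ge0 // sqr_ge0.
have V1 : V <= 4 * M ^+ 2.
  have : `|V| <= (2 * M) ^+ 2.
    by apply: sum_le => i; rewrite normrX lerXn2r ?nnegrE // mulr_ge0.
  rewrite ger0_norm //; lra.
have -> : m + ln S - m - 4^-1 * (2 * V) = ln S - V / 2 by field.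
(* For M > 1/4 each term separately is at most a multiple of M^3; the Taylor expansion is needed
   only for M <= 1/4. *)
case: (leP M 4^-1) => M4; last first.
  have l1 : `|ln S| <= 2 * M.
    rewrite ler_norml; case/andP: Sb => s1 s2.
    by rewrite -ler_expR -[X in _ && X]ler_expR lnK ?posrE // s1 s2.
  have h1 : 2 * M <= 32 * M ^+ 3 by nra.
  have h2 : 2 * M ^+ 2 <= 8 * M ^+ 3 by nra.
  apply: (le_trans (ler_normB _ _)); rewrite [X in _ + X]ger0_norm ?divr_ge0 //.
  lra.
have sE : `|S - 1 - V / 2| <= 8 * M ^+ 3.
  have -> : S - 1 - V / 2 = \sum_i p i * (expR (y i) - 1 - y i - y i ^+ 2 / 2).
    have E i : p i * (expR (y i) - 1 - y i - y i ^+ 2 / 2) =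
      p i * expR (y i) - p i - p i * y i - 2^-1 * (p i * y i ^+ 2) by field.
    rewrite (eq_bigr _ (fun i _ => E i)) !sumrB p1 -mulr_sumr -/V -/S.
    have -> : \sum_i p i * y i = 0 by exact: sum_y.
    by field.
  apply: sum_le => i; apply: le_trans (expR_taylor2 _) _.
    by apply: (le_trans (yM i)); lra.
  have := lerXn2r 3 (_ : `|y i| \in Num.nneg) (_ : 2 * M \in Num.nneg) (yM i).
  rewrite !nnegrE => /(_ (normr_ge0 _)) /(_ (mulr_ge0 (ler0n _ _) M0')).
  by move=> /le_trans; apply; rewrite exprMn; lra.
set s := S - 1 in sE.
have M3 : 8 * M ^+ 3 <= 2 * M ^+ 2 by nra.
have s1 : `|s| <= 4 * M ^+ 2.
  have -> : s = (s - V / 2) + V / 2 by ring.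
  apply: (le_trans (ler_normD _ _)); rewrite [X in _ + X]ger0_norm ?divr_ge0 //.
  lra.
have M2 : 4 * M ^+ 2 <= 4^-1 by nra.
have s2 : - 2^-1 <= s by move: s1; rewrite ler_norml => /andP[? ?]; lra.
have /andP[l1 l2] := ln1D_bounds s2.
have -> : S = 1 + s by rewrite /s; ring.
have ss : s ^+ 2 <= 16 * M ^+ 4.
  have := lerXn2r 2 (_ : `|s| \in Num.nneg) (_ : 4 * M ^+ 2 \in Num.nneg) s1.
  rewrite !nnegrE => /(_ (normr_ge0 _)) /(_ (mulr_ge0 (ler0n _ _) (sqr_ge0 _))).
  by rewrite real_normK ?num_real // exprMn -exprM; lra.
have M4' : 32 * M ^+ 4 <= 8 * M ^+ 3.
  have : 0 <= M ^+ 3 by rewrite exprn_ge0.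
  by rewrite (exprS _ 3); nra.
have M30 : 0 <= M ^+ 3 by rewrite exprn_ge0.
move: sE; rewrite !ler_norml => /andP[e1 e2]; apply/andP; split; lra.
Qed.

End cumulant_expansion.

Section softmax.
Context {R : realType} (I : finType) (i0 : I) (b : R).
Hypothesis b0 : 0 < b.
Implicit Types x y u v : I -> R.

Definition maxf x : R := sup (range x).

Lemma maxfP x : (forall i, x i <= maxf x) /\ exists i, maxf x = x i.
Proof.
have [i _ hi] := @arg_maxP _ _ _ i0 xpredT x isT.
have ub : ubound (range x) (x i) by move=> _ [j _ <-]; exact: hi.
have E : maxf x = x i.
  apply/eqP; rewrite eq_le; apply/andP; split.
    by apply: ge_sup => //; exists (x i0); exists i0.
  by apply: ub_le_sup; [exists (x i)|exists i].
by split; [move=> j; rewrite E; exact: hi|exists i].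
Qed.

(** The maximum and the soft maximum are both monotone and commute with the addition of constants;
    this alone makes them Lipschitz. *)
Lemma shift_lipschitz (f : (I -> R) -> R) :
  (forall x y c, (forall i, x i <= y i + c) -> f x <= f y + c) ->
  forall x y, `|f x - f y| <= \sum_i `|x i - y i|.
Proof.
move=> h x y.
have le i : `|x i - y i| <= \sum_i `|x i - y i|.
  by rewrite [leRHS](bigD1 i) //= lerDl sumr_ge0.
rewrite ler_norml lerBlDl lerBrDl; apply/andP; split.
  rewrite lerBlDr; apply: h => i; have := le i.
  by rewrite ler_norml => /andP[? ?]; lra.
by apply: h => i; have := le i; rewrite ler_norml => /andP[? ?]; lra.
Qed.

Lemma maxf_shift x y c : (forall i, x i <= y i + c) -> maxf x <= maxf y + c.
Proof.
move=> h; have [_ [i ->]] := maxfP x; have [hy _] := maxfP y.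
by apply: le_trans (h i) _; rewrite lerD2r.
Qed.

Definition smax x : R := b^-1 * ln (\sum_i expR (b * x i)).

Lemma sum_expR_gt0 x : 0 < \sum_i expR (b * x i).
Proof.
rewrite (bigD1 i0) //= ltr_pwDl ?expR_gt0 //.
by apply: sumr_ge0 => i _; exact: expR_ge0.
Qed.

Lemma smax_shift x y c : (forall i, x i <= y i + c) -> smax x <= smax y + c.
Proof.
move=> h; rewrite /smax -(ler_pM2l b0) mulrDr !mulrA mulfV ?gt_eqF // !mul1r.
rewrite -ler_expR expRD !lnK ?posrE ?sum_expR_gt0 // mulr_suml.
by apply: ler_sum => i _; rewrite -expRD ler_expR -mulrDr ler_pM2l.
Qed.

Lemma maxf_le_smax x : maxf x <= smax x.
Proof.
have [_ [i ->]] := maxfP x.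
rewrite /smax -(ler_pM2l b0) mulrA mulfV ?gt_eqF // mul1r.
rewrite -ler_expR lnK ?posrE ?sum_expR_gt0 // (bigD1 i) //= lerDl.
by apply: sumr_ge0 => j _; exact: expR_ge0.
Qed.

Lemma smax_le_maxf x : smax x <= maxf x + b^-1 * ln #|I|%:R.
Proof.
have I0 : (0 < #|I|%:R :> R) by rewrite ltr0n; apply/card_gt0P; exists i0.
rewrite /smax -(ler_pM2l b0) mulrDr !mulrA mulfV ?gt_eqF // !mul1r.
rewrite -ler_expR expRD !lnK ?posrE ?sum_expR_gt0 // mulr_natr.
rewrite -sumr_const; apply: ler_sum => i _.
by rewrite ler_expR ler_pM2l //; have [] := maxfP x.
Qed.

(** The gradient of the soft maximum at [u], a probability vector. *)
Definition gibbs u i : R := expR (b * u i) / \sum_j expR (b * u j).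

Lemma gibbs_ge0 u i : 0 <= gibbs u i.
Proof. by rewrite divr_ge0 ?expR_ge0 // ltW ?sum_expR_gt0. Qed.

Lemma sum_gibbs u : \sum_i gibbs u i = 1.
Proof. by rewrite -mulr_suml mulfV // gt_eqF ?sum_expR_gt0. Qed.

(** The second-order term sees [v] only through differences, because adding a constant to [v] shifts
    the soft maximum exactly. This is why the comparison concerns increments of the fields rather
    than their covariances. *)
Lemma smax_taylor2 u v :
  `|smax (fun i => u i + v i) - smax u - \sum_i gibbs u i * v i -
    b / 4 * \sum_i \sum_j gibbs u i * gibbs u j * (v i - v j) ^+ 2| <=
  100 * b ^+ 2 * (\sum_i `|v i|) ^+ 3.
Proof.
have vM i : `|b * v i| <= b * \sum_i `|v i|.
  rewrite normrM gtr0_norm // ler_pM2l // [leRHS](bigD1 i) //= lerDl.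
  by apply: sumr_ge0.
have := cumulant_taylor2 (gibbs_ge0 u) (sum_gibbs u) vM i0.
set S := \sum_i gibbs u i * expR (b * v i).
have SE : \sum_i expR (b * (u i + v i)) = (\sum_i expR (b * u i)) * S.
  rewrite mulr_sumr; apply: eq_bigr => i _; rewrite /gibbs mulrDr expRD.
  by field; rewrite gt_eqF ?sum_expR_gt0.
have S0 : 0 < S.
  rewrite -(pmulr_rgt0 _ (sum_expR_gt0 u)) -SE; exact: sum_expR_gt0.
rewrite /smax SE lnM ?posrE ?sum_expR_gt0 //.
have -> : \sum_i gibbs u i * (b * v i) = b * \sum_i gibbs u i * v i.
  by rewrite mulr_sumr; apply: eq_bigr => i _; ring.
have -> : \sum_i \sum_j gibbs u i * gibbs u j * (b * v i - b * v j) ^+ 2 =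
    b ^+ 2 * \sum_i \sum_j gibbs u i * gibbs u j * (v i - v j) ^+ 2.
  rewrite mulr_sumr; apply: eq_bigr => i _; rewrite mulr_sumr.
  by apply: eq_bigr => j _; ring.
set A := \sum_i gibbs u i * v i; set B := \sum_i \sum_j _.
set l := ln (\sum_i expR (b * u i)); set lS := ln S.
have bn : b != 0 by rewrite gt_eqF.
move=> h; have -> : b^-1 * (l + lS) - b^-1 * l - A - b / 4 * B =
    b^-1 * (lS - b * A - 4^-1 * (b ^+ 2 * B)) by field.
rewrite normrM gtr0_norm ?invr_gt0 // mulrC ler_pdivrMr //.
apply: (le_trans h); rewrite exprMn; lra.
Qed.

End softmax.

Section lipschitz_fields.
Context {R : realType}.

Definition lips (I : finType) (f : (I -> R) -> R) : Prop :=
  forall x y, `|f x - f y| <= \sum_i `|x i - y i|.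

Section on_space.
Context d (T : measurableType d) (P : probability T R) (I : finType)
  (f : (I -> R) -> R) (Z : I -> T -> R).
Hypothesis fL : lips f.

Lemma measurable_lips : (forall i, measurable_fun setT (Z i)) ->
  measurable_fun setT (fun o => f (Z^~ o)).
Proof.
move=> mZ; apply: (measurable_lipschitz fL) => m.
(* Comparing [Z] with itself makes the equality of cosine integrals trivial; what is extracted from
   [cw_good] is measurability. *)
by case: (@cw_good_gridf _ _ _ _ _ P P _ _ _ mZ mZ (fun _ _ => erefl) f m).
Qed.

Lemma itg_lips : (forall i, itg P (Z i)) -> itg P (fun o => f (Z^~ o)).
Proof.
move=> iZ; apply: (@itg_dom _ _ _ _ _ (fun o => `|f (fun=> 0)| + \sum_i `|Z i o|)).
- by apply: measurable_lips => i; exact: itg_measurable (iZ i).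
- move=> o; have := fL (Z^~ o) (fun=> 0); under eq_bigr do rewrite subr0.
  move=> h; have -> : f (Z^~ o) = f (fun=> 0) + (f (Z^~ o) - f (fun=> 0)) by ring.
  by apply: (le_trans (ler_normD _ _)); rewrite lerD2l.
- by apply: itgD; [exact: itg_cst|apply: itg_sum => i; exact: itg_norm].
Qed.

End on_space.

Section products.
Context d1 d2 (T1 : measurableType d1) (T2 : measurableType d2)
  (P : probability T1 R) (Q : probability T2 R).

Lemma Rintegral_prod (F : T1 * T2 -> R) : itg (P \x Q)%E F ->
  (forall x, itg Q (fun y => F (x, y))) ->
  \int[(P \x Q)%E]_p F p = \int[P]_x \int[Q]_y F (x, y) /\
  itg P (fun x => \int[Q]_y F (x, y)).
Proof.
move=> iF iy.
have E : fubini_F Q (EFin \o F) = (fun x => (\int[Q]_y F (x, y))%:E).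
  by apply/funext => x; rewrite EFin_Rintegral.
have i1 : itg P (fun x => \int[Q]_y F (x, y)).
  by have := integrable_fubini_F iF; rewrite E.
split=> //; apply: EFin_inj; rewrite !EFin_Rintegral //.
by have := integral12_prod_meas1 iF; rewrite E => ->.
Qed.

End products.

Lemma gaussP_itg_cos (v a b : R) : itg (gaussP v) (fun z => cos (a * z + b)).
Proof.
apply: (@itg_bounded _ _ _ _ _ 1); last by move=> z; exact: cos_max.
apply: measurableT_comp; first exact: continuous_measurable_fun (@continuous_cos R).
by apply: measurable_funD => //; apply: measurable_funM.
Qed.

Lemma isG_same_law d1 d2 (T1 : measurableType d1) (T2 : measurableType d2)
    (P : probability T1 R) (Q : probability T2 R) (I : finType)
    (X : I -> T1 -> R) (Y : I -> T2 -> R) C D (f : (I -> R) -> R) :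
  isG P X C -> isG Q Y D -> (forall a, quad C a = quad D a) -> lips f ->
  \int[P]_o f (X^~ o) = \int[Q]_o f (Y^~ o).
Proof.
move=> GX GY CD fL; have [mX C0 _] := GX; have [mY D0 _] := GY.
apply: cramer_wold_lipschitz => //; last 2 first.
- by move=> i; exact: isG_itg_X GX i.
- by move=> i; exact: isG_itg_X GY i.
move=> a b.
have e := gaussP_itg_cos (quad C a) 1 b.
have e2 := gaussP_itg_cos (quad D a) 1 b.
have := isG_Rintegral GX e; have := isG_Rintegral GY e2.
under eq_Rintegral do rewrite mul1r.
move=> ->; under eq_Rintegral do rewrite mul1r.
by move=> ->; rewrite CD.
Qed.

(** The variance of the increment between i and j; both off-diagonal terms are written because [C]
    is not assumed symmetric. *)
Definition qdist (I : finType) (C : I -> I -> R) (i j : I) : R :=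
  C i i + C j j - C i j - C j i.

Lemma lin_diff (I : finType) (i j : I) (x : I -> R) :
  lin (fun k => (k == i)%:R - (k == j)%:R) x = x i - x j.
Proof.
rewrite -(lin_delta i x) -(lin_delta j x) /lin -sumrB.
by apply: eq_bigr => k _; rewrite mulrBl.
Qed.

Lemma quad_diff (I : finType) (C : I -> I -> R) i j :
  quad C (fun k => (k == i)%:R - (k == j)%:R) = qdist C i j.
Proof. by rewrite /quad !lin_diff /qdist; ring. Qed.

(** * The Sudakov-Fernique inequality *)

Section lindeberg.
Context d (T : measurableType d) (P : probability T R) (I : finType)
  (X : I -> T -> R) (C : I -> I -> R) (i0 : I) (b : R).
Hypotheses (GX : isG P X C) (b0 : 0 < b).

Let m3 := \int[P]_o (\sum_i `|X i o| ^+ 3).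

Let im3 : itg P (fun o => \sum_i `|X i o| ^+ 3).
Proof. by apply: itg_sum => i; exact: isG_itg_powX GX i 3. Qed.

Lemma sum_abs_cube (x : I -> R) :
  (\sum_i `|x i|) ^+ 3 <= #|I|%:R ^+ 3 * \sum_i `|x i| ^+ 3.
Proof.
have [h [k hk]] := maxfP i0 (fun i => `|x i|).
have s1 : \sum_i `|x i| <= #|I|%:R * `|x k|.
  rewrite mulr_natl -sumr_const; apply: ler_sum => i _.
  by rewrite -hk.
have := lerXn2r 3 (_ : _ \in Num.nneg) (_ : _ \in Num.nneg) s1.
rewrite !nnegrE => /(_ (sumr_ge0 _ _)) => /(_ (fun i _ => normr_ge0 (x i))).
move=> /(_ (mulr_ge0 (ler0n _ _) (normr_ge0 _))) /le_trans; apply.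
rewrite exprMn ler_wpM2l ?exprn_ge0 // (bigD1 k) //= lerDl.
by apply: sumr_ge0 => i _; rewrite exprn_ge0.
Qed.

Lemma smax_lips : lips (smax b : (I -> R) -> R).
Proof. exact/shift_lipschitz/smax_shift. Qed.

(* The soft maxima of two fields are compared by swapping, one at a time, the terms
   of a sum of [m] independent copies divided by [sqrt m]: the difference of the
   second order terms has a sign and the third order ones sum to [O(m^(-1/2))]. *)
Lemma lindeberg_step (h : R) (u : I -> R) : 0 <= h ->
  `|\int[P]_o smax b (fun i => u i + h * X i o) - smax b u -
    b / 4 * h ^+ 2 * \sum_i \sum_j gibbs b u i * gibbs b u j * qdist C i j| <=
  100 * b ^+ 2 * #|I|%:R ^+ 3 * m3 * h ^+ 3.
Proof.
move=> h0; have iX := isG_itg_X GX.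
have iL : itg P (fun o => smax b (fun i => u i + h * X i o)).
  apply: (@itg_lips _ _ _ _ _ (fun i o => u i + h * X i o)); first exact: smax_lips.
  by move=> i; apply: itgD; [exact: itg_cst|exact: itgZ].
have iq i j : itg P (fun o => (X i o - X j o) ^+ 2).
  have := isG_itg_second GX (fun k => (k == i)%:R - (k == j)%:R).
  by under eq_fun do rewrite lin_diff.
have Iq i j : \int[P]_o ((X i o - X j o) ^+ 2) = qdist C i j.
  rewrite -quad_diff -(isG_second GX).
  by apply: eq_Rintegral => o _; rewrite lin_diff.
pose p := gibbs b u.
pose A o := \sum_i p i * X i o.
pose B o := \sum_i \sum_j p i * p j * (X i o - X j o) ^+ 2.
have iA : itg P A by apply: itg_sum => i; exact: itgZ.
have iB : itg P B by apply: itg_sum => i; apply: itg_sum => j; exact: itgZ.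
have IA : \int[P]_o A o = 0.
  rewrite Rintegral_sum; last by move=> i; exact: itgZ.
  apply: big1 => i _; rewrite RintegralZl; [|exact: measurableT|exact: iX].
  by rewrite (isG_mean GX i) mulr0.
have IB : \int[P]_o B o = \sum_i \sum_j p i * p j * qdist C i j.
  rewrite Rintegral_sum; last by move=> i; apply: itg_sum => j; exact: itgZ.
  apply: eq_bigr => i _; rewrite Rintegral_sum; last by move=> j; exact: itgZ.
  by apply: eq_bigr => j _; rewrite RintegralZl; [rewrite (Iq i j)|exact: measurableT|exact: iq].
pose G o := smax b (fun i => u i + h * X i o) - smax b u - h * A o - b / 4 * h ^+ 2 * B o.
have ic := @itg_cst _ _ _ P (smax b u).
have i1 := itgB iL ic.
have i2 := itgB i1 (itgZ h iA).
have iG : itg P G := itgB i2 (itgZ (b / 4 * h ^+ 2) iB).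
have -> : \int[P]_o smax b (fun i => u i + h * X i o) - smax b u -
    b / 4 * h ^+ 2 * \sum_i \sum_j p i * p j * qdist C i j = \int[P]_o G o.
  rewrite /G RintegralB //; last exact: itgZ.
  rewrite RintegralB //; last exact: itgZ.
  rewrite RintegralB // (RintegralZl _ measurableT iA) (RintegralZl _ measurableT iB) IA IB mulr0 subr0.
  by rewrite Rintegral_probability_cst.
apply: (le_trans (le_normr_Rintegral _ _)) => //.
have -> : 100 * b ^+ 2 * #|I|%:R ^+ 3 * m3 * h ^+ 3 =
    \int[P]_o (100 * b ^+ 2 * #|I|%:R ^+ 3 * h ^+ 3 * \sum_i `|X i o| ^+ 3).
  by rewrite RintegralZl // /m3; ring.
apply: le_Rintegral => //.
- exact: itg_norm.
- exact: itgZ.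
move=> o _.
have := smax_taylor2 i0 b0 u (fun i => h * X i o).
have -> : \sum_i gibbs b u i * (h * X i o) = h * A o.
  by rewrite mulr_sumr; apply: eq_bigr => i _; rewrite mulrCA.
have -> : b / 4 * \sum_i \sum_j gibbs b u i * gibbs b u j * (h * X i o - h * X j o) ^+ 2 =
    b / 4 * h ^+ 2 * B o.
  rewrite -[RHS]mulrA; congr (_ * _); rewrite /B mulr_sumr; apply: eq_bigr => i _.
  by rewrite mulr_sumr; apply: eq_bigr => j _; rewrite /p; ring.
move=> /le_trans; apply.
have -> : \sum_i `|h * X i o| = h * \sum_i `|X i o|.
  by rewrite mulr_sumr; apply: eq_bigr => i _; rewrite normrM ger0_norm.
rewrite exprMn; have := sum_abs_cube (X^~ o).
have k0 : 0 <= 100 * b ^+ 2 * h ^+ 3.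
  by apply: mulr_ge0; [apply: mulr_ge0 => //; exact: sqr_ge0|exact: exprn_ge0].
move=> /(ler_wpM2l k0); lra.
Qed.

End lindeberg.

Lemma swap_arith (a1 a2 s x y k1 k2 : R) : a1 - s - x <= k1 ->
  - k2 <= a2 - s - y -> x <= y -> a1 <= a2 + (k1 + k2).
Proof. lra. Qed.

Section comparison.
Context d1 d2 (T1 : measurableType d1) (T2 : measurableType d2)
  (P : probability T1 R) (Q : probability T2 R) (I : finType)
  (X : I -> T1 -> R) (Y : I -> T2 -> R) (C D : I -> I -> R) (i0 : I).
Hypotheses (GX : isG P X C) (GY : isG Q Y D)
  (CD : forall i j, qdist C i j <= qdist D i j).

Let mix (s t : R) (i : I) (p : T1 * T2) : R := s * X i p.1 + t * Y i p.2.

Let mixG s t : isG (P \x Q)%E (mix s t)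
  (fun i j => s * s * C i j + t * t * D i j).
Proof. exact: (isG_prod (fun i => i) (fun i => i) (fun=> s) (fun=> t) GX GY). Qed.

Let addG d3 (T3 : measurableType d3) (P3 : probability T3 R) (Z : I -> T3 -> R) E (s t h : R) :
  isG P3 Z E ->
  isG ((P \x Q) \x P3)%E (fun i p => 1 * mix s t i p.1 + h * Z i p.2)
  (fun i j => 1 * 1 * (s * s * C i j + t * t * D i j) + h * h * E i j).
Proof. exact: (isG_prod (fun i => i) (fun i => i) (fun=> 1) (fun=> h) (mixG s t)). Qed.

Lemma quad_lin2 (s t : R) (E1 E2 : I -> I -> R) a :
  quad (fun i j => s * E1 i j + t * E2 i j) a = s * quad E1 a + t * quad E2 a.
Proof.
rewrite /quad /lin !mulr_sumr -big_split /=; apply: eq_bigr => i _.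
rewrite mulrCA [t * _]mulrCA -mulrDr; congr (_ * _).
rewrite !mulr_sumr -big_split /=; apply: eq_bigr => j _; ring.
Qed.

Section fixed_b.
Variable b : R.
Hypothesis b0 : 0 < b.

Let F := smax b : (I -> R) -> R.
Let FL : lips F := smax_lips i0 b0.
Let Phi s t := \int[(P \x Q)%E]_p F ((mix s t)^~ p).

Let fub d3 (T3 : measurableType d3) (P3 : probability T3 R) (Z : I -> T3 -> R) E (s t h : R) :
  isG P3 Z E ->
  \int[((P \x Q) \x P3)%E]_p F (fun i => 1 * mix s t i p.1 + h * Z i p.2) =
  \int[(P \x Q)%E]_p \int[P3]_o F (fun i => mix s t i p + h * Z i o) /\
  itg (P \x Q)%E (fun p => \int[P3]_o F (fun i => mix s t i p + h * Z i o)).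
Proof.
move=> GZ; have G1 := addG s t h GZ.
have i1 : itg ((P \x Q) \x P3)%E (fun p => F (fun i => 1 * mix s t i p.1 + h * Z i p.2)).
  by apply: (itg_lips FL) => i; exact: isG_itg_X G1 i.
have i2 p : itg P3 (fun o => F (fun i => 1 * mix s t i p + h * Z i o)).
  apply: (itg_lips (Z := fun i o => 1 * mix s t i p + h * Z i o) FL) => i.
  by apply: itgD; [exact: itg_cst|apply: itgZ; exact: isG_itg_X GZ i].
have := Rintegral_prod i1 i2; rewrite /=.
by under [in X in _ = X /\ _ -> _]eq_Rintegral do
  under eq_Rintegral do under eq_fun do rewrite mul1r;
  under [in X in _ = _ /\ itg _ X -> _]eq_fun do
  under eq_Rintegral do under eq_fun do rewrite mul1r.
Qed.

Let K := 100 * b ^+ 2 * #|I|%:R ^+ 3 * \int[P]_o (\sum_i `|X i o| ^+ 3) +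
         100 * b ^+ 2 * #|I|%:R ^+ 3 * \int[Q]_o (\sum_i `|Y i o| ^+ 3).

(** A law depends only on the squares of the coefficients, so [mix s1 t1] and [mix s2 t2] are
    [mix s2 t1] plus h times an independent copy of X, respectively Y. Given the common part, the
    two expansions differ to second order by a term whose sign is given by [CD]. *)
Let one_swap (s1 s2 t1 t2 h : R) : 0 <= h ->
  s1 ^+ 2 = s2 ^+ 2 + h ^+ 2 -> t2 ^+ 2 = t1 ^+ 2 + h ^+ 2 ->
  Phi s1 t1 <= Phi s2 t2 + K * h ^+ 3.
Proof.
move=> h0 es et.
have [eX iX] := fub s2 t1 h GX; have [eY iY] := fub s2 t1 h GY.
have e1 : Phi s1 t1 = \int[((P \x Q) \x P)%E]_p F (fun i => 1 * mix s2 t1 i p.1 + h * X i p.2).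
  apply: (isG_same_law (mixG s1 t1) (addG s2 t1 h GX)) => // a.
  by rewrite !quad_lin2; move: es; rewrite !expr2 => ->; ring.
have e2 : Phi s2 t2 = \int[((P \x Q) \x Q)%E]_p F (fun i => 1 * mix s2 t1 i p.1 + h * Y i p.2).
  apply: (isG_same_law (mixG s2 t2) (addG s2 t1 h GY)) => // a.
  by rewrite !quad_lin2; move: et; rewrite !expr2 => ->; ring.
rewrite e1 e2 eX eY.
have -> : K * h ^+ 3 = \int[(P \x Q)%E]_p (K * h ^+ 3) by rewrite Rintegral_probability_cst.
rewrite -RintegralD //; last exact: itg_cst.
apply: le_Rintegral => //.
  by apply: itgD => //; exact: itg_cst.
move=> p _; set u := (mix s2 t1)^~ p.
have := lindeberg_step i0 GX b0 u h0; have := lindeberg_step i0 GY b0 u h0.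
rewrite !ler_norml -/F => /andP[l1 _] /andP[_ l2].
have : b / 4 * h ^+ 2 * (\sum_i \sum_j gibbs b u i * gibbs b u j * qdist C i j) <=
       b / 4 * h ^+ 2 * (\sum_i \sum_j gibbs b u i * gibbs b u j * qdist D i j).
  rewrite ler_wpM2l ?mulr_ge0 ?exprn_ge0 ?divr_ge0 ?(ltW b0) //.
  apply: ler_sum => i _; apply: ler_sum => j _.
  by apply: ler_wpM2l; [apply: mulr_ge0; exact: gibbs_ge0|exact: CD].
rewrite /K mulrDl; exact: swap_arith l2 l1.
Qed.

Lemma smax_comparison :
  \int[P]_o smax b (X^~ o) <= \int[Q]_o smax b (Y^~ o).
Proof.
(* No family of copies has to be built: since only the law matters, m + 1 - k copies of X divided by
   sqrt(m + 1) amount to a single copy with the weight sqrt((m + 1 - k) / (m + 1)). *)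
have step m k : (k <= m.+1)%N -> Phi 1 0 <=
    Phi (Num.sqrt ((m.+1 - k)%:R / m.+1%:R)) (Num.sqrt (k%:R / m.+1%:R)) +
    k%:R * (K * (Num.sqrt m.+1%:R^-1) ^+ 3).
  elim: k => [_|k ih km].
    by rewrite subn0 divff ?pnatr_eq0 // sqrtr1 mul0r sqrtr0 mul0r addr0.
  have h0 : 0 <= Num.sqrt (m.+1%:R^-1 : R) := sqrtr_ge0 _.
  have sq (j : nat) : (Num.sqrt (j%:R / m.+1%:R : R)) ^+ 2 = j%:R / m.+1%:R.
    by rewrite sqr_sqrtr // divr_ge0.
  have sm : (Num.sqrt (m.+1%:R^-1 : R)) ^+ 2 = m.+1%:R^-1.
    by rewrite sqr_sqrtr // invr_ge0.
  have e1 : (Num.sqrt ((m.+1 - k)%:R / m.+1%:R : R)) ^+ 2 =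
      (Num.sqrt ((m.+1 - k.+1)%:R / m.+1%:R)) ^+ 2 + (Num.sqrt m.+1%:R^-1) ^+ 2.
    rewrite !sq sm subnS -[in LHS](prednK (_ : 0 < m.+1 - k)%N) ?subn_gt0 //.
    by rewrite -natr1 mulrDl mul1r.
  have e2 : (Num.sqrt (k.+1%:R / m.+1%:R : R)) ^+ 2 =
      (Num.sqrt (k%:R / m.+1%:R)) ^+ 2 + (Num.sqrt m.+1%:R^-1) ^+ 2.
    by rewrite !sq sm -natr1 mulrDl mul1r.
  have := one_swap h0 e1 e2; have := ih (ltnW km).
  move: (Phi _ _) (Phi _ _) (Phi _ _) (K * _) => p0 p1 p2 z a1 a2.
  by apply: (le_trans a1); rewrite -natr1 mulrDl mul1r [_ * z + z]addrC addrA lerD2r.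
have E1 : Phi 1 0 = \int[P]_o smax b (X^~ o).
  apply: (isG_same_law (mixG 1 0) GX) => // a.
  by rewrite quad_lin2; ring.
have E2 : Phi 0 1 = \int[Q]_o smax b (Y^~ o).
  apply: (isG_same_law (mixG 0 1) GY) => // a.
  by rewrite quad_lin2; ring.
have K0 : 0 <= K.
  have z d3 (T3 : measurableType d3) (P3 : probability T3 R) (Z : I -> T3 -> R) :
      0 <= \int[P3]_o (\sum_i `|Z i o| ^+ 3).
    by apply: Rintegral_ge0 => o _; apply: sumr_ge0 => i _; rewrite exprn_ge0.
  by rewrite addr_ge0 // mulr_ge0 ?z // !mulr_ge0 ?exprn_ge0 // ltW.
rewrite -E1 -E2; apply/ler_addgt0Pr => e e0.
have [m hm] : exists m : nat, (K / e) ^+ 2 <= m%:R.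
  exists (Num.truncn ((K / e) ^+ 2)).+1; apply/ltW.
  by rewrite truncnS_gt.
apply: le_trans (step m m.+1 (leqnn _)) _.
rewrite subnn mul0r sqrtr0 divff ?pnatr_eq0 // sqrtr1 lerD2l.
set q := Num.sqrt _.
have q2 : q ^+ 2 = m.+1%:R^-1 by rewrite sqr_sqrtr ?invr_ge0.
rewrite exprS q2.
have -> : m.+1%:R * (K * (q / m.+1%:R)) = K * q.
  have mn : m.+1%:R != 0 :> R by rewrite pnatr_eq0.
  by field.
move: K0; rewrite le_eqVlt => /predU1P[<-|K0]; first by rewrite mul0r ltW.
have q0 : 0 <= q := sqrtr_ge0 _.
have hq : (K * q) ^+ 2 <= e ^+ 2.
  rewrite exprMn q2 ler_pdivrMr ?ltr0n // -ler_pdivrMl ?exprn_gt0 //.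
  by rewrite mulrC -expr_div_n (le_trans hm) // ler_nat leqnSn.
move: hq; rewrite ler_sqr // nnegrE; first by rewrite mulr_ge0 // ltW.
by rewrite ltW.
Qed.

End fixed_b.

Lemma maxf_lips : lips (@maxf R I).
Proof. exact/shift_lipschitz/maxf_shift. Qed.

Theorem sudakov_fernique :
  \int[P]_o maxf (X^~ o) <= \int[Q]_o maxf (Y^~ o).
Proof.
have iX : itg P (fun o => maxf (X^~ o)).
  by apply: (itg_lips maxf_lips); exact: isG_itg_X GX.
have iY : itg Q (fun o => maxf (Y^~ o)).
  by apply: (itg_lips maxf_lips); exact: isG_itg_X GY.
apply/ler_addgt0Pr => e e0.
have I0 : (1 <= #|I|%:R :> R) by rewrite ler1n; apply/card_gt0P; exists i0.
(* Then ln #|I| / b, the gap between the maximum and the soft maximum, is at most e. *)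
pose b := (ln #|I|%:R + 1) / e.
have l0 : 0 <= ln (#|I|%:R : R) by rewrite ln_ge0.
have b0 : 0 < b by rewrite divr_gt0 // ltr_wpDl.
have be : b^-1 * ln #|I|%:R <= e.
  rewrite ler_pdivrMl // /b mulrVK ?unitfE ?gt_eqF //; lra.
have jX : itg P (fun o => smax b (X^~ o)).
  by apply: (itg_lips (smax_lips i0 b0)); exact: isG_itg_X GX.
have jY : itg Q (fun o => smax b (Y^~ o)).
  by apply: (itg_lips (smax_lips i0 b0)); exact: isG_itg_X GY.
have h1 : \int[P]_o maxf (X^~ o) <= \int[P]_o smax b (X^~ o).
  by apply: le_Rintegral => // o _; exact: maxf_le_smax.
apply: (le_trans h1); apply: (le_trans (smax_comparison b0)).
have h2 : \int[Q]_o smax b (Y^~ o) <= \int[Q]_o (maxf (Y^~ o) + e).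
  apply: le_Rintegral => //; first by apply: itgD => //; exact: itg_cst.
  move=> o _; apply: (le_trans (smax_le_maxf i0 b0 _)); by rewrite lerD2l.
apply: (le_trans h2); rewrite RintegralD //; last exact: itg_cst.
by rewrite Rintegral_probability_cst.
Qed.

End comparison.
End lipschitz_fields.

(** * Dilations of Gaussian laws *)

Definition dilR {R : realType} (c : R) : measurableTypeR R -> measurableTypeR R :=
  fun x => c * x.

Lemma measurable_dilR {R : realType} (c : R) : measurable_fun setT (dilR c).
Proof. exact: measurable_funM. Qed.

Section gaussian_scaling.
Context {R : realType}.
Local Notation mu := (@lebesgue_measure R).

Let dil (c : R) : measure (measurableTypeR R) R :=
  measure_function_pushforward__canonical__measure_function_Measure mu (measurable_dilR c).
Local Open Scope ereal_scope.

Lemma lebesgue_measure_dilate (c : R) (A : set R) : c != 0%R -> measurable A ->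
  `|c|%:E * pushforward mu (dilR c) A = mu A.
Proof.
move=> c0 mA.
have c1 : (0 <= `|c|)%R by [].
apply/esym; apply: (@lebesgue_measure_unique R (mscale (NngNum c1) (dil c))) => //.
move=> _ [[a b]] _ <- /=.
rewrite /mscale /= /pushforward /dilR /=.
have [cp|cn] := ltP 0%R c.
  rewrite (_ : _ @^-1` _ = `](a / c)%R, (b / c)%R]%classic); last first.
    by apply/seteqP; split => x /=; rewrite !in_itv/= ltr_pdivrMr // ler_pdivlMr // mulrC.
  rewrite !lebesgue_measure_itv/= !lte_fin ltr_pM2r ?invr_gt0 //; case: ifP => _.
    by rewrite -!EFinD -EFinM; congr (_%:E); rewrite gtr0_norm //; field; rewrite gt_eqF.
  by rewrite mule0.
have {}cn : (c < 0)%R by rewrite lt_neqAle c0.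
rewrite (_ : _ @^-1` _ = `[(b / c)%R, (a / c)%R[%classic); last first.
  by apply/seteqP; split => x /=; rewrite !in_itv/= ler_ndivrMr // ltr_ndivlMr // mulrC => /andP[-> ->].
rewrite !lebesgue_measure_itv/= !lte_fin ltr_nM2r ?invr_lt0 //; case: ifP => _.
  by rewrite -!EFinD -EFinM; congr (_%:E); rewrite ltr0_norm //; field; rewrite lt_eqF.
by rewrite mule0.
Qed.

Lemma ge0_integral_lebesgue_dilate (c : R) (f : R -> \bar R) : c != 0%R ->
  measurable_fun [set: R] f -> (forall x, 0 <= f x) ->
  `|c|%:E * \int[mu]_x f (c * x)%R = \int[mu]_x f x.
Proof.
move=> c0 mf f0.
have c1 : (0 <= `|c|)%R by [].
transitivity (\int[mscale (NngNum c1) (dil c)]_x f x).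
  rewrite ge0_integral_mscale //=; congr (_ * _).
  have := @ge0_integral_pushforward _ _ _ _ _ _ (measurable_dilR c) mu setT f.
  by rewrite preimage_setT => -> //.
by apply: eq_measure_integral => A mA _; exact: lebesgue_measure_dilate.
Qed.

Lemma normal_pdf_dilate (s c x : R) : c != 0%R -> (0 < s)%R ->
  (normal_pdf 0 (Num.sqrt s) x = `|c| * normal_pdf 0 (Num.sqrt (c ^+ 2 * s)) (c * x))%R.
Proof.
move=> c0 s0; have c2 : (0 < c ^+ 2)%R by rewrite lt_neqAle sqr_ge0 eq_sym expf_neq0.
have c2s : (0 < c ^+ 2 * s)%R by exact: mulr_gt0.
rewrite (normal_pdf_sqrtE _ _ s0) (normal_pdf_sqrtE _ _ c2s). rewrite mulrA; congr (_ * expR _)%R; rewrite ?subr0.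
  have -> : (c ^+ 2 * s * pi *+ 2 = c ^+ 2 * (s * pi *+ 2))%R by rewrite -mulrA mulrnAr.
  rewrite sqrtrM ?ltW // sqrtr_sqr.
  by field; rewrite normr_eq0 c0 gt_eqF // sqrtr_gt0 mulrn_wgt0 // mulr_gt0 ?pi_gt0.
rewrite !mulr2n; field.
by apply/andP; split; rewrite gt_eqF //; exact: addr_gt0.
Qed.

Lemma ge0_integral_gaussP_dilate (s c : R) (h : R -> \bar R) : (0 <= s)%R ->
  measurable_fun [set: R] h -> (forall x, 0 <= h x) ->
  \int[gaussP s]_z h (c * z)%R = \int[gaussP (c ^+ 2 * s)]_z h z.
Proof.
move=> + mh h0.
have mhc : measurable_fun [set: R] (fun z => h (c * z)%R).
  by apply: (measurableT_comp mh); exact: measurable_funM.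
rewrite le_eqVlt => /predU1P[<-|s0].
  by rewrite mulr0 !integral_gaussP0 // mulr0.
have [->|c0] := eqVneq c 0%R.
  rewrite expr0n mul0r integral_gaussP0 //.
  under eq_integral do rewrite mul0r.
  rewrite -[RHS]mule1 -(@probability_setT _ _ _ (gaussP s)).
  exact: (@integral_cst _ _ _ (gaussP s) setT measurableT (h 0%R)).
have c2 : (0 < c ^+ 2)%R by rewrite lt_neqAle sqr_ge0 eq_sym expf_neq0.
rewrite (gaussPE s0) (gaussPE (mulr_gt0 c2 s0)).
rewrite [LHS]ge0_integral_normalP; [|exact: mhc|by move=> x; exact: h0].
rewrite [RHS]ge0_integral_normalP; [|exact: mh|exact: h0].
rewrite -[RHS](ge0_integral_lebesgue_dilate c0); last 2 first.
- apply: emeasurable_funM => //; apply/measurable_EFinP.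
  exact: measurable_normal_pdf.
- by move=> x; rewrite mule_ge0 // lee_fin normal_pdf_ge0.
rewrite -ge0_integralZl_EFin //; last 2 first.
- by move=> x _; rewrite mule_ge0 // lee_fin normal_pdf_ge0.
- apply: emeasurable_funM => //; apply/measurable_EFinP.
  apply: (measurableT_comp (measurable_normal_pdf _ _)); exact: measurable_funM.
apply: eq_integral => x _.
by rewrite (normal_pdf_dilate x c0 s0) EFinM [RHS]muleCA.
Qed.

Lemma isG_gaussP (s : R) : (0 <= s)%R ->
  isG (gaussP s) (fun (_ : unit) (z : R) => z) (fun _ _ => s).
Proof.
move=> s0; have lE (a x : unit -> R) : lin a x = (a tt * x tt)%R.
  by rewrite /lin (bigD1 tt) //= big1 ?addr0 // => -[].
have qE a : quad (fun _ _ => s) a = (a tt ^+ 2 * s)%R.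
  by rewrite /quad !lE mulrA.
split.
- by move=> _; exact: measurable_id.
- by move=> a; rewrite qE mulr_ge0 ?sqr_ge0.
- move=> a A mA; rewrite qE.
  have mh : measurable_fun [set: R] (fun x => (\1_A x)%:E : \bar R).
    by apply/measurable_EFinP; exact: measurable_indic.
  have h0 (x : R) : (0 <= ((\1_A x)%:E : \bar R))%E by rewrite lee_fin.
  have i1 v B : measurable B -> (\int[gaussP v]_z (\1_B z)%:E = gaussP v B :> \bar R)%E.
    by move=> mB; rewrite integral_indic // setIT.
  have mB : measurable ((fun z => a tt * z)%R @^-1` A : set R).
    rewrite -[X in measurable X]setTI; apply: (_ : measurable_fun setT (fun z => a tt * z)%R) => //.
    exact: measurable_funM.
  rewrite -[RHS](i1 _ _ mA) -(ge0_integral_gaussP_dilate (a tt) s0 mh h0).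
  transitivity (gaussP s ((fun z => a tt * z)%R @^-1` A)); last by rewrite -(i1 _ _ mB).
  by congr (gaussP s _); apply/seteqP; split => z /=; rewrite lE.
Qed.

End gaussian_scaling.

(** * Branching random walks on the quaternary tree *)

Section branching.
Context {R : realType}.

Lemma isG_ext d (T : measurableType d) (P : probability T R) (I : finType)
    (X X' : I -> T -> R) (C C' : I -> I -> R) :
  (forall i o, X i o = X' i o) -> (forall i j, C i j = C' i j) ->
  isG P X C -> isG P X' C'.
Proof.
move=> EX EC; have -> : X = X' by apply/funext => i; apply/funext => o.
by have -> : C = C' by apply/funext => i; apply/funext => j.
Qed.

Definition sublevel (T : Type) (I : finType) (X : I -> T -> R) (t : R) : set T :=
  [set o | forall i, X i o <= t].

Lemma measurable_sublevel d (T : measurableType d) (I : finType)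
    (X : I -> T -> R) t : (forall i, measurable_fun setT (X i)) ->
  measurable (sublevel X t).
Proof.
move=> mX; have -> : sublevel X t = \bigcap_(i in [set: I]) (X i @^-1` `]-oo, t]).
  apply/seteqP; split => o /=.
    by move=> h i _ /=; rewrite in_itv /= h.
  by move=> h i; have := h i Logic.I; rewrite /= in_itv.
apply: fin_bigcap_measurable => // i _.
by rewrite -[X in measurable X]setTI; apply: mX.
Qed.

Definition double (T : Type) (I : finType) (X : I -> T -> R) (j : bool * I) (p : T * T) : R :=
  if j.1 then X j.2 p.1 else X j.2 p.2.

Lemma isG_double d (T : measurableType d) (P : probability T R) (I : finType)
    (X : I -> T -> R) (C : I -> I -> R) : isG P X C ->
  isG (P \x P)%E (double X)
    (fun j k => (j.1 == k.1)%:R * C j.2 k.2) /\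
  forall t, (P \x P)%E (sublevel (double X) t) =
    (P (sublevel X t) * P (sublevel X t))%E.
Proof.
move=> GX; split.
  have := isG_prod (fun j : bool * I => j.2) (fun j : bool * I => j.2)
    (fun j => j.1%:R) (fun j => (~~ j.1)%:R) GX GX.
  apply: isG_ext.
    by move=> [[] i] o /=; rewrite ?mul1r ?mul0r ?addr0 ?add0r.
  by move=> [[] i] [[] j] /=; rewrite ?mul1r ?mul0r ?addr0 ?add0r ?mulr0 ?mul0r.
move=> t; have [mX _ _] := GX; rewrite -product_measure1E; [|exact: measurable_sublevel..].
congr ((P \x P)%E _); apply/seteqP; split => p /=.
  by move=> h; split => i; [exact: (h (true, i))|exact: (h (false, i))].
by move=> [h1 h2] [[] i]; [exact: h1|exact: h2].
Qed.

(* The four children of a vertex are coded by two booleans, the bits of the two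
   coordinates of a point of a square box. *)
Fixpoint leaf (l : nat) : finType :=
  if l is l'.+1 then (bool * (bool * leaf l'))%type else unit.

(* [s k] is the variance on the edges above the vertices of height [k]; [rho] is
   an extra variance at the leaves. *)
Variables (rho : R) (s : nat -> R).

(** The Boolean factors stop the recursion at the generation where the two leaves separate, so only
    their common edges contribute. *)
Fixpoint tcov (l : nat) : leaf l -> leaf l -> R :=
  match l with
  | 0 => fun _ _ => rho
  | l'.+1 => fun x y =>
      (x.1 == y.1)%:R * ((x.2.1 == y.2.1)%:R * (s l' + tcov x.2.2 y.2.2))
  end.

Fixpoint brw_cdf (l : nat) : R -> R :=
  match l with
  | 0 => fun t => fine (gaussP rho [set z | z <= t])
  | l'.+1 => fun t => (\int[gaussP (s l')]_z brw_cdf l' (t - z)) ^+ 4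
  end.

(** The space is built along with the tree: the variable of an edge is adjoined to a subtree by a
    product, and doubling the space twice yields four independent children. *)
Lemma brw_exists (l : nat) : 0 <= rho -> (forall k, 0 <= s k) ->
  exists d (T : measurableType d) (P : probability T R) (Y : leaf l -> T -> R),
    isG P Y (@tcov l) /\ forall t, P (sublevel Y t) = (brw_cdf l t)%:E.
Proof.
move=> rho0 s0; elim: l => [|l [d [T [P [Y [GY FY]]]]]].
  do 4 eexists; split; first exact: isG_gaussP rho0.
  move=> t /=; rewrite fineK ?fin_num_measure //; last first.
    have -> : [set z | z <= t] = `]-oo, t]%classic by apply/seteqP; split => z; rewrite /= in_itv.
    exact: measurable_itv.
  by congr (gaussP rho _); apply/seteqP; split => z /= h //; exact: (h tt).
pose Z (i : leaf l) (p : R * T) := p.1 + Y i p.2.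
have GZ : isG (gaussP (s l) \x P)%E Z (fun i j => s l + tcov i j).
  have := isG_prod (fun _ : leaf l => tt) (fun i : leaf l => i) (fun=> 1) (fun=> 1)
    (isG_gaussP (s0 l)) GY.
  by apply: isG_ext => [i o|i j]; rewrite !mul1r.
have [G1 F1] := isG_double GZ; have [G2 F2] := isG_double G1.
have key d' (T' : measurableType d') (P' : probability T' R) (W : leaf l.+1 -> T' -> R) :
    isG P' W (@tcov l.+1) -> (forall t, P' (sublevel W t) = (brw_cdf l.+1 t)%:E) ->
    exists d (T : measurableType d) (P : probability T R) (Y : leaf l.+1 -> T -> R),
    isG P Y (@tcov l.+1) /\ forall t, P (sublevel Y t) = (brw_cdf l.+1 t)%:E.
  by move=> h1 h2; exists d', T', P', W.
apply: (key _ _ _ (double (double Z)) G2).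
move=> t; have -> : brw_cdf l.+1 t = (\int[gaussP (s l)]_z brw_cdf l (t - z)) ^+ 4 by [].
have [mY _ _] := GY; have [mZ _ _] := GZ.
have mS := measurable_sublevel t mZ.
have E : (gaussP (s l) \x P)%E (sublevel Z t) =
    (\int[gaussP (s l)]_z brw_cdf l (t - z))%:E.
  have e z : P (xsection (sublevel Z t) z) = (brw_cdf l (t - z))%:E.
    rewrite -FY; congr (P _); apply/seteqP; split => o /=; rewrite /xsection /= inE.
      by move=> h i; have := h i; rewrite /Z /=; lra.
    by move=> h i; have := h i; rewrite /Z /=; lra.
  rewrite EFin_Rintegral; last first.
    apply: (@itg_bounded _ _ _ _ _ 1).
      apply/measurable_EFinP; have := measurable_fun_xsection P mS.
      by congr measurable_fun; apply/funext => z /=; rewrite e.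
    move=> z; have := probability_le1 P (measurable_xsection z mS).
    rewrite e lee_fin => h; rewrite ger0_norm // -lee_fin -e.
    exact: measure_ge0.
  by apply: eq_integral => z _; rewrite /= e.
have h := eq_trans (F1 t) (f_equal2 mule E E).
refine (eq_trans (F2 t) (eq_trans (f_equal2 mule h h) _)).
by rewrite -!EFinM; congr EFin; ring.
Qed.

End branching.

(** * Gaussian convolution of the barrier profiles *)

Section gaussian_convolution.
Context {R : realType}.

Definition gconv (s : R) (f : R -> R) (x : R) : R := \int[gaussP s]_z f (x - z).

Definition cand (m k Z : R) : R := Z * expR (- m * Z - k * Z ^+ 2 / 2).

(** The tilt formula is known for nonnegative integrands; writing f = (|f| + f) - |f| extends it to
    integrable ones, which is needed for [cand], since it changes sign at 0. *)
Lemma signed_transfer (N N' : probability R R) (phi t : R -> R) (c : R) :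
  measurable_fun setT phi -> measurable_fun setT t -> (forall z, 0 <= t z) ->
  (forall f : R -> \bar R, measurable_fun setT f -> (forall x, 0 <= f x)%E ->
    (\int[N]_z (f (phi z) * (t z)%:E) = c%:E * \int[N']_z f z)%E) ->
  forall f : R -> R, itg N' f ->
  itg N (fun z => f (phi z) * t z) /\
  \int[N]_z (f (phi z) * t z) = c * \int[N']_z f z.
Proof.
move=> mp mt t0 H.
have pos (f : R -> R) : itg N' f -> (forall z, 0 <= f z) ->
    itg N (fun z => f (phi z) * t z) /\ \int[N]_z (f (phi z) * t z) = c * \int[N']_z f z.
  move=> fi f0; have mf := itg_measurable fi.
  have E : (\int[N]_z (f (phi z) * t z)%:E = (c * \int[N']_z f z)%:E)%E.
    rewrite EFinM EFin_Rintegral // -(H (EFin \o f)); last 2 first.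
    - exact/measurable_EFinP.
    - by move=> x; rewrite lee_fin; exact: f0.
    by [].
  have i : itg N (fun z => f (phi z) * t z).
    apply: itg_of_ge0 E; first by apply: measurable_funM => //; exact: measurableT_comp.
    by move=> x; rewrite mulr_ge0.
  by split=> //; apply: EFin_inj; rewrite EFin_Rintegral.
move=> f fi; have mf := itg_measurable fi.
have ia : itg N' (fun z => `|f z|) by exact: itg_norm.
have [i1 e1] := pos _ ia (fun z => normr_ge0 _).
have g0 z : 0 <= `|f z| + f z by have := ler_norm (- f z); rewrite normrN; lra.
have [i2 e2] := pos _ (itgD ia fi) g0.
have E : (fun z => f (phi z) * t z) =
    (fun z => (`|f (phi z)| + f (phi z)) * t z - `|f (phi z)| * t z).
  by apply/funext => z; ring.
split; first by rewrite E; exact: itgB.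
by rewrite E RintegralB // e1 e2 RintegralD //; ring.
Qed.

Lemma ge0_integral_normalP_shift (m v : R) (f : R -> \bar R) : 0 < v ->
  measurable_fun setT f -> (forall x, 0 <= f x)%E ->
  (\int[normalP m v]_z f (z - m)%R = \int[normalP 0 v]_z f z)%E.
Proof.
move=> v0 mf f0.
have mfm : measurable_fun [set: R] (fun z => f (z - m)).
  by apply: (measurableT_comp mf); exact: measurable_funB.
have h0 x : (0 <= f x * (normal_pdf 0 (Num.sqrt v) x)%:E)%E.
  by rewrite mule_ge0 // lee_fin normal_pdf_ge0.
have mh : measurable_fun [set: R] (fun x => f x * (normal_pdf 0 (Num.sqrt v) x)%:E)%E.
  by apply: emeasurable_funM => //; apply/measurable_EFinP; exact: measurable_normal_pdf.
rewrite (ge0_integral_normalP m v mfm); last by move=> x; exact: f0.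
rewrite (ge0_integral_normalP 0 v mf f0).
rewrite -[RHS](ge0_integral_lebesgue_shift (- m) mh h0).
apply: eq_integral => x _; congr (_ * _%:E)%E.
by rewrite !normal_pdf_sqrtE // subr0.
Qed.

(** Under the tilted law [w - z] is Gaussian with mean (w - m s) / (1 + k s), and the linear factor
    integrates to this mean. The mean contributes (1 + k s)^-1 and the normalisation (1 + k
    s)^(-1/2), whence the exponent 3/2. *)
Lemma cand_tilt (s m k w : R) : 0 < s -> 0 <= k ->
  itg (gaussP s) (fun z => cand m k (w - z)) /\
  gconv s (cand m k) w =
    expR (- m ^+ 2 * s / 2 - 3 / 2 * ln (1 + k * s)) *
    cand m (k / (1 + k * s)) (w - m * s).
Proof.
move=> s0 k0; have D0 : 0 < 1 + k * s by rewrite ltr_pwDl ?mulr_ge0 // ltW.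
have v0 : 0 < s / (1 + k * s) by rewrite divr_gt0.
pose m' := s * (m + k * w) / (1 + k * s).
pose t z := expR (- m * (w - z) - k * (w - z) ^+ 2 / 2).
pose c := (Num.sqrt (1 + k * s))^-1 *
    expR ((- m * w + m ^+ 2 * s / 2 - k * w ^+ 2 / 2) / (1 + k * s)).
have H (f : R -> \bar R) : measurable_fun setT f -> (forall x, 0 <= f x)%E ->
    (\int[normalP 0 s]_z (f (z - m')%R * (t z)%:E) =
     c%:E * \int[normalP 0 (s / (1 + k * s))]_z f z)%E.
  move=> mf f0.
  have mfm : measurable_fun [set: R] (fun z => f (z - m')).
    by apply: (measurableT_comp mf); exact: measurable_funB.
  rewrite (integral_normal_tilt m w s0 D0 mfm); last by move=> x; exact: f0.
  by rewrite -(ge0_integral_normalP_shift m' v0 mf f0).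
have mp : measurable_fun [set: R] (fun z => z - m') by exact: measurable_funB.
have T := signed_transfer mp (measurable_tilt m k w) (fun z => expR_ge0 _) H.
pose f z := (w - m') - z.
have iid : itg (normalP 0 (s / (1 + k * s))) idfun.
  by rewrite -gaussPE //; apply: gaussP_itg_id; rewrite ltW.
have fi : itg (normalP 0 (s / (1 + k * s))) f by apply: itgB => //; exact: itg_cst.
have [i e] := T f fi.
have E z : f (z - m') * t z = cand m k (w - z).
  by rewrite /f /cand /t; congr (_ * _); ring.
split.
  rewrite gaussPE //; move: i; congr (itg _ _); apply/funext => z; exact: E.
rewrite /gconv gaussPE //.
transitivity (\int[normalP 0 s]_z (f (z - m') * t z)).
  by apply: eq_Rintegral => z _; rewrite E.
rewrite e /f RintegralB //; last exact: itg_cst.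
rewrite Rintegral_probability_cst -gaussPE // gaussP_mean ?(ltW v0) // subr0 /c.
have -> : (Num.sqrt (1 + k * s))^-1 = expR (- 2^-1 * ln (1 + k * s)).
  apply: (@mulfI _ (Num.sqrt (1 + k * s))); first by rewrite gt_eqF ?sqrtr_gt0.
  rewrite mulfV ?gt_eqF ?sqrtr_gt0 //.
  have -> : Num.sqrt (1 + k * s) = expR (2^-1 * ln (1 + k * s)).
    have -> : Num.sqrt (1 + k * s) = Num.sqrt (expR (2^-1 * ln (1 + k * s)) ^+ 2).
      rewrite expr2 -expRD -mulrDl.
      have -> : 2^-1 + 2^-1 = 1 :> R by field.
      by rewrite mul1r lnK ?posrE.
    by rewrite sqrtr_sqr ger0_norm ?expR_ge0.
  by rewrite -expRD mulNr subrr expR0.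
rewrite /cand.
have -> : w - m' = (w - m * s) * expR (- ln (1 + k * s)).
  rewrite expRN lnK ?posrE // /m'; field; exact: lt0r_neq0.
rewrite mulrC -!mulrA; rewrite [RHS]mulrCA; congr (_ * _).
rewrite -!expRD; congr expR.
field; exact: lt0r_neq0.
Qed.

End gaussian_convolution.

Section brw_recursion.
Context {R : realType}.
Variables (rho : R) (s : nat -> R).
Hypotheses (rho0 : 0 <= rho) (s0 : forall k, 0 <= s k).
Local Notation F := (brw_cdf rho s).

Lemma brw_cdf_ge0 l t : 0 <= F l t.
Proof.
have [d [T [P [Y [_ h]]]]] := brw_exists l rho0 s0.
by rewrite -lee_fin -h measure_ge0.
Qed.

Lemma brw_cdf_mono l : {homo F l : x y / x <= y}.
Proof.
have [d [T [P [Y [[mY _ _] h]]]]] := brw_exists l rho0 s0.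
move=> x y xy; rewrite -lee_fin -!h; apply: le_measure.
- by rewrite inE; exact: measurable_sublevel.
- by rewrite inE; exact: measurable_sublevel.
- by move=> o /= ho i; exact: le_trans (ho i) xy.
Qed.

Lemma brw_cdf_le1 l t : F l t <= 1.
Proof.
have [d [T [P [Y [[mY _ _] h]]]]] := brw_exists l rho0 s0.
by rewrite -lee_fin -h probability_le1 //; exact: measurable_sublevel.
Qed.

Lemma measurable_brw_cdf l : measurable_fun setT (F l).
Proof. by apply: nondecreasing_measurable => //; exact: brw_cdf_mono. Qed.

Lemma itg_brw_cdf (v : R) l x : itg (gaussP v) (fun z => F l (x - z)).
Proof.
apply: (@itg_bounded _ _ _ _ _ 1).
  by apply: (measurableT_comp (measurable_brw_cdf l)); exact: measurable_funB.
by move=> z; rewrite ger0_norm ?brw_cdf_ge0 ?brw_cdf_le1.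
Qed.

Lemma brw_cdfS l x : F l.+1 x = gconv (s l) (F l) x ^+ 4.
Proof. by []. Qed.

Lemma le_gconv (v : R) (f g : R -> R) x : (forall t, f t <= g t) ->
  itg (gaussP v) (fun z => f (x - z)) -> itg (gaussP v) (fun z => g (x - z)) ->
  gconv v f x <= gconv v g x.
Proof. by move=> fg i1 i2; apply: le_Rintegral. Qed.

Lemma brw_upper_step l (w : R -> R) x : (forall t, 1 - F l t <= w t) ->
  itg (gaussP (s l)) (fun z => w (x - z)) ->
  1 - F l.+1 x <= 4 * gconv (s l) w x.
Proof.
move=> h iw; rewrite brw_cdfS.
have i1 := itgB (@itg_cst _ _ _ (gaussP (s l)) 1) (itg_brw_cdf (s l) l x).
have := le_gconv h i1 iw; rewrite /gconv (RintegralB measurableT (@itg_cst _ _ _ (gaussP (s l)) 1) (itg_brw_cdf (s l) l x)).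
rewrite Rintegral_probability_cst; set p := \int[_]_z F l _.
have p0 : 0 <= p by apply: Rintegral_ge0 => z _; exact: brw_cdf_ge0.
set g := \int[_]_z w _; move=> hg.
have p1 : p <= 1.
  rewrite -[leRHS](Rintegral_probability_cst (gaussP (s l))); apply: le_Rintegral => //.
  - exact: itg_brw_cdf.
  - exact: itg_cst.
  - by move=> z _; exact: brw_cdf_le1.
have : 1 - p ^+ 4 <= 4 * (1 - p).
  have -> : 1 - p ^+ 4 = (1 + p + p ^+ 2 + p ^+ 3) * (1 - p) by ring.
  rewrite ler_wpM2r ?subr_ge0 //.
  have := exprn_ile1 2 p0 p1; have := exprn_ile1 3 p0 p1; lra.
by move=> /le_trans; apply; rewrite ler_wpM2l.
Qed.

(** The first two terms of inclusion-exclusion for four independent events, 4 g - 6 g^2. The factor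
    1 - 3 g / 2 is the nonlinear loss that the prefactor of the subsolution has to keep summable. *)
Lemma brw_lower_step l (w : R -> R) x : (forall t, w t <= 1 - F l t) ->
  itg (gaussP (s l)) (fun z => w (x - z)) ->
  0 <= gconv (s l) w x ->
  4 * gconv (s l) w x * (1 - 3 / 2 * gconv (s l) w x) <= 1 - F l.+1 x.
Proof.
move=> h iw; rewrite brw_cdfS.
have i1 := itgB (@itg_cst _ _ _ (gaussP (s l)) 1) (itg_brw_cdf (s l) l x).
have := le_gconv h iw i1; rewrite /gconv (RintegralB measurableT (@itg_cst _ _ _ (gaussP (s l)) 1) (itg_brw_cdf (s l) l x)).
rewrite Rintegral_probability_cst; set p := \int[_]_z F l _.
have p0 : 0 <= p by apply: Rintegral_ge0 => z _; exact: brw_cdf_ge0.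
set g := \int[_]_z w _ => hg g0.
have : p ^+ 4 <= (1 - g) ^+ 4 by rewrite lerXn2r ?nnegrE //; lra.
have : (1 - g) ^+ 4 <= 1 - 4 * g * (1 - 3 / 2 * g).
  have -> : (1 - g) ^+ 4 = 1 - 4 * g * (1 - 3 / 2 * g) - g ^+ 3 * (4 - g) by field.
  by rewrite gerBl mulr_ge0 ?exprn_ge0 //; lra.
lra.
Qed.

(** The fourth power multiplies the exponential rate by four, while the Gaussian step adds only
    [2 * b ^+ 2 * s l] to the exponent; far enough to the left this is a net gain. *)
Lemma brw_lefttail_step l (b c : R) x : (forall t, F l t <= expR (b * (t - c))) ->
  F l.+1 x <= expR (4 * b * (x - c) + 2 * b ^+ 2 * s l).
Proof.
move=> h; rewrite brw_cdfS.
have E t z : expR (b * (t - z - c)) = expR (b * (t - c)) * expR (- b * z).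
  by rewrite -expRD; congr expR; ring.
have i1 : itg (gaussP (s l)) (fun z => expR (b * (x - z - c))).
  by under eq_fun do rewrite E; apply: itgZ; exact: gaussP_itg_expR.
have := le_gconv h (itg_brw_cdf (s l) l x) i1.
rewrite [leRHS]/gconv; under eq_Rintegral do rewrite E.
rewrite (RintegralZl _ measurableT (gaussP_itg_expR (- b) (s0 l))).
have -> : \int[gaussP (s l)]_z expR (- b * z) = expR (b ^+ 2 * s l / 2).
  apply: EFin_inj; rewrite EFin_Rintegral; last exact: gaussP_itg_expR.
  by rewrite gaussP_mgf // sqrrN.
move=> hp; have p0 : 0 <= gconv (s l) (F l) x.
  by apply: Rintegral_ge0 => z _; exact: brw_cdf_ge0.
have -> : expR (4 * b * (x - c) + 2 * b ^+ 2 * s l) =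
    (expR (b * (x - c)) * expR (b ^+ 2 * s l / 2)) ^+ 4.
  by rewrite -expRD -expRM_natl; congr expR; field.
by rewrite lerXn2r // nnegrE mulr_ge0 ?expR_ge0.
Qed.

Let mle (x : R) : measurable [set z : R | z <= x].
Proof.
have -> : [set z | z <= x] = `]-oo, x]%classic by apply/seteqP; split => z; rewrite /= in_itv.
exact: measurable_itv.
Qed.

Let chernoff (A : set R) (t c : R) : measurable A -> (forall z, A z -> 0 <= t * z - c) ->
  fine (gaussP rho A) <= expR (t ^+ 2 * rho / 2 - c).
Proof.
move=> mA h; rewrite -lee_fin fineK ?fin_num_measure //.
have -> : gaussP rho A = (\int[gaussP rho]_z (\1_A z)%:E)%E by rewrite integral_indic // setIT.
have i1 : itg (gaussP rho) (fun z => expR (- c) * expR (t * z)) by apply: itgZ; exact: gaussP_itg_expR.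
have -> : expR (t ^+ 2 * rho / 2 - c) = \int[gaussP rho]_z (expR (- c) * expR (t * z)).
  rewrite RintegralZl //; last exact: gaussP_itg_expR.
  rewrite addrC expRD; congr (_ * _); apply: EFin_inj.
  by rewrite EFin_Rintegral ?gaussP_mgf //; exact: gaussP_itg_expR.
rewrite EFin_Rintegral //; apply: ge0_le_integral => //.
- by apply/measurable_EFinP; exact: measurable_indic.
- by apply/measurable_EFinP; exact: itg_measurable i1.
move=> z _; rewrite lee_fin indicE -expRD; case: (boolP (z \in A)) => [/set_mem Az|_].
  by rewrite /= -expR0 ler_expR; have := h z Az; lra.
by rewrite expR_ge0.
Qed.

Lemma brw_cdf0_compl x : 1 - F 0 x = fine (gaussP rho [set z | x < z]).
Proof.
apply: EFin_inj; rewrite EFinB /= !fineK ?fin_num_measure //; last first.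
  have -> : [set z | x < z] = `]x, +oo[%classic by apply/seteqP; split => z; rewrite /= in_itv /= andbT.
  exact: measurable_itv.
have -> : [set z | x < z] = ~` [set z | z <= x].
  apply/seteqP; split => z /=; first by move=> h; apply/negP; rewrite -ltNge.
  by move/negP; rewrite -ltNge.
rewrite (probability_setC _ (mle x)).
by rewrite EFinN fineK // fin_num_measure.
Qed.

Lemma brw_cdf0_upper (t x : R) : 0 <= t -> 1 - F 0 x <= expR (t ^+ 2 * rho / 2 - t * x).
Proof.
move=> t0; rewrite brw_cdf0_compl; apply: chernoff.
  have -> : [set z | x < z] = `]x, +oo[%classic by apply/seteqP; split => z; rewrite /= in_itv /= andbT.
  exact: measurable_itv.
by move=> z /= xz; rewrite -mulrBr mulr_ge0 // subr_ge0 ltW.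
Qed.

Lemma brw_cdf0_left (t x : R) : 0 <= t -> F 0 x <= expR (t ^+ 2 * rho / 2 + t * x).
Proof.
move=> t0; have := @chernoff [set z | z <= x] (- t) (- t * x) (mle x).
rewrite sqrrN mulNr opprK; apply.
by move=> z /= xz; have := ler_wpM2l t0 xz; lra.
Qed.

(** Only the mass of the interval ]x, x + 1] is kept, where the density is smallest at the right
    end. *)
Lemma brw_cdf0_lower x : 0 < rho -> 0 <= x ->
  (Num.sqrt (rho * pi *+ 2))^-1 * expR (- (x + 1) ^+ 2 / (rho *+ 2)) <= 1 - F 0 x.
Proof.
move=> r0 x0; rewrite brw_cdf0_compl.
have mI : measurable `]x, (x + 1)]%classic by exact: measurable_itv.
have mI2 : measurable [set z : R | x < z].
  have -> : [set z | x < z] = `]x, +oo[%classic by apply/seteqP; split => z; rewrite /= in_itv /= andbT.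
  exact: measurable_itv.
rewrite -lee_fin fineK ?fin_num_measure //.
apply: (@le_trans _ _ (gaussP rho `]x, (x + 1)]%classic)); last first.
  by apply: le_measure; rewrite ?inE // => z /=; rewrite in_itv /= => /andP[].
have -> : gaussP rho `]x, (x + 1)]%classic = (\int[gaussP rho]_z (\1_(`]x, (x + 1)]%classic) z)%:E)%E.
  by rewrite integral_indic // setIT.
rewrite gaussPE // ge0_integral_normalP; last 2 first.
- by apply/measurable_EFinP; exact: measurable_indic.
- by move=> z; rewrite lee_fin.
set c := _ * expR _.
have c0 : 0 <= c by rewrite mulr_ge0 ?expR_ge0 // invr_ge0 sqrtr_ge0.
have -> : (c%:E = \int[@lebesgue_measure R]_z (c * \1_(`]x, (x + 1)]%classic) z)%:E)%E.
  under eq_integral do rewrite EFinM.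
  rewrite ge0_integralZl_EFin; [|exact: measurableT|by move=> z _; rewrite lee_fin
    |by apply/measurable_EFinP; exact: measurable_indic|exact: c0].
  - rewrite integral_indic // setIT.
  have e1 : @lebesgue_measure R `]x, (x + 1)]%classic = 1%:E.
      rewrite lebesgue_measure_itv /= lte_fin ltrDl ltr01.
      by rewrite -EFinB; congr EFin; ring.
    by refine (esym (eq_trans (congr1 (fun y => c%:E * y)%E e1) _)); rewrite mule1.
apply: ge0_le_integral => //.
- by move=> z _; rewrite lee_fin mulr_ge0.
- by apply/measurable_EFinP; apply: measurable_funM => //; exact: measurable_indic.
- apply: emeasurable_funM; apply/measurable_EFinP; first exact: measurable_indic.
  exact: measurable_normal_pdf.
move=> z _; rewrite -EFinM lee_fin indicE mulrC.
case: (boolP (z \in _)) => [/set_mem|]; last by rewrite !mul0r.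
rewrite /= in_itv /= => /andP[z1 z2]; rewrite !mul1r normal_pdf_sqrtE // /c.
apply: ler_wpM2l; first by rewrite invr_ge0 sqrtr_ge0.
rewrite ler_expR !mulNr lerN2 ler_pM2r ?invr_gt0 ?mulrn_wgt0 //.
by rewrite subr0 lerXn2r // nnegrE; lra.
Qed.

End brw_recursion.

(** * Upper tail of the homogeneous branching random walk *)

Section boundary_layer.
Context {R : realType}.
Variables (s g : R).
Hypotheses (s0 : 0 < s) (g0 : 0 <= g).

Definition blay (t : R) : R := (t < 1)%R%:R * expR (g * (1 - t)).

Definition edge_bump (t : R) : R := (1 <= t <= 2)%R%:R.

Lemma measurable_blay : measurable_fun [set: R] blay.
Proof.
apply: measurable_funM; last first.
  by apply: measurableT_comp => //; apply: measurable_funM => //; exact: measurable_funB.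
have -> : (fun t : R => (t < 1)%R%:R) = \1_(`]-oo, 1[%classic) :> (R -> R).
  by apply/funext => t; rewrite indicE; congr (_%:R); rewrite mem_setE /= in_itv.
exact: measurable_indic.
Qed.

Lemma measurable_edge_bump : measurable_fun [set: R] edge_bump.
Proof.
have -> : edge_bump = \1_(`[1, 2]%classic) :> (R -> R).
  by apply/funext => t; rewrite indicE; congr (_%:R); rewrite mem_setE /= in_itv.
exact: measurable_indic.
Qed.

Let B0 := Num.sqrt (s * pi *+ 2).

Let B0_gt0 : 0 < B0.
Proof. by rewrite sqrtr_gt0 mulrn_wgt0 // mulr_gt0 ?pi_gt0. Qed.

Let pE (m z : R) : normal_pdf m (Num.sqrt s) z = B0^-1 * expR (- (z - m) ^+ 2 / (s *+ 2)).
Proof. exact: normal_pdf_sqrtE. Qed.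

(* Truncating a supersolution near its zero costs a term supported in [t < 1];
   after one Gaussian step it is paid for by the mass lost on [1 <= t <= 2]. *)
Lemma boundary_layer (w : R) : g * s + 1 <= w - 1 ->
  itg (gaussP s) (fun z => blay (w - z)) /\
  gconv s blay w <= B0 * gconv s edge_bump w.
Proof.
move=> gw; set D := w - 1 in gw.
have gs : 0 <= g * s by rewrite mulr_ge0 // ltW.
have D1 : 1 <= D by lra.
have mwl : measurable_fun [set: R] (fun z => w - z) by exact: measurable_funB.
have m1 : measurable_fun [set: R] (fun z => blay (w - z)).
  exact: (measurableT_comp measurable_blay).
have m2 : measurable_fun [set: R] (fun z => edge_bump (w - z)).
  exact: (measurableT_comp measurable_edge_bump).
have b0 t : 0 <= blay t by rewrite mulr_ge0 ?expR_ge0.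
have c0 t : 0 <= edge_bump t by [].
have i2 : itg (gaussP s) (fun z => edge_bump (w - z)).
  apply: (@itg_bounded _ _ _ _ _ 1) => // z.
  by rewrite ger0_norm // /edge_bump lern1 leq_b1.
pose q := normal_pdf 0 (Num.sqrt s) D.
have q0 : 0 <= q by exact: normal_pdf_ge0.
have mpdf m : measurable_fun [set: R] (fun z => (normal_pdf m (Num.sqrt s) z)%:E : \bar R).
  by apply/measurable_EFinP; exact: measurable_normal_pdf.
have U : (\int[gaussP s]_z (blay (w - z))%:E <= (B0 * q)%:E)%E.
  rewrite gaussPE // ge0_integral_normalP; last 2 first.
  - exact/measurable_EFinP.
  - by move=> z; rewrite lee_fin.
  have -> : (B0 * q)%:E = (\int[@lebesgue_measure R]_z ((B0 * q) * normal_pdf D (Num.sqrt s) z)%:E)%E.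
    under eq_integral do rewrite EFinM.
    rewrite ge0_integralZl_EFin; [|exact: measurableT|by move=> z _; rewrite lee_fin normal_pdf_ge0
      |exact: mpdf|by rewrite mulr_ge0 // ltW].
    by rewrite integral_normal_pdf mule1.
  apply: ge0_le_integral => //.
  - by move=> z _; rewrite mule_ge0 // lee_fin ?normal_pdf_ge0.
  - by apply: emeasurable_funM; [exact/measurable_EFinP|exact: mpdf].
  - by apply/measurable_EFinP; apply: measurable_funM => //; exact: measurable_normal_pdf.
  move=> z _; rewrite -EFinM lee_fin /blay.
  have [zD|zD] := ltP (w - z) 1; last by rewrite !mul0r mulr_ge0 ?normal_pdf_ge0 // mulr_ge0 // ltW.
  rewrite mul1r /q !pE [B0 * (_ * _)]mulrA mulfV ?gt_eqF // mul1r.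
  rewrite mulrCA [leRHS]mulrCA ler_pM2l ?invr_gt0 // -!expRD ler_expR.
  (* The two exponents differ by (z - D)(D - g s) / s, which is nonnegative because z > D here and
     the hypothesis places D beyond g s. *)
  rewrite -subr_ge0.
  have -> : - (D - 0) ^+ 2 / (s *+ 2) + - (z - D) ^+ 2 / (s *+ 2) -
      (g * (1 - (w - z)) + - (z - 0) ^+ 2 / (s *+ 2)) = (z - D) * (D - g * s) / s.
    have sn : s != 0 by rewrite gt_eqF.
    have s2 : s + s != 0 by rewrite gt_eqF // addr_gt0.
    by rewrite /D mulr2n; field; rewrite ?s2 ?sn.
  apply: divr_ge0; last by rewrite ltW.
  by apply: mulr_ge0; rewrite /D in gw *; lra.
have L : (q%:E <= \int[gaussP s]_z (edge_bump (w - z))%:E)%E.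
  rewrite gaussPE // ge0_integral_normalP; last 2 first.
  - exact/measurable_EFinP.
  - by move=> z; rewrite lee_fin.
  have -> : q%:E = (\int[@lebesgue_measure R]_z (q * \1_(`[D - 1, D]%classic) z)%:E)%E.
    under eq_integral do rewrite EFinM.
    rewrite ge0_integralZl_EFin; [|exact: measurableT|by move=> z _; rewrite lee_fin
      |by apply/measurable_EFinP; exact: measurable_indic|exact: q0].
    rewrite integral_indic // setIT.
    have e1 : @lebesgue_measure R `[D - 1, D]%classic = 1%:E.
      rewrite lebesgue_measure_itv /= lte_fin gtrBl ltr01.
      by rewrite -EFinB; congr EFin; ring.
    by refine (esym (eq_trans (congr1 (fun y => q%:E * y)%E e1) _)); rewrite mule1.
  apply: ge0_le_integral => //.
  - by move=> z _; rewrite lee_fin mulr_ge0.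
  - by apply/measurable_EFinP; apply: measurable_funM => //; exact: measurable_indic.
  - by apply: emeasurable_funM; [exact/measurable_EFinP|exact: mpdf].
  move=> z _; rewrite -EFinM lee_fin indicE.
  case: (boolP (z \in _)) => [/set_mem|_]; last by rewrite mulr0 mulr_ge0 ?normal_pdf_ge0.
  rewrite /= in_itv /= => /andP[z1 z2].
  have -> : edge_bump (w - z) = 1.
    by rewrite /edge_bump; have -> : 1 <= w - z <= 2 by apply/andP; split; rewrite /D in z1 z2; lra.
  rewrite mulr1 mul1r /q !pE ler_pM2l ?invr_gt0 // ler_expR !subr0 !mulNr lerN2.
  rewrite ler_pM2r ?invr_gt0 ?mulrn_wgt0 // lerXn2r // nnegrE; lra.
have i1 : itg (gaussP s) (fun z => blay (w - z)).
  apply/integrableP; split; first exact/measurable_EFinP.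
  under eq_integral do rewrite /= ger0_norm //.
  by apply: le_lt_trans U _; rewrite ltry.
split=> //; rewrite -EFin_Rintegral // lee_fin in U.
rewrite -EFin_Rintegral // lee_fin in L.
by apply: (le_trans U); rewrite ler_pM2l.
Qed.

End boundary_layer.

Section step_exponents.
Context {R : realType}.

Lemma ln1D_ge (y : R) : 0 <= y -> y / (1 + y) <= ln (1 + y).
Proof.
move=> y0; have p : 0 < 1 + y by lra.
have : ln (1 + y)^-1 <= (1 + y)^-1 - 1.
  by rewrite -[X in ln X](subrK 1) addrC; apply: le_ln1Dx; rewrite ltrBrDr addrC subrr invr_gt0.
rewrite lnV ?posrE //; have -> : (1 + y)^-1 - 1 = - (y / (1 + y)) by field; rewrite gt_eqF.
by rewrite lerN2.
Qed.

Lemma quadratic_opt (A B Z : R) : 0 < B -> A * Z - B * Z ^+ 2 / 2 <= A ^+ 2 / (2 * B).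
Proof.
move=> B0; rewrite -subr_ge0.
have -> : A ^+ 2 / (2 * B) - (A * Z - B * Z ^+ 2 / 2) = (B * Z - A) ^+ 2 / (2 * B).
  by field; rewrite gt_eqF.
by rewrite divr_ge0 ?sqr_ge0 // mulr_ge0 // ltW.
Qed.

Variables (lam s p q : R).
Hypotheses (lam0 : 0 < lam) (s0 : 0 < s) (p1 : 1 <= p) (q0 : 0 <= q) (qp : q ^+ 2 = p ^+ 2 + 1).

Let pq : p <= q.
Proof.
have [P1 [Q0 QP]] : 1 <= p /\ 0 <= q /\ q ^+ 2 = p ^+ 2 + 1 by [].
have : p ^+ 2 <= q ^+ 2 by lra.
by rewrite ler_sqr // nnegrE; lra.
Qed.

Let q2p : q <= 2 * p.
Proof.
have [P1 [Q0 QP]] : 1 <= p /\ 0 <= q /\ q ^+ 2 = p ^+ 2 + 1 by [].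
have : q ^+ 2 <= (2 * p) ^+ 2 by nra.
by rewrite ler_sqr // nnegrE; lra.
Qed.

Let pn : p != 0. Proof. by rewrite gt_eqF // (lt_le_trans ltr01). Qed.
Let qn : q != 0. Proof. by rewrite gt_eqF // (lt_le_trans ltr01) // (le_trans p1). Qed.

(** [p] and [q] are the square roots of consecutive scale counts m and m + 1. The errors at each
    scale are O(m^(-3/2)), and this difference of inverse square roots pays for them by
    telescoping. *)
Lemma barrier_gain : (6 * p ^+ 3)^-1 <= p^-1 - q^-1.
Proof.
have [P1 [Q0 QP]] : 1 <= p /\ 0 <= q /\ q ^+ 2 = p ^+ 2 + 1 by [].
have [PQ Q2P] : p <= q /\ q <= 2 * p by [].
have q1 : 0 < q by lra. have p0 : 0 < p by lra.
have -> : p^-1 - q^-1 = (p * q * (p + q))^-1.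
  have pqn : p + q != 0 by rewrite gt_eqF // addr_gt0.
  apply: (@mulIf _ (p * q * (p + q))); first by rewrite !mulf_neq0.
  rewrite mulVf ?mulf_neq0 //.
  have -> : (p^-1 - q^-1) * (p * q * (p + q)) = (q ^+ 2 - p ^+ 2) by field; rewrite pn qn.
  by rewrite qp; ring.
rewrite lef_pV2 ?posrE ?mulr_gt0 ?exprn_gt0 ?addr_gt0 //.
have h1 : p * q <= 2 * p ^+ 2 by nra.
have h2 : p * q * (p + q) <= 2 * p ^+ 2 * (3 * p).
  by apply: ler_pM => //; [rewrite mulr_ge0 // ltW|rewrite addr_ge0 // ltW|lra].
by apply: (le_trans h2); rewrite (exprS _ 2); lra.
Qed.

(** With m = p^2 and curvature 1 / (s (m + sqrt m)), the factor (1 + kap s)^(-3/2) has logarithm - 3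
    / (2 m) to leading order; the added sqrt m produces the error m^(-3/2). *)
Lemma entropy_cost : 3 / (2 * p ^+ 2) - 3 / 2 * ln (1 + (s * (p ^+ 2 + p))^-1 * s) <= 3 / p ^+ 3.
Proof.
have [P1 [Q0 QP]] : 1 <= p /\ 0 <= q /\ q ^+ 2 = p ^+ 2 + 1 by [].
have [PQ Q2P] : p <= q /\ q <= 2 * p by [].
have p0 : 0 < p by lra.
have -> : (s * (p ^+ 2 + p))^-1 * s = (p ^+ 2 + p)^-1.
  by rewrite invfM mulrAC mulVf ?mul1r // gt_eqF.
have A0 : 0 < p ^+ 2 + p by rewrite addr_gt0 // exprn_gt0.
have := @ln1D_ge (p ^+ 2 + p)^-1; rewrite invr_ge0 (ltW A0) => /(_ isT).
have -> : (p ^+ 2 + p)^-1 / (1 + (p ^+ 2 + p)^-1) = (p ^+ 2 + p + 1)^-1.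
  by field; rewrite !gt_eqF // addr_gt0.
move=> h; have e : 3 / (2 * p ^+ 2) - 3 / 2 / (p ^+ 2 + p + 1) <= 3 / p ^+ 3; last by lra.
have -> : 3 / (2 * p ^+ 2) - 3 / 2 / (p ^+ 2 + p + 1) =
    3 / p ^+ 3 * ((p * (p + 1)) / (2 * (p ^+ 2 + p + 1))).
  by field; rewrite pn gt_eqF // addr_gt0.
rewrite ler_piMr ?divr_ge0 ?exprn_ge0 ?(ltW p0) // ler_pdivrMr; last by rewrite mulr_gt0 // addr_gt0 // exprn_gt0.
by rewrite mul1r; nra.
Qed.

(** From one scale to the next the slope moves by order m^-2, while the sqrt m in the inverse
    curvature leaves a surplus of curvature of order m^(-5/2). Completing the square gives (m^-2)^2
    / m^(-5/2) = m^(-3/2). *)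
Lemma slope_cost (Z : R) :
  (3 / (2 * lam * s * p ^+ 2) - 3 / (2 * lam * s * q ^+ 2)) * Z -
  ((s * (p ^+ 2 + p) + s)^-1 - (s * (q ^+ 2 + q))^-1) * Z ^+ 2 / 2 <=
  18 / (lam ^+ 2 * s) / p ^+ 3.
Proof.
have [P1 [Q0 QP]] : 1 <= p /\ 0 <= q /\ q ^+ 2 = p ^+ 2 + 1 by [].
have [PQ Q2P] : p <= q /\ q <= 2 * p by [].
have q1 : 0 < q by lra. have p0 : 0 < p by lra.
set A := (X in X * Z - _); set B := (X in _ - X * _ / _).
have AE : A = 3 / (2 * lam * s) / (p ^+ 2 * q ^+ 2).
  have -> : A = 3 / (2 * lam * s) * ((q ^+ 2 - p ^+ 2) / (p ^+ 2 * q ^+ 2)).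
    by rewrite /A; field; rewrite pn qn !gt_eqF.
  have -> : q ^+ 2 - p ^+ 2 = 1 by rewrite qp; ring.
  by rewrite mul1r.
have dq : (2 * q)^-1 <= q - p.
  rewrite -[leLHS]mulr1 ler_pdivrMl ?mulr_gt0 //.
  nra.
have D1 : 0 < s * (p ^+ 2 + p) + s by rewrite addr_gt0 // mulr_gt0 // addr_gt0 // exprn_gt0.
have D2 : 0 < s * (q ^+ 2 + q) by rewrite mulr_gt0 // addr_gt0 // exprn_gt0.
have D12 : s * (p ^+ 2 + p) + s <= 2 * s * q ^+ 2.
  have : p ^+ 2 + p + 1 <= 2 * q ^+ 2 by nra.
  by move=> /(ler_wpM2l (ltW s0)); lra.
have D22 : s * (q ^+ 2 + q) <= 2 * s * q ^+ 2.
  have : q ^+ 2 + q <= 2 * q ^+ 2 by nra.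
  by move=> /(ler_wpM2l (ltW s0)); lra.
have BE : B = s * (q - p) / ((s * (p ^+ 2 + p) + s) * (s * (q ^+ 2 + q))).
  rewrite /B.
  have -> : s * (q - p) = s * (q ^+ 2 + q) - (s * (p ^+ 2 + p) + s) by rewrite qp; ring.
  have D3 : 0 < q ^+ 2 + q by rewrite addr_gt0 // exprn_gt0.
  by field; rewrite !gt_eqF.
have Bl : (8 * s * q ^+ 5)^-1 <= B.
  have -> : (8 * s * q ^+ 5)^-1 = s * (2 * q)^-1 / ((2 * s * q ^+ 2) * (2 * s * q ^+ 2)).
    by field; rewrite qn gt_eqF.
  rewrite BE; apply: ler_pM.
  - by rewrite mulr_ge0 ?invr_ge0 ?mulr_ge0 // ltW.
  - by rewrite invr_ge0 !mulr_ge0 ?exprn_ge0 // ltW.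
  - by rewrite ler_pM2l.
  - rewrite lef_pV2 ?posrE; [|by rewrite mulr_gt0 // mulr_gt0 ?exprn_gt0 // mulr_gt0|by rewrite mulr_gt0].
    by apply: ler_pM => //; rewrite ltW.
have B0 : 0 < B by apply: lt_le_trans Bl; rewrite invr_gt0 !mulr_gt0 ?exprn_gt0.
apply: le_trans (quadratic_opt A Z B0) _.
apply: (@le_trans _ _ (A ^+ 2 * (4 * s * q ^+ 5))).
  rewrite ler_wpM2l ?sqr_ge0 //.
  have -> : (2 * B)^-1 = B^-1 / 2 by field; rewrite gt_eqF.
  rewrite ler_pdivrMr //.
  have : B^-1 <= 8 * s * q ^+ 5.
    by rewrite -[leRHS]invrK lef_pV2 ?posrE // invr_gt0 !mulr_gt0 ?exprn_gt0.
  lra.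
have -> : A ^+ 2 * (4 * s * q ^+ 5) = 18 / (lam ^+ 2 * s) / p ^+ 3 * (q / (2 * p)).
  by rewrite AE; field; rewrite pn qn !gt_eqF.
rewrite ler_piMr ?divr_ge0 ?mulr_ge0 ?exprn_ge0 ?(ltW p0) ?(ltW s0) ?(ltW lam0) //.
by rewrite ler_pdivrMr ?mulr_gt0 // mul1r.
Qed.

End step_exponents.

Section upper_supersolution.
Context {R : realType}.
Variables (rho lam s : R) (l0 : nat).
Hypotheses (rho0 : 0 <= rho) (lam0 : 0 < lam) (s0 : 0 < s)
  (ls : expR (lam ^+ 2 * s / 2) = 4)
  (l01 : (1 <= l0)%N) (l0s : 1 <= s * l0%:R) (l0r : 2 * rho <= s * l0%:R)
  (l0l : 3 / (2 * lam * s * l0%:R) <= lam / 2).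

(* The supersolution is [Z exp(- mu Z - kap Z^2 / 2)], [Z] being the distance to
   the barrier: the Gaussian term, with [1 / kap] growing slightly faster than the
   variance [s l], leaves room for the decrease of the speed [mu] below [lam], and
   [mu] is chosen so that the factor [(1 + kap s)^(-3/2)] of each convolution is
   compensated, which gives the logarithmic correction. *)
Let mm (l : nat) : R := (l + l0)%:R.
Let r l := Num.sqrt (mm l).
Let delta l := 3 / (2 * lam * s * mm l).
Let mu l := lam - delta l.
Let tau l := s * (mm l + r l).
Let kap l := (tau l)^-1.
(** Six times the constants of [entropy_cost] and [slope_cost], six being the denominator in
    [barrier_gain]. *)
Let Cp := 18 + 108 / (lam ^+ 2 * s).

Let mm_ge1 l : 1 <= mm l.
Proof. by rewrite ler1n addn_gt0 l01 orbT. Qed.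

Let r_sqr l : r l ^+ 2 = mm l.
Proof. by rewrite sqr_sqrtr // ler0n. Qed.

Let r_ge1 l : 1 <= r l.
Proof. by rewrite -sqrtr1 ler_wsqrtr. Qed.

Let mmS l : mm l.+1 = mm l + 1.
Proof. by rewrite /mm addSn natr1. Qed.

Let mm_ge l : l0%:R <= mm l.
Proof. by rewrite ler_nat leq_addl. Qed.

Let tau_gt0 l : 0 < tau l.
Proof. by rewrite mulr_gt0 // addr_gt0 // (lt_le_trans ltr01). Qed.

Let kap_gt0 l : 0 < kap l. Proof. by rewrite invr_gt0. Qed.

Let tau_ge1 l : 1 <= tau l.
Proof.
apply: (le_trans l0s); rewrite ler_pM2l //.
by apply: (le_trans (mm_ge l)); rewrite lerDl sqrtr_ge0.
Qed.

Let kap_le1 l : kap l <= 1.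
Proof. by rewrite invf_le1. Qed.

Let delta_gt0 l : 0 < delta l.
Proof. by rewrite divr_gt0 // mulr_gt0 ?mulr_gt0 // (lt_le_trans ltr01). Qed.

Let mu_ge l : lam / 2 <= mu l.
Proof.
have : delta l <= lam / 2.
  apply: le_trans l0l; rewrite /delta ler_pM2l // lef_pV2 ?posrE ?mulr_gt0 ?ltr0n //.
  - by rewrite ler_pM2l ?mulr_gt0.
  - by rewrite addn_gt0 l01 orbT.
by rewrite /mu; lra.
Qed.

Let mu_le l : mu l <= lam.
Proof. by rewrite /mu gerBl ltW. Qed.

Let Cp_ge0 : 0 <= Cp.
Proof. by rewrite addr_ge0 // divr_ge0 // mulr_ge0 ?exprn_ge0 ?ltW. Qed.

(** Lowering the speed from [lam] to [mu l] lets the mass grow by an exponent of at most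
    [lam * delta l * s], that is 3 / (2 m), which the convolution factor cancels to leading order.
    The errors that remain are telescoped by - Cp / r. *)
Lemma exponent_step l (Z : R) :
  lam ^+ 2 * s / 2 + (- mu l ^+ 2 * s / 2 - 3 / 2 * ln (1 + kap l * s)) +
  (- mu l * Z - kap l / (1 + kap l * s) * Z ^+ 2 / 2) - Cp / r l <=
  - Cp / r l.+1 + (- mu l.+1 * Z - kap l.+1 * Z ^+ 2 / 2).
Proof.
have p1 := r_ge1 l; have q0 : 0 <= r l.+1 := sqrtr_ge0 _.
have qp : r l.+1 ^+ 2 = r l ^+ 2 + 1 by rewrite !r_sqr mmS.
have h1 := barrier_gain p1 q0 qp.
have h2 := entropy_cost s0 p1 q0 qp.
have h3 := slope_cost lam0 s0 p1 q0 qp Z.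
rewrite !r_sqr in h2 h3.
rewrite -/(tau l) -/(tau l.+1) -/(delta l) -/(delta l.+1) -/(kap l) -/(kap l.+1) in h2 h3.
have t0 := tau_gt0 l.
have -> : kap l / (1 + kap l * s) = (tau l + s)^-1.
  rewrite /kap; field; rewrite !gt_eqF // ?addr_gt0 //.
have ed : lam * delta l * s = 3 / (2 * mm l).
  have mn : mm l != 0 by rewrite pnatr_eq0 -lt0n addn_gt0 l01 orbT.
  by rewrite /delta; move: (mm l) mn => X Xn; field; rewrite Xn (gt_eqF lam0) (gt_eqF s0).
have em : lam ^+ 2 * s / 2 - mu l ^+ 2 * s / 2 <= lam * delta l * s.
  have -> : lam ^+ 2 * s / 2 - mu l ^+ 2 * s / 2 = lam * delta l * s - delta l ^+ 2 * s / 2.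
    by rewrite /mu; field.
  by rewrite gerBl divr_ge0 // mulr_ge0 ?sqr_ge0 // ltW.
have eC : Cp * (6 * r l ^+ 3)^-1 = 3 / r l ^+ 3 + 18 / (lam ^+ 2 * s) / r l ^+ 3.
  by rewrite /Cp; field; rewrite !gt_eqF // (lt_le_trans ltr01).
have := ler_wpM2l Cp_ge0 h1; rewrite eC mulrBr.
have -> : mu l = lam - delta l by [].
have -> : mu l.+1 = lam - delta l.+1 by [].
move: em ed h2 h3; rewrite /mu; lra.
Qed.

Let B0 := Num.sqrt (s * pi *+ 2).
(** [c] is half of a lower bound of [cand] on [1, 2]; [g] is so large that e^-g B0 <= c / 2; [A]
    leaves the room that [boundary_layer] asks for. The terms of [Kmin] serve, in order, the
    repayment of the layer, the bump, the plateau up to [A] and the initial law. *)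
Let c := expR (- (2 * lam) - 2) / 2.
Let g := lam + 1 + 2 * B0 / c.
Let A := g * s + 3.
Let Kmin := 2 * B0 / c + c^-1 + expR (lam * A + A ^+ 2 / 2) + expR (rho * lam ^+ 2).
Let K l := Kmin * expR (Cp - Cp / r l).

Let B0_ge0 : 0 <= B0. Proof. exact: sqrtr_ge0. Qed.

Let c_gt0 : 0 < c. Proof. by rewrite divr_gt0 ?expR_gt0. Qed.
Let g_ge : lam + 1 <= g.
Proof. by rewrite lerDl divr_ge0 ?mulr_ge0 // ltW. Qed.
Let g_ge0 : 0 <= g.
Proof. by apply: le_trans g_ge; rewrite addr_ge0 // ltW. Qed.
Let A_ge3 : 3 <= A.
Proof. by rewrite lerDr mulr_ge0 // ltW. Qed.

Let g_small : expR (- g) * B0 <= c / 2.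
Proof.
have [B1 C1] : 0 <= B0 /\ 0 < c by [].
have G0 : 0 < 1 + g by rewrite ltr_pwDl.
have h1 : expR (- g) <= (1 + g)^-1.
  by rewrite expRN lef_pV2 ?posrE ?expR_gt0 // expR_ge1Dx.
apply: (le_trans (ler_wpM2r B1 h1)).
rewrite mulrC ler_pdivrMr //.
have : 2 * B0 / c <= 1 + g by have := lam0; rewrite /g; lra.
move=> /(ler_wpM2l (ltW C1)).
by have -> : c * (2 * B0 / c) = 2 * B0; [field; rewrite gt_eqF|lra].
Qed.

Let Kmin_gt0 : 0 < Kmin.
Proof.
by rewrite /Kmin ltr_wpDl ?expR_gt0 // !addr_ge0 ?expR_ge0 ?invr_ge0 ?divr_ge0 ?mulr_ge0 // ltW.
Qed.

Let K_ge l : Kmin <= K l.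
Proof.
have kp := Cp_ge0; rewrite /K ler_peMr ?(ltW Kmin_gt0) // -[leLHS]expR0 ler_expR subr_ge0.
by rewrite ler_pdivrMr ?(lt_le_trans ltr01) // ler_peMr.
Qed.

Let K_le l : K l <= Kmin * expR Cp.
Proof.
rewrite /K ler_pM2l // ler_expR gerBl divr_ge0 ?Cp_ge0 //.
exact: sqrtr_ge0.
Qed.

Let K_gt0 l : 0 < K l. Proof. exact: lt_le_trans (K_ge l). Qed.

Definition upper_barrier l : R := lam * s * l%:R - 3 / (2 * lam) * \sum_(j < l) (mm j)^-1.

Let barrierS l : upper_barrier l.+1 = upper_barrier l + mu l * s.
Proof.
have mn : mm l != 0 by rewrite pnatr_eq0 -lt0n addn_gt0 l01 orbT.
rewrite /upper_barrier big_ord_recr /= /mu /delta -natr1.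
by move: (\sum_(j < l) _) (mm l) mn => S X Xn; field; rewrite Xn (gt_eqF lam0) (gt_eqF s0).
Qed.

Let supersol l (Z : R) : R := if Z < A then 1 else K l * cand (mu l) (kap l) Z.

(** The convolution formula involves [cand] on the whole line, also where it is negative. The layer
    on Z < 1 repairs the negative part and covers the plateau 1; the bump withdrawn from [1, 2] is
    surplus of [cand] there and pays for the layer after the convolution. *)
Let majorant l (Z : R) : R := K l * cand (mu l) (kap l) Z +
  (1 + K l * expR (- g)) * blay g Z - c * K l * edge_bump Z.

Let cand_ge l Z : 0 <= Z -> Z * expR (- (lam * Z) - Z ^+ 2 / 2) <= cand (mu l) (kap l) Z.
Proof.
move=> Z0; rewrite /cand ler_wpM2l // ler_expR.
have h1 := ler_wpM2r Z0 (mu_le l).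
have h2 := ler_wpM2r (sqr_ge0 Z) (kap_le1 l).
lra.
Qed.

Let supersol_le_majorant l Z : supersol l Z <= majorant l Z.
Proof.
have K0 := K_gt0 l; have C0 := c_gt0; have A2 := A_ge3; have L0 := lam0.
have k1 : 1 <= c * K l.
  rewrite -ler_pdivrMl // mulr1 (le_trans _ (K_ge l)) // /Kmin.
  have : 0 <= 2 * B0 / c by rewrite divr_ge0 ?mulr_ge0 // ltW.
  have := expR_ge0 (lam * A + A ^+ 2 / 2); have := expR_ge0 (rho * lam ^+ 2); lra.
have k2 : 1 <= K l * expR (- (lam * A) - A ^+ 2 / 2).
  have -> : - (lam * A) - A ^+ 2 / 2 = - (lam * A + A ^+ 2 / 2) by ring.
  rewrite expRN ler_pdivlMr ?expR_gt0 // mul1r (le_trans _ (K_ge l)) // /Kmin.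
  have : 0 <= 2 * B0 / c by rewrite divr_ge0 ?mulr_ge0 // ltW.
  have : 0 < c^-1 by rewrite invr_gt0.
  have := expR_ge0 (rho * lam ^+ 2); lra.
have V0 : 0 <= 1 + K l * expR (- g) by rewrite addr_ge0 ?mulr_ge0 ?expR_ge0 // ltW.
rewrite /supersol /majorant /blay /edge_bump.
case: (ltP Z 1) => Z1.
  have -> : (Z < A) by lra.
  rewrite /= mul1r mulr0 subr0 mulrDl.
  have e1 : 1 <= expR (g * (1 - Z)).
    by rewrite -[leLHS]expR0 ler_expR mulr_ge0 ?g_ge0 // subr_ge0 ltW.
  have e2 : K l * expR (- g) * expR (g * (1 - Z)) = K l * expR (- g * Z).
    by rewrite -mulrA -expRD; congr (_ * expR _); ring.
  have [Z0|Z0] := leP 0 Z.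
    have : 0 <= K l * cand (mu l) (kap l) Z by rewrite mulr_ge0 ?mulr_ge0 ?expR_ge0 // ltW.
    have : 0 <= K l * expR (- g) * expR (g * (1 - Z)) by rewrite !mulr_ge0 ?expR_ge0 // ltW.
    lra.
  have : - Z * expR (- mu l * Z - kap l * Z ^+ 2 / 2) <= expR (- g * Z).
    have h1 : - Z <= expR (- Z) by have := expR_ge1Dx (- Z); lra.
    apply: (@le_trans _ _ (expR (- Z) * expR (- lam * Z))).
      apply: ler_pM; [lra|exact: expR_ge0|exact: h1|rewrite ler_expR].
      have h2 := ler_wnM2r (ltW Z0) (mu_le l).
      have h3 : 0 <= kap l * Z ^+ 2 by rewrite mulr_ge0 ?sqr_ge0 // ltW.
      lra.
    rewrite -expRD ler_expR.
    have := ler_wnM2r (ltW Z0) g_ge; lra.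
  move=> /(ler_wpM2l (ltW K0)); rewrite /cand; lra.
have Z0 : 0 <= Z by lra.
have -> : false%:R * expR (g * (1 - Z)) = 0 :> R by rewrite mul0r.
rewrite mulr0 addr0.
case: (ltP Z A) => hA; last first.
  by have -> : (Z <= 2) = false by [apply/negP => ?; lra]; rewrite mulr0 subr0.
have cl := ler_wpM2l (ltW K0) (cand_ge l Z0).
case: (leP Z 2) => Z2; last first.
  rewrite mulr0 subr0; apply: le_trans cl.
  apply: (le_trans k2); rewrite ler_wpM2l ?(ltW K0) //.
  apply: (@le_trans _ _ (expR (- (lam * Z) - Z ^+ 2 / 2))).
    rewrite ler_expR; have := ler_wpM2l (ltW L0) (ltW hA).
    have : Z ^+ 2 <= A ^+ 2 by rewrite lerXn2r ?nnegrE //; lra.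
    lra.
  by rewrite ler_peMl ?expR_ge0.
rewrite mulr1.
have : 2 * c <= Z * expR (- (lam * Z) - Z ^+ 2 / 2).
  apply: (@le_trans _ _ (expR (- (lam * Z) - Z ^+ 2 / 2))); last by rewrite ler_peMl ?expR_ge0.
  have -> : 2 * c = expR (- (2 * lam) - 2) by rewrite /c; field.
  rewrite ler_expR; have := ler_wpM2l (ltW L0) Z2.
  have : Z ^+ 2 <= 2 ^+ 2 by rewrite lerXn2r ?nnegrE //; lra.
  lra.
move=> /(ler_wpM2l (ltW K0)); lra.
Qed.

Let cand_step l (Z : R) : 0 <= Z ->
  4 * (K l * (expR (- mu l ^+ 2 * s / 2 - 3 / 2 * ln (1 + kap l * s)) *
     cand (mu l) (kap l / (1 + kap l * s)) Z)) <= K l.+1 * cand (mu l.+1) (kap l.+1) Z.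
Proof.
move=> Z0; rewrite -ls /K /cand.
have -> : expR (lam ^+ 2 * s / 2) * (Kmin * expR (Cp - Cp / r l) *
    (expR (- mu l ^+ 2 * s / 2 - 3 / 2 * ln (1 + kap l * s)) *
     (Z * expR (- mu l * Z - kap l / (1 + kap l * s) * Z ^+ 2 / 2)))) =
    (Kmin * Z) * expR (Cp + (lam ^+ 2 * s / 2 + (- mu l ^+ 2 * s / 2 - 3 / 2 * ln (1 + kap l * s)) +
  (- mu l * Z - kap l / (1 + kap l * s) * Z ^+ 2 / 2) - Cp / r l)).
  rewrite !expRD; ring.
have -> : Kmin * expR (Cp - Cp / r l.+1) * (Z * expR (- mu l.+1 * Z - kap l.+1 * Z ^+ 2 / 2)) =
    (Kmin * Z) * expR (Cp + (- Cp / r l.+1 + (- mu l.+1 * Z - kap l.+1 * Z ^+ 2 / 2))).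
  by rewrite mulrACA -expRD; congr (_ * expR _); ring.
rewrite ler_wpM2l ?mulr_ge0 ?(ltW Kmin_gt0) // ler_expR lerD2l.
exact: exponent_step.
Qed.

Let base_bound x : 1 - brw_cdf rho (fun=> s) 0 x <= supersol 0 (x - upper_barrier 0).
Proof.
have -> : upper_barrier 0 = 0 by rewrite /upper_barrier big_ord0 mulr0 mulr0 subr0.
rewrite subr0 /supersol; case: ifP => [_|/negbT]; first by rewrite gerBl; exact: (brw_cdf_ge0 rho0 (fun=> ltW s0)).
rewrite -leNgt => xA; have A2 := A_ge3; have x0 : 0 <= x by lra.
have K1 : expR (rho * lam ^+ 2) <= K 0.
  apply: (le_trans _ (K_ge 0)); rewrite /Kmin.
  have : 0 <= 2 * B0 / c by rewrite divr_ge0 ?mulr_ge0 // ltW.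
  have : 0 < c^-1 by rewrite invr_gt0.
  have := expR_ge0 (lam * A + A ^+ 2 / 2); lra.
(* The Chernoff parameter grows with x, so as to yield the Gaussian factor of the profile along with
   the exponential one. *)
pose t := lam + kap 0 * x.
have k0 := kap_gt0 0%N.
have t0 : 0 <= t by rewrite addr_ge0 ?mulr_ge0 // ltW.
apply: (le_trans (brw_cdf0_upper (fun=> s) rho0 x t0)).
apply: (@le_trans _ _ (expR (rho * lam ^+ 2) * expR (- mu 0 * x - kap 0 * x ^+ 2 / 2))); last first.
  apply: ler_pM; rewrite ?expR_ge0 //.
  by rewrite ler_peMl ?expR_ge0 //; lra.
rewrite -expRD ler_expR.
have kr : 2 * rho * kap 0 <= 1.
  rewrite /kap ler_pdivrMr // mul1r; apply: (le_trans l0r); rewrite /tau ler_pM2l // /mm add0n.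
  by rewrite lerDl sqrtr_ge0.
have h1 : rho * t ^+ 2 <= rho * (2 * lam ^+ 2 + 2 * (kap 0 * x) ^+ 2).
  rewrite ler_wpM2l // -subr_ge0.
  have -> : 2 * lam ^+ 2 + 2 * (kap 0 * x) ^+ 2 - t ^+ 2 = (lam - kap 0 * x) ^+ 2.
    by rewrite /t; ring.
  exact: sqr_ge0.
have h2 : 0 <= kap 0 * x ^+ 2 by rewrite mulr_ge0 ?sqr_ge0 // ltW.
have h3 := ler_wpM2r h2 kr.
have h4 := ler_wpM2r x0 (mu_le 0).
rewrite /t in h1 *; lra.
Qed.

Lemma upper_supersolution l x :
  1 - brw_cdf rho (fun=> s) l x <= supersol l (x - upper_barrier l).
Proof.
elim: l x => [|l ih] x; first exact: base_bound.
rewrite /supersol; case: ifP => [_|/negbT]; first by rewrite gerBl; exact: (brw_cdf_ge0 rho0 (fun=> ltW s0)).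
rewrite -leNgt => ZA; set Z := x - _ in ZA *.
have A2 := A_ge3; have Z0 : 0 <= Z by lra.
have K0 := K_gt0 l; have G0 := g_ge0; have C0 := c_gt0.
pose w := Z + mu l * s.
have mu0 : 0 <= mu l by apply: le_trans (mu_ge l); rewrite divr_ge0 // ltW.
have wA : A <= w by apply: (le_trans ZA); rewrite lerDl mulr_ge0 // ltW.
have gw : g * s + 1 <= w - 1 by move: wA; rewrite /A; lra.
have [ib hb] := boundary_layer s0 g_ge0 gw.
have [ic ec] := cand_tilt (mu l) w s0 (ltW (kap_gt0 l)).
have im : itg (gaussP s) (fun z => edge_bump (w - z)).
  apply: (@itg_bounded _ _ _ _ _ 1).
    by apply: (measurableT_comp (@measurable_edge_bump R)); exact: measurable_funB.
  by move=> z; rewrite ger0_norm // /edge_bump lern1 leq_b1.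
have xw z : x - z - upper_barrier l = w - z.
  by rewrite /w /Z barrierS; ring.
have i1 := itgZ (K l) ic.
have i2 := itgZ (1 + K l * expR (- g)) ib.
have i3 := itgZ (c * K l) im.
have id : itg (gaussP s) (fun z => majorant l (x - z - upper_barrier l)).
  under eq_fun do rewrite xw.
  exact: itgB (itgD i1 i2) i3.
have h t : 1 - brw_cdf rho (fun=> s) l t <= majorant l (t - upper_barrier l).
  exact: le_trans (ih t) (supersol_le_majorant l _).
have := brw_upper_step rho0 (fun=> ltW s0) h id; move=> /le_trans; apply.
apply: (le_trans _ (cand_step l Z0)); rewrite ler_pM2l //.
have -> : gconv s (fun t => majorant l (t - upper_barrier l)) x =
    K l * gconv s (cand (mu l) (kap l)) w + (1 + K l * expR (- g)) * gconv s (blay g) w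
    - c * K l * gconv s edge_bump w.
  rewrite /gconv; under eq_Rintegral do rewrite xw.
  rewrite /majorant (RintegralB measurableT (itgD i1 i2) i3) (RintegralD measurableT i1 i2).
  by rewrite (RintegralZl _ measurableT ic) (RintegralZl _ measurableT ib) (RintegralZl _ measurableT im).
rewrite ec.
have -> : w - mu l * s = Z by rewrite /w addrK.
rewrite -addrA gerDl subr_le0.
have m0 : 0 <= gconv s edge_bump w by apply: Rintegral_ge0 => z _; rewrite /edge_bump.
have V0 : 0 <= 1 + K l * expR (- g) by rewrite addr_ge0 ?mulr_ge0 ?expR_ge0 // ltW.
(* What remains is (1 + K e^-g) B0 <= c K: each of the two summands is at most c K / 2, the first by
   the choice of [Kmin], the second by that of [g]. *)
apply: (le_trans (ler_wpM2l V0 hb)); rewrite mulrA ler_wpM2r // -/B0.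
have k1 : 2 * B0 <= K l * c.
  rewrite -ler_pdivrMr // (le_trans _ (K_ge l)) // /Kmin.
  have : 0 < c^-1 by rewrite invr_gt0.
  have := expR_ge0 (lam * A + A ^+ 2 / 2); have := expR_ge0 (rho * lam ^+ 2); lra.
have := ler_wpM2l (ltW K0) g_small; lra.
Qed.

Lemma upper_tail_barrier : exists C A' : R, 0 <= C /\ forall n y, 0 <= y ->
  1 - brw_cdf rho (fun=> s) n (upper_barrier n + A' + y) <= C * expR (- (lam / 4) * y).
Proof.
exists (Kmin * expR Cp * (4 / lam)), A; split.
  by rewrite !mulr_ge0 ?expR_ge0 ?invr_ge0 // ltW.
move=> n y y0; have L0 := lam0; have A3 := A_ge3.
have := upper_supersolution n (upper_barrier n + A + y).
have -> : upper_barrier n + A + y - upper_barrier n = A + y by ring.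
move=> /le_trans; apply; rewrite /supersol ltNge lerDl y0 /=.
have Z0 : 0 <= A + y by lra.
rewrite -[leRHS]mulrA; apply: ler_pM; [exact: ltW|by rewrite mulr_ge0 ?expR_ge0|exact: K_le|].
(* Of the decay rate lam / 2 guaranteed by [mu_ge], one half is spent on absorbing the linear
   factor. *)
rewrite /cand; apply: (@le_trans _ _ (4 / lam * expR (lam / 4 * (A + y)) * expR (- (lam / 2) * (A + y)))).
  apply: ler_pM; rewrite ?expR_ge0 //.
    have h := expR_ge1Dx (lam / 4 * (A + y)).
    have p : 0 <= 4 / lam by rewrite divr_ge0 // ltW.
    have := ler_wpM2l p h.
    have -> : 4 / lam * (1 + lam / 4 * (A + y)) = 4 / lam + (A + y) by field; rewrite gt_eqF.
    lra.
  rewrite ler_expR; have := ler_wpM2r Z0 (mu_ge n).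
  have : 0 <= kap n * (A + y) ^+ 2 by rewrite mulr_ge0 ?sqr_ge0 // ltW.
  lra.
rewrite -mulrA -expRD ler_wpM2l ?divr_ge0 ?(ltW L0) // ler_expR.
have LA : 0 <= lam * A by rewrite mulr_ge0 ?(ltW L0) //; lra.
lra.
Qed.

End upper_supersolution.

Lemma harmonic_ge_ln {R : realType} (l0 n : nat) : (1 <= l0)%N ->
  ln ((n + l0)%:R : R) - ln l0%:R <= \sum_(j < n) ((j + l0)%:R)^-1.
Proof.
move=> l1; elim: n => [|n ih]; first by rewrite add0n subrr big_ord0.
rewrite big_ord_recr /=.
have p : 0 < (n + l0)%:R :> R by rewrite ltr0n addn_gt0 l1 orbT.
have -> : ((n.+1 + l0)%:R : R) = (n + l0)%:R * (1 + (n + l0)%:R^-1).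
  by rewrite mulrDr mulr1 mulfV ?gt_eqF // addSn natr1.
have q : 0 < (n + l0)%:R^-1 :> R by rewrite invr_gt0.
rewrite lnM ?posrE ?addr_gt0 //.
have := @le_ln1Dx R (n + l0)%:R^-1 (lt_trans (ltrN10 _) q); lra.
Qed.

Lemma upper_tail {R : realType} (rho lam s : R) : 0 <= rho -> 0 < lam -> 0 < s ->
  expR (lam ^+ 2 * s / 2) = 4 ->
  exists C : R, 0 <= C /\ forall (n : nat) (y : R), (1 <= n)%N -> 0 <= y ->
    1 - brw_cdf rho (fun=> s) n (lam * s * n%:R - 3 / (2 * lam) * ln n%:R + C + y) <=
    C * expR (- (lam / 4) * y).
Proof.
move=> rho0 lam0 s0 ls.
pose X := s^-1 + 2 * rho / s + 3 / (lam ^+ 2 * s).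
have X0 : 0 <= X by rewrite !addr_ge0 ?invr_ge0 ?divr_ge0 ?mulr_ge0 ?sqr_ge0 // ltW.
(* A starting index for which all largeness conditions of the supersolution hold; it costs a
   multiple of ln l0 in the barrier. *)
pose l0 := (Num.truncn X).+1.
have Xl : X <= l0%:R by apply/ltW; rewrite truncnS_gt.
have a1 : 0 <= s^-1 by rewrite invr_ge0 ltW.
have a2 : 0 <= 2 * rho / s by rewrite divr_ge0 ?mulr_ge0 // ltW.
have a3 : 0 <= 3 / (lam ^+ 2 * s) by rewrite divr_ge0 ?mulr_ge0 ?sqr_ge0 // ltW.
have sn : s != 0 by rewrite gt_eqF.
have h1 : 1 <= s * l0%:R by rewrite -ler_pdivrMl // mulr1 (le_trans _ Xl) // /X; lra.
have h2 : 2 * rho <= s * l0%:R by rewrite -ler_pdivrMl // mulrC (le_trans _ Xl) // /X; lra.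
have h3 : 3 / (2 * lam * s * l0%:R) <= lam / 2.
  have l0p : 0 < l0%:R :> R by rewrite ltr0n.
  rewrite ler_pdivrMr ?mulr_gt0 //.
  have -> : lam / 2 * (2 * lam * s * l0%:R) = (lam ^+ 2 * s) * l0%:R by field.
  rewrite -ler_pdivrMl ?mulr_gt0 ?exprn_gt0 // mulrC (le_trans _ Xl) // /X; lra.
have [C [A [C0 H]]] := upper_tail_barrier rho0 lam0 s0 ls (isT : (1 <= l0)%N) h1 h2 h3.
pose C' := C + `|A| + 3 / (2 * lam) * ln l0%:R.
have k0 : 0 <= 3 / (2 * lam) by rewrite divr_ge0 // mulr_ge0 // ltW.
have ll : 0 <= 3 / (2 * lam) * ln (l0%:R : R) by rewrite mulr_ge0 // ln_ge0 // ler1n.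
exists C'; split; first by rewrite !addr_ge0.
move=> n y n1 y0; apply: (@le_trans _ _ (C * expR (- (lam / 4) * y))); last first.
  by rewrite ler_wpM2r ?expR_ge0 // /C' -addrA lerDl addr_ge0.
apply: le_trans (H n y y0); rewrite lerD2l lerN2.
apply: (brw_cdf_mono rho0 (fun=> ltW s0)); rewrite lerD2r.
have hh := @harmonic_ge_ln R l0 n isT.
have hn : ln (n%:R : R) <= ln (n + l0)%:R.
  by rewrite ler_ln ?posrE ?ltr0n ?addn_gt0 ?n1 // ler_nat leq_addr.
have : 3 / (2 * lam) * (ln n%:R - ln l0%:R) <= 3 / (2 * lam) * \sum_(j < n) ((j + l0)%:R)^-1.
  by rewrite ler_wpM2l //; lra.
rewrite /upper_barrier /C'; have := ler_norm A; lra.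
Qed.

(** * Lower tail of a branching random walk with decreasing variances *)

Section lower_subsolution.
Context {R : realType}.
Variables (rho : R) (s a mu kap k : nat -> R) (n : nat).
Local Notation F := (brw_cdf rho s).
Hypotheses (rho0 : 0 <= rho) (s0 : forall l, 0 < s l)
  (mu1 : forall l, (l <= n)%N -> 1 <= mu l)
  (kap0 : forall l, (l <= n)%N -> 0 <= kap l)
  (k3 : forall l, (l <= n)%N -> expR (k l) <= 3^-1)
  (aS : forall l, (l < n)%N -> a l.+1 = a l + mu l * s l)
  (base : forall x, 0 <= x - a 0 -> expR (k 0) * cand (mu 0) (kap 0) (x - a 0) <= 1 - F 0 x)
  (step : forall l Z, (l < n)%N -> 0 <= Z ->
     k l.+1 - mu l.+1 * Z - kap l.+1 * Z ^+ 2 / 2 <=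
     ln 4 + k l - mu l ^+ 2 * s l / 2 - 3 / 2 * ln (1 + kap l * s l) - mu l * Z
     - kap l / (1 + kap l * s l) * Z ^+ 2 / 2 - 3 * expR (k l)).

Let s0w l : 0 <= s l. Proof. exact: ltW. Qed.

Lemma expR_N2_le (x : R) : 0 <= x -> x <= 2^-1 -> expR (- (2 * x)) <= 1 - x.
Proof.
move=> x0 x2; have p : 0 < 1 + 2 * x by lra.
have h1 : expR (- (2 * x)) <= (1 + 2 * x)^-1.
  by rewrite expRN lef_pV2 ?posrE ?expR_gt0 // expR_ge1Dx.
apply: (le_trans h1); rewrite -[leLHS]mul1r ler_pdivrMr //; nra.
Qed.

(* [cand] is odd in its last argument, so that no truncation at the barrier is
   needed: where [cand] is negative the inequality is trivial. *)
Lemma lower_subsolution l x : (l <= n)%N ->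
  expR (k l) * cand (mu l) (kap l) (x - a l) <= 1 - F l x.
Proof.
have neg l' y : y - a l' <= 0 -> expR (k l') * cand (mu l') (kap l') (y - a l') <= 1 - F l' y.
  move=> h; apply: (@le_trans _ _ 0).
    apply: mulr_ge0_le0; first exact: expR_ge0.
    by apply: mulr_le0_ge0 => //; exact: expR_ge0.
  by rewrite subr_ge0; exact: brw_cdf_le1.
elim: l x => [|l ih] x hl.
  by have [h|h] := leP 0 (x - a 0); [exact: base|apply: neg; exact: ltW].
have [Z0|h] := leP 0 (x - a l.+1); last by apply: neg; exact: ltW.
set Z := x - _ in Z0 *.
have hl' := ltnW hl.
have k0 := kap0 hl'; have m1 := mu1 hl'; have sp := s0 l.
pose w := Z + mu l * s l.
have wx z : x - z - a l = w - z by rewrite /w /Z (aS hl); ring.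
have [ic ec] := cand_tilt (mu l) w sp k0.
have i1 : itg (gaussP (s l)) (fun z => expR (k l) * cand (mu l) (kap l) (x - z - a l)).
  by under eq_fun do rewrite wx; exact: itgZ.
set e := - mu l ^+ 2 * s l / 2 - 3 / 2 * ln (1 + kap l * s l) in ec.
set kp := kap l / (1 + kap l * s l) in ec.
set p := gconv (s l) (fun t => expR (k l) * cand (mu l) (kap l) (t - a l)) x.
have pE : p = expR (k l + e) * cand (mu l) kp Z.
  rewrite /p /gconv; under eq_Rintegral do rewrite wx.
  by rewrite (RintegralZl _ measurableT ic) -/(gconv _ _ _) ec expRD -mulrA /w addrK.
have ks : 0 <= kap l * s l by rewrite mulr_ge0 // ltW.
have kp0 : 0 <= kp by rewrite divr_ge0 // addr_ge0.
have cand0 : 0 <= cand (mu l) kp Z by rewrite mulr_ge0 ?expR_ge0.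
have p0 : 0 <= p by rewrite pE mulr_ge0 ?expR_ge0.
have e0 : e <= 0.
  have : 0 <= mu l ^+ 2 * s l by rewrite mulr_ge0 ?sqr_ge0 // ltW.
  have : 0 <= ln (1 + kap l * s l) by rewrite ln_ge0 // lerDl.
  rewrite /e; lra.
have pk : p <= expR (k l).
  rewrite pE expRD -[leRHS]mulr1 -mulrA ler_pM2l ?expR_gt0 //.
  rewrite -[leRHS]mulr1; apply: ler_pM; rewrite ?expR_ge0 //.
    by rewrite -expR0 ler_expR.
  rewrite /cand; apply: (@le_trans _ _ (expR Z * expR (- Z))); last by rewrite expRN mulfV ?gt_eqF ?expR_gt0.
  apply: ler_pM; rewrite ?expR_ge0 //; first by have := expR_ge1Dx Z; lra.
  rewrite ler_expR; have := ler_wpM2r Z0 m1.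
  have : 0 <= kp * Z ^+ 2 by rewrite mulr_ge0 ?sqr_ge0.
  lra.
have p3 : p <= 3^-1 := le_trans pk (k3 hl').
apply: le_trans (brw_lower_step rho0 s0w (fun t => ih t hl') i1 p0); rewrite -/p.
(* The nonlinear loss is put into the exponent as - 3 e^k, so that the whole step becomes an
   inequality between exponents. *)
have q : expR (- (2 * (3 / 2 * p))) <= 1 - 3 / 2 * p by apply: expR_N2_le; lra.
have q' : expR (- (3 * expR (k l))) <= 1 - 3 / 2 * p.
  by apply: le_trans q; rewrite ler_expR; lra.
apply: le_trans (ler_wpM2l _ q'); last by rewrite mulr_ge0.
rewrite pE /cand.
have -> : 4 * (expR (k l + e) * (Z * expR (- mu l * Z - kp * Z ^+ 2 / 2))) * expR (- (3 * expR (k l))) =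
    Z * expR (ln 4 + (k l + e) + (- mu l * Z - kp * Z ^+ 2 / 2) - 3 * expR (k l)).
  have e4 : expR (ln 4) = 4 :> R by rewrite lnK // posrE.
  by rewrite [in RHS]expRD [in RHS]expRD [in RHS]expRD e4; ring.
rewrite mulrCA -expRD ler_wpM2l // ler_expR.
have := step hl Z0; rewrite /e /kp; lra.
Qed.

Variables (M D : R).
Hypotheses (D0 : 0 <= D) (a0 : a 0 = 0)
  (muM : forall l, (l <= n)%N -> mu l + kap l / 2 <= M)
  (sD : forall l, s l <= D) (musD : forall l, (l < n)%N -> mu l * s l <= D)
  (k2 : forall l, (l < n)%N -> k l.+1 <= k l + ln 2).

(** One unit above the barrier the subsolution gives an exceedance probability of at least [d l],
    hence F <= e^(- d l) there, and the rate [d l / C] follows within distance C to the left.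
    Farther left, [brw_lefttail_step] multiplies the rate by four whereas [d] at most doubles by
    [k2]; the surplus covers the variance terms. *)
Lemma lower_left_tail y : 0 <= y ->
  F n (a n + 1 - y) <= expR (- (expR (k n - M) / (3 * D + rho + 4)) * y).
Proof.
have [D1 r1] : 0 <= D /\ 0 <= rho by [].
pose C := 3 * D + rho + 4.
have C4 : 4 <= C by rewrite /C; lra.
pose b l := a l + 1.
pose d l := expR (k l - M).
pose be l := d l / C.
have dl l : (l <= n)%N -> d l <= 1 - F l (b l).
  move=> h; apply: le_trans (lower_subsolution (b l) h).
  have -> : b l - a l = 1 by rewrite /b; ring.
  rewrite /cand mul1r -expRD ler_expR; have := muM h; lra.
have d1 l : (l <= n)%N -> d l <= 1.
  by move=> h; apply: (le_trans (dl l h)); rewrite gerBl; exact: brw_cdf_ge0.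
have d0 l : 0 < d l by exact: expR_gt0.
have b0 l : 0 < be l by rewrite divr_gt0 //; lra.
have be4 l : (l <= n)%N -> be l <= 4^-1.
  by move=> h; rewrite ler_pdivrMr; [have := d1 l h; lra|lra].
have near l x : (l <= n)%N -> b l - C <= x -> F l x <= expR (be l * (x - b l)).
  move=> h xC; have [xb|xb] := leP (b l) x.
    apply: (@le_trans _ _ 1); first exact: brw_cdf_le1.
    by rewrite -[leLHS]expR0 ler_expR mulr_ge0 ?subr_ge0 // ltW.
  apply: (@le_trans _ _ (F l (b l))).
    by apply: (brw_cdf_mono rho0 s0w); exact: ltW.
  apply: (@le_trans _ _ (expR (- d l))).
    by have := expR_ge1Dx (- d l); have := dl l h; lra.
  rewrite ler_expR; have : be l * (b l - x) <= be l * C by rewrite ler_pM2l //; lra.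
  have -> : be l * C = d l by rewrite /be divfK // gt_eqF //; lra.
  lra.
have main l : (l <= n)%N -> forall x, F l x <= expR (be l * (x - b l)).
  elim: l => [|l ih] h x.
    have [xC|xC] := leP (b 0 - C) x; first exact: near.
    apply: (le_trans (brw_cdf0_left s rho0 x ler01)); rewrite ler_expR.
    have bb : b 0 = 1 by rewrite /b a0 add0r.
    rewrite bb in xC *.
    have : be 0 * (1 - x) <= 4^-1 * (1 - x).
      by rewrite ler_wpM2r ?be4 //; lra.
    move: xC; rewrite /C expr1n; lra.
  have [xC|xC] := leP (b l.+1 - C) x; first exact: near.
  apply: (le_trans (brw_lefttail_step rho0 s0w x (ih (ltnW h)))); rewrite ler_expR.
  have bS : b l.+1 = b l + mu l * s l by rewrite /b (aS h); ring.
  have m1 := musD h; have s1 := sD l; have B0 := b0 l; have B4 := be4 l (ltnW h).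
  have bb : be l.+1 <= 2 * be l.
    rewrite /be mulrA ler_pM2r ?invr_gt0; last by lra.
    have -> : 2 * d l = expR (ln 2 + (k l - M)) by rewrite expRD lnK // posrE.
    rewrite ler_expR; have := k2 h; lra.
  set y' := b l.+1 - x.
  have yC : C <= y' by rewrite /y'; lra.
  have -> : x - b l.+1 = - y' by rewrite /y'; ring.
  have -> : x - b l = - y' + mu l * s l by rewrite /y' bS; ring.
  have h1 : be l.+1 * y' <= 2 * be l * y' by rewrite ler_wpM2r //; lra.
  have h2 : be l * (mu l * s l) <= be l * D by rewrite ler_pM2l.
  have h3 : be l ^+ 2 * s l <= be l * D.
    rewrite expr2 -mulrA ler_pM2l //.
    have : be l * s l <= 4^-1 * D by apply: ler_pM => //; exact: ltW.
    lra.
  have h4 : be l * C <= be l * y' by rewrite ler_pM2l.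
  move: h4; rewrite /C.
  have : 0 <= be l * (rho + 4) by rewrite mulr_ge0 ?(ltW B0) //; lra.
  lra.
move=> y0; apply: (le_trans (main n (leqnn n) _)); rewrite ler_expR.
rewrite /b; have -> : a n + 1 - y - (a n + 1) = - y by ring.
rewrite mulrN mulNr. exact: lexx.
Qed.

End lower_subsolution.

(** * Costs of one step for the lower barrier *)

Section log_differences.
Context {R : realType}.

Definition dln (x : R) : R := ln (x + 1) - ln x.

Lemma dlnE (x : R) : 0 < x -> dln x = ln (1 + x^-1).
Proof.
move=> x0; have i0 : 0 < x^-1 by rewrite invr_gt0.
rewrite /dln; have -> : x + 1 = x * (1 + x^-1) by rewrite mulrDr mulr1 mulfV ?gt_eqF.
by rewrite lnM ?posrE ?addr_gt0 // addrC addKr.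
Qed.

Lemma dln_le (x : R) : 0 < x -> dln x <= x^-1.
Proof.
move=> x0; rewrite dlnE //; apply: le_ln1Dx.
by apply: (@lt_trans _ _ 0); rewrite ?ltrN10 ?invr_gt0.
Qed.

Lemma dln_ge (x : R) : 0 < x -> (x + 1)^-1 <= dln x.
Proof.
move=> x0; rewrite dlnE //.
have i0 : 0 <= x^-1 by rewrite invr_ge0 ltW.
apply: le_trans (ln1D_ge i0).
by have -> : x^-1 / (1 + x^-1) = (x + 1)^-1 by field; rewrite !gt_eqF // addr_gt0.
Qed.

Lemma dln_gt0 (x : R) : 0 < x -> 0 < dln x.
Proof. by move=> x0; apply: lt_le_trans (dln_ge x0); rewrite invr_gt0 addr_gt0. Qed.

Lemma dln_diff (x : R) : 0 < x -> 0 <= dln x - dln (x + 1) /\ dln x - dln (x + 1) <= x ^- 2.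
Proof.
move=> x0; have x1 : 0 < x + 1 by rewrite addr_gt0.
have x2 : 0 < x + 1 + 1 by rewrite addr_gt0.
have y0 : 0 < (x * (x + 2))^-1 by rewrite invr_gt0 mulr_gt0 // addr_gt0.
have E : dln x - dln (x + 1) = ln (1 + (x * (x + 2))^-1).
  have -> : 1 + (x * (x + 2))^-1 = (x + 1) / x * ((x + 1) / (x + 1 + 1)).
    by field; rewrite !gt_eqF // addr_gt0.
  by rewrite lnM ?posrE ?divr_gt0 // !ln_div ?posrE // /dln; ring.
rewrite E; split; first by rewrite ln_ge0 // lerDl ltW.
apply: (@le_trans _ _ (x * (x + 2))^-1).
  by apply: le_ln1Dx; apply: (@lt_trans _ _ 0); rewrite ?ltrN10.
rewrite lef_pV2 ?posrE ?mulr_gt0 ?exprn_gt0 ?addr_gt0 //.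
by rewrite expr2 ler_pM2l // lerDl.
Qed.

End log_differences.

Section lower_costs.
Context {R : realType}.
Variables (lam sg : R).
Hypotheses (lam2 : 2 <= lam) (sg0 : 0 < sg).

Let c := 8 / lam ^+ 2.

Let lam0 : 0 < lam. Proof. by apply: lt_le_trans lam2. Qed.

Lemma quadratic_opt_le (A B A1 B1 Z : R) : 0 <= Z -> A <= A1 -> 0 < B1 -> B1 <= B ->
  A * Z - B * Z ^+ 2 / 2 <= A1 ^+ 2 / (2 * B1).
Proof.
move=> Z0 AA b0 BB; apply: le_trans (quadratic_opt A1 Z b0).
have := ler_wpM2r Z0 AA; have := ler_wpM2r (sqr_ge0 Z) BB; lra.
Qed.

Lemma cost_sum (a b d e f x y z : R) : a + d <= x -> b <= y -> e - f <= z ->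
  a + b + d + e - f <= x + y + z.
Proof. lra. Qed.

Section first_half.
Variables (p q : R).
Hypotheses (p4 : 4 <= p) (hp : 64 / (lam ^+ 2 * sg) <= p) (q0 : 0 <= q)
  (qp : q ^+ 2 = p ^+ 2 + 1).

Let D := dln (p ^+ 2).
Let s := sg - c * D.

Let p0 : 0 < p. Proof. by apply: lt_le_trans p4. Qed.
Let pq : p <= q.
Proof. by rewrite -ler_sqr ?nnegrE ?(ltW p0) // qp lerDl. Qed.
Let q2p : q <= 2 * p.
Proof.
have P4 := p4; have P0 := p0; have QP := qp.
by rewrite -ler_sqr ?nnegrE ?mulr_ge0 ?(ltW p0) //; nra.
Qed.
Let D_gt0 : 0 < D. Proof. by apply: dln_gt0; rewrite exprn_gt0. Qed.
Let D_le : D <= p ^- 2. Proof. by apply: dln_le; rewrite exprn_gt0. Qed.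
Let c_ge0 : 0 <= c. Proof. by rewrite divr_ge0 // sqr_ge0. Qed.

Let cD : c * D <= sg / (8 * p).
Proof.
apply: (le_trans (ler_wpM2l c_ge0 D_le)).
have -> : c * p ^- 2 = (64 / (lam ^+ 2 * sg)) * (sg / (8 * p ^+ 2)).
  by rewrite /c; field; rewrite !gt_eqF.
apply: (@le_trans _ _ (p * (sg / (8 * p ^+ 2)))).
  by rewrite ler_wpM2r // divr_ge0 ?(ltW sg0) // mulr_ge0 // sqr_ge0.
by have -> : p * (sg / (8 * p ^+ 2)) = sg / (8 * p) by field; rewrite gt_eqF.
Qed.

Lemma first_half_variance : sg / 2 <= s /\ s <= sg.
Proof.
have h := cD; have h1 := mulr_ge0 c_ge0 (ltW D_gt0); split; last by rewrite /s; lra.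
have : sg / (8 * p) <= sg / 2.
  by rewrite ler_wpM2l ?(ltW sg0) // lef_pV2 ?posrE ?mulr_gt0 //; have := p4; lra.
rewrite /s; lra.
Qed.

Let s_ge : sg / 2 <= s. Proof. by have [] := first_half_variance. Qed.
Let s_le : s <= sg. Proof. by have [] := first_half_variance. Qed.
Let s_gt0 : 0 < s. Proof. by apply: lt_le_trans s_ge; rewrite divr_gt0. Qed.
Let A0 : 0 < p ^+ 2 - p.
Proof.
have P4 := p4; have -> : p ^+ 2 - p = p * (p - 1) by ring.
by rewrite mulr_gt0 //; lra.
Qed.

Let nu := 9 / 2 * D / (lam * s).
Let kap := (sg * (p ^+ 2 - p))^-1.

Let entropy : - (3 / 2 * D) + 3 / 2 * ln (1 + kap * s) <= 6 / p ^+ 3.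
Proof.
have P4 := p4; have P0 := p0.
have k0 : 0 <= kap by rewrite invr_ge0 mulr_ge0 ?(ltW sg0) ?(ltW A0).
have h1 : ln (1 + kap * s) <= (p ^+ 2 - p)^-1.
  apply: (@le_trans _ _ (kap * s)).
    by apply: le_ln1Dx; rewrite (lt_le_trans (ltrN10 _)) // mulr_ge0 // ltW.
  apply: (le_trans (ler_wpM2l k0 s_le)).
  by rewrite /kap invfM mulrAC mulVf ?mul1r // gt_eqF.
have h2 : (p ^+ 2 + 1)^-1 <= D by apply: dln_ge; rewrite exprn_gt0.
have h3 : (p ^+ 2 - p)^-1 - (p ^+ 2 + 1)^-1 <= 4 / p ^+ 3.
  have -> : (p ^+ 2 - p)^-1 - (p ^+ 2 + 1)^-1 =
      4 / p ^+ 3 * ((p ^+ 2 * (p + 1)) / (4 * (p - 1) * (p ^+ 2 + 1))).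
    have n1 : p - 1 != 0 by rewrite gt_eqF //; lra.
    have n2 : p ^+ 2 + 1 != 0 by rewrite gt_eqF // addr_gt0 ?exprn_gt0.
    have n3 : p != 0 by rewrite gt_eqF.
    have n4 : p ^+ 2 - p != 0 by rewrite (gt_eqF A0).
    by field; rewrite n1 n2 n3 n4.
  rewrite ler_piMr ?divr_ge0 ?exprn_ge0 ?(ltW p0) // ler_pdivrMr; last first.
    by apply: mulr_gt0; [apply: mulr_gt0 => //; lra|rewrite addr_gt0 ?exprn_gt0].
  nra.
lra.
Qed.

Let drift : nu ^+ 2 * s / 2 <= 21 / (lam ^+ 2 * sg) / p ^+ 3.
Proof.
have P4 := p4; have P0 := p0.
have -> : nu ^+ 2 * s / 2 = 81 / 8 * D ^+ 2 / (lam ^+ 2 * s) by rewrite /nu; field; rewrite !gt_eqF.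
apply: (@le_trans _ _ (81 / 8 * (p ^- 2) ^+ 2 / (lam ^+ 2 * (sg / 2)))).
  apply: ler_pM.
  - by rewrite mulr_ge0 ?sqr_ge0.
  - by rewrite invr_ge0 mulr_ge0 ?sqr_ge0 // ltW.
  - by rewrite ler_pM2l // lerXn2r ?nnegrE ?(ltW D_gt0) // invr_ge0 sqr_ge0.
  - rewrite lef_pV2 ?posrE ?mulr_gt0 ?exprn_gt0 ?invr_gt0 //.
    by rewrite ler_pM2l ?exprn_gt0.
have -> : 81 / 8 * (p ^- 2) ^+ 2 / (lam ^+ 2 * (sg / 2)) =
    21 / (lam ^+ 2 * sg) / p ^+ 3 * (81 / (84 * p)) by field; rewrite !gt_eqF.
rewrite ler_piMr ?divr_ge0 ?mulr_ge0 ?exprn_ge0 ?(ltW p0) ?(ltW sg0) ?(ltW lam0) //.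
by rewrite ler_pdivrMr ?mulr_gt0 //; lra.
Qed.

Let qq_gt0 : 0 < q ^+ 2 - q.
Proof.
have P4 := p4; have PQ := pq.
have -> : q ^+ 2 - q = q * (q - 1) by ring.
by rewrite mulr_gt0 //; lra.
Qed.

(** For a subsolution the inverse curvature sg (m - sqrt m), with m = p^2, must grow by less than
    the variance of the step. The sqrt m opens a gap of at least sg / (4 p), and the variance
    missing because of the corridors takes at most half of it by [cD]. *)
Let bump1 : (32 * sg * p ^+ 5)^-1 <= (sg * (q ^+ 2 - q))^-1 - kap / (1 + kap * s).
Proof.
have [P4 P0] := (p4, p0); have [PQ Q2 QP] := And3 pq q2p qp.
have sn : sg != 0 by rewrite gt_eqF.
have An : p ^+ 2 - p != 0 by rewrite (gt_eqF A0).
have E1 : 0 < sg * (p ^+ 2 - p) + s by rewrite addr_gt0 // mulr_gt0.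
have E2 : 0 < sg * (q ^+ 2 - q) by rewrite mulr_gt0.
have -> : kap / (1 + kap * s) = (sg * (p ^+ 2 - p) + s)^-1.
  by rewrite /kap; field; rewrite !gt_eqF //=.
have num : sg / (8 * p) <= (sg * (p ^+ 2 - p) + s) - sg * (q ^+ 2 - q).
  have -> : sg * (p ^+ 2 - p) + s - sg * (q ^+ 2 - q) = sg * (q - p) - c * D.
    by rewrite QP /s; ring.
  have dq : (4 * p)^-1 <= q - p.
    rewrite -[leLHS]mulr1 ler_pdivrMl ?mulr_gt0 //; nra.
  have := ler_wpM2l (ltW sg0) dq; have := cD.
  have -> : sg / (4 * p) = 2 * (sg / (8 * p)) by field; rewrite gt_eqF.
  lra.
have den1 : sg * (p ^+ 2 - p) + s <= 2 * sg * p ^+ 2.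
  have S1 := s_le; have : sg * (p ^+ 2 - p + 1) <= sg * (2 * p ^+ 2).
    by rewrite ler_pM2l //; nra.
  lra.
have den2 : sg * (q ^+ 2 - q) <= 2 * sg * p ^+ 2.
  have : sg * (q ^+ 2 - q) <= sg * (2 * p ^+ 2) by rewrite ler_pM2l // QP; nra.
  lra.
have -> : (sg * (q ^+ 2 - q))^-1 - (sg * (p ^+ 2 - p) + s)^-1 =
    (sg * (p ^+ 2 - p) + s - sg * (q ^+ 2 - q)) / ((sg * (p ^+ 2 - p) + s) * (sg * (q ^+ 2 - q))).
  move: E1 E2; move: (sg * (p ^+ 2 - p) + s) (sg * (q ^+ 2 - q)) => X Y X0 Y0.
  by field; rewrite !gt_eqF.
have -> : (32 * sg * p ^+ 5)^-1 = sg / (8 * p) / ((2 * sg * p ^+ 2) * (2 * sg * p ^+ 2)).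
  by field; rewrite !gt_eqF.
apply: ler_pM => //.
- by rewrite divr_ge0 ?mulr_ge0 // ltW.
- by rewrite invr_ge0 !mulr_ge0 ?sqr_ge0 // ltW.
- rewrite lef_pV2 ?posrE; [|by rewrite !mulr_gt0 ?exprn_gt0|by rewrite mulr_gt0].
  by apply: ler_pM => //; exact: ltW.
Qed.

(** The shares of entropy, drift and slope; 5184 = 18^2 * 32 / 2 comes from completing the square
    with slope 18 and curvature 1/32. *)
Definition first_half_const := 6 + (21 + 5184) / (lam ^+ 2 * sg).

Lemma first_half_cost (kap' Z : R) : 0 <= Z -> (sg * (q ^+ 2 - q))^-1 <= kap' ->
  - (3 / 2 * D) + nu ^+ 2 * s / 2 + 3 / 2 * ln (1 + kap * s) +
  (nu - 9 / 2 * dln (q ^+ 2) / (lam * (sg - c * dln (q ^+ 2)))) * Z - (kap' - kap / (1 + kap * s)) * Z ^+ 2 / 2 <=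
  first_half_const / p ^+ 3.
Proof.
move=> Z0 kk; have P4 := p4; set D' := dln (q ^+ 2).
have q2 : q ^+ 2 = p ^+ 2 + 1 := qp.
have [dd1 dd2] := @dln_diff R (p ^+ 2) (exprn_gt0 2 p0).
rewrite -q2 -/D -/D' in dd1 dd2.
pose s' := sg - c * D'.
have ss' : s <= s' by rewrite /s /s' lerD2l lerN2 ler_wpM2l //; lra.
have s'0 : 0 < s' := lt_le_trans s_gt0 ss'.
have AE : nu - 9 / 2 * D' / (lam * s') = 9 / 2 * sg * (D - D') / (lam * (s * s')).
  by rewrite /nu /s' /s; field; rewrite -/s -/s' !gt_eqF.
have A1 : nu - 9 / 2 * D' / (lam * s') <= 18 / (lam * sg * p ^+ 4).
  rewrite AE; apply: (@le_trans _ _ (9 / 2 * sg * p ^- 4 / (lam * (sg / 2 * (sg / 2))))).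
    apply: ler_pM.
    - by rewrite !mulr_ge0 // ltW.
    - by rewrite invr_ge0 !mulr_ge0 // ltW.
    - by rewrite ler_pM2l ?mulr_gt0 //; move: dd2; rewrite -exprM.
    - rewrite lef_pV2 ?posrE ?mulr_gt0 ?invr_gt0 // ler_pM2l //.
      apply: ler_pM => //; try by rewrite divr_ge0 // ltW.
      exact: le_trans ss'.
  by rewrite le_eqVlt; apply/orP; left; apply/eqP; field; rewrite !gt_eqF.
have B1 : (32 * sg * p ^+ 5)^-1 <= kap' - kap / (1 + kap * s) by have := bump1; lra.
have B0 : 0 < (32 * sg * p ^+ 5)^-1 by rewrite invr_gt0 !mulr_gt0 ?exprn_gt0.
have h3 := quadratic_opt_le Z0 A1 B0 B1.
have e3 : (18 / (lam * sg * p ^+ 4)) ^+ 2 / (2 * (32 * sg * p ^+ 5)^-1) =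
    5184 / (lam ^+ 2 * sg) / p ^+ 3 by field; rewrite !gt_eqF.
rewrite e3 in h3.
have -> : first_half_const / p ^+ 3 = 6 / p ^+ 3 + 21 / (lam ^+ 2 * sg) / p ^+ 3 +
   5184 / (lam ^+ 2 * sg) / p ^+ 3 by rewrite /first_half_const; field; rewrite !gt_eqF.
exact: cost_sum entropy drift h3.
Qed.

(** Where the speed drops from above [lam] to below it, the slope jumps by order p^-2, against p^-4
    elsewhere. The curvature of order p^-3 that is added from there on bounds the cost by a multiple
    of (p^-2)^2 / p^-3 <= 1, paid at this single scale. *)
Lemma turning_cost (kap' Z : R) : 0 <= Z -> (sg * (q ^+ 2 - q))^-1 + q ^- 3 <= kap' ->
  - (3 / 2 * D) + nu ^+ 2 * s / 2 + 3 / 2 * ln (1 + kap * s) +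
  (nu + 6 * D / (lam * (sg + c * D))) * Z - (kap' - kap / (1 + kap * s)) * Z ^+ 2 / 2 <=
  first_half_const / p ^+ 3 + 1764 / (lam ^+ 2 * sg ^+ 2).
Proof.
move=> Z0 kk; have P4 := p4.
have p900 : 900 <= 1 * (1764 * p) by lra.
have q1 : 0 < q := lt_le_trans p0 pq.
have cD0 : 0 <= c * D by rewrite mulr_ge0 // ltW.
have A1 : nu + 6 * D / (lam * (sg + c * D)) <= 15 / (lam * sg * p ^+ 2).
  have h1 : nu <= 9 / (lam * sg * p ^+ 2).
    apply: (@le_trans _ _ (9 / 2 * p ^- 2 / (lam * (sg / 2)))).
      apply: ler_pM.
      - by rewrite mulr_ge0 // ltW.
      - by rewrite invr_ge0 !mulr_ge0 // ltW.
      - by rewrite ler_pM2l.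
      - by rewrite lef_pV2 ?posrE ?mulr_gt0 ?invr_gt0 // ler_pM2l.
    by rewrite le_eqVlt; apply/orP; left; apply/eqP; field; rewrite !gt_eqF.
  have h2 : 6 * D / (lam * (sg + c * D)) <= 6 / (lam * sg * p ^+ 2).
    apply: (@le_trans _ _ (6 * p ^- 2 / (lam * sg))).
      apply: ler_pM.
      - by rewrite mulr_ge0 // ltW.
      - by rewrite invr_ge0 !mulr_ge0 ?addr_ge0 // ltW.
      - by rewrite ler_pM2l.
      - by rewrite lef_pV2 ?posrE ?mulr_gt0 ?ltr_wpDr // ler_pM2l // lerDl.
    by rewrite le_eqVlt; apply/orP; left; apply/eqP; field; rewrite !gt_eqF.
  have -> : 15 / (lam * sg * p ^+ 2) = 9 / (lam * sg * p ^+ 2) + 6 / (lam * sg * p ^+ 2).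
    by field; rewrite !gt_eqF.
  exact: lerD.
have B1 : (8 * p ^+ 3)^-1 <= kap' - kap / (1 + kap * s).
  have h : (8 * p ^+ 3)^-1 <= q ^- 3.
    have -> : 8 * p ^+ 3 = (2 * p) ^+ 3 by ring.
    rewrite lef_pV2 ?posrE ?exprn_gt0 ?mulr_gt0 //.
    by rewrite lerXn2r ?nnegrE ?mulr_ge0 // ltW.
  have : 0 <= (32 * sg * p ^+ 5)^-1 by rewrite invr_ge0 !mulr_ge0 ?exprn_ge0 // ltW.
  have := bump1; lra.
have B0 : 0 < (8 * p ^+ 3)^-1 by rewrite invr_gt0 !mulr_gt0 ?exprn_gt0.
have h3 := quadratic_opt_le Z0 A1 B0 B1.
have E : (15 / (lam * sg * p ^+ 2)) ^+ 2 / (2 * (8 * p ^+ 3)^-1) <= 1764 / (lam ^+ 2 * sg ^+ 2).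
  have -> : (15 / (lam * sg * p ^+ 2)) ^+ 2 / (2 * (8 * p ^+ 3)^-1) =
    1764 / (lam ^+ 2 * sg ^+ 2) * (900 / (1764 * p)) by field; rewrite !gt_eqF.
  have pp : 0 < 1764 * p by apply: mulr_gt0; [exact: ltr0Sn|].
  apply: ler_piMr; last by rewrite (ler_pdivrMr _ _ pp).
  by apply: divr_ge0; [exact: ler0n|rewrite mulr_ge0 ?sqr_ge0].
have -> : first_half_const / p ^+ 3 = 6 / p ^+ 3 + 21 / (lam ^+ 2 * sg) / p ^+ 3 +
   5184 / (lam ^+ 2 * sg) / p ^+ 3 by rewrite /first_half_const; field; rewrite !gt_eqF.
have h5 : 0 <= 5184 / (lam ^+ 2 * sg) / p ^+ 3.
  apply: divr_ge0; last by rewrite exprn_ge0 ?(ltW p0).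
  by apply: divr_ge0; [exact: ler0n|rewrite mulr_ge0 ?sqr_ge0 ?(ltW sg0)].
apply: (le_trans (cost_sum entropy drift (le_trans h3 E))).
by rewrite lerD2r lerDl.
Qed.

End first_half.

End lower_costs.

Section second_half.
Context {R : realType}.
Variables (lam sg p q : R).
Hypotheses (lam2 : 2 <= lam) (sg0 : 0 < sg) (p4 : 4 <= p)
  (hp : 64 / (lam ^+ 2 * sg) <= p) (q0 : 0 <= q) (qp : q ^+ 2 = p ^+ 2 - 1).

Let c := 8 / lam ^+ 2.
Let D := dln (q ^+ 2).
Let s := sg + c * D.

Let lam0 : 0 < lam. Proof. by apply: lt_le_trans lam2. Qed.
Let p0 : 0 < p. Proof. by apply: lt_le_trans p4. Qed.
Let c_ge0 : 0 <= c. Proof. by rewrite divr_ge0 // sqr_ge0. Qed.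
Let qq : p ^+ 2 / 2 <= q ^+ 2 - 1.
Proof. have [P4 QP] := conj p4 qp; nra. Qed.
Let pp0 : 0 < p ^+ 2 / 2. Proof. by rewrite divr_gt0 ?exprn_gt0. Qed.
Let q2_gt1 : 0 < q ^+ 2 - 1. Proof. exact: lt_le_trans pp0 qq. Qed.
Let q2_gt0 : 0 < q ^+ 2. Proof. by have h := q2_gt1; lra. Qed.
Let q_gt0 : 0 < q.
Proof. by rewrite lt_neqAle q0 andbT; apply/eqP => h; have := q2_gt0; rewrite -h expr0n ltxx. Qed.
Let qp_lt : q <= p.
Proof. by rewrite -ler_sqr ?nnegrE ?(ltW p0) // qp gerBl. Qed.
Let D_gt0 : 0 < D. Proof. exact: dln_gt0. Qed.

Lemma second_half_dln : D <= 2 / p ^+ 2.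
Proof.
apply: (le_trans (dln_le q2_gt0)).
have -> : 2 / p ^+ 2 = (p ^+ 2 / 2)^-1 by field; rewrite gt_eqF.
by rewrite lef_pV2 ?posrE //; have := qq; lra.
Qed.

Lemma second_half_variance : sg <= s /\ s <= 2 * sg.
Proof.
split; first by rewrite lerDl mulr_ge0 // ltW.
have h := ler_wpM2l c_ge0 second_half_dln.
have h2 : c * (2 / p ^+ 2) <= sg.
  have -> : c * (2 / p ^+ 2) = 64 / (lam ^+ 2 * sg) * (sg / (4 * p ^+ 2)).
    by rewrite /c; field; rewrite !gt_eqF.
  have u0 : 0 <= sg / (4 * p ^+ 2).
    by apply: divr_ge0; [exact: ltW|apply: mulr_ge0 => //; exact: sqr_ge0].
  apply: (le_trans (ler_wpM2r u0 hp)).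
  have -> : p * (sg / (4 * p ^+ 2)) = sg / (4 * p) by field; rewrite gt_eqF.
  have P4 := p4; have p16 : 1 <= 4 * p by lra.
  by rewrite ler_piMr ?(ltW sg0) // invf_le1 // (lt_le_trans ltr01).
rewrite /s; lra.
Qed.

Let s_ge : sg <= s. Proof. by have [] := second_half_variance. Qed.
Let s_le : s <= 2 * sg. Proof. by have [] := second_half_variance. Qed.
Let s_gt0 : 0 < s. Proof. exact: lt_le_trans s_ge. Qed.

Definition second_half_const := 3 * sg + 18 / (lam ^+ 2 * sg) + 576 / (lam ^+ 2 * sg ^+ 2).

Let nu := - (6 * D / (lam * s)).

(** The curvature stays near [km], which will be of order 1 / N, so the convolutions cost 3 sg km
    each and O(1) altogether. As p decreases, p^-3 increases by at least a multiple of p^-5, which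
    controls the change of slope p^-4 after completing the square. *)
Lemma second_half_cost (km Z : R) : 0 <= Z -> 0 <= km ->
  nu ^+ 2 * s / 2 + 3 / 2 * ln (1 + (km + p ^- 3) * s) +
  (nu + 6 * dln (q ^+ 2 - 1) / (lam * (sg + c * dln (q ^+ 2 - 1)))) * Z -
  ((km + q ^- 3) - (km + p ^- 3) / (1 + (km + p ^- 3) * s)) * Z ^+ 2 / 2 <=
  3 * sg * km + second_half_const / p ^+ 3.
Proof.
move=> Z0 km0; have P4 := p4.
set D' := dln (q ^+ 2 - 1); set s' := sg + c * D'.
have D'0 : 0 < D' by exact: dln_gt0.
have s'0 : sg <= s' by rewrite lerDl mulr_ge0 // ltW.
have s'p : 0 < s' := lt_le_trans sg0 s'0.
have k0 : 0 <= km + p ^- 3 by rewrite addr_ge0 // invr_ge0 exprn_ge0 // ltW.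
have drift : nu ^+ 2 * s / 2 <= 18 / (lam ^+ 2 * sg) / p ^+ 3.
  have -> : nu ^+ 2 * s / 2 = 18 * D ^+ 2 / (lam ^+ 2 * s) by rewrite /nu; field; rewrite !gt_eqF.
  apply: (@le_trans _ _ (18 * (2 / p ^+ 2) ^+ 2 / (lam ^+ 2 * sg))).
    apply: ler_pM.
    - by rewrite mulr_ge0 ?sqr_ge0.
    - by rewrite invr_ge0 mulr_ge0 ?sqr_ge0 // ltW.
    - by rewrite ler_pM2l // lerXn2r ?nnegrE ?(ltW D_gt0) ?second_half_dln // divr_ge0 ?sqr_ge0.
    - by rewrite lef_pV2 ?posrE ?mulr_gt0 ?exprn_gt0 // ler_pM2l ?exprn_gt0.
  have -> : 18 * (2 / p ^+ 2) ^+ 2 / (lam ^+ 2 * sg) = 18 / (lam ^+ 2 * sg) / p ^+ 3 * (4 / p).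
    by field; rewrite !gt_eqF.
  apply: ler_piMr; last by rewrite ler_pdivrMr // mul1r.
  by rewrite !divr_ge0 ?mulr_ge0 ?exprn_ge0 ?(ltW p0) ?(ltW sg0) ?(ltW lam0).
have entropy : 3 / 2 * ln (1 + (km + p ^- 3) * s) <= 3 * sg * km + 3 * sg / p ^+ 3.
  have h1 : ln (1 + (km + p ^- 3) * s) <= (km + p ^- 3) * s.
    by apply: le_ln1Dx; rewrite (lt_le_trans (ltrN10 _)) // mulr_ge0 // ltW.
  have h2 := ler_wpM2l k0 s_le.
  have -> : 3 * sg * km + 3 * sg / p ^+ 3 = 3 / 2 * ((km + p ^- 3) * (2 * sg)) by field; rewrite gt_eqF.
  by rewrite ler_wpM2l // (le_trans h1).
have [_ dd] := @dln_diff R (q ^+ 2 - 1) q2_gt1.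
rewrite subrK -/D -/D' in dd.
have dd4 : D' - D <= 4 / p ^+ 4.
  apply: (le_trans dd).
  have -> : 4 / p ^+ 4 = (p ^+ 2 / 2) ^- 2 by field; rewrite gt_eqF.
  by rewrite lef_pV2 ?posrE ?exprn_gt0 // lerXn2r ?nnegrE // ?(ltW pp0) ?(ltW q2_gt1).
have dd0 : 0 <= D' - D.
  have [h _] := @dln_diff R (q ^+ 2 - 1) q2_gt1.
  by rewrite subrK in h.
have A1 : nu + 6 * D' / (lam * s') <= 24 / (lam * sg * p ^+ 4).
  have -> : nu + 6 * D' / (lam * s') = 6 * sg * (D' - D) / (lam * (s * s')).
    by rewrite /nu /s' /s; field; rewrite -/s -/s' !gt_eqF.
  apply: (@le_trans _ _ (6 * sg * (4 / p ^+ 4) / (lam * (sg * sg)))).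
    apply: ler_pM.
    - by rewrite !mulr_ge0 // ltW.
    - by rewrite invr_ge0 !mulr_ge0 // ltW.
    - by rewrite ler_pM2l ?mulr_gt0.
    - rewrite lef_pV2 ?posrE ?mulr_gt0 // ler_pM2l //.
      by apply: ler_pM => //; exact: ltW.
  by rewrite le_eqVlt; apply/orP; left; apply/eqP; field; rewrite !gt_eqF.
have B1 : (2 * p ^+ 5)^-1 <=
    (km + q ^- 3) - (km + p ^- 3) / (1 + (km + p ^- 3) * s).
  have h1 : (km + p ^- 3) / (1 + (km + p ^- 3) * s) <= km + p ^- 3.
    have d1 : 1 <= 1 + (km + p ^- 3) * s by rewrite lerDl mulr_ge0 // ltW.
    by rewrite ler_piMr // invf_le1 // (lt_le_trans ltr01).
  have h2 : (2 * p ^+ 5)^-1 <= q ^- 3 - p ^- 3.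
    have QP := qp; have Q1 := q_gt0; have QL := qp_lt.
    have -> : q ^- 3 - p ^- 3 = (p ^+ 3 - q ^+ 3) / (p ^+ 3 * q ^+ 3) by field; rewrite !gt_eqF.
    have -> : (2 * p ^+ 5)^-1 = (p / 2) / (p ^+ 3 * p ^+ 3) by field; rewrite gt_eqF.
    apply: ler_pM.
    - by rewrite divr_ge0 // ltW.
    - by rewrite invr_ge0 mulr_ge0 ?exprn_ge0 // ltW.
    - have e1 : (p - q) * (p + q) = 1.
        have -> : (p - q) * (p + q) = p ^+ 2 - q ^+ 2 by ring.
        by rewrite QP; ring.
      have -> : p ^+ 3 - q ^+ 3 = (p - q) * (p + q) * p + (p - q) * q ^+ 2 by ring.
      rewrite e1 mul1r; have : 0 <= (p - q) * q ^+ 2 by rewrite mulr_ge0 ?sqr_ge0 ?subr_ge0.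
      lra.
    - rewrite lef_pV2 ?posrE ?mulr_gt0 ?exprn_gt0 // ler_pM2l ?exprn_gt0 //.
      by rewrite lerXn2r ?nnegrE // ltW.
  lra.
have B0 : 0 < (2 * p ^+ 5)^-1 by rewrite invr_gt0 mulr_gt0 ?exprn_gt0.
have h3 := quadratic_opt_le Z0 A1 B0 B1.
have e3 : (24 / (lam * sg * p ^+ 4)) ^+ 2 / (2 * (2 * p ^+ 5)^-1) =
  576 / (lam ^+ 2 * sg ^+ 2) / p ^+ 3 by field; rewrite !gt_eqF.
rewrite e3 in h3.
have -> : 3 * sg * km + second_half_const / p ^+ 3 =
  18 / (lam ^+ 2 * sg) / p ^+ 3 + (3 * sg * km + 3 * sg / p ^+ 3) + 576 / (lam ^+ 2 * sg ^+ 2) / p ^+ 3.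
  by rewrite /second_half_const; field; rewrite !gt_eqF.
by rewrite -addrA; apply: lerD h3; apply: lerD.
Qed.

End second_half.

Section step_arithmetic.
Context {R : realType}.

Lemma up_arith (l4 m D d L k k' lam n1 n2 Z kp kp' Z2 E F G T T' : R) :
  l4 - m = 4 * 1 * D - 9 / 2 * D - d ->
  - (3 / 2 * D) + d + 3 / 2 * L + (n1 - n2) * Z - (kp' - kp) * Z2 / 2 <= F + T ->
  2 * D + G + T' <= k - k' -> F + 3 * E <= G -> T <= T' ->
  k' - (lam + n2) * Z - kp' * Z2 / 2 <=
  l4 + k - m - 3 / 2 * L - (lam + n1) * Z - kp * Z2 / 2 - 3 * E.
Proof. lra. Qed.

Lemma down_arith (l4 m D d L k k' lam n1 n2 Z kp kp' Z2 E F G T T' : R) :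
  l4 - m = 4 * (- 1) * D - - (6 * D) - d ->
  d + 3 / 2 * L + (- n1 + n2) * Z - (kp' - kp) * Z2 / 2 <= T + F ->
  - 2 * D + G + T' <= k - k' -> F + 3 * E <= G -> T <= T' ->
  k' - (lam - n2) * Z - kp' * Z2 / 2 <=
  l4 + k - m - 3 / 2 * L - (lam - n1) * Z - kp * Z2 / 2 - 3 * E.
Proof. lra. Qed.

End step_arithmetic.

Section lower_tree.
Context {R : realType}.
Variables (lam sg : R) (J0 N : nat).
Hypotheses (lam2 : 2 <= lam) (sg0 : 0 < sg) (ls : expR (lam ^+ 2 * sg / 2) = 4)
  (J17 : (17 <= J0)%N) (Jhp : 64 / (lam ^+ 2 * sg) <= Num.sqrt J0%:R)
  (Jsg : 6 / sg <= J0%:R) (N1 : (1 <= N)%N).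

Let c := 8 / lam ^+ 2.

(* Removing corridors of relative width [low_index ^ -2] between the subboxes makes
   the increments of the free field dominate those of a tree whose total variance
   up to height [l] is [sg * l - 8 / lam^2 * ln low_index] up to a constant. *)
Definition low_index (l : nat) : nat := (minn l (2 * N - l) + J0)%N.

Let X (l : nat) : R := (low_index l)%:R.
Let p l := Num.sqrt (X l).

Definition low_var (l : nat) : R := sg - 8 / lam ^+ 2 * (ln (X l.+1) - ln (X l)).

Let s := low_var.
Let km := (sg * (X N - p N))^-1.
(** With D the increment of ln X, the variance deficit c D adds 4 D to the exponent, the convolution
    adds - 3 D / 2 and the prefactor is to change by - 2 D; this forces 9/2 = 4 - 3/2 + 2. In the
    upper half the signs are reversed and the convolution factor is negligible, which leaves 6 = 4 +
    2. *)
Let mu (l : nat) : R := if (l < N)%N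
  then lam + 9 / 2 * dln (X l) / (lam * (sg - c * dln (X l)))
  else lam - 6 * dln (X l - 1) / (lam * (sg + c * dln (X l - 1))).
Let kap (l : nat) : R := if (l < N)%N then (sg * (X l - p l))^-1 else km + p l ^- 3.
Let Cg := first_half_const lam sg + 1764 / (lam ^+ 2 * sg ^+ 2) + second_half_const lam sg + 9.
Let rho := 2 * sg * J0%:R.
Let e0 := `|ln (Num.sqrt (rho * pi *+ 2))| + rho^-1.
(** The logarithm of the prefactor. The term - 2 ln X keeps the nonlinear losses below X^-2; 6 Cg /
    p pays the errors p^-3 by telescoping, with the opposite sign once p decreases; the linear term
    pays for [km] in portions Cg / N; [e0] fits the initial law. *)
Let kk (l : nat) : R := - 6 * Cg - e0 - 2 * ln (X l) +
  (if (l < N)%N then 6 * Cg / p l else - Cg - 6 * Cg / p l) - Cg * (l%:R / N%:R).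
Let a (l : nat) : R := \sum_(j < l) mu j * s j.

Let lam0 : 0 < lam. Proof. by apply: lt_le_trans lam2. Qed.

Let X_ge l : J0%:R <= X l. Proof. by rewrite ler_nat leq_addl. Qed.
Let X_ge17 l : 17 <= X l.
Proof. by apply: le_trans (X_ge l); rewrite ler_nat. Qed.
Let X_gt0 l : 0 < X l. Proof. by apply: lt_le_trans (X_ge17 l). Qed.
Let pX l : p l ^+ 2 = X l. Proof. by rewrite sqr_sqrtr // ltW. Qed.
Let p_ge4 l : 4 <= p l.
Proof.
have h := X_ge17 l; have p0 : 0 <= p l := sqrtr_ge0 _.
by rewrite -ler_sqr ?nnegrE // pX; lra.
Qed.
Let p_gt0 l : 0 < p l. Proof. by apply: lt_le_trans (p_ge4 l). Qed.
Let p_hp l : 64 / (lam ^+ 2 * sg) <= p l.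
Proof. by apply: (le_trans Jhp); rewrite ler_wsqrtr. Qed.

Let index_up l : (l < N)%N -> low_index l.+1 = (low_index l).+1.
Proof. by rewrite /low_index; lia. Qed.
Let index_down l : (N <= l)%N -> (l < 2 * N)%N -> low_index l = (low_index l.+1).+1.
Proof. by rewrite /low_index; lia. Qed.

Let index_mid : low_index N = (N + J0)%N.
Proof. by rewrite /low_index; lia. Qed.
Let index_end : low_index (2 * N) = J0.
Proof. by rewrite /low_index; lia. Qed.
Let end_ge : (2 * N < N)%N = false.
Proof. by lia. Qed.

Let X_up l : (l < N)%N -> X l.+1 = X l + 1.
Proof. by move=> h; rewrite /X (index_up h) natr1. Qed.
Let X_down l : (N <= l)%N -> (l < 2 * N)%N -> X l.+1 = X l - 1.
Proof. by move=> h1 h2; rewrite /X (index_down h1 h2) -natr1 addrK. Qed.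

Let s_up l : (l < N)%N -> s l = sg - c * dln (X l).
Proof. by move=> h; rewrite /s /low_var X_up. Qed.
Let s_down l : (N <= l)%N -> (l < 2 * N)%N -> s l = sg + c * dln (X l - 1).
Proof. by move=> h1 h2; rewrite /s /low_var X_down // /dln subrK /c; ring. Qed.
Let s_end l : (2 * N <= l)%N -> s l = sg.
Proof.
move=> h; rewrite /s /low_var; have -> : X l.+1 = X l by rewrite /X /low_index; congr _%:R; lia.
by rewrite subrr mulr0 subr0.
Qed.

Let fh l : sg / 2 <= sg - c * dln (X l) /\ sg - c * dln (X l) <= sg.
Proof. by have := first_half_variance lam2 sg0 (p_ge4 l) (p_hp l); rewrite pX. Qed.

Let q2 l : Num.sqrt (X l - 1) ^+ 2 = X l - 1.
Proof. by rewrite sqr_sqrtr //; have := X_ge17 l; lra. Qed.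
Let q2p l : Num.sqrt (X l - 1) ^+ 2 = p l ^+ 2 - 1.
Proof. by rewrite q2 pX. Qed.

Let sh l : sg <= sg + c * dln (X l - 1) /\ sg + c * dln (X l - 1) <= 2 * sg.
Proof. by have := second_half_variance lam2 sg0 (p_ge4 l) (p_hp l) (q2p l); rewrite q2. Qed.

Let s_bounds l : 0 < s l /\ s l <= 2 * sg.
Proof.
have S0 := sg0.
have [h|h] := ltnP l N; first by rewrite s_up //; have [? ?] := fh l; split; lra.
have [h2|h2] := ltnP l (2 * N); first by rewrite s_down //; have [? ?] := sh l; split; lra.
by rewrite s_end //; split; lra.
Qed.

Lemma low_var_gt0 l : 0 < low_var l. Proof. by have [] := s_bounds l. Qed.

Lemma sum_low_var l : \sum_(j < l) low_var j =
  sg * l%:R - 8 / lam ^+ 2 * (ln (low_index l)%:R - ln J0%:R).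
Proof.
elim: l => [|l ih].
  by rewrite big_ord0 /low_index min0n add0n subrr !mulr0 subr0.
by rewrite big_ord_recr /= ih /low_var /X -natr1; ring.
Qed.

Let X2 l : dln (X l - 1) <= 2 / X l.
Proof. by have := second_half_dln (p_ge4 l) (q2p l); rewrite q2 pX. Qed.

Let X_m1 l : 0 < X l - 1. Proof. by have := X_ge17 l; lra. Qed.

Let sgX l : 6 <= sg * X l.
Proof. by rewrite -ler_pdivrMl // mulrC (le_trans Jsg). Qed.

Let mu_bounds l : 1 <= mu l /\ mu l <= lam + 1.
Proof.
have [S0 L0 L2] := And3 sg0 lam0 lam2; have X0 := X_gt0 l; have SX := sgX l.
rewrite /mu; case: ifP => _.
  have D0 := dln_gt0 X0; have D1 := dln_le X0; have [s1 s2] := fh l.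
  have sp : 0 < sg - c * dln (X l) by lra.
  have h0 : 0 <= 9 / 2 * dln (X l) / (lam * (sg - c * dln (X l))).
    by rewrite divr_ge0 ?mulr_ge0 // ltW.
  have h1 : 9 / 2 * dln (X l) / (lam * (sg - c * dln (X l))) <= 1.
    rewrite ler_pdivrMr ?mulr_gt0 // mul1r.
    have e1 : dln (X l) <= sg / 6.
      apply: (le_trans D1); rewrite -[leLHS]mul1r ler_pdivrMr //; lra.
    have : 2 * (sg / 2) <= lam * (sg - c * dln (X l)) by apply: ler_pM => //; lra.
    lra.
  by split; lra.
have D0 := dln_gt0 (X_m1 l); have D1 := X2 l; have [s1 s2] := sh l.
have sp : 0 < sg + c * dln (X l - 1) by lra.
have h0 : 0 <= 6 * dln (X l - 1) / (lam * (sg + c * dln (X l - 1))).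
  by rewrite divr_ge0 ?mulr_ge0 // ltW.
have h1 : 6 * dln (X l - 1) / (lam * (sg + c * dln (X l - 1))) <= 1.
  rewrite ler_pdivrMr ?mulr_gt0 // mul1r.
  have e1 : dln (X l - 1) <= sg / 3.
    apply: (le_trans D1); rewrite ler_pdivrMr //; lra.
  have : 2 * sg <= lam * (sg + c * dln (X l - 1)) by apply: ler_pM => //; lra.
  lra.
by split; lra.
Qed.

Let Xp l : X l / 2 <= X l - p l.
Proof. by have P := p_ge4 l; rewrite -pX; nra. Qed.

Let Xp_gt0 l : 0 < sg * (X l - p l).
Proof. by rewrite mulr_gt0 // (lt_le_trans _ (Xp l)) // divr_gt0. Qed.

Let km_ge0 : 0 <= km. Proof. by rewrite invr_ge0 ltW. Qed.

Let Xp_ge3 l : 3 <= sg * (X l - p l).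
Proof. by have := ler_wpM2l (ltW sg0) (Xp l); have := sgX l; lra. Qed.

Let kap_bounds l : 0 <= kap l /\ kap l <= 1.
Proof.
have inv3 l' : (sg * (X l' - p l'))^-1 <= 3^-1.
  by rewrite lef_pV2 ?posrE // (lt_le_trans _ (Xp_ge3 l')).
rewrite /kap; case: ifP => _.
  by split; [rewrite invr_ge0 ltW|have := inv3 l; lra].
have h : p l ^- 3 <= 2^-1.
  have P := p_ge4 l.
  rewrite lef_pV2 ?posrE ?exprn_gt0 //; nra.
have h0 : 0 <= p l ^- 3 by rewrite invr_ge0 exprn_ge0 // ltW.
by have := inv3 N; have := km_ge0; rewrite -/km; split; lra.
Qed.

Let Cg_parts : [/\ 0 <= first_half_const lam sg, 0 <= 1764 / (lam ^+ 2 * sg ^+ 2),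
   0 <= second_half_const lam sg & Cg = first_half_const lam sg + 1764 / (lam ^+ 2 * sg ^+ 2) + second_half_const lam sg + 9].
Proof.
have h2 : 0 <= lam ^+ 2 * sg by rewrite mulr_ge0 ?sqr_ge0 // ltW.
have h3 : 0 <= lam ^+ 2 * sg ^+ 2 by rewrite mulr_ge0 ?sqr_ge0.
split; last by [].
- apply: addr_ge0; first exact: ler0n.
  by apply: divr_ge0 h2; apply: addr_ge0; exact: ler0n.
- by apply: divr_ge0 h3; exact: ler0n.
- apply: addr_ge0; last by apply: divr_ge0 h3; exact: ler0n.
  apply: addr_ge0; last by apply: divr_ge0 h2; exact: ler0n.
  by apply: mulr_ge0; [exact: ler0n|exact: ltW].
Qed.

Let Cg_ge0 : 0 <= Cg. Proof. by have [? ? ? ->] := Cg_parts; lra. Qed.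
Let e0_ge0 : 0 <= e0.
Proof. by rewrite addr_ge0 // invr_ge0 !mulr_ge0 // ltW. Qed.

Let Cgp l : 0 <= Cg / p l /\ Cg / p l <= Cg.
Proof.
have P := p_ge4 l; split; first by rewrite divr_ge0 // ltW.
by rewrite ler_piMr // invf_le1 //; lra.
Qed.

Let kk_le l : kk l <= - e0 - 2 * ln (X l).
Proof.
have [h1 h2] := Cgp l; have C0 := Cg_ge0.
have h3 : 0 <= Cg * (l%:R / N%:R) by rewrite mulr_ge0 // divr_ge0.
by rewrite /kk; case: ifP => _; lra.
Qed.

Let expkk l : expR (kk l) <= X l ^- 2.
Proof.
have := kk_le l; have E0 := e0_ge0 => h.
apply: (@le_trans _ _ (expR (- (ln (X l) + ln (X l))))); first by rewrite ler_expR; lra.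
by rewrite expRN expRD lnK ?posrE.
Qed.

Let expkk3 l : 3 * expR (kk l) <= 3 / p l ^+ 3.
Proof.
rewrite ler_pM2l // (le_trans (expkk l)) // -pX -exprM lef_pV2 ?posrE ?exprn_gt0 //.
by rewrite ler_eXn2l // ?(lt_le_trans _ (p_ge4 l)) // ltr1n.
Qed.

Let ln4 : ln 4 = lam ^+ 2 * sg / 2 :> R.
Proof. by rewrite -ls expRK. Qed.

Let p_ge1 l : 1 <= p l. Proof. by have := p_ge4 l; lra. Qed.

Let gain l l' : p l' ^+ 2 = p l ^+ 2 + 1 -> Cg / p l ^+ 3 <= 6 * Cg / p l - 6 * Cg / p l'.
Proof.
move=> h; have g := barrier_gain (p_ge1 l) (ltW (p_gt0 l')) h.
have C6 : 0 <= 6 * Cg by rewrite mulr_ge0 // Cg_ge0.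
have := ler_wpM2l C6 g; rewrite mulrBr.
by have -> : 6 * Cg * (6 * p l ^+ 3)^-1 = Cg / p l ^+ 3 by field; rewrite gt_eqF.
Qed.

Let NR : 0 < N%:R :> R. Proof. by rewrite ltr0n. Qed.

Let frac l : Cg * (l.+1%:R / N%:R) = Cg * (l%:R / N%:R) + Cg / N%:R.
Proof. by rewrite -natr1 [(_ + 1) / _]mulrDl mul1r [Cg * _]mulrDr. Qed.

Let CgN : 0 <= Cg / N%:R. Proof. by rewrite divr_ge0 // ?Cg_ge0 // ltW. Qed.

Let kkS_up l : (l.+1 < N)%N -> 2 * dln (X l) + Cg / p l ^+ 3 <= kk l - kk l.+1.
Proof.
move=> h; have h' := ltnW h.
have qp : p l.+1 ^+ 2 = p l ^+ 2 + 1 by rewrite !pX X_up.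
have g := gain qp; have C := CgN.
rewrite /kk h h' frac X_up // /dln; lra.
Qed.

Let kkS_turn l : l.+1 = N -> 2 * dln (X l) + Cg / p l ^+ 3 + Cg <= kk l - kk l.+1.
Proof.
move=> h; have h' : (l < N)%N by rewrite -h.
have hn : (l.+1 < N)%N = false by rewrite h ltnn.
have [c1 c2] := Cgp l.+1; have C := CgN; have C0 := Cg_ge0.
have g : Cg / p l ^+ 3 <= 6 * Cg / p l.
  have -> : Cg / p l ^+ 3 = Cg / p l * (p l ^- 2) by field; rewrite gt_eqF.
  have -> : 6 * Cg / p l = Cg / p l * 6 by ring.
  have [d1 d2] := Cgp l; rewrite ler_wpM2l // (le_trans _ (ler1n _ 6)) //.
  by rewrite invf_le1 ?exprn_gt0 // exprn_ege1.
rewrite /kk h' hn frac X_up // /dln; lra.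
Qed.

Let kkS_down l : (N <= l)%N -> (l < 2 * N)%N ->
  - 2 * dln (X l - 1) + Cg / p l ^+ 3 + Cg / N%:R <= kk l - kk l.+1.
Proof.
move=> h1 h2; have h3 : (l < N)%N = false by rewrite ltnNge h1.
have h4 : (l.+1 < N)%N = false by rewrite ltnNge (leqW h1).
have qp : p l ^+ 2 = p l.+1 ^+ 2 + 1 by rewrite !pX X_down // subrK.
have g := gain qp; have C0 := Cg_ge0.
have g2 : Cg / p l ^+ 3 <= Cg / p l.+1 ^+ 3.
  rewrite ler_wpM2l // lef_pV2 ?posrE ?exprn_gt0 // lerXn2r ?nnegrE ?(ltW (p_gt0 _)) //.
  by rewrite ler_wsqrtr // X_down // gerBl.
rewrite /kk h3 h4 frac X_down // /dln subrK; lra.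
Qed.

Let aS l : a l.+1 = a l + mu l * s l.
Proof. by rewrite /a big_ord_recr. Qed.

Let mu_shift (t S D : R) : S = sg - t * (8 / lam ^+ 2 * D) -> 0 < S ->
  forall u, lam ^+ 2 * sg / 2 - (lam + u / (lam * S)) ^+ 2 * S / 2 =
    4 * t * D - u - (u / (lam * S)) ^+ 2 * S / 2.
Proof.
move=> SE Sp u.
have -> : sg = S + t * (8 / lam ^+ 2 * D) by rewrite SE; ring.
by field; rewrite !gt_eqF.
Qed.

Let sub3 l x : x + 3 <= Cg -> x / p l ^+ 3 + 3 * expR (kk l) <= Cg / p l ^+ 3.
Proof.
move=> h; apply: (@le_trans _ _ ((x + 3) / p l ^+ 3)).
  have -> : (x + 3) / p l ^+ 3 = x / p l ^+ 3 + 3 / p l ^+ 3 by rewrite mulrDl.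
  by rewrite lerD2l; exact: expkk3.
by rewrite ler_wpM2r // invr_ge0 exprn_ge0 // ltW.
Qed.

Let step l Z : (l < 2 * N)%N -> 0 <= Z ->
  kk l.+1 - mu l.+1 * Z - kap l.+1 * Z ^+ 2 / 2 <=
  ln 4 + kk l - mu l ^+ 2 * s l / 2 - 3 / 2 * ln (1 + kap l * s l) - mu l * Z
  - kap l / (1 + kap l * s l) * Z ^+ 2 / 2 - 3 * expR (kk l).
Proof.
move=> h2N Z0; rewrite ln4; have [f0 t0 g0 CE] := Cg_parts.
have [hN|hN] := ltnP l N.
  have Sp := low_var_gt0 l; rewrite -/s (s_up hN) in Sp.
  have SE : sg - c * dln (X l) = sg - 1 * (8 / lam ^+ 2 * dln (X l)) by rewrite mul1r.
  have ms := mu_shift SE Sp (9 / 2 * dln (X l)).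
  have kE : kap l = (sg * (p l ^+ 2 - p l))^-1 by rewrite /kap hN pX.
  have mE : mu l = lam + 9 / 2 * dln (X l) / (lam * (sg - c * dln (X l))) by rewrite /mu hN.
  have qp : p l.+1 ^+ 2 = p l ^+ 2 + 1 by rewrite !pX X_up.
  have q0 : 0 <= p l.+1 := sqrtr_ge0 _.
  rewrite (s_up hN) mE.
  have [hN2|hN2] := ltnP l.+1 N.
    have k' : (sg * (p l.+1 ^+ 2 - p l.+1))^-1 <= kap l.+1 by rewrite /kap hN2 pX.
    have H := first_half_cost lam2 sg0 (p_ge4 l) (p_hp l) q0 qp Z0 k'.
    have K := kkS_up hN2.
    have E3 : first_half_const lam sg / p l ^+ 3 + 3 * expR (kk l) <= Cg / p l ^+ 3.
      by apply: sub3; lra.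
    rewrite -kE !pX -/c in H.
    have mE' : mu l.+1 = lam + 9 / 2 * dln (X l.+1) / (lam * (sg - c * dln (X l.+1))) by rewrite /mu hN2.
    rewrite mE'.
    rewrite -[first_half_const _ _ / _]addr0 in H.
    rewrite -[2 * dln _ + _]addr0 in K.
    exact: up_arith ms H K E3 (lexx _).
  have hN3 : l.+1 = N by apply/eqP; rewrite eqn_leq hN hN2.
  have hN4 : (l.+1 < N)%N = false by rewrite ltnNge hN2.
  have k' : (sg * (p l.+1 ^+ 2 - p l.+1))^-1 + p l.+1 ^- 3 <= kap l.+1.
    by rewrite /kap hN4 /km -hN3 pX.
  have H := turning_cost lam2 sg0 (p_ge4 l) (p_hp l) q0 qp Z0 k'.
  have K := kkS_turn hN3.
  have E3 : first_half_const lam sg / p l ^+ 3 + 3 * expR (kk l) <= Cg / p l ^+ 3.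
    by apply: sub3; lra.
  rewrite -kE !pX -/c in H.
  have mE' : mu l.+1 = lam - 6 * dln (X l) / (lam * (sg + c * dln (X l))).
    by rewrite /mu hN4 X_up // addrK.
  rewrite mE'.
  have C1 : 1764 / (lam ^+ 2 * sg ^+ 2) <= Cg by lra.
  rewrite -[6 * dln (X l) / _]opprK in H.
  exact: up_arith ms H K E3 C1.
have Sp := low_var_gt0 l; rewrite -/s (s_down hN h2N) in Sp.
have hN4 : (l < N)%N = false by rewrite ltnNge hN.
have hN5 : (l.+1 < N)%N = false by rewrite ltnNge (leqW hN).
have SE : sg + c * dln (X l - 1) = sg - (-1) * (8 / lam ^+ 2 * dln (X l - 1)) by rewrite /c; ring.
have ms := mu_shift SE Sp (- (6 * dln (X l - 1))).
have kE : kap l = km + p l ^- 3 by rewrite /kap hN4.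
have kE' : kap l.+1 = km + p l.+1 ^- 3 by rewrite /kap hN5.
have mE : mu l = lam - 6 * dln (X l - 1) / (lam * (sg + c * dln (X l - 1))) by rewrite /mu hN4.
have mE' : mu l.+1 = lam - 6 * dln (X l - 1 - 1) / (lam * (sg + c * dln (X l - 1 - 1))).
  by rewrite /mu hN5 X_down.
have qp : p l.+1 ^+ 2 = p l ^+ 2 - 1 by rewrite !pX X_down.
have q0 : 0 <= p l.+1 := sqrtr_ge0 _.
have H := second_half_cost lam2 sg0 (p_ge4 l) (p_hp l) q0 qp Z0 km_ge0.
have K := kkS_down hN h2N.
have E3 : second_half_const lam sg / p l ^+ 3 + 3 * expR (kk l) <= Cg / p l ^+ 3.
  by apply: sub3; lra.
have E4 : 3 * sg * km <= Cg / N%:R.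
  have h1 : 3 * sg * km = 3 / (X N - p N).
    by rewrite /km; field; rewrite !gt_eqF // (lt_le_trans _ (Xp N)) // divr_gt0.
  rewrite h1; apply: (@le_trans _ _ (6 / X N)).
    have e6 (x : R) : 0 < x -> 6 / x = 3 / (x / 2) by move=> x0; field; rewrite gt_eqF.
    rewrite (e6 _ (X_gt0 N)).
    by rewrite ler_pM2l // lef_pV2 ?posrE ?divr_gt0 // ?(lt_le_trans _ (Xp N)) ?divr_gt0.
  apply: ler_pM; [exact: ler0n|by rewrite invr_ge0 ltW|lra|].
  by rewrite lef_pV2 ?posrE // ler_nat index_mid leq_addr.
rewrite (s_down hN h2N) mE mE'.
rewrite -kE -kE' qp pX -/c in H.
rewrite mulNr in ms.
exact: down_arith ms H K E3 E4.
Qed.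

Let kk2 l : (l < 2 * N)%N -> kk l.+1 <= kk l + ln 2.
Proof.
move=> h2N.
have l2 : 2^-1 <= ln 2 :> R.
  have := @ln1D_ge R 1 ler01; have -> : 1 + 1 = 2 :> R by ring.
  by rewrite mul1r.
have G0 : 0 <= Cg / p l ^+ 3 by rewrite divr_ge0 ?Cg_ge0 // exprn_ge0 // ltW.
have C0 := Cg_ge0; have D0 := dln_gt0 (X_gt0 l).
have [hN|hN] := ltnP l N.
  have [hN2|hN2] := ltnP l.+1 N; first by have := kkS_up hN2; lra.
  have hN3 : l.+1 = N by apply/eqP; rewrite eqn_leq hN hN2.
  have := kkS_turn hN3; lra.
have := kkS_down hN h2N; have C1 := CgN.
have h : dln (X l - 1) <= 2 / 17.
  apply: (le_trans (X2 l)); rewrite ler_pM2l // lef_pV2 ?posrE //.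
lra.
Qed.

Let rho_gt0 : 0 < rho.
Proof. by rewrite /rho !mulr_gt0 // ltr0n (leq_trans _ J17). Qed.

Let base x : 0 <= x - a 0 ->
  expR (kk 0) * cand (mu 0) (kap 0) (x - a 0) <= 1 - brw_cdf rho s 0 x.
Proof.
have -> : a 0 = 0 by rewrite /a big_ord0.
rewrite subr0 => x0; apply: le_trans (brw_cdf0_lower s rho_gt0 x0).
have r0 := rho_gt0.
set B := Num.sqrt _; have B0 : 0 < B by rewrite sqrtr_gt0 mulrn_wgt0 // mulr_gt0 ?pi_gt0.
have k1 : expR (kk 0) <= B^-1 * expR (- rho^-1).
  have -> : B^-1 = expR (- ln B) by rewrite expRN lnK.
  rewrite -expRD ler_expR; apply: (le_trans (kk_le 0)); rewrite /e0 -/B.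
  have := ler_norm (ln B); have : 0 <= ln (X 0) by rewrite ln_ge0 // (le_trans _ (X_ge17 0)) // ler1n.
  lra.
have [m1 _] := mu_bounds 0.
(* [rho] is so large that the initial law has a heavier Gaussian tail than the initial profile. *)
have kp : 2 / rho <= kap 0.
  rewrite /kap N1 /rho.
  have -> : 2 / (2 * sg * J0%:R) = (sg * J0%:R)^-1.
    have J0p : (J0%:R : R) != 0 by rewrite pnatr_eq0 -lt0n (leq_trans _ J17).
    by move: (J0%:R : R) J0p => x' xn; field; rewrite xn gt_eqF.
  rewrite lef_pV2 ?posrE; [|by rewrite mulr_gt0 // ltr0n (leq_trans _ J17)|exact: Xp_gt0].
  rewrite ler_pM2l //.
  have -> : X 0 = J0%:R by rewrite /X /low_index min0n.
  by rewrite gerBl sqrtr_ge0.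
have c1 : cand (mu 0) (kap 0) x <= expR (- (x ^+ 2 / rho)).
  rewrite /cand; apply: (@le_trans _ _ (expR x * expR (- x - x ^+ 2 / rho))).
    apply: ler_pM; rewrite ?expR_ge0 //; first by have := expR_ge1Dx x; lra.
    rewrite ler_expR.
    have := ler_wpM2r x0 m1; have := ler_wpM2r (sqr_ge0 x) kp.
    have -> : 2 / rho * x ^+ 2 = 2 * (x ^+ 2 / rho) by ring.
    lra.
  by rewrite -expRD ler_expR; lra.
apply: (@le_trans _ _ (B^-1 * expR (- rho^-1) * expR (- (x ^+ 2 / rho)))).
  by apply: ler_pM => //; rewrite ?expR_ge0 ?mulr_ge0 ?expR_ge0.
rewrite -mulrA -expRD ler_pM2l ?invr_gt0 // ler_expR mulr2n.
have -> : - (x + 1) ^+ 2 / (rho + rho) = - (x + 1) ^+ 2 / 2 / rho.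
  by field; rewrite gt_eqF //= gt_eqF // addr_gt0.
have -> : - rho^-1 - x ^+ 2 / rho = (- 1 - x ^+ 2) / rho by field; rewrite gt_eqF.
rewrite ler_pM2r ?invr_gt0 //.
have := sqr_ge0 (x - 1); lra.
Qed.

Let a_up l : (l <= N)%N -> a l = lam * sg * l%:R - 7 / (2 * lam) * (ln (X l) - ln J0%:R).
Proof.
elim: l => [|l ih] h.
  by rewrite /a big_ord0 /X /low_index min0n add0n subrr !mulr0 subr0.
rewrite aS ih ?(ltnW h) // /mu h (s_up h) X_up // -[l.+1%:R]natr1 /dln.
have Sp := low_var_gt0 l; rewrite -/s (s_up h) /dln in Sp.
move: Sp; set D := ln (X l + 1) - ln (X l) => Sp.
have -> : ln (X l + 1) = D + ln (X l) by rewrite /D subrK.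
have -> : (lam + 9 / 2 * D / (lam * (sg - c * D))) * (sg - c * D) = lam * (sg - c * D) + 9 / 2 * D / lam.
  by field; rewrite !gt_eqF.
by rewrite /c; field; rewrite gt_eqF.
Qed.

Let a_down j : (j <= N)%N -> a (N + j)%N = lam * sg * (N + j)%:R
  - 7 / (2 * lam) * (ln (X N) - ln J0%:R) - 2 / lam * (ln (X (N + j)) - ln (X N)).
Proof.
elim: j => [|j ih] h; first by rewrite addn0 a_up // subrr mulr0 subr0.
have h1 : (N <= N + j)%N by rewrite leq_addr.
have h2 : (N + j < 2 * N)%N by rewrite mul2n -addnn ltn_add2l.
have h3 : (N + j < N)%N = false by rewrite ltnNge h1.
rewrite addnS aS ih ?(ltnW h) // /mu h3 (s_down h1 h2) X_down // -[(N + j).+1%:R]natr1 /dln subrK.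
have Sp := low_var_gt0 (N + j); rewrite -/s (s_down h1 h2) /dln subrK in Sp.
move: Sp; set D := ln (X (N + j)) - ln (X (N + j) - 1) => Sp.
have -> : ln (X (N + j) - 1) = ln (X (N + j)) - D by rewrite /D; ring.
have -> : (lam - 6 * D / (lam * (sg + c * D))) * (sg + c * D) = lam * (sg + c * D) - 6 * D / lam.
  by field; rewrite !gt_eqF.
by rewrite /c; move: ((N + j)%:R : R) => nj; field; rewrite gt_eqF.
Qed.

(** Per unit of ln X the lower half moves the barrier by - 8 / lam + 9 / (2 lam), and the upper half
    moves it back by 8 / lam - 6 / lam. The sum is - 3 / (2 lam), as for the homogeneous walk. *)
Let a_end : lam * sg * (2 * N)%:R - 3 / (2 * lam) * (ln N%:R + ln (1 + J0%:R)) <= a (2 * N).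
Proof.
rewrite mul2n -addnn a_down // addnn -mul2n.
have J0p : (0 < J0%:R :> R) by rewrite ltr0n (leq_trans _ J17).
have -> : X (2 * N) = J0%:R by rewrite /X index_end.
have h : ln (X N) <= ln N%:R + ln (1 + J0%:R).
  rewrite -lnM ?posrE ?addr_gt0 // ler_ln ?posrE ?mulr_gt0 ?addr_gt0 //.
  have -> : X N = N%:R + J0%:R by rewrite /X index_mid natrD.
  rewrite mulrDr mulr1 lerD2l ler_peMl ?(ltW J0p) // ler1n //.
have lJ : 0 <= ln (J0%:R : R) by rewrite ln_ge0 // ler1n (leq_trans _ J17).
have k0 : 0 <= 3 / (2 * lam) by rewrite divr_ge0 // mulr_ge0 // ltW.
have := ler_wpM2l k0 h.
have := mulr_ge0 k0 lJ.
have -> : 7 / (2 * lam) = 3 / (2 * lam) + 2 / lam by field; rewrite gt_eqF.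
lra.
Qed.

(** The rate of [lower_left_tail] at the root, where X is again [J0]. It does not involve [N], so
    the lower tail is uniform in the number of scales. *)
Definition low_rate : R := expR (- 7 * Cg - e0 - 2 * ln J0%:R - 6 * Cg / Num.sqrt J0%:R - 2 * Cg - (lam + 2)) /
  (3 * ((lam + 1) * (2 * sg)) + 2 * sg * J0%:R + 4).

Lemma low_rate_gt0 : 0 < low_rate.
Proof.
rewrite divr_gt0 ?expR_gt0 // addr_gt0 // addr_gt0 ?mulr_gt0 ?addr_gt0 // ltr0n.
exact: leq_trans J17.
Qed.

Lemma low_tail y : 0 <= y ->
  brw_cdf (2 * sg * J0%:R) low_var (2 * N)
   (lam * sg * (2 * N)%:R - 3 / (2 * lam) * (ln N%:R + ln (1 + J0%:R)) - y) <= expR (- low_rate * y).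
Proof.
move=> y0.
have [S0 L0 L2] := And3 sg0 lam0 lam2.
have D0 : 0 <= (lam + 1) * (2 * sg) by rewrite mulr_ge0 // ?mulr_ge0 ?addr_ge0 // ltW.
have muM l : (l <= 2 * N)%N -> mu l + kap l / 2 <= lam + 2.
  by move=> _; have [_ m2] := mu_bounds l; have [_ k1] := kap_bounds l; lra.
have sD l : s l <= (lam + 1) * (2 * sg).
  have [_ s2] := s_bounds l; apply: (le_trans s2).
  by rewrite ler_peMl ?mulr_ge0 ?(ltW S0) //; lra.
have musD l : (l < 2 * N)%N -> mu l * s l <= (lam + 1) * (2 * sg).
  move=> _; have [s1 s2] := s_bounds l; have [m1 m2] := mu_bounds l.
  by apply: ler_pM => //; [lra|exact: ltW].
have k3 l : (l <= 2 * N)%N -> expR (kk l) <= 3^-1.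
  move=> _; apply: (le_trans (expkk l)); have := X_ge17 l => X17.
  by rewrite lef_pV2 ?posrE ?exprn_gt0 //; nra.
have m1 l : (l <= 2 * N)%N -> 1 <= mu l by move=> _; have [] := mu_bounds l.
have kp l : (l <= 2 * N)%N -> 0 <= kap l by move=> _; have [] := kap_bounds l.
have a0 : a 0 = 0 by rewrite /a big_ord0.
have T := @lower_left_tail R rho s a mu kap kk (2 * N) (ltW rho_gt0) low_var_gt0 m1 kp k3
  (fun l _ => aS l) base step (lam + 2) ((lam + 1) * (2 * sg)) D0 a0 muM sD musD kk2 y y0.
apply: (@le_trans _ _ (brw_cdf rho s (2 * N) (a (2 * N) + 1 - y))).
  apply: (brw_cdf_mono (ltW rho_gt0) (fun k => ltW (low_var_gt0 k))).
  by have := a_end; lra.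
apply: (le_trans T); rewrite ler_expR /low_rate.
suff -> : kk (2 * N) - (lam + 2) = - 7 * Cg - e0 - 2 * ln J0%:R - 6 * Cg / Num.sqrt J0%:R - 2 * Cg - (lam + 2) by [].
congr (_ - _); rewrite /kk.
rewrite end_ge.
have -> : (2 * N)%:R / N%:R = 2 :> R by rewrite natrM mulfK // gt_eqF.
rewrite /p.
have -> : X (2 * N) = J0%:R by rewrite /X index_end.
ring.
Qed.

End lower_tree.

(** * From exponential tails to expectations *)

Section expectation_from_tails.
Context {R : realType} d (T : measurableType d) (P : probability T R).

Lemma Rintegral_indic (A : set T) : measurable A ->
  itg P (\1_A) /\ \int[P]_o \1_A o = fine (P A).
Proof.
move=> mA; have i : itg P (\1_A).
  apply: (@itg_bounded _ _ _ _ _ 1); first exact: measurable_indic.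
  by move=> o; rewrite indicE ger0_norm ?ler0n // lern1 leq_b1.
split=> //; apply: EFin_inj; rewrite EFin_Rintegral // integral_indic // setIT fineK //.
exact: fin_num_measure.
Qed.

Lemma geometric_sum_le (th : R) (n : nat) : 0 < th ->
  \sum_(k < n) expR (- th * k%:R) <= (1 - expR (- th))^-1.
Proof.
move=> th0; have x1 : expR (- th) < 1 by rewrite -expR0 ltr_expR oppr_lt0.
have q0 : 0 < 1 - expR (- th) by rewrite subr_gt0.
rewrite -[leRHS]mul1r ler_pdivlMr // mulrC.
have -> : (1 - expR (- th)) * \sum_(k < n) expR (- th * k%:R) = 1 - expR (- th * n%:R).
  elim: n => [|n ih]; first by rewrite big_ord0 mulr0 mulr0 expR0 subrr.
  rewrite big_ord_recr /= mulrDr ih mulrBl mul1r -expRD.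
  have -> : - th * n.+1%:R = - th + - th * n%:R by rewrite -natr1; ring.
  ring.
by rewrite gerBl expR_ge0.
Qed.

(** The positive part of Z is at most 1 plus the number of integers k >= 0 below Z. Truncation at n
    makes this a finite sum, and dominated convergence removes the truncation. *)
Lemma expectation_le_tail (Z : T -> R) (C th : R) : itg P Z -> 0 <= C -> 0 < th ->
  (forall k : nat, fine (P [set o | k%:R < Z o]) <= C * expR (- th * k%:R)) ->
  \int[P]_o Z o <= 1 + C / (1 - expR (- th)).
Proof.
move=> iZ C0 th0 tail; have mZ := itg_measurable iZ.
have mA (k : nat) : measurable [set o | k%:R < Z o].
  have -> : [set o | k%:R < Z o] = Z @^-1` `]k%:R, +oo[%classic.
    by apply/seteqP; split => o /=; rewrite in_itv /= andbT.
  by rewrite -[X in measurable X]setTI; exact: mZ.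
pose V o := Num.max (Z o) 0.
have iV : itg P V.
  apply: (itg_dom _ _ (itg_norm iZ)); first exact: measurable_maxr.
  by move=> o; rewrite ger0_norm ?le_max ?lexx ?orbT // ge_max ler_norm normr_ge0.
pose W (n : nat) o := Num.min (V o) n%:R.
have W_le n o : `|W n o| <= V o.
  by rewrite ger0_norm ?ge_min ?lexx // le_min ler0n le_max lexx orbT.
have mW n : measurable_fun setT (W n).
  by apply: measurable_minr => //; exact: itg_measurable iV.
have cW : \int[P]_o W n o @[n --> \oo] --> \int[P]_o V o.
  apply: (Rintegral_cvg mW (itg_measurable iV) _ iV W_le) => o.
  apply: cvg_near_cst; near=> n; rewrite /W; apply/min_idPl.
  by near: n; exact: nbhs_infty_ger.
have ZV : \int[P]_o Z o <= \int[P]_o V o.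
  by apply: le_Rintegral => // o _; rewrite le_max lexx.
apply: (le_trans ZV).
have q0 : 0 < 1 - expR (- th) by rewrite subr_gt0 -expR0 ltr_expR oppr_lt0.
suff bound n : \int[P]_o W n o <= 1 + C / (1 - expR (- th)).
  rewrite -(cvg_lim (@Rhausdorff R) cW); apply: limr_le; first by apply/cvg_ex; exists (\int[P]_o V o).
  exact: nearW.
have iS k : itg P (\1_[set o | (k : nat)%:R < Z o]) by have [] := Rintegral_indic (mA k).
have i2 : itg P (fun o => \sum_(k < n) \1_[set o | (k : nat)%:R < Z o] o) by apply: itg_sum => k.
have pt o : W n o <= 1 + \sum_(k < n) \1_[set o | (k : nat)%:R < Z o] o.
  rewrite /W; elim: n {cW iS i2} => [|n ih].
    by rewrite big_ord0 addr0 ge_min ler01 orbT.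
  rewrite big_ord_recr /= indicE.
  case: (ltP n%:R (Z o)) => h.
    rewrite mem_set //=.
    have S : \sum_(k < n) \1_[set o | (k : nat)%:R < Z o] o = n%:R :> R.
      rewrite -[n in RHS]card_ord -sumr_const; apply: eq_bigr => k _.
      rewrite indicE mem_set //=; apply: le_lt_trans h; rewrite ler_nat; exact: ltnW.
    rewrite S ge_min; apply/orP; right.
    by rewrite -[n.+1%:R]natr1; exact: ler_wpDl.
  rewrite memNset /= ?addr0; last by apply/negP; rewrite -leNgt.
  apply: le_trans ih; rewrite le_min; apply/andP; split; first by rewrite ge_min lexx.
  by rewrite ge_min /V ge_max h ler0n.
have iW : itg P (W n) := itg_dom (mW n) (W_le n) iV.
apply: (@le_trans _ _ (\int[P]_o (1 + \sum_(k < n) \1_[set o | (k : nat)%:R < Z o] o))).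
  by apply: le_Rintegral => //; apply: itgD => //; exact: itg_cst.
rewrite (RintegralD measurableT (@itg_cst _ _ _ P 1) i2) Rintegral_probability_cst lerD2l.
rewrite Rintegral_sum; last by [].
apply: (@le_trans _ _ (\sum_(k < n) C * expR (- th * k%:R))).
  apply: ler_sum => k _; have [_ ->] := Rintegral_indic (mA k); exact: tail.
by rewrite -mulr_sumr ler_wpM2l // geometric_sum_le.
Unshelve. all: by end_near.
Qed.

End expectation_from_tails.

(** * The Green function *)

Section walk_paths.
Context {R : realType}.

Definition dir (e : bool * bool) : int * int :=
  match e with
  | (false, false) => (1, 0) | (false, true) => (- 1, 0)
  | (true, false) => (0, 1) | (true, true) => (0, - 1)
  end.

Definition shift (x : int * int) (e : bool * bool) : int * int :=
  (x.1 + (dir e).1, x.2 + (dir e).2).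

(** [leaf m] is reused as the set of words of m steps, each step being coded by two bits. *)
Fixpoint walk_path (m : nat) : leaf m -> int * int -> nat -> int * int :=
  match m with
  | 0 => fun _ x _ => x
  | m'.+1 => fun d x k => if k is k'.+1
      then walk_path d.2.2 (shift x (d.1, d.2.1)) k' else x
  end.

Lemma shift_inj x : injective (shift x).
Proof.
move=> e e' /pair_equal_spec[/addrI h1 /addrI h2].
by move: e e' h1 h2 => [[] []] [[] []].
Qed.

Lemma step_shift x e : srw_step R x (shift x e) = 4^-1.
Proof.
have h1 (a b : int) : a - (a + b) = - b by rewrite opprD addNKr.
by rewrite /srw_step /shift /= !h1 !normrN; case: e => [[] []].
Qed.

Lemma walk_path0 m (d : leaf m) x : walk_path d x 0 = x.
Proof. by case: m d. Qed.

Lemma walk_path_step m (d : leaf m) x k : (k < m)%N ->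
  srw_step R (walk_path d x k) (walk_path d x k.+1) = 4^-1.
Proof.
elim: m d x k => [//|m ih] [b [b' d]] x [|k] km /=; last exact: ih.
by rewrite walk_path0 step_shift.
Qed.

Lemma walk_path_inj m (d d' : leaf m) x :
  (forall k, (k <= m)%N -> walk_path d x k = walk_path d' x k) -> d = d'.
Proof.
elim: m d d' x => [[] []//|m ih] [b [b1 d]] [b' [b1' d']] x h.
have := h 1%N isT; rewrite /= !walk_path0 => /shift_inj [e1 e2].
congr (_, (_, _)) => //; apply: (ih _ _ (shift x (b, b1))) => k km.
by have := h k.+1 km; rewrite /= e1 e2.
Qed.

Lemma card_leaf l : #|leaf l| = (4 ^ l)%N.
Proof.
elim: l => [|l ih]; first by rewrite card_unit.
by rewrite /= !card_prod card_bool ih expnS mulnA.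
Qed.

Section law.
Context dW (W : measurableType dW) (P : probability W R) (w : nat -> W -> int * int)
  (x : int * int).
Hypothesis Pw : is_srw P w x.

Definition cylinder m (d : leaf m) : set W :=
  [set o | forall k, (k <= m)%N -> w k o = walk_path d x k].

Lemma measurable_cylinder m (d : leaf m) : measurable (cylinder d).
Proof.
have -> : cylinder d = \bigcap_(k in [set k | (k <= m)%N]) (w k @^-1` [set walk_path d x k]).
  by apply/seteqP; split => o h k hk; exact: h.
by apply: bigcap_measurableType => k _; case: Pw => + _; apply.
Qed.

Lemma cylinder_prob m (d : leaf m) : P (cylinder d) = (4^-1 ^+ m)%:E.
Proof.
case: Pw => _ /(_ (walk_path d x) m) ->; rewrite walk_path0 eqxx mul1r; congr EFin.
rewrite (eq_bigr (fun=> 4^-1)) ?prodr_const ?card_ord // => k _.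
exact: walk_path_step.
Qed.

(** The cylinders are disjoint and their probabilities 4^-m add up to 1, so an event that is decided
    on each of them is determined up to a null set. *)
Lemma prob_cylinders m (E : set W) (good : pred (leaf m)) : measurable E ->
  (forall d o, cylinder d o -> E o <-> good d) ->
  P E = (\sum_(d : leaf m) 4^-1 ^+ m * (good d)%:R)%:E.
Proof.
move=> mE Eg.
have mC := @measurable_cylinder m.
have [iE IE] := Rintegral_indic P mE.
have iC d : itg P (\1_(cylinder (d : leaf m))) by have [] := Rintegral_indic P (mC d).
have IC d : \int[P]_o \1_(cylinder (d : leaf m)) o = 4^-1 ^+ m.
  by have [_ ->] := Rintegral_indic P (mC d); rewrite cylinder_prob.
have iS : itg P (fun o => \sum_(d : leaf m) \1_(cylinder d) o) by apply: itg_sum.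
have IS : \int[P]_o (\sum_(d : leaf m) \1_(cylinder d) o) = 1.
  rewrite Rintegral_sum // (eq_bigr (fun=> 4^-1 ^+ m)) //.
  rewrite sumr_const card_leaf -[LHS]mulr_natr natrX -exprMn mulVf ?expr1n //.
have iG : itg P (fun o => \sum_(d : leaf m) \1_(cylinder d) o * (good d)%:R).
  by apply: itg_sum => d; under eq_fun do rewrite mulrC; exact: itgZ.
have IG : \int[P]_o (\sum_(d : leaf m) \1_(cylinder d) o * (good d)%:R) =
    \sum_(d : leaf m) 4^-1 ^+ m * (good d)%:R.
  rewrite Rintegral_sum; last by move=> d; under eq_fun do rewrite mulrC; exact: itgZ.
  apply: eq_bigr => d _; under eq_Rintegral do rewrite mulrC.
  by rewrite (RintegralZl _ measurableT (iC d)) IC mulrC.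
have i0 := itgB (@itg_cst _ _ _ P 1) iS.
pose S1 o : R := \sum_(d : leaf m) \1_(cylinder d) o * (good d)%:R.
pose S2 o : R := \sum_(d : leaf m) \1_(cylinder d) o.
have pt o : 0 <= \1_E o - S1 o <= 1 - S2 o.
  have [[d hd]|h] := pselect (exists d : leaf m, cylinder d o).
    have z d' : d' != d -> \1_(cylinder d') o = 0 :> R.
      move=> dd'; rewrite indicE memNset // => hd'; move/eqP: dd'; apply.
      by apply: (@walk_path_inj _ _ _ x) => k km; rewrite -hd' // hd.
    have s1 : S1 o = (good d)%:R.
      rewrite /S1 (bigD1 d) //= big1 => [|d' /z ->]; last by rewrite mul0r.
      by rewrite addr0 indicE mem_set // mul1r.
    have s2 : S2 o = 1.
      by rewrite /S2 (bigD1 d) //= big1 => [|d' /z //]; rewrite addr0 indicE mem_set.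
    rewrite s1 s2 indicE.
    have -> : o \in E = good d.
      by apply/idP/idP => [/set_mem/(Eg _ _ hd)//|g]; apply/mem_set/(Eg _ _ hd).
    by rewrite !subrr lexx.
  have z d : \1_(cylinder (d : leaf m)) o = 0 :> R.
    by rewrite indicE memNset // => hd; apply: h; exists d.
  have -> : S1 o = 0 by rewrite /S1 big1 // => d _; rewrite z mul0r.
  have -> : S2 o = 0 by rewrite /S2 big1 // => d _; rewrite z.
  rewrite !subr0.
  by rewrite indicE ler0n lern1 leq_b1.
have iD := itgB iE iG.
have ID : \int[P]_o (\1_E o - S1 o) = 0.
  apply/eqP; rewrite eq_le; apply/andP; split; last first.
    by apply: Rintegral_ge0 => o _; have /andP[] := pt o.
  have : \int[P]_o (1 - S2 o) = 0.
    by rewrite (RintegralB measurableT (@itg_cst _ _ _ P 1) iS) IS Rintegral_probability_cst subrr.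
  move=> <-; apply: le_Rintegral => // o _; by have /andP[] := pt o.
move: ID; rewrite (RintegralB measurableT iE iG) IG IE => /eqP; rewrite subr_eq0 => /eqP <-.
by rewrite fineK // fin_num_measure.
Qed.

End law.

Section green_series.
Variable N : nat.

Fixpoint survives (m : nat) (y : int * int) : leaf m -> int * int -> bool :=
  match m with
  | 0 => fun _ x => ~~ box_boundary N x && (x == y)
  | m'.+1 => fun d x => ~~ box_boundary N x && survives y d.2.2 (shift x (d.1, d.2.1))
  end.

Lemma survivesP m y (d : leaf m) x : survives y d x <->
  (forall k, (k <= m)%N -> ~~ box_boundary N (walk_path d x k)) /\ walk_path d x m = y.
Proof.
elim: m d x => [|m ih] d x /=.
  split=> [/andP[h /eqP e]|[h e]]; first by split.
  by rewrite (h 0%N) //= e.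
split=> [/andP[h /ih[h1 h2]]|[h1 h2]].
  by split=> // -[|k] km //=; exact: h1.
apply/andP; split; first by have := h1 0%N isT.
by apply/ih; split=> // k km; exact: (h1 k.+1 km).
Qed.

(** The probability that the walk from x is at y at time m without having met the boundary up to
    then. *)
Definition hit_prob (m : nat) (x y : int * int) : R :=
  \sum_(d : leaf m) 4^-1 ^+ m * (survives y d x)%:R.

Lemma hit_prob_ge0 m x y : 0 <= hit_prob m x y.
Proof. by apply: sumr_ge0 => d _; rewrite mulr_ge0 // exprn_ge0. Qed.

Lemma hit_prob0 x y : hit_prob 0 x y = (~~ box_boundary N x && (x == y))%:R.
Proof. by rewrite /hit_prob (bigD1 tt) //= big1 ?addr0 ?expr0 ?mul1r // => -[]. Qed.

Lemma hit_probS m x y : hit_prob m.+1 x y =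
  (~~ box_boundary N x)%:R * (4^-1 * \sum_(e : bool * bool) hit_prob m (shift x e) y).
Proof.
rewrite /hit_prob mulr_sumr mulr_sumr.
rewrite (eq_bigr (fun d : bool * (bool * leaf m) => (~~ box_boundary N x)%:R * (4^-1 *
    (4^-1 ^+ m * (survives y d.2.2 (shift x (d.1, d.2.1)))%:R)))); last first.
  move=> d _ /=; rewrite exprS; case: (~~ _) => /=; last by rewrite mulr0 mul0r.
  by rewrite mul1r mulrA.
rewrite -(pair_bigA _ (fun b (d : bool * leaf m) => (~~ box_boundary N x)%:R * (4^-1 *
    (4^-1 ^+ m * (survives y d.2 (shift x (b, d.1)))%:R)))) /=.
rewrite [RHS](eq_bigr (fun e : bool * bool => (~~ box_boundary N x)%:R * (4^-1 * \sum_(d : leaf m)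
    (4^-1 ^+ m * (survives y d (shift x (e.1, e.2)))%:R)))); last by move=> [].
rewrite -(pair_bigA _ (fun b b' => (~~ box_boundary N x)%:R * (4^-1 * \sum_(d : leaf m)
    (4^-1 ^+ m * (survives y d (shift x (b, b')))%:R)))) /=.
apply: eq_bigr => b _.
rewrite -(pair_bigA _ (fun b' d => (~~ box_boundary N x)%:R * (4^-1 *
    (4^-1 ^+ m * (survives y d (shift x (b, b')))%:R)))) /=.
by apply: eq_bigr => b' _; rewrite !mulr_sumr.
Qed.

Definition green_fun (x y : int * int) : \bar R := (\sum_(0 <= m <oo) (hit_prob m x y)%:E)%E.

Lemma green_fun_boundary x y : box_boundary N x -> green_fun x y = 0%E.
Proof.
move=> bx; apply: eseries0 => -[|m] _ _; first by rewrite hit_prob0 bx.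
by rewrite hit_probS bx mul0r.
Qed.

(** Decomposition according to the first step, done in the extended reals because finiteness is not
    yet known. *)
Lemma green_fun_inner x y : ~~ box_boundary N x ->
  green_fun x y = ((x == y)%:R%:E + (4^-1)%:E * \sum_(e : bool * bool) green_fun (shift x e) y)%E.
Proof.
move=> bx; rewrite /green_fun nneseries_recl //; last by move=> m _; rewrite lee_fin hit_prob_ge0.
rewrite -(nneseries_addn 1); last by move=> m; rewrite lee_fin hit_prob_ge0.
under eq_eseriesr do rewrite addn1.
congr (_ + _)%E; first by rewrite hit_prob0 bx.
rewrite -nneseries_sum; last by move=> e m; rewrite lee_fin hit_prob_ge0.
rewrite -nneseriesZl; last by move=> m _; apply: sume_ge0 => e _; rewrite lee_fin hit_prob_ge0.
by apply: eq_eseriesr => m _; rewrite hit_probS bx mul1r EFinM sumEFin.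
Qed.

Lemma hitting_time_gt (W : Type) (w : nat -> W -> int * int) m o :
  ((m%:R)%:E < hitting_time R w N o)%E <-> forall k, (k <= m)%N -> ~~ box_boundary N (w k o).
Proof.
split=> [h k km|h].
  apply/negP => b; move: h; apply/negP; rewrite -leNgt.
  apply: (@le_trans _ _ (k%:R)%:E); last by rewrite lee_fin ler_nat.
  by apply: ereal_inf_lbound; exists k.
apply: (@lt_le_trans _ _ (m.+1%:R)%:E); first by rewrite lte_fin ltr_nat.
apply: le_ereal_inf_tmp => _ [k bk <-]; rewrite lee_fin ler_nat ltnNge.
by apply/negP => /h; rewrite bk.
Qed.

Lemma green_series dW (W : measurableType dW) (Q : int * int -> probability W R)
    (w : nat -> W -> int * int) x y : is_srw (Q x) w x ->
  green Q w N x y = green_fun x y.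
Proof.
move=> Pw; have mw k z : measurable (w k @^-1` [set z]) by case: Pw.
pose E m : set W := [set o | (forall k, (k <= m)%N -> ~~ box_boundary N (w k o)) /\ w m o = y].
(* Measurability is given for the events that the walk is at a given point, and the boundary is a
   finite set of points. *)
have mB k : measurable [set o | ~~ box_boundary N (w k o)].
  have -> : [set o | ~~ box_boundary N (w k o)] =
      ~` (\bigcup_(i in [set i : 'I_N * 'I_N | box_boundary N (Defs.point i)]) (w k @^-1` [set Defs.point i])).
    apply/seteqP; split => o /=.
      by move=> /negP nb [i /= bi e]; apply: nb; rewrite e.
    move=> h; apply/negP => b; apply: h.
    have /andP[/andP[/andP[a1 a2] /andP[b1 b2]] _] := b.
    case ew : (w k o) b a1 a2 b1 b2 => [[p|p] [q|q]] //= b a1 a2 b1 b2.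
    have pN : (p < N)%N by lia.
    have qN : (q < N)%N by lia.
    by exists (Ordinal pN, Ordinal qN); [exact: b|exact: ew].
  apply: measurableC; apply: fin_bigcup_measurable => // i _; exact: mw.
have mE m : measurable (E m).
  have -> : E m = (\bigcap_(k in [set k | (k <= m)%N]) [set o | ~~ box_boundary N (w k o)])
      `&` (w m @^-1` [set y]).
    by apply/seteqP; split => o [h1 h2]; split=> // k hk; exact: h1.
  by apply: measurableI => //; apply: bigcap_measurableType => k _; exact: mB.
have EP m : Q x (E m) = (hit_prob m x y)%:E.
  apply: (prob_cylinders Pw) => // d o hd; split.
    move=> [h1 h2]; apply/survivesP; split; last by rewrite -hd.
    by move=> k km; rewrite -hd //; exact: h1.
  move/survivesP => [h1 h2]; split; last by rewrite hd.
  by move=> k km; rewrite hd //; exact: h1.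
rewrite /green /green_fun.
transitivity (\int[Q x]_o \sum_(0 <= m <oo) (\1_(E m) o)%:E)%E.
  apply: eq_integral => o _; rewrite eseries_mkcond; apply: eq_eseriesr => m _.
  rewrite indicE; case: ifPn => [/hitting_time_gt h|h].
    by have -> : (o \in E m) = (w m o == y) by apply/idP/eqP => [/set_mem[]//|e]; exact/mem_set.
  rewrite memNset // => -[h1 _]; move/negP: h; apply; exact/hitting_time_gt.
rewrite integral_nneseries //.
- by apply: eq_eseriesr => m _; rewrite -EP integral_indic // setIT.
- by move=> m; apply/measurable_EFinP; exact: measurable_indic.
Qed.

End green_series.
End walk_paths.

(** * Gaussian fields specified by their expectations *)

Section gaussian_laws.
Context {R : realType}.

Lemma gaussian_law_normalP (m s : R) (A : set R) : s != 0 -> measurable A ->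
  gaussian_law m s A = normalP m (s ^+ 2) A.
Proof.
move=> s0 mA; rewrite /gaussian_law (negbTE s0).
have mi : measurable_fun [set: R] (fun x => (\1_A x)%:E : \bar R).
  by apply/measurable_EFinP; exact: measurable_indic.
have i0 (x : R) : (0 <= ((\1_A x)%:E : \bar R))%E by rewrite lee_fin.
have -> : normal_prob m s A = (\int[normal_prob m s]_x (\1_A x)%:E)%E by rewrite integral_indic // setIT.
have -> : normalP m (s ^+ 2) A = (\int[normalP m (s ^+ 2)]_x (\1_A x)%:E)%E by rewrite integral_indic // setIT.
rewrite ge0_integral_normal_prob; [|exact: mi|exact: i0].
rewrite ge0_integral_normalP; [|exact: mi|exact: i0].
have s2 : 0 < s ^+ 2 by rewrite lt_neqAle sqr_ge0 eq_sym expf_neq0.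
apply: eq_integral => x _; congr (_ * _%:E)%E.
by rewrite normal_pdf_sqrtE // normal_pdfE.
Qed.

Lemma normalP_mean (m v : R) : 0 < v ->
  itg (normalP m v) idfun /\ \int[normalP m v]_z z = m.
Proof.
move=> v0.
have mp : measurable_fun [set: R] (fun z => z - m) by exact: measurable_funB.
have T := @signed_transfer R (normalP m v) (normalP 0 v) (fun z => z - m) (fun=> 1) 1
  mp (measurable_cst _) (fun _ => ler01).
have i0 : itg (normalP 0 v) (fun z => z + m).
  by apply: itgD; [rewrite -gaussPE //; apply: gaussP_itg_id; exact: ltW|exact: itg_cst].
have H (f : R -> \bar R) : measurable_fun setT f -> (forall x, (0 <= f x)%E) ->
    (\int[normalP m v]_z (f (z - m)%R * 1%:E) = 1%:E * \int[normalP 0 v]_z f z)%E.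
  move=> mf f0; rewrite mul1e -(ge0_integral_normalP_shift m v0 mf f0).
  by apply: eq_integral => z _; rewrite mule1.
have [i e] := T H _ i0.
have E : (fun z => (z - m + m) * 1) = idfun by apply/funext => z; rewrite subrK mulr1.
rewrite E in i; split=> //.
have -> : \int[normalP m v]_z z = \int[normalP m v]_z ((z - m + m) * 1).
  by apply: eq_Rintegral => z _; rewrite subrK mulr1.
rewrite e mul1r (RintegralD measurableT) ?itg_cst //; last exact: itg_cst.
  by rewrite Rintegral_probability_cst -gaussPE // gaussP_mean ?add0r // ltW.
by rewrite -gaussPE //; apply: gaussP_itg_id; exact: ltW.
Qed.

Section on_space.
Context d (T : measurableType d) (P : probability T R).

Lemma law_transfer (mu : probability R R) (f : T -> R) (h : R -> R) :
  measurable_fun setT f ->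
  (forall A, measurable A -> P (f @^-1` A) = mu A) -> itg mu h ->
  itg P (fun o => h (f o)) /\ \int[P]_o h (f o) = \int[mu]_z h z.
Proof.
move=> mf l ih; have mh := itg_measurable ih.
have i : itg P (fun o => h (f o)).
  apply/integrableP; split.
    by apply/measurable_EFinP; apply: (measurableT_comp mh).
  have mn : measurable_fun [set: R] (fun z => `|(h z)%:E|)%E.
    by apply: measurableT_comp => //; exact/measurable_EFinP.
  have -> : (\int[P]_x `|(EFin \o (fun o => h (f o))) x| = \int[mu]_z `|(h z)%:E|)%E.
    rewrite -(@ge0_integral_pushforward _ _ _ _ _ _ mf P setT (fun z => `|(h z)%:E|)%E) //.
    by apply: eq_measure_integral => A mA _; exact: (l A mA).
  by case/integrableP : ih.
split=> //; apply: EFin_inj; rewrite !EFin_Rintegral //.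
rewrite -(@integral_pushforward _ _ _ _ _ _ mf P setT (EFin \o h)) //.
- by apply: eq_measure_integral => A mA _; exact: (l A mA).
- exact/measurable_EFinP.
Qed.

Lemma is_gaussian_mean (f : T -> R) : measurable_fun setT f -> is_gaussian P f ->
  itg P f /\ (\int[P]_o f o = 0 ->
    exists2 v, 0 <= v & forall A, measurable A -> P (f @^-1` A) = gaussP v A).
Proof.
move=> mf [m [s l]]; have [s0|s0] := eqVneq s 0.
  have l' A : measurable A -> P (f @^-1` A) = (\d_m : probability R R) A.
    by move=> mA; rewrite l // /gaussian_law s0 eqxx.
  have im : itg (\d_m : probability R R) idfun.
    apply/integrableP; split; first by apply/measurable_EFinP; exact: measurable_id.
    rewrite integral_dirac //=; first by rewrite diracT mul1e ltry.
    by apply/measurable_EFinP; exact: normr_measurable.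
  have [i e] := law_transfer mf l' im; split=> // f0.
  have e2 : \int[(\d_m : probability R R)]_z z = m.
    by rewrite /Rintegral integral_dirac ?diracT ?mul1e //=.
  exists 0 => // A mA; rewrite l' // gaussP0.
  by rewrite -e2 -e f0.
have l' A : measurable A -> P (f @^-1` A) = normalP m (s ^+ 2) A.
  by move=> mA; rewrite l // gaussian_law_normalP.
have s2 : 0 < s ^+ 2 by rewrite lt_neqAle sqr_ge0 eq_sym expf_neq0.
have [im em] := normalP_mean m s2.
have [i e] := law_transfer mf l' im; split=> // f0.
exists (s ^+ 2); first exact: sqr_ge0.
move=> A mA; rewrite l' // gaussPE //.
by rewrite -em -e f0.
Qed.

(** Gaussian linear forms have second moments, so the products are integrable; hence the covariances
    may be prescribed conditionally on integrability. The variance of each linear form is then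
    recovered from its second moment. *)
Lemma gaussian_field_isG (I : finType) (X : I -> {RV P >-> R}) (C : I -> I -> R) :
  gaussian_field X -> (forall z, ('E_P[X z] = 0)%E) ->
  (forall x y, itg P (fun o => X x o * X y o) -> \int[P]_o (X x o * X y o) = C x y) ->
  isG P (fun i => X i : T -> R) C /\ forall x y, itg P (fun o => X x o * X y o).
Proof.
move=> GX EX CX.
have mX i : measurable_fun setT (X i) by exact: measurable_funPT.
have mlin a : measurable_fun setT (fun o => \sum_i a i * X i o).
  by apply: measurable_sum => i; apply: measurable_funM.
have itX i : itg P (X i).
  have [h _] := is_gaussian_mean (mlin (fun j => (j == i)%:R)) (GX (fun j => (j == i)%:R)).
  have E : (fun o => \sum_j (j == i)%:R * X j o) = X i.
    by apply/funext => o; exact: (lin_delta i (fun j => X j o)).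
  by rewrite E in h.
have mean i : \int[P]_o X i o = 0.
  by apply: EFin_inj; rewrite EFin_Rintegral //; have := EX i; rewrite unlock.
have law a : exists2 v, 0 <= v & forall A, measurable A ->
    P ((fun o => \sum_i a i * X i o) @^-1` A) = gaussP v A.
  have [_ h] := is_gaussian_mean (mlin a) (GX a); apply: h.
  rewrite Rintegral_sum; last by move=> i; exact: itgZ.
  by apply: big1 => i _; rewrite (RintegralZl _ measurableT (itX i)) mean mulr0.
have it2 a : itg P (fun o => (\sum_i a i * X i o) ^+ 2).
  have [v v0 l] := law a.
  by have [] := law_transfer (h := fun z => z ^+ 2) (mlin a) l (gaussP_itg_sqr v0).
have itXX x y : itg P (fun o => X x o * X y o).
  pose a (z j : I) : R := (j == z)%:R.
  have i1 z : itg P (fun o => X z o ^+ 2).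
    have := it2 (a z); congr (itg _ _); apply/funext => o; congr (_ ^+ 2).
    exact: (lin_delta z (fun j => X j o)).
  apply: (@itg_dom _ _ _ _ _ (fun o => X x o ^+ 2 + X y o ^+ 2)); last exact: itgD.
    exact: measurable_funM.
  move=> o; rewrite ler_norml; have := sqr_ge0 (X x o + X y o); have := sqr_ge0 (X x o - X y o).
  by have := sqr_ge0 (X x o); have := sqr_ge0 (X y o); move=> *; apply/andP; split; lra.
split=> //.
have second a : \int[P]_o (\sum_i a i * X i o) ^+ 2 = quad C a.
  have E o : (\sum_i a i * X i o) ^+ 2 = \sum_i \sum_j (a i * a j) * (X i o * X j o).
    rewrite expr2 mulr_suml; apply: eq_bigr => i _; rewrite mulr_sumr.
    by apply: eq_bigr => j _; ring.
  under eq_Rintegral do rewrite E.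
  rewrite Rintegral_sum; last by move=> i; apply: itg_sum => j; exact: itgZ.
  apply: eq_bigr => i _; rewrite Rintegral_sum; last by move=> j; exact: itgZ.
  rewrite /lin mulr_sumr; apply: eq_bigr => j _.
  by rewrite (RintegralZl _ measurableT (itXX i j)) CX // mulrA.
have vE a v : 0 <= v -> (forall A, measurable A ->
    P ((fun o => \sum_i a i * X i o) @^-1` A) = gaussP v A) -> quad C a = v.
  move=> v0 l; rewrite -second.
  have [_ ->] := law_transfer (h := fun z => z ^+ 2) (mlin a) l (gaussP_itg_sqr v0).
  exact: gaussP_second_moment.
split=> //.
- by move=> a; have [v v0 l] := law a; rewrite (vE a v v0 l).
- by move=> a A mA; have [v v0 l] := law a; rewrite (vE a v v0 l); exact: l.
Qed.

End on_space.
End gaussian_laws.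

(** * Variational bounds for the increments of the Green function *)

Section grid_forms.
Context {R : realType}.
Variable M : nat.
Implicit Types f g H V : nat -> nat -> R.

(* The box is [0, M+1]^2; [H i j] lives on the edge from (i, j) to (i+1, j) and
   [V i j] on the edge from (i, j) to (i, j+1). *)
Definition vanishing f : Prop :=
  [/\ forall j, f 0%N j = 0, forall j, f M.+1 j = 0,
      forall i, f i 0%N = 0 & forall i, f i M.+1 = 0].

Definition gradh f (i j : nat) : R := f i.+1 j - f i j.
Definition gradv f (i j : nat) : R := f i j.+1 - f i j.

(** The edges lying on the sides of the box are omitted: a vanishing function has zero gradient
    along them. *)
Definition edge_sum H V : R :=
  \sum_(i < M.+1) \sum_(j < M) H i j.+1 + \sum_(i < M) \sum_(j < M.+1) V i.+1 j.

Definition pairing H V f : R :=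
  edge_sum (fun i j => H i j * gradh f i j) (fun i j => V i j * gradv f i j).

Definition energy f : R := edge_sum (fun i j => gradh f i j ^+ 2) (fun i j => gradv f i j ^+ 2).

Lemma sum_by_parts (n : nat) (t g : nat -> R) : g 0%N = 0 -> g n.+1 = 0 ->
  \sum_(i < n.+1) t i * (g i.+1 - g i) = \sum_(i < n) g i.+1 * (t i - t i.+1).
Proof.
move=> g0 gn; under eq_bigr do rewrite mulrBr; rewrite sumrB.
rewrite big_ord_recr /= gn mulr0 addr0 [X in _ - X]big_ord_recl /= g0 mulr0 add0r -sumrB.
by apply: eq_bigr => i _; rewrite /bump /= add1n; ring.
Qed.

Lemma pairing_div H V f : vanishing f -> pairing H V f =
  \sum_(i < M) \sum_(j < M) f i.+1 j.+1 *
    (H i j.+1 - H i.+1 j.+1 + V i.+1 j - V i.+1 j.+1).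
Proof.
move=> [f1 f2 f3 f4]; rewrite /pairing /edge_sum /gradh /gradv exchange_big /=.
rewrite (eq_bigr (fun j : 'I_M => \sum_(i < M) f i.+1 j.+1 * (H i j.+1 - H i.+1 j.+1))); last first.
  by move=> j _; rewrite (sum_by_parts (fun i => H i j.+1) (g := fun i => f i j.+1)).
rewrite exchange_big /= -big_split /=; apply: eq_bigr => i _.
rewrite (sum_by_parts (fun j => V i.+1 j) (g := fun j => f i.+1 j)) // -big_split /=.
by apply: eq_bigr => j _; ring.
Qed.

(** When (u1, u2) lies on the boundary no interior point matches it, and both sides are 0. *)
Lemma sum_delta g u1 u2 : vanishing g -> (u1 <= M.+1)%N -> (u2 <= M.+1)%N ->
  \sum_(i < M) \sum_(j < M) g i.+1 j.+1 * ((i.+1 == u1) && (j.+1 == u2))%:R = g u1 u2.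
Proof.
move=> [g1 g2 g3 g4] h1 h2.
have zero : (forall i j : 'I_M, (i.+1 == u1) && (j.+1 == u2) = false) -> g u1 u2 = 0 ->
    \sum_(i < M) \sum_(j < M) g i.+1 j.+1 * ((i.+1 == u1) && (j.+1 == u2))%:R = g u1 u2.
  by move=> h ->; apply: big1 => i _; apply: big1 => j _; rewrite h mulr0.
case: u1 h1 zero => [|u1] h1 zero; first by apply: zero; rewrite ?g1.
case: u2 h2 zero => [|u2] h2 zero; first by apply: zero; rewrite ?g3 // => i j; rewrite andbF.
have [e1|n1] := eqVneq u1 M.
  by apply: zero; rewrite e1 ?g2 // => i j; rewrite eqSS ltn_eqF.
have [e2|n2] := eqVneq u2 M.
  by apply: zero; rewrite e2 ?g4 // => i j; rewrite andbC eqSS ltn_eqF.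
have l1 : (u1 < M)%N by rewrite ltn_neqAle n1.
have l2 : (u2 < M)%N by rewrite ltn_neqAle n2.
rewrite (bigD1 (Ordinal l1)) //= (bigD1 (Ordinal l2)) //= !eqxx mulr1.
rewrite big1 ?addr0; last first.
  by move=> j /negPf jn; rewrite eqSS; have -> : (j == u2 :> nat) = false by []; rewrite andbF mulr0.
rewrite big1 ?addr0 // => i /negPf jn; apply: big1 => j _.
by rewrite eqSS; have -> : (i == u1 :> nat) = false by []; rewrite mulr0.
Qed.

Lemma ler_edge_sum H V H' V' : (forall i j, H i j <= H' i j) -> (forall i j, V i j <= V' i j) ->
  edge_sum H V <= edge_sum H' V'.
Proof.
by move=> h v; apply: lerD; apply: ler_sum => i _; apply: ler_sum => j _.
Qed.

Lemma edge_sumD H V H' V' : edge_sum (fun i j => H i j + H' i j) (fun i j => V i j + V' i j) =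
  edge_sum H V + edge_sum H' V'.
Proof.
rewrite /edge_sum; under eq_bigr do rewrite big_split /=.
rewrite big_split /=; under [X in _ + X = _]eq_bigr do rewrite big_split /=.
by rewrite big_split /= addrACA.
Qed.

Lemma edge_sumZ c H V : edge_sum (fun i j => c * H i j) (fun i j => c * V i j) = c * edge_sum H V.
Proof.
rewrite /edge_sum mulrDr !mulr_sumr; congr (_ + _); apply: eq_bigr => i _;
by rewrite mulr_sumr.
Qed.

Section potential.
Variables (f : nat -> nat -> R) (u1 u2 v1 v2 : nat).
Hypotheses (f0 : vanishing f) (hu1 : (u1 <= M.+1)%N) (hu2 : (u2 <= M.+1)%N)
  (hv1 : (v1 <= M.+1)%N) (hv2 : (v2 <= M.+1)%N).

Definition charge (i j : nat) : R := ((i.+1 == u1) && (j.+1 == u2))%:R - ((i.+1 == v1) && (j.+1 == v2))%:R.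

Hypothesis fL : forall i j, (i < M)%N -> (j < M)%N ->
  4 * f i.+1 j.+1 - (f i j.+1 + f i.+2 j.+1 + f i.+1 j + f i.+1 j.+2) = 4 * charge i j.

Let D := f u1 u2 - f v1 v2.

Let sum_charge g : vanishing g ->
  \sum_(i < M) \sum_(j < M) g i.+1 j.+1 * charge i j = g u1 u2 - g v1 v2.
Proof.
move=> g0; rewrite -(sum_delta g0 hu1 hu2) -(sum_delta g0 hv1 hv2) -sumrB.
by apply: eq_bigr => i _; rewrite -sumrB; apply: eq_bigr => j _; rewrite -mulrBr.
Qed.

Lemma pairing_potential g : vanishing g ->
  pairing (gradh f) (gradv f) g = 4 * (g u1 u2 - g v1 v2).
Proof.
move=> g0; rewrite pairing_div // -(sum_charge g0) mulr_sumr; apply: eq_bigr => i _.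
rewrite mulr_sumr; apply: eq_bigr => j _.
by rewrite [RHS]mulrCA -fL // /gradh /gradv; ring.
Qed.

Lemma energy_potential : energy f = 4 * D.
Proof.
rewrite -(pairing_potential f0); rewrite /energy /pairing; congr edge_sum;
by apply/funext => i; apply/funext => j; rewrite expr2.
Qed.

(** Pairing the flow with [f] gives - D. By - a b <= 2 a^2 + b^2 / 8, D is at most twice the energy
    of the flow plus an eighth of the energy 4 D of [f], that is D / 2. *)
Lemma thomson_upper H V :
  (forall i j, (i < M)%N -> (j < M)%N ->
     H i.+1 j.+1 - H i j.+1 + V i.+1 j.+1 - V i.+1 j = charge i j) ->
  D <= 4 * edge_sum (fun i j => H i j ^+ 2) (fun i j => V i j ^+ 2).
Proof.
move=> HV; have DE : pairing H V f = - D.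
  rewrite pairing_div // /D -(sum_charge f0) -sumrN; apply: eq_bigr => i _.
  rewrite -sumrN; apply: eq_bigr => j _; rewrite -HV //; ring.
have : edge_sum (fun i j => - 1 * (H i j * gradh f i j)) (fun i j => - 1 * (V i j * gradv f i j)) <=
    edge_sum (fun i j => 2 * H i j ^+ 2 + 8^-1 * gradh f i j ^+ 2)
             (fun i j => 2 * V i j ^+ 2 + 8^-1 * gradv f i j ^+ 2).
  have h (a b : R) : - 1 * (a * b) <= 2 * a ^+ 2 + 8^-1 * b ^+ 2.
    by have := sqr_ge0 (a + b / 4); lra.
  by apply: ler_edge_sum => i j; exact: h.
rewrite edge_sumZ edge_sumD !edge_sumZ -/(pairing H V f) DE.
have := energy_potential; rewrite /energy => ->; lra.
Qed.

(** The energy of f - t g is nonnegative, and t = 4 De / E is the optimal choice in the resulting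
    quadratic inequality. *)
Lemma dirichlet_lower g E : vanishing g -> energy g <= E -> 0 < E ->
  4 * (g u1 u2 - g v1 v2) ^+ 2 / E <= D.
Proof.
move=> g0 gE E0; set De := g u1 u2 - g v1 v2.
pose t := 4 * De / E.
have h : 0 <= edge_sum (fun i j => (gradh f i j - t * gradh g i j) ^+ 2)
                       (fun i j => (gradv f i j - t * gradv g i j) ^+ 2).
  by apply: addr_ge0; apply: sumr_ge0 => i _; apply: sumr_ge0 => j _; exact: sqr_ge0.
have e : edge_sum (fun i j => (gradh f i j - t * gradh g i j) ^+ 2)
                  (fun i j => (gradv f i j - t * gradv g i j) ^+ 2) =
    energy f + ((- 2 * t) * pairing (gradh f) (gradv f) g + t ^+ 2 * energy g).
  rewrite /energy /pairing -!edge_sumZ -!edge_sumD.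
  by congr edge_sum; apply/funext => i; apply/funext => j; ring.
rewrite e energy_potential pairing_potential // -/De in h.
have t2 : t ^+ 2 * energy g <= t ^+ 2 * E by rewrite ler_wpM2l // sqr_ge0.
have e1 : t ^+ 2 * E = 4 * (4 * De ^+ 2 / E) by rewrite /t; field; rewrite gt_eqF.
have e2 : t * De = 4 * De ^+ 2 / E by rewrite /t; ring.
lra.
Qed.

End potential.
End grid_forms.

(** * The angular flow and its squared fluxes *)

Section atan_estimates.
Context {R : realType}.
Implicit Types x y A : R.

(** With c the mean slope of f, the function F + c^2 t - 2 c f has derivative (f' - c)^2 >= 0. This
    is the Cauchy-Schwarz inequality without integrals. *)
Lemma cauchy_schwarz_increment (f F df : R -> R) (x y : R) : x <= y ->
  (forall t : R, is_derive t 1 f (df t)) -> (forall t : R, is_derive t 1 F (df t ^+ 2)) ->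
  (f y - f x) ^+ 2 <= (y - x) * (F y - F x).
Proof.
move=> + hf hF; rewrite le_eqVlt => /predU1P[->|xy]; first by rewrite !subrr expr0n mul0r.
have d0 : 0 < y - x by rewrite subr_gt0.
pose c := (f y - f x) / (y - x).
have := @le_of_derive_ge0 R (fun t => F t + c ^+ 2 * t - 2 * c * f t)
  (fun t => (df t - c) ^+ 2) x y (ltW xy).
have isd (t : R) : is_derive t 1 (fun t => F t + c ^+ 2 * t - 2 * c * f t) ((df t - c) ^+ 2).
  by apply: (is_derive_eq (isdD (isdD (hF t) (isdZ (c ^+ 2) (isd_id t)))
    (isdN (isdZ (2 * c) (hf t))))); ring.
move=> /(_ isd (fun t _ => sqr_ge0 _)) h.
have e1 : c * (y - x) = f y - f x by rewrite /c divfK // gt_eqF.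
have e2 : (f y - f x) ^+ 2 = (y - x) * (2 * c * (f y - f x) - c ^+ 2 * (y - x)).
  by rewrite -e1; ring.
rewrite e2 ler_pM2l //; lra.
Qed.

Lemma isd_atan x : is_derive x 1 (@atan R) (1 + x ^+ 2)^-1.
Proof. exact: is_derive1_atan. Qed.

Lemma one_sqr_gt0 x : 0 < 1 + x ^+ 2.
Proof. by rewrite ltr_pwDl // sqr_ge0. Qed.

Lemma atan_diff_le x y : x <= y -> atan y - atan x <= y - x.
Proof.
move=> xy.
have := @le_of_derive_ge0 R (fun t => t - atan t) (fun t => 1 - (1 + t ^+ 2)^-1) x y xy
  (fun t => isdD (isd_id t) (isdN (isd_atan t))).
have h t : x <= t <= y -> 0 <= 1 - (1 + t ^+ 2)^-1.
  move=> _; rewrite subr_ge0 invf_le1 ?one_sqr_gt0 // lerDl sqr_ge0 //.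
move=> /(_ h); lra.
Qed.

Lemma isd_inv1Dsqr x : is_derive x 1 (fun y : R => (1 + y ^+ 2)^-1) (- (2 * x) / (1 + x ^+ 2) ^+ 2).
Proof.
apply: (is_derive_eq (@isdV R (fun y => 1 + y ^+ 2) x _ (lt0r_neq0 (one_sqr_gt0 x))
  (isdD (isd_cst 1 x) (isdX 2 (isd_id x))))) => /=.
by rewrite expr1 add0r mulr1.
Qed.

(** A primitive of the squared derivative of [atan]; its total variation pi / 2 is what fixes the
    leading constant in the energy of the flow. *)
Definition atan_energy x : R := (x / (1 + x ^+ 2) + atan x) / 2.

Lemma isd_atan_energy x : is_derive x 1 atan_energy ((1 + x ^+ 2) ^- 2).
Proof.
have h := isdM (isdD (isdM (isd_id x) (isd_inv1Dsqr x)) (isd_atan x)) (isd_cst 2^-1 x).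
apply: (is_derive_eq h).
by have n := lt0r_neq0 (one_sqr_gt0 x); field.
Qed.

Lemma atan_diff_sqr x y : x <= y ->
  (atan y - atan x) ^+ 2 <= (y - x) * (atan_energy y - atan_energy x).
Proof.
move=> xy; apply: (cauchy_schwarz_increment xy isd_atan) => t.
by rewrite exprVn; exact: isd_atan_energy.
Qed.

Lemma atanV x : 0 < x -> atan x + atan x^-1 = pi / 2.
Proof.
move=> x0; have y0 : 0 < atan x by rewrite -atan0 lt_atan.
have y1 := atan_ltpi2 x.
have E : atan x^-1 = pi / 2 - atan x; last by rewrite E; ring.
have <- : tan (pi / 2 - atan x) = x^-1; last first.
  rewrite tanK // in_itv /=; apply/andP; split; have := @pi_gt0 R; lra.
have -> : pi / 2 - atan x = - (atan x - pi / 2) by ring.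
rewrite tanN /tan sinBpihalf cosBpihalf mulNr opprK -invf_div.
by rewrite -[in RHS](atanK x).
Qed.

Lemma atan_ge_frac x : 0 <= x -> x / (1 + x ^+ 2) <= atan x.
Proof.
move=> x0.
have isd (t : R) : is_derive t 1 (fun t => atan t - t / (1 + t ^+ 2)) (2 * t ^+ 2 / (1 + t ^+ 2) ^+ 2).
  apply: (is_derive_eq (isdD (isd_atan t) (isdN (isdM (isd_id t) (isd_inv1Dsqr t))))).
  by have n := lt0r_neq0 (one_sqr_gt0 t); field.
have := le_of_derive_ge0 x0 isd.
rewrite atan0 mul0r subrr subr_ge0; apply => t _.
by apply: divr_ge0; [apply: mulr_ge0 => //|]; exact: sqr_ge0.
Qed.

Lemma atan_energyN x : atan_energy (- x) = - atan_energy x.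
Proof. by rewrite /atan_energy atanN sqrrN; ring. Qed.

Lemma atan_energy_le x : atan_energy x <= pi / 4.
Proof.
have [x0|x0] := leP x 0.
  have : atan x <= 0 by rewrite -atan0 le_atan.
  have : x / (1 + x ^+ 2) <= 0 by rewrite mulr_le0_ge0 // invr_ge0 ltW // one_sqr_gt0.
  rewrite /atan_energy; have := @pi_gt0 R; lra.
have := atanV x0; have := @atan_ge_frac x^-1; rewrite invr_ge0 (ltW x0) => /(_ isT).
have -> : x^-1 / (1 + x^-1 ^+ 2) = x / (1 + x ^+ 2).
  have n1 := lt0r_neq0 (one_sqr_gt0 x); have n3 := lt0r_neq0 x0.
  have n2 := lt0r_neq0 (one_sqr_gt0 x^-1); apply/eqP.
  rewrite eqr_div //; apply/eqP; rewrite exprVn; by field.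
rewrite /atan_energy; lra.
Qed.

Lemma atan_energy_diff x y : atan_energy y - atan_energy x <= pi / 2.
Proof.
have := atan_energy_le y; have := atan_energy_le (- x); rewrite atan_energyN; lra.
Qed.

Lemma atan_sgV (a b : R) : a != 0 -> b != 0 ->
  atan (b / a) + atan (a / b) = pi / 2 * (Num.sg a * Num.sg b).
Proof.
move=> a0 b0; have -> : a / b = (b / a)^-1 by rewrite invf_div.
have [h|h|h] := ltgtP 0 (b / a).
- rewrite atanV // -sgrM gtr0_sg ?mulr1 //.
  by have -> : a * b = (b / a) * a ^+ 2 by [field]; rewrite mulr_gt0 // exprn_even_gt0.
- have h' : 0 < - (b / a) by rewrite oppr_gt0.
  have := atanV h'; rewrite invrN !atanN -sgrM ltr0_sg; first by move=> e; lra.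
  have -> : a * b = (b / a) * a ^+ 2 by field.
  by rewrite pmulr_llt0 // exprn_even_gt0.
- by move/esym/eqP: h; rewrite mulf_eq0 invr_eq0 (negbTE a0) (negbTE b0).
Qed.

(* The angle under which the origin sees the dual edge of abscissa [A] centred at
   ordinate [y]: the flux of the radial vector field [x / |x|^2] through it. *)
Definition flux A y : R := atan ((y + 2^-1) / A) - atan ((y - 2^-1) / A).

Lemma fluxN A y : flux (- A) y = - flux A y.
Proof. by rewrite /flux !invrN !mulrN !atanN; ring. Qed.

Lemma flux_ge0 A y : 0 < A -> 0 <= flux A y.
Proof. by move=> A0; rewrite subr_ge0 le_atan // ler_pM2r ?invr_gt0 //; lra. Qed.

Lemma flux_le A y : 0 < A -> flux A y <= A^-1.
Proof.
move=> A0; have h : (y - 2^-1) / A <= (y + 2^-1) / A by rewrite ler_pM2r ?invr_gt0 //; lra.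
apply: (le_trans (atan_diff_le h)).
by rewrite -mulrBl; have -> : y + 2^-1 - (y - 2^-1) = 1 by [field]; rewrite mul1r.
Qed.

Lemma flux_sqr A y : 0 < A ->
  flux A y ^+ 2 <= A^-1 * (atan_energy ((y + 2^-1) / A) - atan_energy ((y - 2^-1) / A)).
Proof.
move=> A0; have h : (y - 2^-1) / A <= (y + 2^-1) / A by rewrite ler_pM2r ?invr_gt0 //; lra.
apply: (le_trans (atan_diff_sqr h)).
by rewrite -mulrBl; have -> : y + 2^-1 - (y - 2^-1) = 1 by [field]; rewrite mul1r.
Qed.

Lemma sum_flux A (c : R) (n : nat) : 0 < A -> \sum_(j < n) flux A (j%:R - c) <= pi.
Proof.
move=> A0; have -> : \sum_(j < n) flux A (j%:R - c) =
    atan ((n%:R - c - 2^-1) / A) - atan ((- c - 2^-1) / A).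
  elim: n => [|n ih]; first by rewrite big_ord0 sub0r subrr.
  rewrite big_ord_recr /= ih /flux.
  have -> : n.+1%:R - c - 2^-1 = n%:R - c + 2^-1 by rewrite -natr1; field.
  by ring.
have := atan_ltpi2 ((n%:R - c - 2^-1) / A); have := atan_gtNpi2 ((- c - 2^-1) / A); lra.
Qed.

Lemma sum_flux_sqr A (c : R) (n : nat) : 0 < A -> \sum_(j < n) flux A (j%:R - c) ^+ 2 <= pi / 2 / A.
Proof.
move=> A0; apply: (@le_trans _ _ (\sum_(j < n) A^-1 *
    (atan_energy ((j%:R - c + 2^-1) / A) - atan_energy ((j%:R - c - 2^-1) / A)))).
  by apply: ler_sum => j _; exact: flux_sqr.
rewrite -mulr_sumr mulrC ler_pM2r ?invr_gt0 //.
have -> : \sum_(j < n) (atan_energy ((j%:R - c + 2^-1) / A) - atan_energy ((j%:R - c - 2^-1) / A)) =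
    atan_energy ((n%:R - c - 2^-1) / A) - atan_energy ((- c - 2^-1) / A).
  elim: n => [|n ih]; first by rewrite big_ord0 sub0r subrr.
  rewrite big_ord_recr /= ih.
  have -> : n.+1%:R - c - 2^-1 = n%:R - c + 2^-1 by rewrite -natr1; field.
  by ring.
exact: atan_energy_diff.
Qed.

Lemma flux_mvt A y : A != 0 -> exists2 z, `|z - y| <= 2^-1 & flux A y = A / (A ^+ 2 + z ^+ 2).
Proof.
move=> A0.
have isd (t : R) : is_derive t 1 (fun t => atan (t / A)) ((1 + (t / A) ^+ 2)^-1 * (1 * A^-1)).
  apply: (is_derive_eq (@isd_comp R (@atan R) (fun t => t / A) t _ _ (isd_atan (t / A))
    (isdM (isd_id t) (isd_cst A^-1 t)))).
  by congr (_ * _); ring.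
have le : y - 2^-1 <= y + 2^-1 by lra.
have [z /andP[z1 z2] e] := is_derive_MVT le isd.
exists z; first by rewrite ler_norml; apply/andP; split; lra.
rewrite /flux e; have -> : y + 2^-1 - (y - 2^-1) = 1 by field.
have p : 0 < A ^+ 2 by rewrite exprn_even_gt0.
have q : A ^+ 2 + z ^+ 2 != 0 by rewrite gt_eqF // ltr_pwDl // sqr_ge0.
rewrite mulr1 mul1r; field; by rewrite ?A0 ?q.
Qed.

(** By the mean value theorem both fluxes are values of the kernel A / (A^2 + z^2), at ordinates
    that differ by at most 2 r. For |A| >= 4 r the two denominators are comparable, and the
    numerator of the difference is O(r) times one of them: the dipole decay r / A^2. *)
Lemma flux_far (A A' y y' r : R) : 1 <= r -> `|A - A'| <= r -> `|y - y'| <= r -> 4 * r <= `|A| ->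
  `|flux A y - flux A' y'| <= 36 * r / A ^+ 2.
Proof.
move=> r1 hA hy Ar.
have A0 : A != 0 by rewrite -normr_gt0; lra.
have A'r : 3 * r <= `|A'|.
  have := ler_normD A' (A - A'); rewrite addrC subrK; lra.
have A'0 : A' != 0 by rewrite -normr_gt0; lra.
have [z hz ->] := flux_mvt y A0; have [z' hz' ->] := flux_mvt y' A'0.
have hzz : `|z - z'| <= 2 * r.
  have -> : z - z' = (z - y) + (y - y') - (z' - y') by ring.
  have := ler_normB ((z - y) + (y - y')) (z' - y'); have := ler_normD (z - y) (y - y'); lra.
pose n := A ^+ 2 + z ^+ 2; pose n' := A' ^+ 2 + z' ^+ 2.
have A2 : 16 * r ^+ 2 <= A ^+ 2.
  have : (4 * r) ^+ 2 <= `|A| ^+ 2 by rewrite lerXn2r ?nnegrE //; lra.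
  rewrite real_normK ?num_real //; lra.
have A2' : 9 * r ^+ 2 <= A' ^+ 2.
  have : (3 * r) ^+ 2 <= `|A'| ^+ 2 by rewrite lerXn2r ?nnegrE //; lra.
  rewrite real_normK ?num_real //; lra.
have dA : (A - A') ^+ 2 <= r ^+ 2.
  by rewrite -(real_normK (num_real (A - A'))) lerXn2r ?nnegrE //; lra.
have dz : (z - z') ^+ 2 <= 4 * r ^+ 2.
  have : `|z - z'| ^+ 2 <= (2 * r) ^+ 2 by rewrite lerXn2r ?nnegrE //; lra.
  rewrite real_normK ?num_real //; lra.
have nn' : n <= 4 * n'.
  have h : n <= 2 * n' + 10 * r ^+ 2.
    rewrite /n /n'; have := sqr_ge0 (A - A' - A'); have := sqr_ge0 (z - z' - z'); nra.
  have : 9 * r ^+ 2 <= n' by rewrite /n'; have := sqr_ge0 z'; lra.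
  have := sqr_ge0 r; lra.
have n'n : n' <= 3 * n.
  have h : n' <= 2 * n + 10 * r ^+ 2.
    rewrite /n /n'; have := sqr_ge0 (A' - A - A); have := sqr_ge0 (z' - z - z); nra.
  have : 16 * r ^+ 2 <= n by rewrite /n; have := sqr_ge0 z; lra.
  have := sqr_ge0 r; lra.
have r2 : 0 < r ^+ 2 by rewrite exprn_gt0 //; lra.
have n0 : 0 < n by rewrite /n; have := sqr_ge0 z; lra.
have n'0 : 0 < n' by rewrite /n'; have := sqr_ge0 z'; lra.
have -> : A / n - A' / n' = (A * A' * (A' - A) + A * (z' - z) * (z' + z) + (A - A') * z ^+ 2) / (n * n').
  by rewrite /n /n'; field; rewrite -/n -/n' !gt_eqF.
rewrite normrM [X in _ * X]ger0_norm ?invr_ge0 ?mulr_ge0 ?(ltW n0) ?(ltW n'0) //.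
have num : `|A * A' * (A' - A) + A * (z' - z) * (z' + z) + (A - A') * z ^+ 2| <= 9 * r * n.
  have t1 : `|A * A' * (A' - A)| <= 2 * n * r.
    rewrite normrM; apply: ler_pM => //; last by rewrite distrC.
    rewrite ler_norml; have := sqr_ge0 (A + A'); have := sqr_ge0 (A - A').
    have := sqr_ge0 z; have := sqr_ge0 z'; rewrite /n /n' in n'n *.
    by move=> *; apply/andP; split; lra.
  have t2 : `|A * (z' - z) * (z' + z)| <= 2 * r * (3 * n).
    have -> : A * (z' - z) * (z' + z) = (z' - z) * (A * (z' + z)) by ring.
    rewrite normrM; apply: ler_pM => //; first by rewrite distrC.
    rewrite ler_norml; have := sqr_ge0 (A + z'); have := sqr_ge0 (A - z').
    have := sqr_ge0 (A + z); have := sqr_ge0 (A - z); have := sqr_ge0 A'.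
    have := sqr_ge0 A; have := sqr_ge0 z; rewrite /n /n' in n'n *.
    by move=> *; apply/andP; split; lra.
  have t3 : `|(A - A') * z ^+ 2| <= r * n.
    rewrite normrM; apply: ler_pM => //.
    by rewrite ger0_norm ?sqr_ge0 // /n lerDr sqr_ge0.
  have := ler_normD (A * A' * (A' - A) + A * (z' - z) * (z' + z)) ((A - A') * z ^+ 2).
  have := ler_normD (A * A' * (A' - A)) (A * (z' - z) * (z' + z)); lra.
apply: (@le_trans _ _ (9 * r * n / (n * n'))).
  by rewrite ler_pM2r // invr_gt0 mulr_gt0.
have -> : 9 * r * n / (n * n') = 9 * r / n' by field; rewrite !gt_eqF.
have -> : 36 * r / A ^+ 2 = 9 * r / (A ^+ 2 / 4) by field.
rewrite ler_pM2l; last by lra.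
rewrite lef_pV2 ?posrE //; last by lra.
have := sqr_ge0 z; rewrite /n in nn'; lra.
Qed.

End atan_estimates.

(** * Upper bound for the increments: energy of the dipole flow *)

Section green_upper.
Context {R : realType}.
Implicit Types (u v i j n m r : nat).

Definition line_dist u i : nat := if (i < u)%N then (u - i.+1)%N else (i - u)%N.

(** Dual edges have half-integer abscissae, so they are never at distance 0 from [u]. *)
Definition half_diff u i : R := i%:R - u%:R + 2^-1.

Lemma half_diffE u i : half_diff u i =
  if (i < u)%N then - ((line_dist u i)%:R + 2^-1) else (line_dist u i)%:R + 2^-1.
Proof.
rewrite /half_diff /line_dist; case: ltnP => h; last by rewrite natrB.
by rewrite natrB // -[i.+1%:R]natr1; field.
Qed.

Lemma half_diff_norm u i : `|half_diff u i| = (line_dist u i)%:R + 2^-1.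
Proof.
have h : 0 <= (line_dist u i)%:R + 2^-1 :> R by rewrite addr_ge0.
by rewrite half_diffE; case: ifP => _; rewrite ?normrN ger0_norm.
Qed.

Lemma half_diff_neq0 u i : half_diff u i != 0.
Proof. by rewrite -normr_gt0 half_diff_norm ltr_wpDl. Qed.

Lemma half_diff_sg u i : Num.sg (half_diff u i) = if (i < u)%N then -1 else 1.
Proof.
have h : 0 < (line_dist u i)%:R + 2^-1 :> R by rewrite ltr_wpDl.
by rewrite half_diffE; case: ifP => _; rewrite ?sgrN gtr0_sg.
Qed.

(** Each distance is attained at most twice, once on either side of [u]. *)
Lemma sum_line_dist (phi : nat -> R) (S : R) u n : (forall k, 0 <= phi k) ->
  (forall m, \sum_(k < m) phi k <= S) -> \sum_(i < n) phi (line_dist u i) <= 2 * S.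
Proof.
move=> phi0 hS; apply: (@le_trans _ _ (\sum_(i < u + n) phi (line_dist u i))).
  by rewrite addnC big_split_ord /= lerDl sumr_ge0.
have := hS u; have := hS n; rewrite big_split_ord /=.
have -> : \sum_(i < u) phi (line_dist u i) = \sum_(i < u) phi i.
  rewrite (reindex_inj rev_ord_inj) /=; apply: eq_bigr => i _; congr phi.
  rewrite /line_dist /=; have h := ltn_ord i; case: ifP; lia.
have -> : \sum_(i < n) phi (line_dist u (u + i)) = \sum_(i < n) phi i.
  by apply: eq_bigr => i _; congr phi; rewrite /line_dist; case: ltnP; lia.
lra.
Qed.

(** The correction - 1 / (2 n) strengthens the induction hypothesis enough to cover the excess of (x
    + 1/2)^-1 over ln (x + 1) - ln x. *)
Lemma sum_half_inv n : (0 < n)%N -> \sum_(k < n) (k%:R + 2^-1)^-1 <= 3 + ln n%:R - (2 * n%:R)^-1 :> R.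
Proof.
elim: n => // -[_ _|n /(_ isT) ih _].
  by rewrite big_ord1 ln1 add0r invrK; lra.
rewrite big_ord_recr /=; apply: (le_trans (lerD ih (lexx _))).
have [x xE] : exists x : R, x = n.+1%:R by exists n.+1%:R.
have x0 : 0 < x by rewrite xE.
rewrite -[n.+2%:R]natr1 -xE.
have l : (x + 1)^-1 <= ln (x + 1) - ln x.
  have : ln (1 + (- (x + 1)^-1)) <= - (x + 1)^-1.
    by apply: le_ln1Dx; rewrite ltrN2 invf_lt1 ?ltrDr //; lra.
  have -> : 1 - (x + 1)^-1 = x / (x + 1) by field; rewrite gt_eqF //; lra.
  by rewrite ln_div ?posrE //; lra.
have e : (x + 2^-1)^-1 <= (x + 1)^-1 + ((2 * x)^-1 - (2 * (x + 1))^-1).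
  rewrite -subr_ge0.
  have -> : (x + 1)^-1 + ((2 * x)^-1 - (2 * (x + 1))^-1) - (x + 2^-1)^-1 =
    4^-1 * ((x + 1) * x * (x + 2^-1))^-1.
    by field; rewrite !gt_eqF //; lra.
  by rewrite mulr_ge0 // invr_ge0 !mulr_ge0 //; lra.
lra.
Qed.

Lemma sum_near K m : (0 < K)%N ->
  \sum_(k < m) (k < K)%N%:R * (k%:R + 2^-1)^-1 <= 3 + ln K%:R :> R.
Proof.
move=> K0; apply: (@le_trans _ _ (\sum_(k < K) (k%:R + 2^-1)^-1)); last first.
  apply: (le_trans (sum_half_inv K0)); rewrite lerBlDr lerDl invr_ge0 mulr_ge0 //.
have h k : 0 <= (k%:R + 2^-1 : R)^-1 by rewrite invr_ge0 addr_ge0.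
elim: m => [|m ih]; first by rewrite big_ord0 sumr_ge0.
have [mK|Km] := ltnP m K.
  apply: (@le_trans _ _ (\sum_(k < m.+1) (k%:R + 2^-1)^-1)).
    by apply: ler_sum => k _; case: ltnP => _; rewrite ?mul1r ?mul0r.
  rewrite -(subnKC mK) [X in _ <= X]big_split_ord /= lerDl sumr_ge0 //.
by rewrite big_ord_recr /= ltnNge Km mul0r addr0.
Qed.

Lemma sum_far K m : (0 < K)%N ->
  \sum_(k < m) (K <= k)%N%:R * (k%:R + 2^-1) ^- 2 <= K%:R^-1 :> R.
Proof.
move=> K0; apply: (@le_trans _ _ (K%:R^-1 - (maxn m K)%:R^-1)); last by rewrite gerBl.
elim: m => [|m ih]; first by rewrite big_ord0 max0n subrr.
rewrite big_ord_recr /=; apply: (le_trans (lerD ih (lexx _))).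
have [mK|Km] := ltnP m K.
  by rewrite (maxn_idPr mK) mul0r addr0.
rewrite (maxn_idPl (leqW Km)) mul1r.
have [x xE] : exists x : R, x = m%:R by exists m%:R.
have x0 : 0 < x by rewrite xE ltr0n (leq_trans K0).
rewrite -[m.+1%:R]natr1 -xE.
have e : (x + 2^-1) ^- 2 <= x^-1 - (x + 1)^-1.
  have -> : x^-1 - (x + 1)^-1 = (x * (x + 1))^-1 by field; rewrite !gt_eqF //; lra.
  by rewrite lef_pV2 ?posrE ?exprn_gt0 ?mulr_gt0 //; lra.
lra.
Qed.

Lemma sum_between u v n (a : R) : 0 <= a ->
  \sum_(i < n) ((i < u)%N (+) (i < v)%N)%:R * a <= `|u%:R - v%:R| * a.
Proof.
move=> a0; rewrite -mulr_suml ler_wpM2r //.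
wlog uv : u v / (u <= v)%N => [W|].
  have [/W//|/ltnW/W] := leqP u v; rewrite distrC.
  by under eq_bigr do rewrite addbC.
rewrite distrC ger0_norm ?subr_ge0 ?ler_nat // -natrB // -natr_sum ler_nat.
apply: (@leq_trans (minn n v - minn n u)%N); last by lia.
elim: n => [|n ih]; first by rewrite big_ord0.
rewrite big_ord_recr /=; move: ih; set s := (\sum_(i < n) _)%N => ih.
by case: ltnP; case: ltnP => /= *; lia.
Qed.

Definition column A A' (c c' : R) n : R := \sum_(j < n) (flux A (j%:R - c) - flux A' (j%:R - c')) ^+ 2.

Lemma flux_norm_sqr (A y : R) : flux A y ^+ 2 = flux `|A| y ^+ 2.
Proof. by case: (ger0P A) => // _; rewrite fluxN sqrrN. Qed.

Lemma sum_flux_norm (A c : R) n : A != 0 -> \sum_(j < n) `|flux A (j%:R - c)| <= pi.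
Proof.
move=> A0; have A1 : 0 < `|A| by rewrite normr_gt0.
apply: le_trans (sum_flux c n A1); apply: ler_sum => j _.
rewrite -[X in _ <= X]ger0_norm ?flux_ge0 //.
by case: (ger0P A) => // _; rewrite fluxN normrN.
Qed.

(** On the same side of both points the two fluxes have the same sign, so the cross term of the
    square only helps. *)
Lemma column_same (A A' c c' : R) n : 0 < A * A' ->
  column A A' c c' n <= pi / 2 * (`|A|^-1 + `|A'|^-1).
Proof.
move=> AA; have A0 : A != 0 by apply: contraTneq AA => ->; rewrite mul0r ltxx.
have A'0 : A' != 0 by apply: contraTneq AA => ->; rewrite mulr0 ltxx.
have A1 : 0 < `|A| by rewrite normr_gt0.
have A1' : 0 < `|A'| by rewrite normr_gt0.
rewrite mulrDr; apply: le_trans (lerD (sum_flux_sqr c n A1) (sum_flux_sqr c' n A1')).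
rewrite -big_split /=; apply: ler_sum => j _; rewrite -!flux_norm_sqr.
suff : 0 <= flux A (j%:R - c) * flux A' (j%:R - c') by lra.
have [Ap|Am|/eqP] := ltgtP 0 A; last by rewrite eq_sym (negbTE A0).
  by rewrite mulr_ge0 ?flux_ge0 //; move: AA; rewrite pmulr_rgt0.
have Am' : A' < 0 by move: AA; rewrite nmulr_rgt0.
by rewrite -mulrNN -!fluxN mulr_ge0 // flux_ge0 // oppr_gt0.
Qed.

(** Between the points the cross term is unfavourable, but one of the two abscissae is at least half
    of |A - A'| in absolute value, and the fluxes from the other point sum to at most pi. There are
    at most |u - v| such columns, so the total excess will be O(1). *)
Lemma column_opp (A A' c c' : R) n : A * A' < 0 ->
  column A A' c c' n <= pi / 2 * (`|A|^-1 + `|A'|^-1) + 4 * pi / `|A - A'|.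
Proof.
move=> AA; have A0 : A != 0 by apply: contraTneq AA => ->; rewrite mul0r ltxx.
have A'0 : A' != 0 by apply: contraTneq AA => ->; rewrite mulr0 ltxx.
have A1 : 0 < `|A| by rewrite normr_gt0.
have A1' : 0 < `|A'| by rewrite normr_gt0.
have dA : `|A - A'| = `|A| + `|A'|.
  have [Ap|Am|/eqP] := ltgtP 0 A; last by rewrite eq_sym (negbTE A0).
    have Am' : A' < 0 by move: AA; rewrite pmulr_rlt0.
    by rewrite gtr0_norm ?(gtr0_norm Ap) ?(ltr0_norm Am') //; lra.
  have Ap' : 0 < A' by move: AA; rewrite nmulr_rlt0.
  by rewrite ltr0_norm ?(ltr0_norm Am) ?(gtr0_norm Ap') //; lra.
have fl (B y : R) : B != 0 -> `|flux B y| <= `|B|^-1.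
  move=> B0; have B1 : 0 < `|B| by rewrite normr_gt0.
  apply: le_trans (flux_le y B1); rewrite -[X in _ <= X]ger0_norm ?flux_ge0 //.
  by case: (ger0P B) => // _; rewrite fluxN normrN.
have key (B B' b b' : R) : B != 0 -> B' != 0 -> `|A - A'| <= 2 * `|B| ->
    \sum_(j < n) `|flux B (j%:R - b)| * `|flux B' (j%:R - b')| <= 2 * pi / `|A - A'|.
  move=> B0 B'0 h; apply: (@le_trans _ _ (\sum_(j < n) 2 / `|A - A'| * `|flux B' (j%:R - b')|)).
    apply: ler_sum => j _; rewrite ler_wpM2r //; apply: (le_trans (fl _ _ B0)).
    have B1 : 0 < `|B| by rewrite normr_gt0.
    have -> : 2 / `|A - A'| = (`|A - A'| / 2)^-1 by rewrite invf_div.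
    by rewrite lef_pV2 ?posrE //; lra.
  by rewrite -mulr_sumr mulrAC ler_wpM2r ?invr_ge0 // ler_wpM2l // sum_flux_norm.
have {}key : \sum_(j < n) `|flux A (j%:R - c)| * `|flux A' (j%:R - c')| <= 2 * pi / `|A - A'|.
  have [h|h] := leP `|A'| `|A|; first by apply: key => //; rewrite dA; lra.
  under eq_bigr do rewrite mulrC.
  by apply: key => //; rewrite dA; lra.
have -> : 4 * pi / `|A - A'| = 2 * (2 * pi / `|A - A'|) by ring.
rewrite mulrDr.
have s1 := sum_flux_sqr c n A1; have s2 := sum_flux_sqr c' n A1'.
apply: le_trans (lerD (lerD s1 s2) (ler_wpM2l (ler0n R 2) key)).
rewrite mulr_sumr -!big_split /=; apply: ler_sum => j _; rewrite -!flux_norm_sqr.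
rewrite -normrM; have := ler_norm (- (flux A (j%:R - c) * flux A' (j%:R - c'))); rewrite normrN.
by lra.
Qed.

Lemma column_far (A A' c c' r : R) n : 1 <= r -> `|A - A'| <= r -> `|c - c'| <= r ->
  4 * r <= `|A| -> column A A' c c' n <= 72 * pi * (r * A ^- 2).
Proof.
move=> r1 hA hc Ar; have A0 : A != 0 by rewrite -normr_gt0; lra.
have A'0 : A' != 0.
  rewrite -normr_gt0; have := ler_normD A' (A - A'); rewrite addrC subrK; lra.
have q0 : 0 <= 36 * r / A ^+ 2 by rewrite divr_ge0 ?sqr_ge0 //; lra.
apply: (@le_trans _ _ (\sum_(j < n) 36 * r / A ^+ 2 *
    (`|flux A (j%:R - c)| + `|flux A' (j%:R - c')|))).
  apply: ler_sum => j _; rewrite -real_normK ?num_real // expr2.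
  apply: ler_pM => //; last exact: ler_normB.
  apply: flux_far => //; have -> : j%:R - c - (j%:R - c') = - (c - c') by ring.
  by rewrite normrN.
rewrite -mulr_sumr big_split /=.
have -> : 72 * pi * (r * A ^- 2) = 36 * r / A ^+ 2 * (pi + pi) by ring.
by rewrite ler_wpM2l // lerD // sum_flux_norm.
Qed.

Lemma ln_le (x : R) : 0 < x -> ln x <= x - 1.
Proof. by move=> x0; rewrite -{1}(subrK 1 x) addrC; apply: le_ln1Dx; lra. Qed.

(** Columns at distance below 4 r are bounded by the two single sources, whose inverse distances sum
    to the logarithm. Farther columns see a dipole, and r times the sum of their inverse squared
    distances is bounded. *)
Lemma sum_column u v r (c c' : R) n m : (0 < r)%N -> `|u%:R - v%:R| <= r%:R :> R -> `|c - c'| <= r%:R ->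
  \sum_(i < m) column (half_diff u i) (half_diff v i) c c' n <= 2 * pi * (ln r%:R + 27).
Proof.
move=> r0 huv hc; have r1 : 1 <= r%:R :> R by rewrite ler1n.
have p0 := @pi_gt0 R.
pose near K k : R := (k < K)%N%:R * (k%:R + 2^-1)^-1.
pose far K k : R := (K <= k)%N%:R * (k%:R + 2^-1) ^- 2.
have half0 (k : nat) : 0 <= k%:R + 2^-1 :> R by rewrite addr_ge0.
have near0 K k : 0 <= near K k by rewrite mulr_ge0 // invr_ge0.
have far0 K k : 0 <= far K k by rewrite mulr_ge0 // invr_ge0 exprn_ge0.
have dd i : `|half_diff u i - half_diff v i| = `|u%:R - v%:R|.
  by rewrite -normrN /half_diff; congr `|_|; ring.
pose cross i : R := ((i < u)%N (+) (i < v)%N)%:R * (4 * pi / `|u%:R - v%:R|).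
have cross0 i : 0 <= cross i by rewrite /cross mulr_ge0 // divr_ge0 // mulr_ge0 // ltW.
have step (i : nat) : column (half_diff u i) (half_diff v i) c c' n <=
    pi / 2 * near (4 * r)%N (line_dist u i) + pi / 2 * near (5 * r)%N (line_dist v i) +
    cross i + 72 * pi * (r%:R * far (4 * r)%N (line_dist u i)).
  have [kr|kr] := ltnP (line_dist u i) (4 * r)%N; last first.
    have h : 4 * r%:R <= `|half_diff u i|.
      rewrite half_diff_norm -natrM; apply: (@le_trans _ _ (line_dist u i)%:R); rewrite ?ler_nat //.
      by rewrite lerDl.
    apply: (le_trans (column_far n r1 _ hc h)); first by rewrite dd.
    rewrite /far kr mul1r -half_diff_norm real_normK ?num_real // -[X in X <= _]add0r lerD2r.
    by rewrite !addr_ge0 // mulr_ge0 // divr_ge0 // ltW.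
  have kr' : (line_dist v i < 5 * r)%N.
    rewrite -(ltr_nat R) -(ltrD2r 2^-1).
    have := ler_normD (half_diff u i) (half_diff v i - half_diff u i).
    rewrite addrCA subrr addr0 distrC dd !half_diff_norm.
    have : (line_dist u i)%:R + 1 <= (4 * r)%:R :> R by rewrite natr1 ler_nat.
    rewrite !natrM; lra.
  rewrite /near kr kr' !mul1r -!half_diff_norm -mulrDr.
  have F0 : 0 <= 72 * pi * (r%:R * far (4 * r)%N (line_dist u i)).
    by rewrite !mulr_ge0 // ltW.
  have [same|opp|e] := ltgtP 0 (half_diff u i * half_diff v i).
  - by apply: (le_trans (column_same c c' n same)); have := cross0 i; lra.
  - have -> : cross i = 4 * pi / `|half_diff u i - half_diff v i|.
      rewrite dd /cross; move: opp; rewrite -sgr_cp0 sgrM !half_diff_sg.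
      case: (i < u)%N; case: (i < v)%N => /=; rewrite ?mulrNN ?mulr1 ?mul1r // => /eqP; lra.
    by apply: (le_trans (column_opp c c' n opp)); lra.
  - by move/esym/eqP: e; rewrite mulf_eq0 !(negbTE (half_diff_neq0 _ _)).
apply: (@le_trans _ _ (\sum_(i < m) (pi / 2 * near (4 * r)%N (line_dist u i) +
    pi / 2 * near (5 * r)%N (line_dist v i) + cross i + 72 * pi * (r%:R * far (4 * r)%N (line_dist u i))))).
  by apply: ler_sum => i _; exact: step.
rewrite !big_split /= -!mulr_sumr.
have r4 : (0 < 4 * r)%N by rewrite muln_gt0.
have r5 : (0 < 5 * r)%N by rewrite muln_gt0.
have n1 := sum_line_dist u m (near0 _) (fun k => sum_near k r4).
have n2 := sum_line_dist v m (near0 _) (fun k => sum_near k r5).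
have n3 := sum_line_dist u m (far0 _) (fun k => sum_far k r4).
have n4 : \sum_(i < m) cross i <= 4 * pi.
  apply: (le_trans (sum_between u v m _)); first by rewrite divr_ge0 // mulr_ge0 // ltW.
  have [e|ne] := eqVneq (`|u%:R - v%:R| : R) 0; first by rewrite e mul0r mulr_ge0 // ltW.
  by rewrite mulrCA divff // mulr1.
have {}n3 : r%:R * \sum_(i < m) far (4 * r)%N (line_dist u i) <= 2^-1.
  have -> : 2^-1 = r%:R * (2 * (4 * r)%:R^-1) :> R by rewrite natrM; field; rewrite gt_eqF //; lra.
  by rewrite ler_wpM2l.
have l4 : ln (4 * r)%:R <= ln r%:R + 3 :> R.
  by rewrite natrM lnM ?posrE ?ltr0n //; have := @ln_le 4; lra.
have l5 : ln (5 * r)%:R <= ln r%:R + 4 :> R.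
  by rewrite natrM lnM ?posrE ?ltr0n //; have := @ln_le 5; lra.
have N1 : pi / 2 * \sum_(i < m) near (4 * r)%N (line_dist u i) <= pi / 2 * (2 * (3 + (ln r%:R + 3))).
  by rewrite ler_wpM2l ?divr_ge0 ?(ltW p0) // (le_trans n1) //; lra.
have N2 : pi / 2 * \sum_(i < m) near (5 * r)%N (line_dist v i) <= pi / 2 * (2 * (3 + (ln r%:R + 4))).
  by rewrite ler_wpM2l ?divr_ge0 ?(ltW p0) // (le_trans n2) //; lra.
have N3 : 72 * pi * (r%:R * \sum_(i < m) far (4 * r)%N (line_dist u i)) <= 72 * pi * 2^-1.
  by rewrite ler_wpM2l // mulr_ge0 // ltW.
lra.
Qed.

Definition flow u1 u2 i j : R := flux (half_diff u1 i) (j%:R - u2%:R).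

(** The fluxes through the dual square around a lattice point add up to the angle it subtends at the
    source: the eight arctangents pair up into quarter turns by [atan_sgV], which cancel unless the
    square contains the source. *)
Lemma flow_div u1 u2 i j :
  flow u1 u2 i.+1 j.+1 - flow u1 u2 i j.+1 + flow u2 u1 j.+1 i.+1 - flow u2 u1 j i.+1 =
  2 * pi * ((i.+1 == u1) && (j.+1 == u2))%:R.
Proof.
have s1 u k : k.+1%:R - u%:R + 2^-1 = half_diff u k.+1 :> R by [].
have s2 u k : k.+1%:R - u%:R - 2^-1 = half_diff u k :> R by rewrite /half_diff -natr1; field.
have d u k : Num.sg (half_diff u k.+1) - Num.sg (half_diff u k) = 2 * (k.+1 == u)%:R :> R.
  rewrite !half_diff_sg; have [<-|ne] := eqVneq k.+1 u; first by rewrite ltnn ltnSn mulr1; lra.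
  have -> : (k < u)%N = (k.+1 < u)%N by lia.
  by rewrite subrr mulr0.
rewrite /flow /flux !s1 !s2.
set a := half_diff u1 i.+1; set a' := half_diff u1 i; set b := half_diff u2 j.+1; set b' := half_diff u2 j.
have e1 := atan_sgV (half_diff_neq0 u1 i.+1) (half_diff_neq0 u2 j.+1).
have e2 := atan_sgV (half_diff_neq0 u1 i.+1) (half_diff_neq0 u2 j).
have e3 := atan_sgV (half_diff_neq0 u1 i) (half_diff_neq0 u2 j.+1).
have e4 := atan_sgV (half_diff_neq0 u1 i) (half_diff_neq0 u2 j).
have -> : 2 * pi * ((i.+1 == u1) && (j.+1 == u2))%:R =
    pi / 2 * ((Num.sg a - Num.sg a') * (Num.sg b - Num.sg b')) :> R.
  by rewrite !d -mulnb natrM; field.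
rewrite -/a -/a' -/b -/b' in e1 e2 e3 e4.
transitivity ((atan (b / a) + atan (a / b)) - (atan (b' / a) + atan (a / b'))
  - (atan (b / a') + atan (a' / b)) + (atan (b' / a') + atan (a' / b'))); first by ring.
by rewrite e1 e2 e3 e4; ring.
Qed.

Lemma green_diff_upper M (f : nat -> nat -> R) u1 u2 v1 v2 r : vanishing M f ->
  (u1 <= M.+1)%N -> (u2 <= M.+1)%N -> (v1 <= M.+1)%N -> (v2 <= M.+1)%N ->
  (forall i j, (i < M)%N -> (j < M)%N ->
    4 * f i.+1 j.+1 - (f i j.+1 + f i.+2 j.+1 + f i.+1 j + f i.+1 j.+2) =
    4 * charge u1 u2 v1 v2 i j) ->
  (0 < r)%N -> `|u1%:R - v1%:R| <= r%:R :> R -> `|u2%:R - v2%:R| <= r%:R :> R ->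
  f u1 u2 - f v1 v2 <= 4 / pi * (ln r%:R + 27).
Proof.
move=> f0 hu1 hu2 hv1 hv2 fL r0 d1 d2; have p0 := @pi_gt0 R.
pose H i j := (2 * pi)^-1 * (flow u1 u2 i j - flow v1 v2 i j).
pose V i j := (2 * pi)^-1 * (flow u2 u1 j i - flow v2 v1 j i).
have HV i j : (i < M)%N -> (j < M)%N ->
     H i.+1 j.+1 - H i j.+1 + V i.+1 j.+1 - V i.+1 j = charge u1 u2 v1 v2 i j.
  move=> _ _; rewrite /charge.
  have e1 := flow_div u1 u2 i j; have e2 := flow_div v1 v2 i j.
  transitivity ((2 * pi : R)^-1 * ((2 * pi * ((i.+1 == u1) && (j.+1 == u2))%:R) -
     (2 * pi * ((i.+1 == v1) && (j.+1 == v2))%:R))).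
    by rewrite -e1 -e2 /H /V; ring.
  by rewrite -mulrBr mulrA mulVf ?mul1r // gt_eqF // mulr_gt0.
apply: (le_trans (thomson_upper f0 hu1 hu2 hv1 hv2 fL HV)).
have E : edge_sum M (fun i j => H i j ^+ 2) (fun i j => V i j ^+ 2) = (2 * pi) ^- 2 *
   (\sum_(i < M.+1) column (half_diff u1 i) (half_diff v1 i) (u2%:R - 1) (v2%:R - 1) M +
    \sum_(j < M.+1) column (half_diff u2 j) (half_diff v2 j) (u1%:R - 1) (v1%:R - 1) M).
  have sh (k u : nat) : k.+1%:R - u%:R = k%:R - (u%:R - 1) :> R by rewrite -natr1; ring.
  rewrite /edge_sum [X in _ + X = _]exchange_big /= mulrDr !mulr_sumr.
  congr (_ + _); apply: eq_bigr => i _; rewrite mulr_sumr; apply: eq_bigr => j _;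
  by rewrite /H /V /flow !sh exprMn exprVn.
have c (a b : nat) : `|a%:R - b%:R| <= r%:R :> R -> `|(a%:R - 1) - (b%:R - 1)| <= r%:R :> R.
  by have -> : (a%:R - 1) - (b%:R - 1) = a%:R - b%:R :> R by ring.
have := sum_column M M.+1 r0 d1 (c _ _ d2); have := sum_column M M.+1 r0 d2 (c _ _ d1).
rewrite E; set x := \sum_(i < M.+1) _; set y := \sum_(i < M.+1) _ => hx hy.
have id (p l : R) : p != 0 -> 4 / p * (l + 27) = 4 * ((2 * p) ^- 2 * (2 * (2 * p * (l + 27)))).
  by move=> pn0; field.
rewrite id ?lt0r_neq0 // ler_pM2l // ler_wpM2l ?invr_ge0 ?exprn_ge0 ?mulr_ge0 ?(ltW p0) //; lra.
Qed.

End green_upper.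

(** * Lower bound for the increments: truncated logarithms *)

Section green_lower.
Context {R : realType}.
Implicit Types (u v i j n m K : nat) (q t c L : R).

Definition log_pot q t : R := ln (q + t ^+ 2) / 2.

(** The primitive, vanishing at 0, of the squared derivative of [log_pot]. *)
Definition log_energy q t : R := (atan (t / Num.sqrt q) / Num.sqrt q - t / (q + t ^+ 2)) / 2.

Lemma isd_log_pot q t : 0 < q -> is_derive t 1 (log_pot q) (t / (q + t ^+ 2)).
Proof.
move=> q0; have p (s : R) : 0 < q + s ^+ 2 by rewrite ltr_wpDr ?sqr_ge0.
have h := isdM (@isd_comp R (@ln R) (fun t => q + t ^+ 2) t _ _ (is_derive1_ln (p t))
  (isdD (isd_cst q t) (isdX 2 (isd_id t)))) (isd_cst 2^-1 t).
by apply: (is_derive_eq h); rewrite /= expr1; field; rewrite gt_eqF.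
Qed.

Lemma isd_log_energy q t : 0 < q -> is_derive t 1 (log_energy q) ((t / (q + t ^+ 2)) ^+ 2).
Proof.
move=> q0; have p (s : R) : 0 < q + s ^+ 2 by rewrite ltr_wpDr ?sqr_ge0.
have s0 : 0 < Num.sqrt q by rewrite sqrtr_gt0.
have qE : q = Num.sqrt q ^+ 2 by rewrite sqr_sqrtr // ltW.
have d1 : is_derive t 1 (fun t => q + t ^+ 2) (0 + 2%:R * t ^+ 1 * 1).
  exact: isdD (isd_cst q t) (isdX 2 (isd_id t)).
have d2 : is_derive t 1 (fun t => atan (t / Num.sqrt q)) ((1 + (t / Num.sqrt q) ^+ 2)^-1 *
    (t * 0 + (Num.sqrt q)^-1 * 1)).
  exact: (@isd_comp R (@atan R) (fun t => t / Num.sqrt q) t _ _ (isd_atan _)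
    (isdM (isd_id t) (isd_cst (Num.sqrt q)^-1 t))).
have h := isdM (isdD (isdM d2 (isd_cst (Num.sqrt q)^-1 t))
  (isdN (isdM (isd_id t) (@isdV R (fun t => q + t ^+ 2) t _ (lt0r_neq0 (p t)) d1)))) (isd_cst 2^-1 t).
apply: (is_derive_eq h); move: (p t) s0; rewrite {h d1 d2}.
set s := Num.sqrt q in qE *; rewrite qE => pt s0.
have n1 := lt0r_neq0 pt; have n2 := lt0r_neq0 s0.
have -> : 1 + (t / s) ^+ 2 = (s ^+ 2 + t ^+ 2) / s ^+ 2 by field.
rewrite invf_div; by field; rewrite n1 n2.
Qed.

Lemma log_energy0 q : log_energy q 0 = 0.
Proof. by rewrite /log_energy !mul0r atan0 mul0r subrr mul0r. Qed.

Lemma log_energyN q t : log_energy q (- t) = - log_energy q t.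
Proof. by rewrite /log_energy sqrrN mulNr atanN; ring. Qed.

Lemma log_energy_le q t : 0 < q -> log_energy q t <= pi / 4 / Num.sqrt q.
Proof.
move=> q0; have s0 : 0 < Num.sqrt q by rewrite sqrtr_gt0.
have p0 := @pi_gt0 R.
have [t0|t0] := leP t 0.
  apply: (@le_trans _ _ 0); last by rewrite !divr_ge0 // ltW.
  rewrite -(log_energy0 q); apply: (le_of_derive_ge0 t0 (fun t => isd_log_energy t q0)).
  by move=> s _; exact: sqr_ge0.
rewrite /log_energy.
have a : atan (t / Num.sqrt q) / Num.sqrt q <= pi / 2 / Num.sqrt q.
  by rewrite ler_pM2r ?invr_gt0 // ltW // atan_ltpi2.
have b : 0 <= t / (q + t ^+ 2) by rewrite divr_ge0 ?(ltW t0) // addr_ge0 ?sqr_ge0 // ltW.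
have -> : pi / 4 / Num.sqrt q = pi / 2 / Num.sqrt q / 2 by field; rewrite gt_eqF.
lra.
Qed.

Definition trunc_log L q t : R := Num.max 0 (L - log_pot q t).

Lemma trunc_log_contraction L q t t' : (trunc_log L q t' - trunc_log L q t) ^+ 2 <= (log_pot q t' - log_pot q t) ^+ 2.
Proof.
have -> : (log_pot q t' - log_pot q t) ^+ 2 = ((L - log_pot q t') - (L - log_pot q t)) ^+ 2 by ring.
rewrite /trunc_log; set a := L - log_pot q t'; set b := L - log_pot q t.
rewrite -[X in X <= _]real_normK ?num_real // -[X in _ <= X]real_normK ?num_real //.
rewrite lerXn2r ?nnegrE //.
have := ler_norm (a - b); have := ler_norm (- (a - b)); rewrite normrN => h1 h2.
by rewrite ler_norml; case: (leP 0 a); case: (leP 0 b) => ? ?; apply/andP; split; lra.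
Qed.

(** Truncation is a contraction; Cauchy-Schwarz then bounds each squared step by an increment of
    [log_energy], and the row telescopes. *)
Lemma trunc_log_row L q c n : 0 < q ->
  \sum_(i < n) (trunc_log L q (i.+1%:R - c) - trunc_log L q (i%:R - c)) ^+ 2 <= pi / 2 / Num.sqrt q.
Proof.
move=> q0; apply: (@le_trans _ _ (log_energy q (n%:R - c) - log_energy q (- c))).
  elim: n => [|n ih]; first by rewrite big_ord0 sub0r subrr.
  rewrite big_ord_recr /=.
  have h := trunc_log_contraction L q (n%:R - c) (n.+1%:R - c).
  have le : n%:R - c <= n.+1%:R - c by rewrite lerD2r ler_nat.
  have := cauchy_schwarz_increment le (fun t => isd_log_pot t q0) (fun t => isd_log_energy t q0).
  have -> : n.+1%:R - c - (n%:R - c) = 1 by rewrite -natr1; ring.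
  rewrite mul1r; lra.
have := log_energy_le (n%:R - c) q0; have := log_energy_le c q0; rewrite log_energyN.
have -> : pi / 2 / Num.sqrt q = pi / 4 / Num.sqrt q + pi / 4 / Num.sqrt q.
  by field; rewrite gt_eqF // sqrtr_gt0.
lra.
Qed.

Lemma trunc_log_eq0 K q t : (0 < K)%N -> K%:R ^+ 2 <= q + t ^+ 2 -> trunc_log (ln K%:R) q t = 0.
Proof.
move=> K0 h; apply/max_idPl; rewrite subr_le0 /log_pot ler_pdivlMr // mulr_natr.
rewrite -lnXn ?ltr0n // ler_ln ?posrE ?exprn_gt0 ?ltr0n //.
by apply: lt_le_trans h; rewrite exprn_gt0 ?ltr0n.
Qed.

Definition inv_norm K k : R := (k < K)%N%:R * (Num.sqrt (1 + k%:R ^+ 2))^-1.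

Lemma inv_norm_ge0 K k : 0 <= inv_norm K k.
Proof. by rewrite mulr_ge0 // invr_ge0 sqrtr_ge0. Qed.

Lemma sum_inv_norm K m : (0 < K)%N -> \sum_(k < m) inv_norm K k <= 3 + ln K%:R.
Proof.
move=> K0; apply: (@le_trans _ _ (\sum_(k < K) (Num.sqrt (1 + k%:R ^+ 2))^-1)).
  have h k : 0 <= (Num.sqrt (1 + k%:R ^+ 2 : R))^-1 by rewrite invr_ge0 sqrtr_ge0.
  elim: m => [|m ih]; first by rewrite big_ord0 sumr_ge0.
  have [mK|Km] := ltnP m K.
    apply: (@le_trans _ _ (\sum_(k < m.+1) (Num.sqrt (1 + k%:R ^+ 2))^-1)).
      by apply: ler_sum => k _; rewrite /inv_norm; case: ltnP => _; rewrite ?mul1r ?mul0r.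
    rewrite -(subnKC mK) [X in _ <= X]big_split_ord /= lerDl sumr_ge0 //.
  by rewrite big_ord_recr /= /inv_norm ltnNge Km mul0r addr0.
apply: (@le_trans _ _ (3 + ln K%:R - K%:R^-1)); last by rewrite gerBl.
elim: K K0 => // -[_ _|n /(_ isT) ih _].
  by rewrite big_ord1 ln1 expr0n addr0 sqrtr1 invr1; lra.
rewrite big_ord_recr /=; apply: (le_trans (lerD ih (lexx _))).
have [x xE] : exists x : R, x = n.+1%:R by exists n.+1%:R.
have x0 : 0 < x by rewrite xE.
rewrite -[n.+2%:R]natr1 -xE.
have l : (x + 1)^-1 <= ln (x + 1) - ln x.
  have : ln (1 + (- (x + 1)^-1)) <= - (x + 1)^-1.
    by apply: le_ln1Dx; rewrite ltrN2 invf_lt1 ?ltrDr //; lra.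
  have -> : 1 - (x + 1)^-1 = x / (x + 1) by field; rewrite gt_eqF //; lra.
  by rewrite ln_div ?posrE //; lra.
have e : (Num.sqrt (1 + x ^+ 2))^-1 <= x^-1.
  rewrite lef_pV2 ?posrE ?sqrtr_gt0 //; last by rewrite ltr_pwDl // sqr_ge0.
  by rewrite -[X in X <= _](ger0_norm (ltW x0)) -sqrtr_sqr ler_wsqrtr // lerDr.
lra.
Qed.

Section one_bump.
Variables (K u1 u2 : nat).
Hypothesis K0 : (0 < K)%N.

(** The positive part of ln K - ln (1 + |x|^2) / 2, x being the position relative to (u1, u2). The 1
    removes the singularity at the centre, and the function is 0 beyond distance K. *)
Definition log_bump i j : R := trunc_log (ln K%:R) (1 + (j%:R - u2%:R) ^+ 2) (i%:R - u1%:R).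

Lemma log_bumpC i j : log_bump i j = trunc_log (ln K%:R) (1 + (i%:R - u1%:R) ^+ 2) (j%:R - u2%:R).
Proof. by rewrite /log_bump /trunc_log /log_pot; congr (Num.max _ (_ - ln _ / _)); ring. Qed.

Lemma log_bump_center : log_bump u1 u2 = ln K%:R.
Proof.
rewrite /log_bump /trunc_log /log_pot !subrr expr0n !addr0 ln1 mul0r subr0.
by apply/max_idPr; rewrite ln_ge0 // ler1n.
Qed.

Lemma log_bump_eq0 i j : K%:R <= `|i%:R - u1%:R : R| \/ K%:R <= `|j%:R - u2%:R : R| -> log_bump i j = 0.
Proof.
move=> h; apply: trunc_log_eq0 => //.
have s1 := sqr_ge0 (i%:R - u1%:R : R); have s2 := sqr_ge0 (j%:R - u2%:R : R).
have sq (x : R) : K%:R <= `|x| -> K%:R ^+ 2 <= x ^+ 2.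
  by move=> hx; rewrite -[x ^+ 2]real_normK ?num_real // lerXn2r ?nnegrE.
by case: h => /sq; lra.
Qed.

End one_bump.

Lemma norm_line_dist u i : (line_dist u i)%:R <= `|i%:R - u%:R : R|.
Proof.
rewrite /line_dist; case: ltnP => h.
  rewrite distrC -natrB ?(ltnW h) // ger0_norm // ler_nat; lia.
by rewrite -natrB // ger0_norm.
Qed.

Lemma row_le K u c j n : (0 < K)%N ->
  \sum_(i < n) (trunc_log (ln K%:R) (1 + (j%:R - u%:R) ^+ 2) (i.+1%:R - c) -
    trunc_log (ln K%:R) (1 + (j%:R - u%:R) ^+ 2) (i%:R - c)) ^+ 2 <= pi / 2 * inv_norm K (line_dist u j).
Proof.
move=> K0; have p0 := @pi_gt0 R; have ld := norm_line_dist u j.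
have sq : `|j%:R - u%:R| ^+ 2 = (j%:R - u%:R) ^+ 2 :> R by rewrite real_normK ?num_real.
have [h|h] := leP K%:R `|j%:R - u%:R : R|.
  rewrite big1 ?mulr_ge0 ?inv_norm_ge0 // ?invr_ge0 ?(ltW p0) // => i _.
  have h2 : K%:R ^+ 2 <= (j%:R - u%:R) ^+ 2 :> R by rewrite -sq lerXn2r ?nnegrE.
  rewrite !trunc_log_eq0 ?subrr ?expr0n //;
    [have := sqr_ge0 (i%:R - c)|have := sqr_ge0 (i.+1%:R - c)]; lra.
have q0 : 0 < 1 + (j%:R - u%:R) ^+ 2 :> R by rewrite ltr_pwDl // sqr_ge0.
apply: (le_trans (trunc_log_row _ c n q0)); rewrite /inv_norm.
have -> : (line_dist u j < K)%N by rewrite -(ltr_nat R); apply: le_lt_trans h.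
rewrite mul1r ler_wpM2l ?divr_ge0 ?(ltW p0) //.
have q1 : 0 < 1 + (line_dist u j)%:R ^+ 2 :> R by rewrite ltr_pwDl // sqr_ge0.
rewrite lef_pV2 ?posrE ?sqrtr_gt0 // ler_wsqrtr // lerD2l -sq lerXn2r ?nnegrE //.
Qed.

Lemma sum_row K u n : (0 < K)%N -> \sum_(j < n) pi / 2 * inv_norm K (line_dist u j.+1) <= pi * (3 + ln K%:R).
Proof.
move=> K0; have p0 := @pi_gt0 R.
rewrite -mulr_sumr; have h := sum_line_dist u n.+1 (inv_norm_ge0 K) (fun m => sum_inv_norm m K0).
have -> : pi * (3 + ln K%:R) = pi / 2 * (2 * (3 + ln K%:R)) :> R by field.
rewrite ler_wpM2l ?divr_ge0 ?(ltW p0) //; apply: le_trans h.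
by rewrite big_ord_recl lerDr inv_norm_ge0.
Qed.

Lemma log_bump_energy M K u1 u2 : (0 < K)%N ->
  energy M (log_bump K u1 u2) <= 2 * pi * (3 + ln K%:R).
Proof.
move=> K0; rewrite /energy /edge_sum exchange_big /=.
have -> : 2 * pi * (3 + ln K%:R) = pi * (3 + ln K%:R) + pi * (3 + ln K%:R) :> R by ring.
apply: lerD.
  apply: le_trans (sum_row u2 M K0); apply: ler_sum => j _.
  exact: row_le.
apply: le_trans (sum_row u1 M K0); apply: ler_sum => i _.
rewrite /gradv; under eq_bigr do rewrite !log_bumpC.
exact: row_le.
Qed.

(** Ensures that no edge meets the supports of both bumps, so that their energies add. *)
Lemma far_pair (k u v x : R) : 2 * k + 1 <= `|u - v| ->
  (k <= `|x - u| /\ k <= `|x + 1 - u|) \/ (k <= `|x - v| /\ k <= `|x + 1 - v|).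
Proof.
have right_of (a y : R) : k <= y - a -> k <= `|y - a| by move=> h; apply: le_trans (ler_norm _).
have left_of (a y : R) : k <= a - y -> k <= `|y - a|.
  by move=> h; rewrite distrC; apply: le_trans (ler_norm _).
rewrite ler_normr => /orP[] h.
  have [h1|h1] := leP k (x - v); first by right; split; apply: right_of; lra.
  by left; split; apply: left_of; lra.
have [h1|h1] := leP k (x - u); first by left; split; apply: right_of; lra.
by right; split; apply: left_of; lra.
Qed.

(** The test function is the bump at u minus the bump at v: with L = ln K its difference is 2 L and
    its energy at most 4 pi (3 + L). Dirichlet's principle gives 4 L^2 / (pi (3 + L)), and L^2 >= (L
    - 3)(L + 3). *)
Lemma green_diff_lower M (f : nat -> nat -> R) u1 u2 v1 v2 K : vanishing M f ->
  (forall i j, (i < M)%N -> (j < M)%N ->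
    4 * f i.+1 j.+1 - (f i j.+1 + f i.+2 j.+1 + f i.+1 j + f i.+1 j.+2) =
    4 * charge u1 u2 v1 v2 i j) ->
  (1 < K)%N ->
  (K <= u1)%N -> (u1 + K <= M.+1)%N -> (K <= u2)%N -> (u2 + K <= M.+1)%N ->
  (K <= v1)%N -> (v1 + K <= M.+1)%N -> (K <= v2)%N -> (v2 + K <= M.+1)%N ->
  2 * K%:R + 1 <= `|u1%:R - v1%:R : R| \/ 2 * K%:R + 1 <= `|u2%:R - v2%:R : R| ->
  4 / pi * (ln K%:R - 3) <= f u1 u2 - f v1 v2.
Proof.
move=> f0 fL K1 a1 a2 a3 a4 b1 b2 b3 b4 sep; have p0 := @pi_gt0 R.
have K0 := ltnW K1.
pose a := log_bump K u1 u2; pose b := log_bump K v1 v2.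
pose g i j : R := a i j - b i j.
have far (x y : nat) : (x + K <= y)%N -> K%:R <= `|x%:R - y%:R : R| /\ K%:R <= `|y%:R - x%:R : R|.
  move=> h; have : K%:R + x%:R <= y%:R :> R by rewrite -natrD ler_nat addnC.
  rewrite [`|x%:R - _|]distrC => ?.
  by have := ler_norm (y%:R - x%:R : R); split; lra.
have g0 : vanishing M g.
  split=> i; rewrite /g /a /b !log_bump_eq0 ?subrr //;
   try (by left; case: (@far 0%N u1) => //; case: (@far u1 M.+1));
   try (by left; case: (@far 0%N v1) => //; case: (@far v1 M.+1));
   try (by right; case: (@far 0%N u2) => //; case: (@far u2 M.+1));
   by right; case: (@far 0%N v2) => //; case: (@far v2 M.+1).
have lK : 0 < ln K%:R :> R by rewrite ln_gt0 // ltr1n.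
pose E : R := 4 * pi * (3 + ln K%:R).
have E0 : 0 < E by rewrite /E !mulr_gt0 //; lra.
have sepK : K%:R <= `|u1%:R - v1%:R : R| \/ K%:R <= `|u2%:R - v2%:R : R|.
  have k0 : 0 <= K%:R :> R by [].
  by case: sep => h; [left|right]; lra.
have zh i j : (a i j = 0 /\ a i.+1 j = 0) \/ (b i j = 0 /\ b i.+1 j = 0).
  case: sep => /far_pair h.
    have [[h1 h2]|[h1 h2]] := h i%:R; [left|right];
    by split; apply: log_bump_eq0 => //; left; rewrite -?natr1.
  have [[h1 h2]|[h1 h2]] := h j%:R; [left|right];
  by split; apply: log_bump_eq0 => //; right.
have zv i j : (a i j = 0 /\ a i j.+1 = 0) \/ (b i j = 0 /\ b i j.+1 = 0).
  case: sep => /far_pair h; last first.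
    have [[h1 h2]|[h1 h2]] := h j%:R; [left|right];
    by split; apply: log_bump_eq0 => //; right; rewrite -?natr1.
  have [[h1 h2]|[h1 h2]] := h i%:R; [left|right];
  by split; apply: log_bump_eq0 => //; left.
have gE : energy M g <= E.
  have -> : E = 2 * pi * (3 + ln K%:R) + 2 * pi * (3 + ln K%:R) by rewrite /E; ring.
  apply: le_trans (lerD (log_bump_energy M u1 u2 K0) (log_bump_energy M v1 v2 K0)).
  rewrite /energy -edge_sumD; apply: ler_edge_sum => i j; rewrite -/a -/b.
    rewrite /gradh /g; case: (zh i j) => -[-> ->]; lra.
  rewrite /gradv /g; case: (zv i j) => -[-> ->]; lra.
have := @dirichlet_lower _ M f u1 u2 v1 v2 f0 _ _ _ _ fL g E g0 gE E0.
have -> : g u1 u2 = ln K%:R.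
  by rewrite /g /a log_bump_center // /b log_bump_eq0 ?subr0.
have -> : g v1 v2 = - ln K%:R.
  rewrite /g /b log_bump_center // /a log_bump_eq0 ?sub0r //.
  by move: sepK; rewrite distrC [X in _ \/ _ <= X]distrC.
have h4 : (u1 <= M.+1)%N /\ (u2 <= M.+1)%N /\ (v1 <= M.+1)%N /\ (v2 <= M.+1)%N by lia.
case: h4 => ? [? [? ?]] /(_ _ _ _ _)h; apply: le_trans (h _ _ _ _) => //.
rewrite /E; move: (ln K%:R) lK => L L0.
have id (p : R) : p != 0 -> 4 * (L - - L) ^+ 2 / (4 * p * (3 + L)) - 4 / p * (L - 3) = 36 / (p * (3 + L)).
  by move=> pn0; field; rewrite pn0 /= gt_eqF //; lra.
by rewrite -subr_ge0 id ?lt0r_neq0 // divr_ge0 // mulr_ge0 ?(ltW p0) //; lra.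
Qed.

End green_lower.

(** * The covariance of the free field as a potential *)

Section gff_covariance.
Context {R : realType}.

Definition gcov (N : nat) (x y : 'I_N * 'I_N) : R := fine (green_fun (R := R) N (Defs.point x) (Defs.point y)).

Section field.
Context dW (W : measurableType dW) (Q : int * int -> probability W R) (w : nat -> W -> int * int).
Hypothesis Qw : forall x, is_srw (Q x) w x.
Variable N : nat.
Context d (T : measurableType d) (P : probability T R) (X : 'I_N * 'I_N -> {RV P >-> R}).
Hypothesis gffX : is_gff Q w X.

Let second (x y : 'I_N * 'I_N) : itg P (fun o => X x o * X y o) ->
  green_fun N (Defs.point x) (Defs.point y) = (\int[P]_o (X x o * X y o))%:E.
Proof.
move=> i; have [_ _ h] := gffX.
rewrite -(green_series _ _ (Qw (Defs.point x))) -h unlock /Rintegral fineK //.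
exact: integrable_fin_num.
Qed.

(** Finiteness of the Green function comes from the field: it is the expectation of a product of
    Gaussian variables, which is integrable. *)
Lemma gff_isG : isG P (fun z => X z : T -> R) (@gcov N) /\
  forall x y : 'I_N * 'I_N, green_fun (R := R) N (Defs.point x) (Defs.point y) \is a fin_num.
Proof.
have [G E _] := gffX.
have [h1 h2] := gaussian_field_isG (C := @gcov N) G E (fun x y i => esym (congr1 fine (second i))).
by split=> // x y; rewrite second.
Qed.

End field.

Section grid.
Variable N : nat.
Hypothesis N1 : (1 < N)%N.
Hypothesis fin : forall x y : 'I_N * 'I_N, green_fun (R := R) N (Defs.point x) (Defs.point y) \is a fin_num.

(** [vanishing] quantifies over all of [nat], hence the value 0 outside the box; with M = [N.-2] the
    grid [0, M + 1]^2 is the box of the field. *)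
Let gf (u : 'I_N * 'I_N) (i j : nat) : R :=
  if (i < N)%N && (j < N)%N then fine (green_fun (R := R) N (i%:Z, j%:Z) (Defs.point u)) else 0.

Let gfE u (x : 'I_N * 'I_N) : gf u (x.1 : nat) (x.2 : nat) = gcov x u.
Proof. by rewrite /gf !ltn_ord. Qed.

Let gf_fin u i j : (i < N)%N -> (j < N)%N -> green_fun (R := R) N (i%:Z, j%:Z) (Defs.point u) = (gf u i j)%:E.
Proof.
by move=> hi hj; rewrite /gf hi hj /= fineK //; exact: (fin (Ordinal hi, Ordinal hj) u).
Qed.

Let gf_vanishing u : vanishing N.-2 (gf u).
Proof.
have b i j : (i < N)%N -> (j < N)%N -> [|| i == 0, j == 0, i == N.-1 | j == N.-1]%N ->
    box_boundary N (i%:Z, j%:Z).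
  by rewrite /box_boundary /box /box_interior /=; lia.
by split=> k; rewrite /gf; case: ifP => // /andP[h1 h2]; rewrite green_fun_boundary //; apply: b => //; lia.
Qed.

Let gf_harmonic u i j : (i < N.-2)%N -> (j < N.-2)%N ->
  4 * gf u i.+1 j.+1 - (gf u i j.+1 + gf u i.+2 j.+1 + gf u i.+1 j + gf u i.+1 j.+2) =
  4 * ((i.+1 == u.1) && (j.+1 == u.2))%:R.
Proof.
move=> hi hj; have := @green_fun_inner R N (i.+1%:Z, j.+1%:Z) (Defs.point u).
have b : ~~ box_boundary N (i.+1%:Z, j.+1%:Z).
  by rewrite /box_boundary /box /box_interior /=; lia.
move=> /(_ b).
have sum4 (F : bool * bool -> \bar R) : (\sum_e F e = (F (true, true) + F (true, false)) +
    (F (false, true) + F (false, false)))%E.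
  rewrite (eq_bigr (fun e => F (e.1, e.2))); last by case.
  by rewrite -(pair_bigA _ (fun a c => F (a, c))) /= !big_bool.
rewrite sum4 /shift /=.
have -> : i.+1%:Z + 0 = i.+1 by lia.
have -> : j.+1%:Z + 0 = j.+1 by lia.
have -> : i.+1%:Z + 1 = i.+2 by lia.
have -> : j.+1%:Z + 1 = j.+2 by lia.
have -> : i.+1%:Z + - 1 = i by lia.
have -> : j.+1%:Z + - 1 = j by lia.
rewrite !gf_fin; try lia.
have -> : ((i.+1%:Z, j.+1%:Z) == Defs.point u) = (i.+1 == u.1) && (j.+1 == u.2).
  by rewrite /Defs.point xpair_eqE !eqz_nat.
by rewrite -!EFinD => -[->]; field.
Qed.

Section pair.
Variables u v : 'I_N * 'I_N.

Let f i j : R := gf u i j - gf v i j.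

Let f_vanishing : vanishing N.-2 f.
Proof.
have [a1 a2 a3 a4] := gf_vanishing u; have [b1 b2 b3 b4] := gf_vanishing v.
by split=> k; rewrite /f ?a1 ?a2 ?a3 ?a4 ?b1 ?b2 ?b3 ?b4 subrr.
Qed.

Let f_harmonic i j : (i < N.-2)%N -> (j < N.-2)%N ->
    4 * f i.+1 j.+1 - (f i j.+1 + f i.+2 j.+1 + f i.+1 j + f i.+1 j.+2) =
    4 * charge u.1 u.2 v.1 v.2 i j.
Proof.
move=> hi hj; have := gf_harmonic u hi hj; have := gf_harmonic v hi hj.
by rewrite /f /charge; lra.
Qed.

Let f_diff : f u.1 u.2 - f v.1 v.2 = qdist (@gcov N) u v.
Proof. by rewrite /f !gfE /qdist; ring. Qed.

Let bnd (k : 'I_N) : (k <= N.-2.+1)%N.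
Proof. by have := ltn_ord k; lia. Qed.

Lemma gcov_upper r : (0 < r)%N ->
  `|(u.1 : nat)%:R - (v.1 : nat)%:R| <= r%:R :> R -> `|(u.2 : nat)%:R - (v.2 : nat)%:R| <= r%:R :> R ->
  qdist (@gcov N) u v <= 4 / pi * (ln r%:R + 27).
Proof.
by rewrite -f_diff; apply: (green_diff_upper f_vanishing _ _ _ _ f_harmonic).
Qed.

Lemma gcov_lower K : (1 < K)%N ->
  (K <= u.1)%N -> (u.1 + K < N)%N -> (K <= u.2)%N -> (u.2 + K < N)%N ->
  (K <= v.1)%N -> (v.1 + K < N)%N -> (K <= v.2)%N -> (v.2 + K < N)%N ->
  2 * K%:R + 1 <= `|(u.1 : nat)%:R - (v.1 : nat)%:R : R| \/ 2 * K%:R + 1 <= `|(u.2 : nat)%:R - (v.2 : nat)%:R : R| ->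
  4 / pi * (ln K%:R - 3) <= qdist (@gcov N) u v.
Proof.
rewrite -f_diff => K1 *; apply: (green_diff_lower f_vanishing f_harmonic K1) => //; lia.
Qed.

End pair.
End grid.
End gff_covariance.

(** * Comparison of the free field with branching random walks *)

Section tree_embedding.
Context {R : realType}.
(* A box of side [tree_len l.+1] contains four boxes of side [tree_len l] in its
   corners, separated by corridors of width [w l]. *)
Variable w : nat -> nat.

Fixpoint tree_len (l : nat) : nat := if l is l'.+1 then ((tree_len l').*2 + w l')%N else 1%N.

Fixpoint tree_pos (l : nat) : leaf l -> nat * nat :=
  match l with
  | 0 => fun _ => (0, 0)%N
  | l'.+1 => fun x => ((x.1 * (tree_len l' + w l') + (tree_pos x.2.2).1)%N,
                       (x.2.1 * (tree_len l' + w l') + (tree_pos x.2.2).2)%N)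
  end.

Lemma tree_len_ge l k : (k <= l)%N -> (tree_len k <= tree_len l)%N.
Proof.
elim: l => [|l ih]; first by rewrite leqn0 => /eqP ->.
rewrite leq_eqVlt => /predU1P[->//|]; rewrite ltnS => /ih /= h; lia.
Qed.

Lemma tree_pos_lt l (x : leaf l) : ((tree_pos x).1 < tree_len l)%N /\ ((tree_pos x).2 < tree_len l)%N.
Proof.
elim: l x => [//|l ih] [b [b' x]] /=; have [] := ih x.
by case: b; case: b'; rewrite ?mul1n ?mul0n; split; lia.
Qed.

Definition ndist (a b : nat) : nat := ((a - b) + (b - a))%N.

Lemma ndistE a b : `|a%:R - b%:R : R| = (ndist a b)%:R.
Proof.
rewrite /ndist; have [h|h] := leqP a b.
  by rewrite (eqP h) add0n natrB // distrC ger0_norm // subr_ge0 ler_nat.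
have h' := ltnW h; rewrite [X in (_ + X)%N](eqP h') addn0 natrB // ger0_norm // subr_ge0 ler_nat //.
Qed.

(* [h.+1] is the height of the smallest subtree containing both leaves. *)
Lemma tree_split (rho : R) (s : nat -> R) l (x y : leaf l) : x != y -> exists h : nat,
  [/\ (h < l)%N, qdist (@tcov _ rho s l) x y = 2 * (rho + \sum_(k < h.+1) s k),
      (ndist (tree_pos x).1 (tree_pos y).1 < tree_len h.+1)%N,
      (ndist (tree_pos x).2 (tree_pos y).2 < tree_len h.+1)%N &
      (w h < ndist (tree_pos x).1 (tree_pos y).1)%N \/ (w h < ndist (tree_pos x).2 (tree_pos y).2)%N].
Proof.
have diag l' (z : leaf l') : tcov rho s z z = rho + \sum_(k < l') s k.
  elim: l' z => [z|l' ih z] /=; first by rewrite big_ord0 addr0.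
  by rewrite !eqxx !mul1r ih big_ord_recr /=; ring.
elim: l x y => [[] []//|l ih] [b1 [b2 x]] [c1 [c2 y]] nxy.
have [e|ne] := boolP ((b1 == c1) && (b2 == c2)).
  move/andP: e nxy => [/eqP -> /eqP ->] nxy.
  have {}nxy : x != y by apply: contraNneq nxy => ->.
  have [h [hl hq h1 h2 h3]] := ih _ _ nxy; exists h; split => //=.
  - by rewrite leqW.
  - by rewrite -hq /qdist /= !eqxx !mul1r; ring.
  - by rewrite /ndist !subnDl; exact: h1.
  - by rewrite /ndist !subnDl; exact: h2.
  - by rewrite /ndist !subnDl; exact: h3.
exists l; have [x1 x2] := tree_pos_lt x; have [y1 y2] := tree_pos_lt y; split => //=.
- have z (a : R) : (b1 == c1)%:R * ((b2 == c2)%:R * a) = 0.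
    by rewrite mulrA -natrM mulnb (negbTE ne) mul0r.
  have z1 : tcov rho s (l := l.+1) (b1, (b2, x)) (c1, (c2, y)) = 0 by exact: z.
  have z2 : tcov rho s (l := l.+1) (c1, (c2, y)) (b1, (b2, x)) = 0.
    by rewrite /= eq_sym [c2 == b2]eq_sym z.
  have q4 (S p q r t : R) : p = S -> q = S -> r = 0 -> t = 0 -> p + q - r - t = 2 * S.
    by move=> -> -> -> ->; ring.
  by apply: q4 => //; exact: (diag l.+1).
- by move: x1 y1; rewrite /ndist; case: b1 {ne nxy}; case: c1 => /=; rewrite ?mul1n ?mul0n; lia.
- by move: x2 y2; rewrite /ndist; case: b2 {ne nxy}; case: c2 => /=; rewrite ?mul1n ?mul0n; lia.
- move: ne x1 y1 x2 y2; rewrite /ndist {nxy}.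
  by case: b1; case: c1; case: b2; case: c2 => //= _; rewrite ?mul1n ?mul0n; lia.
Qed.

End tree_embedding.

Section upper_bound.
Context {R : realType}.

Lemma tree_len0 l : tree_len (fun=> 0%N) l = (2 ^ l)%N.
Proof. by elim: l => //= l ->; rewrite addn0 expnS mul2n. Qed.

(** The inverse of [tree_pos] without corridors: the bits are the binary digits of the two
    coordinates. *)
Fixpoint cell (l : nat) (i j : nat) : leaf l :=
  match l with
  | 0 => tt
  | l'.+1 => ((2 ^ l' <= i)%N, ((2 ^ l' <= j)%N,
      cell l' (i - (2 ^ l' <= i)%N * 2 ^ l')%N (j - (2 ^ l' <= j)%N * 2 ^ l')%N))
  end.

Lemma cell_pos l i j : (i < 2 ^ l)%N -> (j < 2 ^ l)%N -> tree_pos (fun=> 0%N) (cell l i j) = (i, j).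
Proof.
elim: l i j => [|l ih] i j /=; first by case: i; case: j.
rewrite expnS => hi hj; rewrite ih /= ?tree_len0 ?addn0; last first.
- by case: leqP => /=; rewrite ?mul1n ?mul0n; lia.
- by case: leqP => /=; rewrite ?mul1n ?mul0n; lia.
by congr pair; case: leqP => /=; rewrite ?mul1n ?mul0n; lia.
Qed.

End upper_bound.

(** * Critical constants and the bounds for the expected maximum *)

Section constants.
Context {R : realType}.

(** The solution lam of lam^2 v / 2 = ln 4 for the step variance v = (2 / pi) ln 2; the critical
    branching walk then has speed lam v and logarithmic correction 3 / (2 lam). *)
Definition tilt : R := Num.sqrt (2 * pi).
Definition step_var : R := 2 / pi * ln 2.

Lemma tilt_gt0 : 0 < tilt.
Proof. by rewrite sqrtr_gt0 mulr_gt0 // pi_gt0. Qed.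

Lemma tilt_sqr : tilt ^+ 2 = 2 * pi.
Proof. by rewrite sqr_sqrtr // mulr_ge0 // ltW // pi_gt0. Qed.

Lemma tilt_ge2 : 2 <= tilt.
Proof.
have p : 2 <= pi :> R by exact: pi_ge2.
rewrite -[2](ger0_norm (ler0n _ 2)) -sqrtr_sqr ler_wsqrtr //; lra.
Qed.

Lemma ln2_gt0 : 0 < ln 2 :> R.
Proof. by rewrite ln_gt0 // ltr1n. Qed.

Lemma step_var_gt0 : 0 < step_var.
Proof. by rewrite mulr_gt0 ?ln2_gt0 // divr_gt0 // pi_gt0. Qed.

Lemma tilt_step_var : expR (tilt ^+ 2 * step_var / 2) = 4.
Proof.
rewrite tilt_sqr /step_var; have p := @pi_gt0 R.
have -> : 2 * pi * (2 / pi * ln 2) / 2 = ln 2 + ln 2 :> R.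
  by move: (pi : R) p => q q0; field; rewrite gt_eqF.
by rewrite expRD lnK ?posrE // -natrM.
Qed.

Lemma tiltE : tilt = pi * Num.sqrt (2 / pi).
Proof.
have p := @pi_gt0 R.
rewrite -[X in X * _](ger0_norm (ltW p)) -sqrtr_sqr -sqrtrM ?sqr_ge0 //; congr Num.sqrt.
by move: (pi : R) p => q q0; field; rewrite gt_eqF.
Qed.

Lemma speedE : tilt * step_var = 2 * Num.sqrt (2 / pi) * ln 2.
Proof.
rewrite tiltE /step_var; move: (Num.sqrt _) (ln 2) => a b; have := @pi_gt0 R.
by move: (pi : R) => q q0; field; rewrite gt_eqF.
Qed.

Lemma correctionE : 3 / (2 * tilt) = 3 / 4 * Num.sqrt (2 / pi).
Proof.
have t0 := tilt_gt0; have p := @pi_gt0 R.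
have e : Num.sqrt (2 / pi) * tilt = 2 :> R.
  transitivity (tilt ^+ 2 / pi : R); last by rewrite tilt_sqr mulfK // gt_eqF.
  rewrite expr2 tiltE; move: (Num.sqrt _) p => a; move: (pi : R) => q q0.
  by field; rewrite gt_eqF.
have -> : 3 / 4 * Num.sqrt (2 / pi) = 3 / 4 * (Num.sqrt (2 / pi) * tilt) / tilt by field; rewrite gt_eqF.
by rewrite e; field; rewrite gt_eqF.
Qed.

End constants.

Section expected_maximum.
Context {R : realType}.

Lemma max_le_tail_upper d (T : measurableType d) (P : probability T R) (I J : finType) (i0 : I)
    (phi : I -> J) (Y : J -> T -> R) (F : R -> R) (a C th : R) :
  (forall j, itg P (Y j)) -> (forall t, P (sublevel Y t) = (F t)%:E) -> 0 <= C -> 0 < th ->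
  (forall k : nat, 1 - F (a + k%:R) <= C * expR (- th * k%:R)) ->
  \int[P]_o maxf (fun i => Y (phi i) o) <= a + 1 + C / (1 - expR (- th)).
Proof.
move=> iY FY C0 th0 tail.
have iM : itg P (fun o => maxf (fun i => Y (phi i) o)).
  by apply: (itg_lips (maxf_lips i0)) => i; exact: iY.
have := @expectation_le_tail _ _ _ P (fun o => maxf (fun i => Y (phi i) o) - a) C th _ C0 th0.
rewrite (RintegralB measurableT iM (itg_cst P a)) Rintegral_probability_cst => h.
suff : \int[P]_o maxf (fun i => Y (phi i) o) - a <= 1 + C / (1 - expR (- th)) by lra.
apply: h; first by apply: itgB => //; exact: itg_cst.
move=> k; apply: le_trans (tail k).
have mS t : measurable (sublevel Y t).
  by apply: measurable_sublevel => j; exact: itg_measurable (iY j).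
have -> : 1 - F (a + k%:R) = fine (P (~` sublevel Y (a + k%:R))).
  by rewrite probability_setC // FY.
have mM : measurable_fun setT (fun o => maxf (fun i => Y (phi i) o)) := itg_measurable iM.
have mA : measurable [set o | k%:R < maxf (fun i => Y (phi i) o) - a].
  have -> : [set o | k%:R < maxf (fun i => Y (phi i) o) - a] =
      (fun o => maxf (fun i => Y (phi i) o)) @^-1` `]a + k%:R, +oo[%classic.
    by apply/seteqP; split => o /=; rewrite in_itv /= andbT; lra.
  by rewrite -[X in measurable X]setTI; exact: mM.
have mB : measurable (~` sublevel Y (a + k%:R)) by exact: measurableC.
apply: fine_le; rewrite ?fin_num_measure //.
apply: le_measure; rewrite ?inE // => o /= h1 h2.
have [_ [i e]] := maxfP i0 (fun i => Y (phi i) o).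
by move: h1; rewrite e; have := h2 (phi i); lra.
Qed.

Lemma max_ge_tail_lower d (T : measurableType d) (P : probability T R) (I : finType) (i0 : I)
    (Y : I -> T -> R) (F : R -> R) (a th : R) :
  (forall j, itg P (Y j)) -> (forall t, P (sublevel Y t) = (F t)%:E) -> 0 < th ->
  (forall k : nat, F (a - k%:R) <= expR (- th * k%:R)) ->
  a - 1 - (1 - expR (- th))^-1 <= \int[P]_o maxf (fun i => Y i o).
Proof.
move=> iY FY th0 tail.
have iM : itg P (fun o => maxf (fun i => Y i o)) by apply: (itg_lips (maxf_lips i0)).
have := @expectation_le_tail _ _ _ P (fun o => a - maxf (fun i => Y i o)) 1 th _ ler01 th0.
rewrite (RintegralB measurableT (itg_cst P a) iM) Rintegral_probability_cst => h.
suff : a - \int[P]_o maxf (fun i => Y i o) <= 1 + 1 / (1 - expR (- th)) by rewrite mul1r; lra.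
apply: h; first by apply: itgB => //; exact: itg_cst.
move=> k; rewrite mul1r; apply: le_trans (tail k).
have mS t : measurable (sublevel Y t).
  by apply: measurable_sublevel => j; exact: itg_measurable (iY j).
have -> : F (a - k%:R) = fine (P (sublevel Y (a - k%:R))) by rewrite FY.
have mM : measurable_fun setT (fun o => maxf (fun i => Y i o)) := itg_measurable iM.
have mA : measurable [set o | k%:R < a - maxf (fun i => Y i o)].
  have -> : [set o | k%:R < a - maxf (fun i => Y i o)] =
      (fun o => maxf (fun i => Y i o)) @^-1` `]-oo, a - k%:R[%classic.
    by apply/seteqP; split => o /=; rewrite in_itv /=; lra.
  by rewrite -[X in measurable X]setTI; exact: mM.
apply: fine_le; rewrite ?fin_num_measure //.
apply: le_measure; rewrite ?inE // => o /= h1 i.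
by have [h2 _] := maxfP i0 (fun i => Y i o); have := h2 i; lra.
Qed.

Lemma max_reindex_le d (T : measurableType d) (P : probability T R) (I J : finType) (i0 : I)
    (phi : I -> J) (X : J -> T -> R) : (forall j, itg P (X j)) ->
  \int[P]_o maxf (fun i => X (phi i) o) <= \int[P]_o maxf (fun j => X j o).
Proof.
move=> iX; apply: le_Rintegral => //.
- by apply: (itg_lips (maxf_lips i0)) => i; exact: iX.
- exact: (itg_lips (maxf_lips (phi i0))).
move=> o _; have [_ [i ->]] := maxfP i0 (fun i => X (phi i) o).
by have [h _] := maxfP (phi i0) (fun j => X j o); exact: h.
Qed.

End expected_maximum.

Section upper_bound.
Context {R : realType}.

Lemma expected_max_upper : exists C : R, forall (n : nat) d (T : measurableType d) (P : probability T R)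
    (X : 'I_(2 ^ n) * 'I_(2 ^ n) -> T -> R), (1 <= n)%N ->
  isG P X (@gcov R (2 ^ n)) ->
  (forall x y : 'I_(2 ^ n) * 'I_(2 ^ n), green_fun (R := R) (2 ^ n) (Defs.point x) (Defs.point y) \is a fin_num) ->
  \int[P]_o maxf (fun z => X z o) <= tilt * step_var * n%:R - 3 / (2 * tilt) * ln n%:R + C.
Proof.
(* Chosen so that 2 rho equals (4 / pi) * 27, the constant in [gcov_upper]. *)
pose rho : R := 54 / pi.
have rho0 : 0 <= rho by rewrite divr_ge0 // ltW // pi_gt0.
have s0 : 0 <= step_var :> R by rewrite ltW // step_var_gt0.
have t0 := @tilt_gt0 R.
have [C [C0 tail]] := upper_tail rho0 t0 step_var_gt0 tilt_step_var.
exists (C + 1 + C / (1 - expR (- (tilt / 4)))) => n d T P X n1 GX fin.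
have N1 : (1 < 2 ^ n)%N by rewrite -{1}(expn0 2) ltn_exp2l.
have z0 : 'I_(2 ^ n) by exact: Ordinal (ltnW N1).
have [dY [TY [PY [Y [GY FY]]]]] := @brw_exists R rho (fun=> step_var) n rho0 (fun=> s0).
pose phi (z : 'I_(2 ^ n) * 'I_(2 ^ n)) : leaf n := cell n z.1 z.2.
have GY' : isG PY (fun z => Y (phi z)) (fun x y => tcov rho (fun=> step_var) (phi x) (phi y)).
  by apply: isG_ext (isG_map GY phi (fun=> 1)) => *; rewrite ?mul1r.
have le : \int[P]_o maxf (fun z => X z o) <= \int[PY]_o maxf (fun z => Y (phi z) o).
  apply: (sudakov_fernique (z0, z0) GX GY') => x y.
  have [->|nxy] := eqVneq x y; first by rewrite /qdist; lra.
  have nphi : phi x != phi y.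
    apply: contra_neq nxy => e; have := congr1 (tree_pos (fun=> 0%N) (l := n)) e.
    rewrite !cell_pos // => -[e1 e2].
    by rewrite (surjective_pairing x) (surjective_pairing y); congr pair; exact: val_inj.
  have [h [_ q h1 h2 _]] := tree_split (fun=> 0%N) rho (fun=> step_var) nphi.
  move: h1 h2; rewrite !cell_pos //= addn0 tree_len0 -mul2n -expnS => h1 h2.
  have r0 : (0 < 2 ^ h.+1)%N by rewrite expn_gt0.
  have D1 : `|(x.1 : nat)%:R - (y.1 : nat)%:R| <= (2 ^ h.+1)%:R :> R by rewrite ndistE ler_nat ltnW.
  have D2 : `|(x.2 : nat)%:R - (y.2 : nat)%:R| <= (2 ^ h.+1)%:R :> R by rewrite ndistE ler_nat ltnW.
  apply: (le_trans (gcov_upper N1 fin r0 D1 D2)).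
  rewrite [leRHS](_ : _ = qdist (@tcov R rho (fun=> step_var) n) (phi x) (phi y)) // q.
  rewrite sumr_const card_ord -[step_var *+ _]mulr_natr natrX lnXn // -[ln 2 *+ _]mulr_natr /rho /step_var.
  move: (h.+1%:R : R) (ln 2 : R) => k l; have := @pi_gt0 R; move: (pi : R) => p p0.
  by rewrite le_eqVlt; apply/orP; left; apply/eqP; field; rewrite gt_eqF.
apply: (le_trans le).
have := @max_le_tail_upper _ _ _ PY _ _ (z0, z0) phi Y _
  (tilt * step_var * n%:R - 3 / (2 * tilt) * ln n%:R + C) C (tilt / 4) (isG_itg_X GY) FY C0.
have t4 : 0 < tilt / 4 :> R by rewrite divr_gt0.
move=> /(_ t4) H; apply: le_trans (H _) _; last by lra.
by move=> k; exact: tail.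
Qed.

End upper_bound.

Section corridors.
Context {R : realType}.
Variables (J0 N kap : nat).
Hypothesis J17 : (17 <= J0)%N.

(** The radius of the bumps; the gap between subboxes is twice as wide, so that bumps in different
    subboxes do not meet. The final 2 makes up for the rounding and keeps the radius above 1. *)
Definition corridor (l : nat) : nat := (2 ^ (l.+1 + kap) %/ low_index J0 N l.+1 ^ 2 + 2)%N.

Lemma low_index_gt0 l : (0 < low_index J0 N l)%N.
Proof. by rewrite /low_index; lia. Qed.

Lemma corridor_ln l :
  (l.+1 + kap)%:R * ln 2 - 2 * ln (low_index J0 N l.+1)%:R <= ln (corridor l)%:R :> R.
Proof.
have x0 := low_index_gt0 l.+1; rewrite /corridor addn2; move: (low_index _ _ _) x0 => x x0.
have x1 : 0 < x%:R :> R by rewrite ltr0n.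
have e : (2 ^ (l.+1 + kap))%:R <= (2 ^ (l.+1 + kap) %/ x ^ 2).+2%:R * (x ^ 2)%:R :> R.
  have h := @ltn_ceil (2 ^ (l.+1 + kap)) (x ^ 2); rewrite expn_gt0 x0 in h.
  by rewrite -natrM ler_nat; apply: leq_trans (ltnW (h isT)) _; rewrite leq_mul2r; apply/orP; right; lia.
move: e; rewrite -ler_ln ?posrE ?mulr_gt0 ?ltr0n ?expn_gt0 ?x0 //.
rewrite lnM ?posrE ?ltr0n ?expn_gt0 ?x0 //.
rewrite !natrX !lnXn // -[ln 2 *+ _]mulr_natr -[ln x%:R *+ _]mulr_natr; lra.
Qed.

(** A minimum contributes at most the sum over both ends, and for each end 1 / x^2 <= 1 / (x - 1) -
    1 / x telescopes. *)
Lemma sum_low_index : \sum_(k < 2 * N) (low_index J0 N k.+1)%:R ^- 2 <= 1 :> R.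
Proof.
have J1 : 17 <= J0%:R :> R by rewrite ler_nat.
have Jp : 0 < J0%:R :> R by lra.
have tel m : \sum_(k < m) (k%:R + J0%:R) ^- 2 <= 2^-1 :> R.
  apply: (@le_trans _ _ ((J0%:R - 1)^-1 - (m%:R + J0%:R - 1)^-1)); last first.
    apply: (@le_trans _ _ (J0%:R - 1)^-1).
      by rewrite gerBl invr_ge0; have := ler0n R m; lra.
    by rewrite lef_pV2 ?posrE //; lra.
  elim: m => [|m ih]; first by rewrite big_ord0 add0r subrr.
  rewrite big_ord_recr /=; apply: (le_trans (lerD ih (lexx _))).
  have [x xE] : exists x : R, x = m%:R + J0%:R by eexists.
  have x17 : 17 <= x by rewrite xE; have := ler0n R m; lra.
  rewrite -[m.+1%:R]natr1 -xE.
  have -> : m%:R + 1 + J0%:R - 1 = x by rewrite xE; ring.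
  have e : x ^- 2 <= (x - 1)^-1 - x^-1.
    have -> : (x - 1)^-1 - x^-1 = (x * (x - 1))^-1.
      by field; apply/andP; split; apply: lt0r_neq0; lra.
    rewrite lef_pV2 ?posrE ?exprn_gt0 ?mulr_gt0 //; nra.
  lra.
have h (a b : nat) : (minn a b + J0)%:R ^- 2 <= (a%:R + J0%:R) ^- 2 + (b%:R + J0%:R) ^- 2 :> R.
  have q (c : nat) : 0 <= (c%:R + J0%:R) ^- 2 :> R by rewrite invr_ge0 sqr_ge0.
  by rewrite natrD; case: leqP => _; rewrite ?lerDl ?lerDr.
apply: (@le_trans _ _ (\sum_(k < 2 * N) (k%:R + J0%:R) ^- 2 + \sum_(k < 2 * N) (k%:R + J0%:R) ^- 2)).
  rewrite [X in _ <= _ + X](reindex_inj rev_ord_inj) -big_split /=; apply: ler_sum => k _.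
  apply: (le_trans (h _ _)); apply: lerD => //.
  have pos (c : nat) : 0 < c%:R + J0%:R :> R by rewrite ltr_wpDl.
  by rewrite lef_pV2 ?posrE ?exprn_gt0 // lerXn2r ?nnegrE ?addr_ge0 // lerD2r ler_nat.
by have := tel (2 * N)%N; lra.
Qed.

Lemma tree_len_le : (tree_len (fun l => 2 * corridor l) (2 * N) <= 2 ^ (2 * N + kap + 3))%N.
Proof.
(* The 4 added to the length absorbs the rounding 2 of each corridor: 2 t + 2 * 2 + 4 = 2 (t +
   4). *)
have claim l : (tree_len (fun l => 2 * corridor l)%N l)%:R + 4 <=
    2 ^+ l * (5 + 2 ^+ kap.+1 * \sum_(k < l) (low_index J0 N k.+1)%:R ^- 2) :> R.
  elim: l => [|l ih]; first by rewrite big_ord0 mulr0 addr0 expr0 mul1r /=; lra.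
  rewrite big_ord_recr /= natrD -mul2n !natrM.
  set S := \sum_(k < l) _ in ih *; set x := (low_index J0 N l.+1)%:R.
  have K : (corridor l)%:R <= 2 ^+ l * 2 ^+ kap.+1 * x ^- 2 + 2 :> R.
    rewrite /corridor natrD lerD2r /x.
    have -> : 2 ^+ l * 2 ^+ kap.+1 = (2 ^ (l.+1 + kap))%:R :> R.
      by rewrite -exprD natrX addnS addSn.
    rewrite ler_pdivlMr ?exprn_gt0 ?ltr0n ?low_index_gt0 //.
    by rewrite -natrX -natrM ler_nat leq_divM.
  rewrite exprS; move: ih K; move: (tree_len _ _)%:R (corridor l)%:R (2 ^+ l) (2 ^+ kap.+1) (x ^- 2).
  move=> t c a b y; nra.
rewrite -(ler_nat R); have := claim (2 * N)%N; have := sum_low_index.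
set S := \sum_(k < _) _; move: (tree_len _ _)%:R => t S1 h.
have -> : (2 ^ (2 * N + kap + 3))%:R = 2 ^+ (2 * N) * (8 * 2 ^+ kap) :> R.
  by rewrite natrX !exprD; ring.
have a0 : 0 <= 2 ^+ (2 * N) :> R by rewrite exprn_ge0.
have b1 : 1 <= 2 ^+ kap :> R by rewrite exprn_ege1 // ler1n.
have : 2 ^+ (2 * N) * (5 + 2 ^+ kap.+1 * S) <= 2 ^+ (2 * N) * (8 * 2 ^+ kap) :> R.
  by rewrite ler_wpM2l // exprS; nra.
lra.
Qed.

End corridors.

Lemma half_block n k : (k + 7 <= n)%N ->
  exists N, [/\ (1 <= N)%N, (2 * N + k + 5 <= n)%N & (n <= 2 * N + k + 6)%N].
Proof. by move=> h; exists ((n - k - 5)./2)%N; split; lia. Qed.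

Lemma inner_cell K L p M : (2 * K <= L)%N -> (p < L)%N -> (3 * L <= M)%N ->
  (K <= L + p)%N /\ (L + p + K < M)%N.
Proof. lia. Qed.

Section lower_bound.
Context {R : realType}.

Lemma expected_max_lower : exists C : R, forall (n : nat) d (T : measurableType d) (P : probability T R)
    (X : 'I_(2 ^ n) * 'I_(2 ^ n) -> T -> R), (1 <= n)%N ->
  isG P X (@gcov R (2 ^ n)) ->
  (forall x y : 'I_(2 ^ n) * 'I_(2 ^ n), green_fun (R := R) (2 ^ n) (Defs.point x) (Defs.point y) \is a fin_num) ->
  tilt * step_var * n%:R - 3 / (2 * tilt) * ln n%:R - C <= \int[P]_o maxf (fun z => X z o).
Proof.
have t2 := @tilt_ge2 R; have t0 := @tilt_gt0 R; have s0 := @step_var_gt0 R; have ls := @tilt_step_var R.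
have l2 := @ln2_gt0 R.
(* The three summands provide the three largeness conditions on [J0] in the lower tail estimate. *)
pose B : R := 17 + (64 / (tilt ^+ 2 * step_var)) ^+ 2 + 6 / step_var.
have b1 : 0 <= 64 / (tilt ^+ 2 * step_var) :> R.
  by rewrite divr_ge0 // mulr_ge0 ?sqr_ge0 // ltW.
have b2 : 0 <= 6 / step_var :> R by rewrite divr_ge0 // ltW.
have [J0 hJ] : exists J0 : nat, B <= J0%:R.
  by exists (Num.truncn B).+1; apply/ltW; rewrite truncnS_gt.
have b3 := sqr_ge0 (64 / (tilt ^+ 2 * step_var) : R).
have J17 : (17 <= J0)%N by rewrite -(ler_nat R); rewrite /B in hJ; lra.
have Jsg : 6 / step_var <= J0%:R :> R by rewrite /B in hJ; lra.
have Jhp : 64 / (tilt ^+ 2 * step_var) <= Num.sqrt J0%:R :> R.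
  rewrite -[leLHS](ger0_norm b1) -sqrtr_sqr ler_wsqrtr //; rewrite /B in hJ; lra.
(* Widening all corridors by 2^kap adds kap ln 2 to each logarithm in the lower bound; this pays for
   the 3 in [gcov_lower], for the leaf variance and for ln J0. *)
pose D : R := (2 * ln J0%:R + 3 + 2 * ln 2 * J0%:R) / ln 2.
have [kap hk] : exists kap : nat, D <= kap%:R.
  by exists (Num.truncn D).+1; apply/ltW; rewrite truncnS_gt.
have {}hk : 2 * ln J0%:R + 3 + 2 * ln 2 * J0%:R <= kap%:R * ln 2 :> R.
  by move: hk; rewrite /D ler_pdivrMr.
pose th := low_rate tilt step_var J0 : R.
have th0 : 0 < th := low_rate_gt0 t2 s0 J17.
have eth : 0 <= (1 - expR (- th))^-1.
  by rewrite invr_ge0 subr_ge0 ltW // expR_lt1 oppr_lt0.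
have lJ : 0 <= ln (1 + J0%:R) :> R by rewrite ln_ge0 // lerDl.
have k0 : 0 <= 3 / (2 * tilt) :> R by rewrite divr_ge0 // mulr_ge0 // ltW.
have ts0 : 0 <= tilt * step_var :> R by rewrite mulr_ge0 // ltW.
exists (tilt * step_var * (kap + 7)%:R + 3 / (2 * tilt) * ln (1 + J0%:R) + 1 + (1 - expR (- th))^-1).
move=> n d T P X n1 GX fin.
have N1 : (1 < 2 ^ n)%N by rewrite -{1}(expn0 2) ltn_exp2l.
have z0 : 'I_(2 ^ n) by exact: Ordinal (ltnW N1).
have ln0 : 0 <= ln n%:R :> R by rewrite ln_ge0 // ler1n.
(* With few scales it suffices that the maximum, being at least one centred variable, has
   nonnegative mean: the speed term is then below the constant. *)
have [small|big] := ltnP n (kap + 7).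
  apply: (@le_trans _ _ 0).
    have : tilt * step_var * n%:R <= tilt * step_var * (kap + 7)%:R :> R.
      by rewrite ler_wpM2l // ler_nat ltnW.
    have := mulr_ge0 k0 ln0; have := mulr_ge0 k0 lJ; lra.
  rewrite -(isG_mean GX (z0, z0)); apply: le_Rintegral => //; first exact: (isG_itg_X GX).
    by apply: (itg_lips (maxf_lips (z0, z0))); exact: isG_itg_X GX.
  by move=> o _; case: (maxfP (z0, z0) (fun z => X z o)).
have [N [hN1 hN2 hN3]] := half_block big.
pose w l := (2 * corridor J0 N kap l)%N.
pose L := tree_len w (2 * N).
(* The tree is embedded with offset [L] in both coordinates, so its points stay at distance at least
   [L] from the sides, and the bumps, of radius at most L / 2, fit into the box. *)
have L3 : (3 * L <= 2 ^ n)%N.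
  apply: (@leq_trans (2 ^ (2 * N + kap + 5))); last by rewrite leq_exp2l.
  rewrite (_ : 2 * N + kap + 5 = 2 + (2 * N + kap + 3))%N; last by rewrite [RHS]addnC -[RHS]addnA.
  by rewrite expnD; apply: leq_mul => //; exact: tree_len_le.
pose leafN := leaf (2 * N).
have [p1 p2] : (forall x : leafN, L + (tree_pos w x).1 < 2 ^ n)%N /\
    (forall x : leafN, L + (tree_pos w x).2 < 2 ^ n)%N.
  split=> x; have [h1 h2] := tree_pos_lt w x.
    by have [_] := inner_cell (K := 0) (leq0n L) h1 L3; rewrite addn0.
  by have [_] := inner_cell (K := 0) (leq0n L) h2 L3; rewrite addn0.
pose phi (x : leafN) : 'I_(2 ^ n) * 'I_(2 ^ n) := (Ordinal (p1 x), Ordinal (p2 x)).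
have v0 k : 0 <= low_var tilt step_var J0 N k :> R.
  exact: ltW (low_var_gt0 t2 s0 J17 Jhp Jsg hN1 k).
have r0 : 0 <= 2 * step_var * J0%:R :> R.
  exact: mulr_ge0 (mulr_ge0 (ler0n R 2) (ltW s0)) (ler0n R J0).
have [dY [TY [PY [Y [GY FY]]]]] := @brw_exists R _ _ (2 * N) r0 v0.
have GX' : isG P (fun x => X (phi x)) (fun x y => gcov (R := R) (phi x) (phi y)).
  by apply: isG_ext (isG_map GX phi (fun=> 1)) => *; rewrite ?mul1r.
have i0 : leafN := cell (2 * N) 0 0.
have le1 : \int[PY]_o maxf (fun x => Y x o) <= \int[P]_o maxf (fun x => X (phi x) o).
  apply: (sudakov_fernique i0 GY GX') => x y.
  have [->|nxy] := eqVneq x y; first by rewrite /qdist; lra.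
  have [h [hl q _ _ sep]] := tree_split w (2 * step_var * J0%:R : R) (low_var tilt step_var J0 N) nxy.
  rewrite q.
  rewrite [leRHS](_ : _ = qdist (@gcov R (2 ^ n)) (phi x) (phi y)) //.
  have KL : (2 * corridor J0 N kap h <= L)%N.
    by apply: leq_trans (tree_len_ge w hl); rewrite /= leq_addl.
  have K1 : (1 < corridor J0 N kap h)%N by rewrite /corridor addn2.
  have [x1 x2] := tree_pos_lt w x; have [y1 y2] := tree_pos_lt w y.
  have [X1 X1'] := inner_cell KL x1 L3; have [X2 X2'] := inner_cell KL x2 L3.
  have [Y1 Y1'] := inner_cell KL y1 L3; have [Y2 Y2'] := inner_cell KL y2 L3.
  have G := gcov_lower N1 fin (u := phi x) (v := phi y) K1.
  apply: le_trans (G X1 X1' X2 X2' Y1 Y1' Y2 Y2' _); rewrite /= ?ndistE.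
    have := @corridor_ln R J0 N kap J17 h.
    rewrite sum_low_var // tilt_sqr /step_var natrD; move: hk.
    move: (h.+1%:R) (kap%:R) (ln 2) (ln J0%:R) (ln (low_index _ _ _)%:R) (ln (corridor _ _ _ _)%:R).
    move: (J0%:R : R) => J a b c e f g hk hc.
    have p0 := @pi_gt0 R; move: (pi : R) p0 => p p0.
    have -> : 2 * (2 * (2 / p * c) * J + (2 / p * c * a - 8 / (2 * p) * (f - e))) =
      4 / p * (2 * c * J + c * a - 2 * f + 2 * e) by field; rewrite gt_eqF.
    by rewrite ler_wpM2l ?divr_ge0 ?(ltW p0) //; lra.
  have nat_le (K m : nat) : (2 * K < m)%N -> 2 * K%:R + 1 <= m%:R :> R.
    by move=> hm; rewrite -natrM natr1 ler_nat.
  by case: sep => h'; [left|right]; apply: nat_le; rewrite /ndist !subnDl.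
have le2 := max_reindex_le i0 phi (isG_itg_X GX).
have le3 := @max_ge_tail_lower _ _ _ PY _ i0 Y _ (tilt * step_var * (2 * N)%:R -
  3 / (2 * tilt) * (ln N%:R + ln (1 + J0%:R))) th (isG_itg_X GY) FY th0.
have Nn : (N <= n)%N /\ (n <= 2 * N + (kap + 7))%N by move: hN2 hN3; clear; lia.
case: Nn => Nn nN.
apply: le_trans (le_trans le1 le2); apply: le_trans (le3 _).
  have lN : ln N%:R <= ln n%:R :> R by rewrite ler_ln ?posrE ?ltr0n // ler_nat.
  have h1 := ler_wpM2l k0 lN.
  have h2 : tilt * step_var * n%:R <= tilt * step_var * ((2 * N)%:R + (kap + 7)%:R) :> R.
    by rewrite ler_wpM2l // -natrD ler_nat.
  lra.
by move=> k; exact: (low_tail t2 s0 ls J17 Jhp Jsg hN1 (ler0n R k)).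
Qed.

End lower_bound.

Theorem theorem1p2 (R : realType) :
  let c1 : R := 2 * Num.sqrt (2 / pi) * ln 2 in
  let c2 : R := 3 / 4 * Num.sqrt (2 / pi) in
  exists C : R,
  forall (dW : measure_display) (W : measurableType dW)
    (Q : int * int -> probability W R) (w : nat -> W -> int * int),
  (forall x : int * int, is_srw (Q x) w x) ->
  forall n : nat, (1 <= n)%N ->
  forall (d : measure_display) (T : measurableType d) (P : probability T R)
    (X : 'I_(2 ^ n) * 'I_(2 ^ n) -> {RV P >-> R}),
  is_gff Q w X ->
  (`| 'E_P[field_max X] - (c1 * n%:R - c2 * ln n%:R)%R%:E | <= C%:E)%E.
Proof.
move=> c1 c2; have [Cu upper] := @expected_max_upper R; have [Cl lower] := @expected_max_lower R.
exists (`|Cu| + `|Cl|) => dW W Q w Qw n n1 d T P X gffX.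
have [GX fin] := gff_isG Qw gffX.
have z0 : 'I_(2 ^ n) by apply: (@Ordinal _ 0); rewrite expn_gt0.
have iM : itg P (fun o => maxf (fun z => X z o)).
  by apply: (itg_lips (maxf_lips (z0, z0))); exact: isG_itg_X GX.
have -> : ('E_P[field_max X])%E = (\int[P]_o maxf (fun z => X z o))%:E.
  by rewrite unlock EFin_Rintegral.
have := upper n _ _ _ _ n1 GX fin; have := lower n _ _ _ _ n1 GX fin.
rewrite speedE correctionE -/c1 -/c2 -EFinB abse_EFin lee_fin ler_norml.
have := ler_norm Cu; have := ler_norm Cl => *.
by have := normr_ge0 Cu; have := normr_ge0 Cl => *; apply/andP; split; lra.
Qed.
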